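(* Let $U$ be an open subset of $\mathbf{C}^n$ and let $f:U\rightarrow\mathbf{C}^k$ be a holomorphic mapping that satisfies a system of equations $Q(x,f(x))=0$ for $x\in U$, where $Q$ is a Nash mapping from an open neighborhood $\hat{U}$ in $\mathbf{C}^n\times\mathbf{C}^k$ of the graph of $f$ into some $\mathbf{C}^q$. Then for every $x_0\in U$ there are an open neighborhood $U_0\subset U$ of $x_0$ and a sequence $\{f^{\nu}:U_0\rightarrow\mathbf{C}^k\}_{\nu\in\mathbf{N}}$ of Nash mappings converging uniformly to $f|_{U_0}$ such that $Q(x,f^{\nu}(x))=0$ for every $x\in U_0$ and $\nu\in\mathbf{N}$.
   Context: Let $\Omega\subset\mathbf{C}^n$ be open. A holomorphic function $f$ on $\Omega$ is a Nash function at $x_0\in\Omega$ if there exist an open neighborhood $W$ of $x_0$ in $\Omega$ and a complex polynomial $P:\mathbf{C}^n\times\mathbf{C}\rightarrow\mathbf{C}$, $P\neq 0$, such that $P(x,f(x))=0$ for $x\in W$. A holomorphic function on $\Omega$ is a Nash function if it is a Nash function at every point of $\Omega$. A holomorphic mapping from $\Omega$ to $\mathbf{C}^N$ is a Nash mapping if each of its components is a Nash function. *)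

(* Defs.v *)
From HB Require Import structures.
From mathcomp Require Import all_boot all_order all_algebra.
From mathcomp Require Import complex.
From mathcomp Require Import all_classical all_reals topology normedtype derive.
(* The notations of mpoly clash with those of MathComp-Analysis. *)
From mathcomp Require Import -(notations) mpoly.

Set Implicit Arguments.
Unset Strict Implicit.
Unset Printing Implicit Defensive.

Import Order.TTheory GRing.Theory Num.Theory numFieldNormedType.Exports.
Local Open Scope classical_set_scope.
Local Open Scope ring_scope.

(* R[i] packed as a numClosedFieldType: numFieldNormedType.Exports gives a
   topology to the sort of such a structure, but not to R[i] itself. *)
Definition Cplx (R : realType) : numClosedFieldType := R[i].
Arguments Cplx : simpl never.

(* The scalar field of V and W is Cplx R, so that differentiable means complex
   differentiable (the differential is Cplx R-linear). *)
Definition holomorphic (R : realType) (V W : normedModType (Cplx R))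
    (Omega : set V) (f : V -> W) : Prop :=
  forall x, Omega x -> differentiable f x.

(* A polynomial on C^n x C is a polynomial in n + 1 variables, the last one
   standing for the second factor. *)
Definition nash_at (R : realType) (n : nat) (Omega : set 'rV[Cplx R]_n)
    (f : 'rV[Cplx R]_n -> Cplx R) (x0 : 'rV[Cplx R]_n) : Prop :=
  exists (W : set 'rV[Cplx R]_n) (P : mpoly (n + 1) (Cplx R)),
    [/\ open W, W x0, W `<=` Omega, P != 0 &
        forall x, W x ->
          meval (fun i => row_mx x (f x)%:M 0 i) P = 0].

Definition nash_function (R : realType) (n : nat) (Omega : set 'rV[Cplx R]_n)
    (f : 'rV[Cplx R]_n -> Cplx R) : Prop :=
  holomorphic Omega f /\ forall x0, Omega x0 -> nash_at Omega f x0.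

Definition nash_mapping (R : realType) (n N : nat) (Omega : set 'rV[Cplx R]_n)
    (F : 'rV[Cplx R]_n -> 'rV[Cplx R]_N) : Prop :=
  holomorphic Omega F /\ forall j, nash_function Omega (fun x => F x 0 j).

(* Main.v *)
(* Induction on n, after Artin.  Let u be a maximal tuple of components of f
   that is algebraically independent over C(x), and let g_j be an equation of
   f_j over C[x, u] of minimal degree, so that
   delta_j := (d g_j / dz)(x, u, f_j) does not vanish identically.
   It suffices to find algebraic G_j close to f_j which, near one point where
   no delta_j vanishes, are roots of the g_j(x, u', .) with u' close to u.
   Indeed, near that point f_j is an algebraic function phi_j of (x, u), and
   Q(x, phi(x, u)), which vanishes on the independent functions (x, u), is
   algebraic over C(x, u), hence identically zero; therefore
   Q(x, phi(x, u')) = 0.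

   To find the G_j, write x = (z, x') and, after a shear, use Weierstrass
   preparation to get z prod_j delta_j = unit * w with w a Weierstrass polynomial in z.
   Dividing by w twice gives f_j = y_j + w^2 h_j with y_j polynomial in z.
   That w^2 divides g_j(x, y) and that w divides z prod_j delta_j(x, y) is a
   polynomial system for the coefficients of w and of the y_j, which are
   functions of x' only.  By induction they have algebraic approximations w'
   and y' solving the same system.  Approximate h by polynomials h'.  In
   g_j(y' + w'^2 h', y'_j + w' z) = 0 the Taylor expansion can be divided by
   w'^2 after multiplication by z prod_(i <> j) delta_i, and the quotient has a
   simple root z near 0 by the implicit function theorem. *)
Require Import Defs.
From HB Require Import structures.
From mathcomp Require Import all_boot all_order all_algebra.
From mathcomp Require Import complex ring lra interval_inference.
From mathcomp Require Import all_classical all_reals topology normedtype derive.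
From mathcomp Require Import landau sequences realfun measure lebesgue_measure.
From mathcomp Require Import lebesgue_integral ftc.
From mathcomp Require Import -(notations) mpoly.
Import Order.TTheory GRing.Theory Num.Theory numFieldNormedType.Exports.
Set Implicit Arguments.
Unset Strict Implicit.
Unset Printing Implicit Defensive.
Local Open Scope classical_set_scope.
Local Open Scope ring_scope.

(** * Real-valued norms *)

(** The square of [w] is Newton's condition: an error in the square of the derivative can be
    corrected by a term of the order of the derivative. Replacing [h] by polynomials that satisfy no
    equation moves [g_j] by a multiple of [w ^ 2]; after multiplication by [z prod_(i <> j) delta_i]
    the linear term of the Taylor expansion is also a multiple of [w ^ 2], with a cofactor [E] that
    is nonzero at the origin. The factor [z] gives the Weierstrass polynomial positive degree and
    kills all terms but the linear one on [z = 0], so that 0 is a simple root at the origin. The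
    multiplier may vanish where [w] does, so [g_j = 0] is obtained only near a point where [w] is
    nonzero; the identity theorem then spreads [Q = 0]. The induction needs any number of unknown
    functions and equations, since the coefficients outnumber the components of [f]. The analysis
    rests on one operator, [F] to [(F - F 0) / z]: it preserves a disc of radius [r] and multiplies
    bounds by [K / r], hence iterates. Taylor remainders, the identity theorem and Weierstrass
    division come from the powers of [K / r]. *)

Section RealNorm.
Variables (R : realType).
Local Notation C := (Cplx R).
Implicit Types V W : normedModType C.

(** A norm over [C] takes its values in [C]; by [norm_nm] its real part loses nothing, and
    inequalities then live in the ordered field [R]. *)
Definition nm V (x : V) : R := complex.Re `|x|.

Lemma norm_nm V (x : V) : `|x| = (nm x)%:C%C :> C.
Proof.
have : (0 : C) <= `|x| by exact: normr_ge0.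
by rewrite /nm; case: (`|x| : R[i]) => a b; rewrite lecE /= => /andP[/eqP ->].
Qed.

Lemma real_complex_le (a b : R) : ((a%:C%C : C) <= b%:C%C) = (a <= b).
Proof. by rewrite lecE /= eqxx. Qed.

Lemma real_complex_lt (a b : R) : ((a%:C%C : C) < b%:C%C) = (a < b).
Proof. by rewrite ltcE /= eqxx. Qed.

Lemma real_complexD (a b : R) : (a + b)%:C%C = a%:C%C + b%:C%C :> C.
Proof. exact: rmorphD. Qed.

Lemma real_complexM (a b : R) : (a * b)%:C%C = a%:C%C * b%:C%C :> C.
Proof. exact: rmorphM. Qed.

Lemma nm_ge0 V (x : V) : 0 <= nm x.
Proof. by rewrite -real_complex_le -norm_nm; exact: (@normr_ge0 C V x). Qed.

Lemma nm0 V : nm (0 : V) = 0.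
Proof. by rewrite /nm normr0. Qed.

Lemma nm_eq0 V (x : V) : (nm x == 0) = (x == 0).
Proof.
apply/eqP/eqP => [h|->]; last exact: nm0.
by apply/eqP; rewrite -normr_eq0 norm_nm h.
Qed.

Lemma nm_gt0 V (x : V) : (0 < nm x) = (x != 0).
Proof. by rewrite lt_def nm_ge0 nm_eq0 andbT. Qed.

Lemma nmN V (x : V) : nm (- x) = nm x.
Proof. by rewrite /nm normrN. Qed.

Lemma nmB V (x y : V) : nm (x - y) = nm (y - x).
Proof. by rewrite -nmN opprB. Qed.

Lemma nmD V (x y : V) : nm (x + y) <= nm x + nm y.
Proof.
by rewrite -real_complex_le real_complexD -!norm_nm ler_normD.
Qed.

Lemma nmBD V (x y : V) : nm (x - y) <= nm x + nm y.
Proof. by rewrite -(nmN y); exact: nmD. Qed.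

Lemma nm_triangle V (y x z : V) : nm (x - z) <= nm (x - y) + nm (y - z).
Proof. by rewrite -(subrKA y); exact: nmD. Qed.

Lemma nmZ V (a : C) (x : V) : nm (a *: x) = nm a * nm x.
Proof.
by apply: (@complexI R); rewrite real_complexM -!norm_nm normrZ.
Qed.

Lemma nmM (a b : C) : nm (a * b) = nm a * nm b.
Proof. by apply: (@complexI R); rewrite rmorphM -!norm_nm; exact: (@normrM C a b). Qed.

Lemma nm1 : nm (1 : C) = 1.
Proof. by apply: (@complexI R); rewrite -norm_nm; exact: (@normr1 C). Qed.

Lemma nmX (a : C) n : nm (a ^+ n) = nm a ^+ n.
Proof. by elim: n => [|n IH]; rewrite ?expr0 ?nm1 // !exprS nmM IH. Qed.

Lemma nmV (a : C) : nm a^-1 = (nm a)^-1.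
Proof. by apply: (@complexI R); rewrite fmorphV -!norm_nm; exact: (@normfV C a). Qed.

Lemma nm_real (a : R) : nm (a%:C%C : C) = `|a|.
Proof.
by rewrite /nm -[`|_|]/(`|a%:C%C : R[i]|) normc_def /= expr0n /= addr0 sqrtr_sqr.
Qed.

Lemma nm_Re (z : C) : `|complex.Re z| <= nm z.
Proof. by rewrite -real_complex_le -norm_nm; exact: normc_ge_Re. Qed.

Lemma nm_Im (z : C) : `|complex.Im z| <= nm z.
Proof.
have -> : complex.Im z = - complex.Re (z * 'i%C) by case: z => a b /=; ring.
rewrite normrN (le_trans (nm_Re _)) // nmM.
suff -> : nm ('i%C : C) = 1 by rewrite mulr1.
by rewrite /nm -[`|_|]/(`|'i%C : R[i]|) normc_def /= expr0n /= add0r expr1n sqrtr1.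
Qed.

Lemma nm_ReIm (z : C) : nm z <= `|complex.Re z| + `|complex.Im z|.
Proof.
have -> : z = (complex.Re z)%:C%C + (complex.Im z)%:C%C * 'i%C :> C.
  by case: z => a b; apply/eqP; rewrite eq_complex /=; apply/andP; split; apply/eqP; ring.
rewrite (le_trans (nmD _ _)) // nmM !nm_real.
have -> : nm ('i%C : C) = 1.
  by rewrite /nm -[`|_|]/(`|'i%C : R[i]|) normc_def /= expr0n /= add0r expr1n sqrtr1.
rewrite mulr1; case: z => a b /=.
by rewrite !mul0r !mulr0 subr0 !addr0 add0r mulr1.
Qed.

Lemma nm_sum V (I : Type) (r : seq I) (P : pred I) (F : I -> V) :
  nm (\sum_(i <- r | P i) F i) <= \sum_(i <- r | P i) nm (F i).
Proof.
apply: (big_ind2 (fun a b => nm a <= b)); first by rewrite nm0.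
  by move=> a b c d h1 h2; rewrite (le_trans (nmD _ _)) // lerD.
by [].
Qed.

Lemma nm_coord N (x : 'rV[C]_N) i : nm (x 0 i) <= nm x.
Proof.
rewrite -real_complex_le -!norm_nm.
rewrite [leRHS]mx_normE -[leLHS]nngE num_le.
exact: (le_bigmax _ (fun ij : 'I_1 * 'I_N => `|x ij.1 ij.2|%:nng) (0, i)).
Qed.

Lemma nm_row_le N (x : 'rV[C]_N) (e : R) : 0 <= e ->
  (forall i, nm (x 0 i) <= e) -> nm x <= e.
Proof.
move=> e0 h; have [->|x0] := eqVneq x 0; first by rewrite nm0.
have /mx_norm_neq0[[i j] /= hij] : mx_norm x != 0 :> C.
  by rewrite -[mx_norm x]/(`|x|) normr_eq0.
suff -> : nm x = nm (x 0 j) by [].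
by rewrite /nm -(ord1 i); congr complex.Re.
Qed.

Lemma nm_row_lt N (x : 'rV[C]_N) (e : R) : 0 < e ->
  (forall i, nm (x 0 i) < e) -> nm x < e.
Proof.
move=> e0 h; have [->|x0] := eqVneq x 0; first by rewrite nm0.
have /mx_norm_neq0[[i j] /= hij] : mx_norm x != 0 :> C.
  by rewrite -[mx_norm x]/(`|x|) normr_eq0.
suff -> : nm x = nm (x 0 j) by [].
by rewrite /nm -(ord1 i); congr complex.Re.
Qed.

Lemma nm_row_mx_le M N (u : 'rV[C]_M) (v : 'rV[C]_N) (a : R) : 0 <= a ->
  nm u <= a -> nm v <= a -> nm (row_mx u v) <= a.
Proof.
move=> a0 hu hv; apply: nm_row_le => // i; have [j ->|j ->] := split_ordP i.
  by rewrite row_mxEl (le_trans (nm_coord _ _)).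
by rewrite row_mxEr (le_trans (nm_coord _ _)).
Qed.

Lemma nm_row_mx_lt M N (u : 'rV[C]_M) (v : 'rV[C]_N) (a : R) : 0 < a ->
  nm u < a -> nm v < a -> nm (row_mx u v) < a.
Proof.
move=> a0 hu hv; apply: nm_row_lt => // i; have [j ->|j ->] := split_ordP i.
  by rewrite row_mxEl (le_lt_trans (nm_coord _ _)).
by rewrite row_mxEr (le_lt_trans (nm_coord _ _)).
Qed.

Lemma half_lt (r : R) : 0 < r -> r / 2 < r.
Proof. by move=> r0; rewrite ltr_pdivrMr // ltr_pMr // ltr1n. Qed.

Lemma half_le (r : R) : 0 <= r -> r / 2 <= r.
Proof. by move=> r0; rewrite ler_pdivrMr // ler_peMr // ler1n. Qed.

Definition pball V (x : V) (r : R) : set V := [set y | nm (y - x) < r].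

Lemma pball_center V (x : V) r : 0 < r -> pball x r x.
Proof. by rewrite /pball /= subrr nm0. Qed.

Lemma real_pos (e : C) : 0 < e -> e = (complex.Re e)%:C%C /\ 0 < complex.Re e.
Proof.
case: e => a b; rewrite (@ltcE R) /= => /andP[/eqP -> h]; split=> //.
Qed.

Lemma nbhs_pball V (x : V) (A : set V) :
  nbhs x A <-> exists2 r : R, 0 < r & pball x r `<=` A.
Proof.
rewrite -nbhs_ballE; split=> [[e e0 h]|[r r0 h]].
  have [ee re0] := real_pos e0.
  exists (complex.Re e) => // y hy; apply: h; rewrite -ball_normE /= -normrN opprB.
  by rewrite norm_nm ee real_complex_lt.
exists (r%:C%C : C); first by rewrite /= (real_complex_lt 0).
move=> y; rewrite -ball_normE /= -normrN opprB norm_nm real_complex_lt.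
exact: h.
Qed.

Lemma open_pballP V (A : set V) :
  open A <-> (forall x, A x -> exists2 r : R, 0 < r & pball x r `<=` A).
Proof.
rewrite openE; split=> h x /h; first by move=> /nbhs_pball.
by move=> ?; apply/nbhs_pball.
Qed.

Lemma pball_open V (x : V) r : open (pball x r).
Proof.
apply/open_pballP => y hy; exists (r - nm (y - x)); first by rewrite subr_gt0.
move=> z; rewrite /pball /= => hz; rewrite (le_lt_trans (nm_triangle y _ _)) //.
by rewrite -ltrBrDr.
Qed.

Lemma pball_subset V (x y : V) r s : nm (y - x) + s <= r -> pball y s `<=` pball x r.
Proof.
move=> h z; rewrite /pball /= => hz.
by rewrite (le_lt_trans (nm_triangle y _ _)) // (lt_le_trans _ h) // addrC ltrD2l.
Qed.

Lemma pball_le V (x : V) r s : s <= r -> pball x s `<=` pball x r.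
Proof. by move=> h; apply: pball_subset; rewrite subrr nm0 add0r. Qed.

Lemma continuous_pballP V W (f : V -> W) x :
  {for x, continuous f} <->
  forall e : R, 0 < e -> exists2 d : R, 0 < d & forall y, nm (y - x) < d -> nm (f y - f x) < e.
Proof.
split=> [h e e0|h A].
  have : nbhs (f x) (pball (f x) e) by apply/nbhs_pball; exists e.
  by move=> /h /nbhs_pball[d d0 hd]; exists d.
move=> /nbhs_pball[e e0 he]; have [d d0 hd] := h _ e0.
by apply/nbhs_pball; exists d => // y hy; apply: he; exact: hd.
Qed.

Lemma differentiable_eps V W (f : V -> W) x : differentiable f x ->
  forall e : R, 0 < e -> exists2 d : R, 0 < d &
    forall h, nm h < d -> nm (f (x + h) - f x - 'd f x h) <= e * nm h.
Proof.
move=> /diff_locallyP[_ /eqaddoP hf] e e0.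
have : (0 : C) < e%:C%C by rewrite (real_complex_lt 0).
move=> /hf /nbhs_pball[d d0 hd]; exists d => // h hh.
have := hd h; rewrite /pball /= subr0 => /(_ hh).
rewrite !norm_nm -real_complexM real_complex_le.
rewrite [X in nm X](_ : _ = f (x + h) - f x - 'd f x h) //.
by rewrite -[LHS]/(f (h + x) - (f x + 'd f x h)) opprD addrA (addrC h).
Qed.

Lemma eps_differentiable V W (f : V -> W) (df : {linear V -> W}) x :
  continuous df ->
  (forall e : R, 0 < e -> exists2 d : R, 0 < d &
    forall h, nm h < d -> nm (f (x + h) - f x - df h) <= e * nm h) ->
  differentiable f x.
Proof.
move=> cdf H.
have hf : f \o shift x = cst (f x) + df +o_ 0 id.
  apply/eqaddoP => e /real_pos[-> e0]; have [d d0 hd] := H _ e0.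
  apply/nbhs_pball; exists d => // h; rewrite /pball /= subr0 => hh.
  rewrite !norm_nm -real_complexM real_complex_le.
  rewrite [X in nm X](_ : _ = f (x + h) - f x - df h); first exact: hd.
  by rewrite -[LHS]/(f (h + x) - (f x + df h)) opprD addrA (addrC h).
by apply/diff_locallyP; rewrite (diff_unique cdf hf).
Qed.

(** The intervals with centre [u k] and radius [T * q ^+ k], where [T = M / (1 - q)], are nested
    because [T - T * q = M]; the limit is the supremum of their left ends. *)
Lemma geometric_cvg_real (u : nat -> R) (M q : R) : 0 <= q -> q < 1 ->
  (forall k, `|u k.+1 - u k| <= M * q ^+ k) ->
  exists l, forall k, `|u k - l| <= M / (1 - q) * q ^+ k.
Proof.
move=> q0 q1 h; have q1' : 0 < 1 - q by rewrite subr_gt0.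
set T := M / (1 - q).
have TE : T * (1 - q) = M by rewrite /T divfK // gt_eqF.
have M0 : 0 <= M by have := h 0; rewrite expr0 mulr1; exact: le_trans.
have T0 : 0 <= T by rewrite divr_ge0 // ltW.
have qk0 k : 0 <= q ^+ k by exact: exprn_ge0.
have bnd j k : `|u (j + k)%N - u j| <= T * q ^+ j - T * q ^+ (j + k).
  elim: k => [|k IH]; first by rewrite addn0 !subrr normr0.
  rewrite addnS; have := h (j + k)%N; rewrite -TE exprS.
  by move: IH; rewrite !ler_norml => /andP[? ?] /andP[? ?]; lra.
have bnd2 j k : u j - T * q ^+ j <= u k + T * q ^+ k.
  have [jk|kj] := leqP j k.
    have := bnd j (k - j)%N; rewrite subnKC // ler_norml => /andP[? ?].
    have := mulr_ge0 T0 (qk0 k); lra.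
  have := bnd k (j - k)%N; rewrite subnKC 1?ltnW // ler_norml => /andP[? ?].
  have := mulr_ge0 T0 (qk0 j); lra.
pose A := range (fun j => u j - T * q ^+ j).
have hA : has_sup A.
  split; first by exists (u 0 - T * q ^+ 0); exists 0.
  by exists (u 0 + T * q ^+ 0) => _ [j _ <-]; exact: bnd2.
exists (sup A) => k.
have l1 : u k - T * q ^+ k <= sup A by apply: ub_le_sup; [exact: hA.2|exists k].
have l2 : sup A <= u k + T * q ^+ k.
  by apply: ge_sup; [exact: hA.1|move=> _ [j _ <-]; exact: bnd2].
by rewrite ler_norml; apply/andP; split; lra.
Qed.

Lemma geometric_cvg (u : nat -> C) (M q : R) : 0 <= q -> q < 1 ->
  (forall k, nm (u k.+1 - u k) <= M * q ^+ k) ->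
  exists l, forall k, nm (u k - l) <= 2 * (M / (1 - q)) * q ^+ k.
Proof.
move=> q0 q1 h.
have hRe k : `|complex.Re (u k.+1) - complex.Re (u k)| <= M * q ^+ k.
  rewrite (le_trans _ (h k)) // (le_trans _ (nm_Re _)) //.
  by case: (u k.+1) (u k) => [a b] [c d].
have hIm k : `|complex.Im (u k.+1) - complex.Im (u k)| <= M * q ^+ k.
  rewrite (le_trans _ (h k)) // (le_trans _ (nm_Im _)) //.
  by case: (u k.+1) (u k) => [a b] [c d].
have [a ha] := geometric_cvg_real q0 q1 hRe.
have [b hb] := geometric_cvg_real q0 q1 hIm.
exists (Complex a b : C) => k; rewrite (le_trans (nm_ReIm _)) //.
have := ha k; have := hb k; case: (u k) => c d /=; lra.
Qed.

End RealNorm.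

(** * Cauchy's formula *)

Section OneVariable.
Variables (R : realType).
Local Notation C := (Cplx R).
Implicit Types (F G : R -> C) (x y : R) (z w : C).

Definition cpt (x y : R) : C := Complex x y.
Definition ci : C := Complex 0 1.

(** Componentwise, so that the mean value theorem and the fundamental theorem of calculus for real
    functions apply to curves in [C]. *)
Definition rderiv (G : R -> C) (x : R) (l : C) :=
  is_derive x 1 (fun t => complex.Re (G t)) (complex.Re l) /\
  is_derive x 1 (fun t => complex.Im (G t)) (complex.Im l).

Lemma ReD z w : complex.Re (z + w) = complex.Re z + complex.Re w.
Proof. by case: z w => [a b] [c d]. Qed.
Lemma ImD z w : complex.Im (z + w) = complex.Im z + complex.Im w.
Proof. by case: z w => [a b] [c d]. Qed.
Lemma ReN z : complex.Re (- z) = - complex.Re z.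
Proof. by case: z. Qed.
Lemma ImN z : complex.Im (- z) = - complex.Im z.
Proof. by case: z. Qed.
Lemma ReM z w : complex.Re (z * w) =
  complex.Re z * complex.Re w - complex.Im z * complex.Im w.
Proof. by case: z w => [a b] [c d]. Qed.
Lemma ImM z w : complex.Im (z * w) =
  complex.Re z * complex.Im w + complex.Im z * complex.Re w.
Proof. by case: z w => [a b] [c d]. Qed.
Lemma Im_ci_mul z : complex.Im (ci * z) = complex.Re z.
Proof. by rewrite ImM /= mul0r mul1r add0r. Qed.
Lemma ci_sqr : ci * ci = -1.
Proof. by apply/eqP; rewrite eq_complex ReM ImM ReN ImN /=; apply/andP; split; apply/eqP; ring. Qed.
Lemma nm_ci : nm ci = 1.
Proof.
apply/eqP; rewrite -(@eqrXn2 _ 2) ?nm_ge0 ?ler01 //.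
by rewrite -nmX expr2 ci_sqr nmN nm1 expr1n.
Qed.

Lemma rderiv_eq (G : R -> C) x l l' : rderiv G x l -> l = l' -> rderiv G x l'.
Proof. by move=> h <-. Qed.

Lemma rderivB F G x l m :
  rderiv F x l -> rderiv G x m -> rderiv (fun t => F t - G t) x (l - m).
Proof.
move=> [? ?] [? ?]; split.
  rewrite (_ : (fun t => _) =
    (fun t => complex.Re (F t)) - (fun t => complex.Re (G t))).
    by rewrite ReD ReN; exact: is_deriveB.
  by apply/funext => t; rewrite ReD ReN.
rewrite (_ : (fun t => _) =
  (fun t => complex.Im (F t)) - (fun t => complex.Im (G t))).
  by rewrite ImD ImN; exact: is_deriveB.
by apply/funext => t; rewrite ImD ImN.
Qed.

Lemma rderivD F G x l m :
  rderiv F x l -> rderiv G x m -> rderiv (fun t => F t + G t) x (l + m).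
Proof.
move=> [? ?] [? ?]; split.
  rewrite (_ : (fun t => _) =
    (fun t => complex.Re (F t)) + (fun t => complex.Re (G t))).
    by rewrite ReD; exact: is_deriveD.
  by apply/funext => t; rewrite ReD.
rewrite (_ : (fun t => _) =
  (fun t => complex.Im (F t)) + (fun t => complex.Im (G t))).
  by rewrite ImD; exact: is_deriveD.
by apply/funext => t; rewrite ImD.
Qed.

Lemma rderivZ c F x l : rderiv F x l -> rderiv (fun t => c * F t) x (c * l).
Proof.
move=> [h1 h2]; split.
  rewrite (_ : (fun t => _) = complex.Re c *: (fun t => complex.Re (F t))
                            - complex.Im c *: (fun t => complex.Im (F t))).
    by rewrite ReM; apply: is_deriveB.
  by apply/funext => t; rewrite ReM.
rewrite (_ : (fun t => _) = complex.Re c *: (fun t => complex.Im (F t))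
                            + complex.Im c *: (fun t => complex.Re (F t))).
  by rewrite ImM; apply: is_deriveD.
by apply/funext => t; rewrite ImM.
Qed.

Lemma derive_eps (f : R -> R) x l :
  (forall e : R, 0 < e -> exists2 d : R, 0 < d &
     forall h, `|h| < d -> `|f (x + h) - f x - h * l| <= e * `|h|) ->
  is_derive x 1 f l.
Proof.
move=> H.
have cdf : continuous (fun h : R => h *: (l : R)) by exact: scalel_continuous.
have sx_lin : linear ( *:%R ^~ l : R -> R).
  by move=> u y z; rewrite scalerDl scalerA.
pose sxlM := GRing.isLinear.Build _ _ _ _ _ sx_lin.
pose sL : {linear _ -> _} := HB.pack ( *:%R ^~ l) sxlM.
have hf : f \o shift x = cst (f x) + ( *:%R^~ l) +o_ 0 id.
  apply/eqaddoP => e e0; have [d d0 hd] := H _ e0.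
  apply/nbhs_ballP; exists d => // h.
  rewrite -ball_normE /= sub0r normrN => hh.
  rewrite [X in `|X|](_ : _ = f (x + h) - f x - h * l); first exact: hd.
  by rewrite -[LHS]/(f (h + x) - (f x + h * l)) opprD addrA (addrC h).
have dE : 'd f x = *:%R^~ l :> (R -> R).
  exact: (diff_unique (df := sL)).
have df : differentiable f x by apply/diff_locallyP; rewrite dE.
split; first exact: diff_derivable.
by rewrite deriveE // dE scale1r.
Qed.

Lemma differentiable1_eps (f : C -> C) z l :
  (forall e : R, 0 < e -> exists2 d : R, 0 < d &
     forall h, nm h < d -> nm (f (z + h) - f z - h * l) <= e * nm h) ->
  differentiable f z /\ 'd f z 1 = l.
Proof.
move=> H.
have cdf : continuous (fun h : C => h *: (l : C)) by exact: scalel_continuous.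
have sx_lin : linear ( *:%R ^~ l : C -> C).
  by move=> u y w; rewrite scalerDl scalerA.
pose sxlM := GRing.isLinear.Build _ _ _ _ _ sx_lin.
pose sL : {linear _ -> _} := HB.pack ( *:%R ^~ l) sxlM.
have hf : f \o shift z = cst (f z) + sL +o_ 0 id.
  apply/eqaddoP => e /real_pos[-> e0]; have [d d0 hd] := H _ e0.
  apply/nbhs_pball; exists d => // h; rewrite /pball /= subr0 => hh.
  rewrite !norm_nm -real_complexM real_complex_le.
  rewrite [X in nm X](_ : _ = f (z + h) - f z - h * l); first exact: hd.
  by rewrite -[LHS]/(f (h + z) - (f z + h * l)) opprD addrA (addrC h).
have dE : 'd f z = *:%R^~ l :> (C -> C) by exact: (diff_unique (df := sL)).
by split; [apply/diff_locallyP; rewrite dE|rewrite dE scale1r].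
Qed.

Lemma differentiable1_epsE (f : C -> C) z : differentiable f z ->
  forall e : R, 0 < e -> exists2 d : R, 0 < d &
    forall h, nm h < d -> nm (f (z + h) - f z - h * 'd f z 1) <= e * nm h.
Proof.
move=> df e /(differentiable_eps df)[d d0 hd]; exists d => // h /hd.
have E : 'd f z h = h * 'd f z 1.
  have -> : h = h *: (1 : C) by rewrite /GRing.scale /= mulr1.
  by rewrite linearZ /GRing.scale /= mulr1.
by rewrite E.
Qed.

Lemma rderiv_eps (G : R -> C) x l :
  (forall e : R, 0 < e -> exists2 d : R, 0 < d &
     forall h, `|h| < d -> nm (G (x + h) - G x - h%:C%C * l) <= e * `|h|) ->
  rderiv G x l.
Proof.
move=> H; split; apply: derive_eps => e /H[d d0 hd]; exists d => // h /hd;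
  apply: le_trans.
  apply: le_trans (nm_Re _); rewrite !(ReD, ReN) ReM /= mul0r subr0 //.
by apply: le_trans (nm_Im _); rewrite !(ImD, ImN) ImM /= mul0r addr0.
Qed.

(** The mean value theorem fails for complex values; applying it to the real and imaginary parts
    costs the factor 2. *)
Lemma rderiv_mv (G g : R -> C) (a b M : R) : a <= b ->
  (forall x, a <= x <= b -> rderiv G x (g x)) ->
  (forall x, a <= x <= b -> nm (g x) <= M) ->
  nm (G b - G a) <= 2 * M * (b - a).
Proof.
move=> ab dG gM.
have aux (G1 g1 : R -> R) :
    (forall x, a <= x <= b -> is_derive x 1 G1 (g1 x)) ->
    (forall x, a <= x <= b -> `|g1 x| <= M) -> `|G1 b - G1 a| <= M * (b - a).
  move=> h1 h2.
  have [||c hc ->] := @MVT_segment _ G1 g1 a b ab.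
  - by move=> x /itvP hx; apply: h1; rewrite !hx.
  - apply: continuous_in_subspaceT => x; rewrite inE /= in_itv /= => hx.
    apply: differentiable_continuous; apply/derivable1_diffP.
    by case: (h1 x hx).
  - rewrite normrM (ger0_norm (_ : 0 <= b - a)) ?subr_ge0 //.
    by rewrite ler_wpM2r ?subr_ge0 // h2.
rewrite (le_trans (nm_ReIm _)) //.
have l1 := aux _ _ (fun x hx => (dG x hx).1)
  (fun x hx => le_trans (nm_Re _) (gM x hx)).
have l2 := aux _ _ (fun x hx => (dG x hx).2)
  (fun x hx => le_trans (nm_Im _) (gM x hx)).
rewrite !(ReD, ReN, ImD, ImN); lra.
Qed.

Lemma prim_exists_real (g : R -> R) (a b : R) :
  (forall x, a <= x <= b -> {for x, continuous g}) ->
  exists G : R -> R, forall x, a < x < b -> is_derive x 1 G (g x).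
Proof.
move=> cg.
exists (fun x => (\int[@lebesgue_measure R]_(t in [set` `[a, x]]) (g t))%R).
move=> x /andP[ax xb].
have [] := @continuous_FTC1_closed R g a x b xb _ ax (cg _ _).
- apply: continuous_compact_integrable; first exact: segment_compact.
  apply: continuous_in_subspaceT => t; rewrite inE /= in_itv /=; exact: cg.
- by rewrite !ltW.
- by move=> h1 h2; split => //; rewrite -derive1E.
Qed.

Lemma prim_exists (g : R -> C) (a b : R) :
  (forall x, a <= x <= b -> forall e : R, 0 < e -> exists2 d : R, 0 < d &
     forall y, `|y - x| < d -> nm (g y - g x) < e) ->
  exists G : R -> C, forall x, a < x < b -> rderiv G x (g x).
Proof.
move=> cg.
have [G1 h1] : exists G : R -> R, forall x, a < x < b ->
    is_derive x 1 G (complex.Re (g x)).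
  apply: (prim_exists_real (g := fun x => complex.Re (g x))) => x hx.
  apply/cvgrPdist_lt => e e0; have [d d0 hd] := cg x hx e e0.
  apply/nbhs_ballP; exists d => // y; rewrite /ball_ /= distrC => /hd.
  by apply: le_lt_trans; rewrite distrC (le_trans _ (nm_Re _)) // ReD ReN.
have [G2 h2] : exists G : R -> R, forall x, a < x < b ->
    is_derive x 1 G (complex.Im (g x)).
  apply: (prim_exists_real (g := fun x => complex.Im (g x))) => x hx.
  apply/cvgrPdist_lt => e e0; have [d d0 hd] := cg x hx e e0.
  apply/nbhs_ballP; exists d => // y; rewrite /ball_ /= distrC => /hd.
  by apply: le_lt_trans; rewrite distrC (le_trans _ (nm_Im _)) // ImD ImN.
by exists (fun x => Complex (G1 x) (G2 x)) => x hx; split; [exact: h1|exact: h2].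
Qed.

Lemma diff_line (B : C -> C) (z v : C) : differentiable B z ->
  forall t : R, forall G : R -> C, (forall s, G s = B (z + (s - t)%:C%C * v)) ->
  rderiv G t ('d B z 1 * v).
Proof.
move=> dB t G GE; apply: rderiv_eps => e e0.
have v0 : 0 < nm v + 1 by rewrite ltr_wpDl ?nm_ge0.
have [|d d0 hd] := differentiable_eps dB (e := e / (nm v + 1)).
  by rewrite divr_gt0.
exists (d / (nm v + 1)); first by rewrite divr_gt0.
move=> h hh; rewrite !GE (_ : t + h - t = h); last by ring.
rewrite (_ : (t - t)%:C%C = 0 :> C) ?mul0r ?addr0; last by rewrite subrr.
have hv : nm (h%:C%C * v : C) <= `|h| * (nm v + 1).
  by rewrite nmM nm_real ler_wpM2l // lerDl.
have -> : h%:C%C * ('d B z 1 * v) = 'd B z (h%:C%C * v).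
  have -> : (h%:C%C * v : C) = (h%:C%C * v) *: (1 : C) by rewrite /GRing.scale /= mulr1.
  by rewrite linearZ /= /GRing.scale /= [RHS]mulrC mulrCA.
rewrite (le_trans (hd _ _)) //.
  by rewrite (le_lt_trans hv) // -ltr_pdivlMr.
apply: le_trans (ler_wpM2l _ hv) _; first by rewrite divr_ge0 // ltW.
by rewrite [leLHS](_ : _ = e * `|h|) //; field; rewrite gt_eqF.
Qed.

End OneVariable.

(** * Goursat's theorem on rectangles *)

Section Goursat.
Variables (R : realType).
Local Notation C := (Cplx R).
Local Notation cpt := (@cpt R).
Local Notation ci := (@ci R).

(* Contour integrals are replaced by differences of primitives along horizontal
   and vertical segments. *)
Definition is_prims (g : C -> C) (s : R) (H V : R -> R -> C) :=
  (forall x y, `|x| < s -> `|y| < s -> rderiv (H y) x (g (cpt x y))) /\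
  (forall x y, `|x| < s -> `|y| < s -> rderiv (V x) y (g (cpt x y))).

(** The integral along the boundary, counterclockwise: bottom, right, top, left. Written with
    primitives, its additivity under subdivision is a ring identity. *)
Definition rect_int (H V : R -> R -> C) (x1 x2 y1 y2 : R) : C :=
  (H y1 x2 - H y1 x1) + ci * (V x2 y2 - V x2 y1)
  - (H y2 x2 - H y2 x1) - ci * (V x1 y2 - V x1 y1).

Lemma cptBx x x' y : cpt x y - cpt x' y = (x - x')%:C%C.
Proof. by apply/eqP; rewrite eq_complex ReD ImD ReN ImN /= subrr !eqxx. Qed.

Lemma cptBy x y y' : cpt x y - cpt x y' = ci * (y - y')%:C%C.
Proof.
apply/eqP; rewrite eq_complex !(ReD, ImD, ReN, ImN, ReM, ImM) /= subrr.
by apply/andP; split; apply/eqP; ring.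
Qed.

Lemma nm_cptB x y x' y' : nm (cpt x y - cpt x' y') <= `|x - x'| + `|y - y'|.
Proof.
by rewrite (le_trans (nm_ReIm _)) // ReD ImD ReN ImN.
Qed.

Lemma prims_exist (g : C -> C) (s : R) :
  (forall x y, `|x| <= s -> `|y| <= s -> {for cpt x y, continuous g}) ->
  exists H V, is_prims g s H V.
Proof.
move=> cg.
have ex1 (y : R) : exists Hy : R -> C, forall x, `|y| < s -> `|x| < s ->
    rderiv Hy x (g (cpt x y)).
  have [ys|_] := ltP `|y| s; last by exists (fun=> 0).
  have [|G hG] := @prim_exists R (fun x => g (cpt x y)) (- s) s.
    move=> x; rewrite -ler_norml => hx e e0.
    have /continuous_pballP/(_ e e0)[d d0 hd] := cg x y hx (ltW ys).
    by exists d => // x' hx'; apply: hd; rewrite cptBx nm_real.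
  by exists G => x _; rewrite ltr_norml; exact: hG.
have ex2 (x : R) : exists Vx : R -> C, forall y, `|x| < s -> `|y| < s ->
    rderiv Vx y (g (cpt x y)).
  have [xs|_] := ltP `|x| s; last by exists (fun=> 0).
  have [|G hG] := @prim_exists R (fun y => g (cpt x y)) (- s) s.
    move=> y; rewrite -ler_norml => hy e e0.
    have /continuous_pballP/(_ e e0)[d d0 hd] := cg x y (ltW xs) hy.
    by exists d => // y' hy'; apply: hd; rewrite cptBy nmM nm_ci mul1r nm_real.
  by exists G => y _; rewrite ltr_norml; exact: hG.
have [H hH] := choice ex1; have [V hV] := choice ex2.
by exists H, V; split=> x y ? ?; [exact: hH|exact: hV].
Qed.

Lemma rect_int_bound g s H V x1 x2 y1 y2 M : is_prims g s H V ->
  - s < x1 -> x1 <= x2 -> x2 < s -> - s < y1 -> y1 <= y2 -> y2 < s ->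
  (forall x y, x1 <= x <= x2 -> y1 <= y <= y2 -> nm (g (cpt x y)) <= M) ->
  nm (rect_int H V x1 x2 y1 y2) <= 4 * M * ((x2 - x1) + (y2 - y1)).
Proof.
move=> [hH hV] sx1 x12 x2s sy1 y12 y2s hM.
have hx x : x1 <= x <= x2 -> `|x| < s.
  by move=> /andP[? ?]; rewrite ltr_norml; apply/andP; split; lra.
have hy y : y1 <= y <= y2 -> `|y| < s.
  by move=> /andP[? ?]; rewrite ltr_norml; apply/andP; split; lra.
have iy1 : y1 <= y1 <= y2 by rewrite lexx.
have iy2 : y1 <= y2 <= y2 by rewrite lexx y12.
have ix1 : x1 <= x1 <= x2 by rewrite lexx.
have ix2 : x1 <= x2 <= x2 by rewrite lexx x12.
have hor y : y1 <= y <= y2 -> nm (H y x2 - H y x1) <= 2 * M * (x2 - x1).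
  move=> iy; apply: (rderiv_mv (g := fun x => g (cpt x y))) => // x ix.
    by apply: hH; [exact: hx|exact: hy].
  exact: hM.
have ver x : x1 <= x <= x2 -> nm (ci * (V x y2 - V x y1)) <= 2 * M * (y2 - y1).
  move=> ix; rewrite nmM nm_ci mul1r.
  apply: (rderiv_mv (g := fun y => g (cpt x y))) => // y iy.
    by apply: hV; [exact: hx|exact: hy].
  exact: hM.
rewrite /rect_int.
have := hor _ iy1; have := hor _ iy2; have := ver _ ix1; have := ver _ ix2.
set a := H y1 x2 - H y1 x1; set b := ci * (V x2 y2 - V x2 y1).
set c := H y2 x2 - H y2 x1; set d := ci * (V x1 y2 - V x1 y1) => l1 l2 l3 l4.
have := nmBD (a + b - c) d; have := nmBD (a + b) c; have := nmD a b; lra.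
Qed.

(** The affine part [A] of [g] at [z0] has the primitive [B], so subtracting it leaves the boundary
    integral unchanged; what remains is at most [e] times the half-perimeter on the whole
    rectangle. *)
Lemma rect_int_local g s H V x0 y0 : is_prims g s H V ->
  differentiable g (cpt x0 y0) ->
  forall e : R, 0 < e -> exists2 d : R, 0 < d &
  forall x1 x2 y1 y2, - s < x1 -> x1 <= x0 <= x2 -> x2 < s ->
  - s < y1 -> y1 <= y0 <= y2 -> y2 < s -> (x2 - x1) + (y2 - y1) < d ->
  nm (rect_int H V x1 x2 y1 y2) <= 4 * e * ((x2 - x1) + (y2 - y1)) ^+ 2.
Proof.
move=> [hH hV] dg e e0; set z0 := cpt x0 y0; set l := 'd g z0 1.
have [d d0 hd] := differentiable1_epsE dg e0; exists d => //.
move=> x1 x2 y1 y2 sx1 /andP[x10 x02] x2s sy1 /andP[y10 y02] y2s hp.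
pose A z := g z0 + (z - z0) * l.
pose B z := g z0 * z + (z - z0) ^+ 2 * (l / 2%:R).
have dB z : differentiable B z /\ 'd B z 1 = A z.
  apply: differentiable1_eps => e' e'0.
  have l0 : 0 < nm (l / 2%:R) + 1 by rewrite ltr_wpDl ?nm_ge0.
  exists (e' / (nm (l / 2%:R) + 1)); first by rewrite divr_gt0.
  move=> h hh; rewrite [X in nm X](_ : _ = h * (h * (l / 2%:R))); last first.
    by rewrite /B /A; field.
  rewrite nmM mulrC ler_wpM2r ?nm_ge0 // nmM.
  rewrite ltr_pdivlMr // in hh; apply: le_trans (ltW hh).
  by rewrite ler_wpM2l ?nm_ge0 // lerDl.
have dBx y x : rderiv (fun t => B (cpt t y)) x (A (cpt x y)).
  apply: rderiv_eq; first apply: (diff_line (v := 1) (dB (cpt x y)).1).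
    by move=> t; rewrite mulr1 -(cptBx _ _ y) (addrC (cpt x y)) subrK.
  by rewrite mulr1 (dB _).2.
have dBy x y : rderiv (fun t => - ci * B (cpt x t)) y (A (cpt x y)).
  apply: rderiv_eq.
    apply: rderivZ; apply: (diff_line (v := ci) (dB (cpt x y)).1).
    by move=> t; rewrite mulrC -(cptBy x) (addrC (cpt x y)) subrK.
  by rewrite (dB _).2 mulNr mulrCA ci_sqr mulrN1 opprK.
have pBA : is_prims (fun z => g z - A z) s (fun y x => H y x - B (cpt x y))
     (fun x y => V x y - (- ci * B (cpt x y))).
  by split=> x y hx hy; apply: rderivB => //; [exact: hH|exact: hV].
have := @rect_int_bound _ s _ _ x1 x2 y1 y2 (e * ((x2 - x1) + (y2 - y1))) pBA sx1.
have -> : rect_int (fun y x => H y x - B (cpt x y))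
    (fun x y => V x y - - ci * B (cpt x y)) x1 x2 y1 y2 = rect_int H V x1 x2 y1 y2.
  rewrite /rect_int; have := ci_sqr R; move: (B _) (B _) (B _) (B _) => b1 b2 b3 b4.
  move: (H _ _) (H _ _) (H _ _) (H _ _) (V _ _) (V _ _) (V _ _) (V _ _).
  move=> h1 h2 h3 h4 v1 v2 v3 v4 i2.
  rewrite !mulrBr !(mulNr ci) !(mulrN ci) !(mulrA ci ci) i2; ring.
have x12 : x1 <= x2 by lra.
have y12 : y1 <= y2 by lra.
move=> /(_ x12 x2s sy1 y12 y2s); rewrite expr2 !mulrA; apply.
move=> x y /andP[k1_ k2_] /andP[k3_ k4_].
have hz : nm (cpt x y - z0) <= x2 - x1 + (y2 - y1).
  rewrite (le_trans (nm_cptB _ _ _ _)) // lerD // ler_norml; apply/andP; split;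
    by clear -x10 x02 y10 y02 k1_ k2_ k3_ k4_; lra.
have := hd (cpt x y - z0); rewrite [z0 + _]addrC subrK => /(_ (le_lt_trans hz hp)).
rewrite /A opprD addrA => /le_trans; apply.
by rewrite ler_wpM2l // ltW.
Qed.

(** Bisection: some quarter carries at least a fourth of the integral. The local bound at the common
    point of the nested quarters is quadratic in the half-perimeter, which is halved at each stage,
    so it compensates the factor [4 ^+ n]. *)
Lemma goursat g s H V x1 x2 y1 y2 : is_prims g s H V ->
  - s < x1 -> x1 <= x2 -> x2 < s -> - s < y1 -> y1 <= y2 -> y2 < s ->
  (forall x y, x1 <= x <= x2 -> y1 <= y <= y2 -> differentiable g (cpt x y)) ->
  rect_int H V x1 x2 y1 y2 = 0.
Proof.
move=> hp sx1 x12 x2s sy1 y12 y2s dg.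
pose T := ((R * R) * (R * R))%type.
pose I (q : T) := rect_int H V q.1.1 q.1.2 q.2.1 q.2.2.
have step (q : T) : exists q' : T,
  [/\ nm (I q) <= 4 * nm (I q'),
   (q'.1.2 - q'.1.1 = (q.1.2 - q.1.1) / 2 /\ q'.2.2 - q'.2.1 = (q.2.2 - q.2.1) / 2) &
   q.1.1 <= q.1.2 -> q.2.1 <= q.2.2 ->
   (q.1.1 <= q'.1.1 /\ q'.1.2 <= q.1.2) /\ (q.2.1 <= q'.2.1 /\ q'.2.2 <= q.2.2)].
  case: q => [[a b] [c d]]; pose m := (a + b) / 2; pose n := (c + d) / 2.
  pose q1 : T := ((a, m), (c, n)); pose q2 : T := ((m, b), (c, n)).
  pose q3 : T := ((a, m), (n, d)); pose q4 : T := ((m, b), (n, d)).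
  have E : I ((a, b), (c, d)) = I q1 + I q2 + I q3 + I q4.
    rewrite /I /rect_int /=; ring.
  have := nmD (I q1 + I q2 + I q3) (I q4); have := nmD (I q1 + I q2) (I q3).
  have := nmD (I q1) (I q2); rewrite -E.
  have [h1|h1] := lerP (nm (I ((a, b), (c, d)))) (4 * nm (I q1)).
    by exists q1; rewrite /q1 /m /n /=; split=> //; split; lra.
  have [h2|h2] := lerP (nm (I ((a, b), (c, d)))) (4 * nm (I q2)).
    by exists q2; rewrite /q2 /m /n /=; split=> //; split; lra.
  have [h3|h3] := lerP (nm (I ((a, b), (c, d)))) (4 * nm (I q3)).
    by exists q3; rewrite /q3 /m /n /=; split=> //; split; lra.
  exists q4; rewrite /q4 /m /n /=; split; [|split; lra|split; lra].
  by rewrite -/q4; lra.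
have [st hst] := choice step.
pose q0 : T := ((x1, x2), (y1, y2)).
pose Q n := iter n st q0.
have w n : (Q n).1.2 - (Q n).1.1 = (x2 - x1) / 2 ^+ n /\
           (Q n).2.2 - (Q n).2.1 = (y2 - y1) / 2 ^+ n.
  elim: n => [|n [IH1 IH2]]; first by rewrite !expr0 !divr1.
  have [_ [-> ->] _] := hst (Q n); rewrite IH1 IH2 !exprS.
  by split; field; exact: expf_neq0.
have wx n : (Q n).1.1 <= (Q n).1.2.
  by rewrite -subr_ge0 (w n).1 divr_ge0 ?exprn_ge0 ?subr_ge0.
have wy n : (Q n).2.1 <= (Q n).2.2.
  by rewrite -subr_ge0 (w n).2 divr_ge0 ?exprn_ge0 ?subr_ge0.
have nest n m : ((Q n).1.1 <= (Q (m + n)%N).1.1 /\ (Q (m + n)%N).1.2 <= (Q n).1.2) /\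
    ((Q n).2.1 <= (Q (m + n)%N).2.1 /\ (Q (m + n)%N).2.2 <= (Q n).2.2).
  elim: m => [//|m [[i1 i2] [i3 i4]]]; rewrite addSn.
  have [_ _ /(_ (wx _) (wy _)) [[]]] := hst (Q (m + n)%N).
  rewrite -/(Q (m + n).+1%N) => ? ? [? ?].
  by split; split; [exact: le_trans i1 _|exact: le_trans i2|exact: le_trans i3 _|exact: le_trans i4].
have bigI n : nm (I q0) <= 4 ^+ n * nm (I (Q n)).
  elim: n => [|n IH]; first by rewrite expr0 mul1r.
  rewrite (le_trans IH) // exprSr -mulrA ler_wpM2l ?exprn_ge0 //.
  by have [] := hst (Q n).
have ord_x n m : (Q n).1.1 <= (Q m).1.2.
  have := nest n m; have := nest m n; rewrite addnC; have := wx (n + m)%N.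
  by rewrite addnC => ? [[? ?] _] [[? ?] _]; lra.
have ord_y n m : (Q n).2.1 <= (Q m).2.2.
  have := nest n m; have := nest m n; rewrite addnC; have := wy (n + m)%N.
  by rewrite addnC => ? [_ [? ?]] [_ [? ?]]; lra.
pose x0 := sup (range (fun n => (Q n).1.1)).
pose y0 := sup (range (fun n => (Q n).2.1)).
have hx0 n : (Q n).1.1 <= x0 <= (Q n).1.2.
  apply/andP; split; first apply: ub_le_sup.
  - by exists (Q 0).1.2 => _ [k _ <-].
  - by exists n.
  - by apply: ge_sup => [|_ [k _ <-]//]; exists (Q 0).1.1; exists 0.
have hy0 n : (Q n).2.1 <= y0 <= (Q n).2.2.
  apply/andP; split; first apply: ub_le_sup.
  - by exists (Q 0).2.2 => _ [k _ <-].
  - by exists n.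
  - by apply: ge_sup => [|_ [k _ <-]//]; exists (Q 0).2.1; exists 0.
have dg0 := dg _ _ (hx0 0) (hy0 0).
apply/eqP; rewrite -nm_eq0; apply/eqP/le_anti; rewrite nm_ge0 andbT.
set p := (x2 - x1) + (y2 - y1).
have p0 : 0 <= p by rewrite /p; lra.
apply/ler_addgt0Pl => e e0; rewrite addr0.
(* The final bound is four times this constant times [p ^+ 2]; adding 1 covers the degenerate
   rectangle [p = 0]. *)
have e1 : 0 < e / (4 * (p ^+ 2 + 1)).
  by rewrite divr_gt0 // mulr_gt0 // ltr_wpDl // exprn_ge0.
have [d d0 hd] := rect_int_local hp dg0 e1.
have [n hn] : exists n, p / 2 ^+ n < d.
  exists (Num.bound (p / d)); rewrite ltr_pdivrMr ?exprn_gt0 // mulrC -ltr_pdivrMr //.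
  apply: lt_le_trans (archi_boundP _) _; first by rewrite divr_ge0 // ltW.
  by rewrite -natrX ler_nat ltnW // ltn_expl.
have wp : (Q n).1.2 - (Q n).1.1 + ((Q n).2.2 - (Q n).2.1) = p / 2 ^+ n.
  by rewrite (w n).1 (w n).2 -mulrDl.
have := nest 0%N n; rewrite addn0 /= => -[[? ?] [? ?]].
have := hd (Q n).1.1 (Q n).1.2 (Q n).2.1 (Q n).2.2; rewrite wp.
move=> /(_ _ (hx0 n) _ _ (hy0 n) _ hn) h.
rewrite (le_trans (bigI n)) //.
have {}h : nm (I (Q n)) <= 4 * (e / (4 * (p ^+ 2 + 1))) * (p / 2 ^+ n) ^+ 2.
  move: h; apply; first by apply: lt_le_trans sx1 _.
  - exact: le_lt_trans x2s.
  - exact: lt_le_trans sy1 _.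
  - exact: le_lt_trans y2s.
apply: le_trans (ler_wpM2l _ h) _; first by rewrite exprn_ge0.
have P0 : 0 <= p ^+ 2 by rewrite exprn_ge0.
have -> : 4 ^+ n = (2 ^+ n) ^+ 2 :> R.
  by rewrite exprAC; congr (_ ^+ _); rewrite expr2; ring.
rewrite [leLHS](_ : _ = e * (p ^+ 2 / (p ^+ 2 + 1))); last first.
  by field; rewrite expf_neq0 // gt_eqF //; lra.
have P1 : 0 < p ^+ 2 + 1 by rewrite ltr_wpDl.
rewrite ler_piMr //; first exact: ltW.
by rewrite ler_pdivrMr // mul1r lerDl.
Qed.

(* The exceptional point is cut out by a small square, on which the integral is
   at most the perimeter times the supremum. *)
Lemma goursat_exceptional g s H V (r : R) (x0 y0 : R) : is_prims g s H V ->
  0 < r -> r < s -> `|x0| < r -> `|y0| < r ->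
  (forall x y, `|x| < s -> `|y| < s -> cpt x y != cpt x0 y0 ->
    differentiable g (cpt x y)) ->
  {for cpt x0 y0, continuous g} ->
  rect_int H V (- r) r (- r) r = 0.
Proof.
move=> hp r0 rs; rewrite !ltr_norml => /andP[x01 x02] /andP[y01 y02] dg cg.
have /continuous_pballP/(_ 1 ltr01)[d d0 hd] := cg.
pose M := nm (g (cpt x0 y0)) + 1.
have M0 : 0 < M by rewrite ltr_wpDl ?nm_ge0.
have zero x1 x2 y1 y2 : - s < x1 -> x1 <= x2 -> x2 < s -> - s < y1 -> y1 <= y2 ->
    y2 < s -> (x0 < x1 \/ x2 < x0 \/ y0 < y1 \/ y2 < y0) ->
    rect_int H V x1 x2 y1 y2 = 0.
  move=> a1 a2 a3 a4 a5 a6 hout; apply: (goursat hp a1 a2 a3 a4 a5 a6).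
  move=> x y /andP[b1 b2] /andP[b3 b4].
  apply: dg; [by rewrite ltr_norml (lt_le_trans a1) // (le_lt_trans b2)|
              by rewrite ltr_norml (lt_le_trans a4) // (le_lt_trans b4)|].
  rewrite eq_complex /= negb_and !neq_lt.
  case: hout => [h|[h|[h|h]]].
  - by rewrite (lt_le_trans h b1) orbT.
  - by rewrite (le_lt_trans b2 h).
  - by rewrite (lt_le_trans h b3) !orbT.
  - by rewrite (le_lt_trans b4 h) orbT.
apply/eqP; rewrite -nm_eq0; apply/eqP/le_anti; rewrite nm_ge0 andbT.
apply/ler_addgt0Pl => e e0; rewrite addr0.
(* The constants in [d] and [e] keep the small square in the ball where [nm g <= M] and make its
   contribution [16 * M * h] at most [e]; the last ones keep it inside the large square. *)
pose h := Num.min (Num.min (d / 3) (e / (16 * M)))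
  (Num.min (Num.min (x0 + r) (r - x0)) (Num.min (y0 + r) (r - y0)) / 2).
have h0 : 0 < h.
  rewrite /h !lt_min !divr_gt0 ?mulr_gt0 //= ?lt_min.
  by apply/andP; split; apply/andP; split; clear -x01 x02 y01 y02; lra.
have : h <= h by [].
rewrite {2}/h !le_min => /andP[/andP[hd3 hM]].
rewrite ler_pdivlMr // !le_min => /andP[/andP[k1 k2] /andP[k3 k4]].
have -> : rect_int H V (- r) r (- r) r =
    rect_int H V (- r) (x0 - h) (- r) r + rect_int H V (x0 + h) r (- r) r
    + rect_int H V (x0 - h) (x0 + h) (- r) (y0 - h)
    + rect_int H V (x0 - h) (x0 + h) (y0 + h) r
    + rect_int H V (x0 - h) (x0 + h) (y0 - h) (y0 + h) by rewrite /rect_int; ring.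
have t1 : - s < - r by rewrite ltrN2.
have t2 : r < s by [].
have t3 : - r <= r by clear -r0; lra.
have [t4 t5 t6] : [/\ - s < x0 + h, x0 + h <= r & x0 + h < s] by split; clear -h0 k1 k2 t1 t2 x01; lra.
have [t7 t8 t9] : [/\ - s < x0 - h, - r <= x0 - h & x0 - h < s] by split; clear -h0 k1 k2 t1 t2 x02; lra.
have [u4 u5 u6] : [/\ - s < y0 + h, y0 + h <= r & y0 + h < s] by split; clear -h0 k3 k4 t1 t2 y01; lra.
have [u7 u8 u9] : [/\ - s < y0 - h, - r <= y0 - h & y0 - h < s] by split; clear -h0 k3 k4 t1 t2 y02; lra.
have [v1 v2] : x0 - h <= x0 + h /\ y0 - h <= y0 + h by split; clear -h0; lra.
have [w1 w2] : x0 - h < x0 /\ x0 < x0 + h by split; clear -h0; lra.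
have [w3 w4] : y0 - h < y0 /\ y0 < y0 + h by split; clear -h0; lra.
rewrite (zero (- r) (x0 - h)) //; last by right; left.
rewrite (zero (x0 + h) r) //; last by left.
rewrite (zero (x0 - h) (x0 + h) (- r) (y0 - h)) //; last by right; right; right.
rewrite (zero (x0 - h) (x0 + h) (y0 + h) r) //; last by right; right; left.
rewrite !add0r.
have := @rect_int_bound g s H V (x0 - h) (x0 + h) (y0 - h) (y0 + h) M hp.
have -> : 4 * M * (x0 + h - (x0 - h) + (y0 + h - (y0 - h))) = 16 * M * h by ring.
move=> b; apply: le_trans (b t7 v1 t6 u7 v2 u6 _) _.
  move=> x y /andP[q1 q2] /andP[q3 q4]; have := hd (cpt x y).
  have hz : nm (cpt x y - cpt x0 y0) < d.
    rewrite (le_lt_trans (nm_cptB _ _ _ _)) //.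
    have : `|x - x0| <= h by rewrite ler_norml; apply/andP; split; clear -q1 q2; lra.
    have : `|y - y0| <= h by rewrite ler_norml; apply/andP; split; clear -q3 q4; lra.
    by clear -hd3 h0 d0; lra.
  move=> /(_ hz); have := nmD (g (cpt x y) - g (cpt x0 y0)) (g (cpt x0 y0)).
  by rewrite subrK /M; clear; lra.
by rewrite mulrC -ler_pdivlMr // mulr_gt0.
Qed.

End Goursat.

(** * Integration along a square and Cauchy's formula *)

Section Cauchy.
Variables (R : realType).
Local Notation C := (Cplx R).
Local Notation cpt := (@cpt R).
Local Notation ci := (@ci R).
Implicit Types (u g F : C -> C) (z a : C).

Lemma differentiable_local (V W : normedModType C) (f g : V -> W) x r : 0 < r ->
  (forall y, pball x r y -> f y = g y) -> differentiable g x -> differentiable f x.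
Proof.
move=> r0 fg dg; apply: (eps_differentiable (df := 'd g x)).
  exact: diff_continuous.
move=> e /(differentiable_eps dg)[d d0 hd].
exists (Num.min d r); first by rewrite lt_min d0.
move=> h; rewrite lt_min => /andP[h1 h2].
rewrite !fg; [exact: hd|exact: pball_center|].
by rewrite /pball /= addrAC subrr add0r.
Qed.

Lemma differentiable_subc (V : normedModType C) (f : V -> C) x (a : C) :
  differentiable f x -> differentiable (fun w => f w - a) x.
Proof. by move=> df; exact: (differentiableB df (differentiable_cst a x)). Qed.

Lemma differentiable_id (V : normedModType C) (x : V) : differentiable (fun w => w) x.
Proof. exact: ex_diff. Qed.

Lemma differentiable_pow (V : normedModType C) (f : V -> C) n x :
  differentiable f x -> differentiable (fun w => f w ^+ n) x.
Proof.
move=> df; elim: n => [|n IH]; first exact: (differentiable_cst (1 : C) x).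
rewrite (_ : (fun w => f w ^+ n.+1) = (fun w => f w * f w ^+ n)).
  exact: differentiableM.
by apply/funext => w; rewrite exprS.
Qed.

(** A square contour has horizontal and vertical sides only, as the primitives of [is_prims]
    require; its points satisfy [1 <= nm z <= 2]. *)
Definition frame z := exists t : R, `|t| <= 1 /\
  (z = cpt t (-1) \/ z = cpt t 1 \/ z = cpt (-1) t \/ z = cpt 1 t).

Lemma frame_nm z : frame z -> 1 <= nm z <= 2.
Proof.
move=> [t [t1 h]]; apply/andP; split.
  case: h => [->|[->|[->|->]]].
  - by apply: le_trans (nm_Im _); rewrite /= normrN1.
  - by apply: le_trans (nm_Im _); rewrite /= normr1.
  - by apply: le_trans (nm_Re _); rewrite /= normrN1.
  - by apply: le_trans (nm_Re _); rewrite /= normr1.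
apply: le_trans (nm_ReIm _) _.
case: h => [->|[->|[->|->]]] /=; rewrite ?normrN1 ?normr1; clear -t1; lra.
Qed.

(* [v] is the integral of [u] along the boundary of the square [-1, 1]^2. *)
Definition contour u (v : C) := exists Gb Gt Gl Gr : R -> C,
  (forall t : R, -1 <= t <= 1 -> [/\ rderiv Gb t (u (cpt t (-1))), rderiv Gt t (u (cpt t 1)),
     rderiv Gl t (u (cpt (-1) t)) & rderiv Gr t (u (cpt 1 t))]) /\
  v = (Gb 1 - Gb (-1)) + ci * (Gr 1 - Gr (-1)) - (Gt 1 - Gt (-1))
      - ci * (Gl 1 - Gl (-1)).

Lemma contour_ext u u' v : (forall z, frame z -> u z = u' z) ->
  contour u v -> contour u' v.
Proof.
move=> uu' [Gb [Gt [Gl [Gr [h ->]]]]]; exists Gb, Gt, Gl, Gr; split=> // t ht.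
have t1 : `|t| <= 1 by rewrite ler_norml.
by have [] := h t ht; rewrite !uu' //; exists t; split; tauto.
Qed.

Lemma contourB u u' v v' : contour u v -> contour u' v' ->
  contour (fun z => u z - u' z) (v - v').
Proof.
move=> [Gb [Gt [Gl [Gr [h ->]]]]] [Gb' [Gt' [Gl' [Gr' [h' ->]]]]].
exists (fun t => Gb t - Gb' t), (fun t => Gt t - Gt' t), (fun t => Gl t - Gl' t),
  (fun t => Gr t - Gr' t); split; last by ring.
move=> t ht; have [? ? ? ?] := h t ht; have [? ? ? ?] := h' t ht.
by split; exact: rderivB.
Qed.

Lemma contourD u u' v v' : contour u v -> contour u' v' ->
  contour (fun z => u z + u' z) (v + v').
Proof.
move=> [Gb [Gt [Gl [Gr [h ->]]]]] [Gb' [Gt' [Gl' [Gr' [h' ->]]]]].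
exists (fun t => Gb t + Gb' t), (fun t => Gt t + Gt' t), (fun t => Gl t + Gl' t),
  (fun t => Gr t + Gr' t); split; last by ring.
move=> t ht; have [? ? ? ?] := h t ht; have [? ? ? ?] := h' t ht.
by split; exact: rderivD.
Qed.

Lemma contourZ k u v : contour u v -> contour (fun z => k * u z) (k * v).
Proof.
move=> [Gb [Gt [Gl [Gr [h ->]]]]].
exists (fun t => k * Gb t), (fun t => k * Gt t), (fun t => k * Gl t),
  (fun t => k * Gr t); split; last by ring.
by move=> t ht; have [? ? ? ?] := h t ht; split; exact: rderivZ.
Qed.

(** 16 is four sides of length 2, times the factor 2 of [rderiv_mv]. *)
Lemma contour_bound u v (M : R) : contour u v ->
  (forall z, frame z -> nm (u z) <= M) -> nm v <= 16 * M.
Proof.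
move=> [Gb [Gt [Gl [Gr [h ->]]]]] hM.
have le11 : -1 <= 1 :> R by lra.
have E : 1 - -1 = 2 :> R by lra.
have fr t : -1 <= t <= 1 -> [/\ frame (cpt t (-1)), frame (cpt t 1),
    frame (cpt (-1) t) & frame (cpt 1 t)].
  by rewrite -ler_norml => ht; split; exists t; split; tauto.
have lb : nm (Gb 1 - Gb (-1)) <= 2 * M * 2.
  rewrite -[X in _ * X]E; apply: (rderiv_mv (g := fun t => u (cpt t (-1)))) => // t ht.
    by have [] := h t ht.
  by apply: hM; have [] := fr t ht.
have lt : nm (Gt 1 - Gt (-1)) <= 2 * M * 2.
  rewrite -[X in _ * X]E; apply: (rderiv_mv (g := fun t => u (cpt t 1))) => // t ht.
    by have [] := h t ht.
  by apply: hM; have [] := fr t ht.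
have ll : nm (ci * (Gl 1 - Gl (-1))) <= 2 * M * 2.
  rewrite nmM nm_ci mul1r.
  rewrite -[X in _ * X]E; apply: (rderiv_mv (g := fun t => u (cpt (-1) t))) => // t ht.
    by have [] := h t ht.
  by apply: hM; have [] := fr t ht.
have lr : nm (ci * (Gr 1 - Gr (-1))) <= 2 * M * 2.
  rewrite nmM nm_ci mul1r.
  rewrite -[X in _ * X]E; apply: (rderiv_mv (g := fun t => u (cpt 1 t))) => // t ht.
    by have [] := h t ht.
  by apply: hM; have [] := fr t ht.
move: lb lt ll lr; set a := Gb 1 - _; set b := ci * (Gr 1 - _).
set c := Gt 1 - _; set d := ci * (Gl 1 - _).
have := nmBD (a + b - c) d; have := nmBD (a + b) c; have := nmD a b.
move: (nm _) (nm _) (nm _) (nm _) (nm _) (nm _) (nm _).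
by clear; move=> *; lra.
Qed.

Lemma contour_exists u : (forall z, 1 <= nm z -> nm z < 4 -> differentiable u z) ->
  exists v, contour u v.
Proof.
move=> du.
have cu z : 1 <= nm z -> nm z < 4 -> {for z, continuous u}.
  by move=> z1 z4; apply: differentiable_continuous; exact: du.
have side (f : R -> C) :
    (forall t : R, `|t| <= 4 / 3 -> 1 <= nm (f t) /\ nm (f t) < 4) ->
    (forall s t : R, nm (f s - f t) = `|s - t|) ->
    exists G : R -> C, forall t : R, -1 <= t <= 1 -> rderiv G t (u (f t)).
  move=> hf isof.
  (* [prim_exists] controls the derivative only inside its interval, hence a margin beyond
     [[-1, 1]]; with [4 / 3] the sides stay in [nm z < 4]. *)
  have [|G hG] := @prim_exists R (fun t => u (f t)) (- (4 / 3)) (4 / 3).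
    move=> t; rewrite -ler_norml => /hf[f1 f4] e e0.
    have /continuous_pballP/(_ e e0)[d d0 hd] := cu _ f1 f4.
    by exists d => // y hy; apply: hd; rewrite isof.
  by exists G => t /andP[? ?]; apply: hG; apply/andP; split; lra.
have [|s t|Gb hb] := side (fun t => cpt t (-1)).
- move=> t ht; split; first by apply: le_trans (nm_Im _); rewrite /= normrN1.
  by apply: le_lt_trans (nm_ReIm _) _; rewrite /= normrN1; clear -ht; lra.
- by rewrite cptBx nm_real.
have [|s t|Gt ht] := side (fun t => cpt t 1).
- move=> t ht; split; first by apply: le_trans (nm_Im _); rewrite /= normr1.
  by apply: le_lt_trans (nm_ReIm _) _; rewrite /= normr1; clear -ht; lra.
- by rewrite cptBx nm_real.
have [|s t|Gl hl] := side (fun t => cpt (-1) t).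
- move=> t h; split; first by apply: le_trans (nm_Re _); rewrite /= normrN1.
  by apply: le_lt_trans (nm_ReIm _) _; rewrite /= normrN1; clear -h; lra.
- by rewrite cptBy nmM nm_ci mul1r nm_real.
have [|s t|Gr hr] := side (fun t => cpt 1 t).
- move=> t h; split; first by apply: le_trans (nm_Re _); rewrite /= normr1.
  by apply: le_lt_trans (nm_ReIm _) _; rewrite /= normr1; clear -h; lra.
- by rewrite cptBy nmM nm_ci mul1r nm_real.
eexists; exists Gb, Gt, Gl, Gr; split; last by reflexivity.
by move=> t t1; split; [exact: hb|exact: ht|exact: hl|exact: hr].
Qed.

Lemma contour_prim (B u : C -> C) :
  (forall z, frame z -> differentiable B z /\ 'd B z 1 = u z) -> contour u 0.
Proof.
move=> dB.
exists (fun t => B (cpt t (-1))), (fun t => B (cpt t 1)),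
  (fun t => - ci * B (cpt (-1) t)), (fun t => - ci * B (cpt 1 t)); split.
  move=> t ht; have t1 : `|t| <= 1 by rewrite ler_norml.
  have hx y : frame (cpt t y) -> rderiv (fun s => B (cpt s y)) t (u (cpt t y)).
    move=> /dB [dz du]; apply: rderiv_eq; first apply: (diff_line (v := 1) dz).
      by move=> s; rewrite mulr1 -(cptBx _ _ y) (addrC (cpt t y)) subrK.
    by rewrite mulr1.
  have hy x : frame (cpt x t) -> rderiv (fun s => - ci * B (cpt x s)) t (u (cpt x t)).
    move=> /dB [dz du]; apply: rderiv_eq.
      apply: rderivZ; apply: (diff_line (v := ci) dz).
      by move=> s; rewrite mulrC -(cptBy x) (addrC (cpt x t)) subrK.
    by rewrite du mulNr mulrCA ci_sqr mulrN1 opprK.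
  by split; [apply: hx|apply: hx|apply: hy|apply: hy]; exists t; split; tauto.
have i2 := ci_sqr R; rewrite !mulNr !opprK -!mulrN.
move: (B _) (B _) (B _) (B _) => b1 b2 b3 b4.
by rewrite !(mulrDr, mulrN, opprD, opprK) !(mulrA ci ci) i2; ring.
Qed.

Lemma contour_goursat g (x0 y0 : R) : `|x0| < 1 -> `|y0| < 1 ->
  (forall z, nm z < 4 -> z != cpt x0 y0 -> differentiable g z) ->
  {for cpt x0 y0, continuous g} -> contour g 0.
Proof.
move=> x01 y01 dg cg.
have n4 x y : `|x| <= 4 / 3 -> `|y| <= 4 / 3 -> nm (cpt x y) < 4.
  by move=> hx hy; apply: le_lt_trans (nm_ReIm _) _; move: hx hy => /=; clear; lra.
have [|H [V hp]] := @prims_exist R g (4 / 3).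
  move=> x y hx hy; have [->//|ne] := eqVneq (cpt x y) (cpt x0 y0).
  by apply: differentiable_continuous; apply: dg => //; exact: n4.
have lt43 : 1 < 4 / 3 :> R by lra.
have E : rect_int H V (- 1) 1 (- 1) 1 = 0.
  apply: (goursat_exceptional hp ltr01 lt43 x01 y01 _ cg) => x y hx hy.
  by apply: dg; exact: (n4 _ _ (ltW hx) (ltW hy)).
rewrite /rect_int in E.
exists (H (-1)), (H 1), (V (-1)), (V 1); split.
  move=> t; rewrite -ler_norml => ht.
  have ht' : `|t| < 4 / 3 by rewrite (le_lt_trans ht).
  by split; [apply: hp.1|apply: hp.1|apply: hp.2|apply: hp.2];
    rewrite ?normrN1 ?normr1.
exact: (esym E).
Qed.

Lemma nm_small_neq z a : 1 <= nm z -> nm a <= 1 / 2 -> z != a /\ nm (z - a) >= 1 / 2.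
Proof.
move=> hz ha.
have : 1 / 2 <= nm (z - a).
  by have := nmD (z - a) a; rewrite subrK; clear -hz ha; lra.
split=> //; apply: contraTneq hz => ->; rewrite -ltNge.
by clear -ha; lra.
Qed.

Lemma derivable_invX n z : z != 0 ->
  differentiable (fun w : C => w^-1 ^+ n.+1) z /\
  'd (fun w : C => w^-1 ^+ n.+1) z 1 = - (n.+1)%:R * z^-1 ^+ n.+2.
Proof.
move=> z0.
have h1 : is_derive z 1 (fun w : C => w^-1) (- z ^- 2 *: 1).
  split; first by apply: (derivableV (f := id)).
  by rewrite (deriveV (f := id)) // derive_id.
have h2 := is_deriveX n.+1 h1.
have E : ((fun w : C => w^-1) ^+ n.+1) = (fun w => w^-1 ^+ n.+1).
  by apply/funext => w; rewrite fctE.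
rewrite E /= in h2; have dd : differentiable (fun w : C => w^-1 ^+ n.+1) z.
  by apply/derivable1_diffP; case: h2.
split=> //; rewrite -deriveE //; case: h2 => _ ->.
by rewrite /GRing.scale /= mulr1 -exprVn mulrN mulNr -mulrA -exprD addn2.
Qed.

(* [c] is 2 i pi, but only [c != 0] matters. *)
Lemma cauchy_constant : exists2 c : C, c != 0 & contour (fun z => z^-1) c.
Proof.
have [|c hc] := @contour_exists (fun z => z^-1).
  move=> z hz _; apply: differentiableV; first exact: differentiable_id.
  by rewrite -nm_gt0 (lt_le_trans _ hz).
exists c => //.
have [Gb [Gt [Gl [Gr [h E]]]]] := hc.
(* Each of the four sides contributes a positive amount to the imaginary part. *)
suff : 0 < complex.Im c by apply: contraTneq => ->; rewrite ltxx.
have pos (f df : R -> R) : (forall t : R, -1 <= t <= 1 -> is_derive t 1 f (df t)) ->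
    (forall t : R, -1 <= t <= 1 -> 0 < df t) -> 0 < f 1 - f (-1).
  move=> h1 h2; have le11 : -1 <= 1 :> R by clear; lra.
  have [||t ht ->] := @MVT_segment _ f df (-1) 1 le11.
  - by move=> x /itvP hx; apply: h1; rewrite !hx.
  - apply: continuous_in_subspaceT => x; rewrite inE /= in_itv /= => hx.
    by apply: differentiable_continuous; apply/derivable1_diffP; case: (h1 x hx).
  - have p2 : 0 < 1 - -1 :> R by clear; lra.
    by apply: mulr_gt0 _ p2; apply: h2; rewrite in_itv in ht.
have negd (f df : R -> R) : (forall t : R, -1 <= t <= 1 -> is_derive t 1 f (df t)) ->
    (forall t : R, -1 <= t <= 1 -> df t < 0) -> f 1 - f (-1) < 0.
  move=> h1 h2; have := pos (fun t => - f t) (fun t => - df t).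
  rewrite -opprD oppr_gt0; apply=> t ht; last by rewrite oppr_gt0 h2.
  by apply: is_deriveN; exact: h1.
have ReV (x y : R) : complex.Re (cpt x y)^-1 = x / (x ^+ 2 + y ^+ 2) by [].
have ImV (x y : R) : complex.Im (cpt x y)^-1 = - y / (x ^+ 2 + y ^+ 2).
  by rewrite mulNr.
have sq (x : R) : 0 < x ^+ 2 + 1 by rewrite ltr_wpDl // exprn_even_ge0.
have sq' (x : R) : 0 < 1 + x ^+ 2 by rewrite addrC.
have b : 0 < complex.Im (Gb 1) - complex.Im (Gb (-1)).
  apply: (pos (fun t => complex.Im (Gb t)) (fun t => complex.Im (cpt t (-1))^-1)) => t ht.
    by have [[]] := h t ht.
  by rewrite ImV sqrrN expr1n opprK divr_gt0.
have t : complex.Im (Gt 1) - complex.Im (Gt (-1)) < 0.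
  apply: (negd (fun t => complex.Im (Gt t)) (fun t => complex.Im (cpt t 1)^-1)) => t ht.
    by have [_ []] := h t ht.
  by rewrite ImV expr1n mulNr oppr_lt0 divr_gt0.
have l : complex.Re (Gl 1) - complex.Re (Gl (-1)) < 0.
  apply: (negd (fun t => complex.Re (Gl t)) (fun t => complex.Re (cpt (-1) t)^-1)) => s hs.
    by have [_ _ []] := h s hs.
  by rewrite ReV sqrrN expr1n mulNr oppr_lt0 divr_gt0.
have r : 0 < complex.Re (Gr 1) - complex.Re (Gr (-1)).
  apply: (pos (fun t => complex.Re (Gr t)) (fun t => complex.Re (cpt 1 t)^-1)) => s hs.
    by have [_ _ _ []] := h s hs.
  by rewrite ReV expr1n divr_gt0.
rewrite E !(ImD, ImN, Im_ci_mul, ReD, ReN).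
by move: b t l r; clear; lra.
Qed.

(** When [(z - a)^-1] is expanded in powers of [a / z], only the first term [z^-1] contributes, the
    next ones having primitives; on the frame the remainder is at most [2 / 2 ^+ n.+1]. *)
Lemma contour_inv (c a : C) : contour (fun z => z^-1) c -> nm a <= 1 / 2 ->
  contour (fun z => (z - a)^-1) c.
Proof.
move=> hc ha.
have nz z : frame z -> z != 0 /\ z != a /\ 1 <= nm z /\ 1 / 2 <= nm (z - a).
  move=> /frame_nm/andP[z1 _]; have [? ?] := nm_small_neq z1 ha.
  by split=> //; rewrite -nm_gt0 (lt_le_trans _ z1).
have part n : contour (fun z => (z - a)^-1 - (a / z) ^+ n.+1 / (z - a)) c.
  elim: n => [|n IH].
    apply: contour_ext hc => z /nz[z0 [za _]].
    by field; rewrite subr_eq0 za z0.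
  have h0 : contour (fun z => z^-1 ^+ n.+2) 0.
    apply: (@contour_prim (fun z => - (n.+1)%:R^-1 * z^-1 ^+ n.+1)) => z /nz[z0 _].
    have [d1 d2] := derivable_invX n z0.
    have dd := differentiableZ (- (n.+1)%:R^-1) d1.
    split; first exact: dd.
    have -> := diffZ (- (n.+1)%:R^-1) d1.
    rewrite -[LHS]/(_ * 'd (fun w : C => w^-1 ^+ n.+1) z 1) d2.
    by rewrite mulrA mulrNN mulVf ?mul1r // pnatr_eq0.
  have := contourD IH (contourZ (a ^+ n.+1) h0); rewrite mulr0 addr0.
  apply: contour_ext => z /nz[z0 [za _]].
  rewrite !exprMn [a ^+ n.+2]exprS [z^-1 ^+ n.+2]exprS.
  move: (a ^+ _) (z^-1 ^+ _) => A Z.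
  by field; rewrite subr_eq0 za z0.
have [|v hv] := @contour_exists (fun z => (z - a)^-1).
  move=> z z1 _; have [za _] := nm_small_neq z1 ha.
  apply: differentiableV; last by rewrite subr_eq0.
  exact/differentiable_subc/differentiable_id.
suff -> : c = v by [].
apply/eqP; rewrite -subr_eq0 -nm_eq0; apply/eqP/le_anti; rewrite nm_ge0 andbT.
apply/ler_addgt0Pl => e e0; rewrite addr0.
have [n hn] : exists n, 32 / 2 ^+ n.+1 < e.
  exists (Num.bound (32 / e)); rewrite ltr_pdivrMr ?exprn_gt0 // mulrC -ltr_pdivrMr //.
  apply: lt_le_trans (archi_boundP _) _; first by rewrite divr_ge0 // ltW.
  by rewrite -natrX ler_nat ltnW // ltnW // ltn_expl.
have := contour_bound (M := 2 / 2 ^+ n.+1) (contourB (part n) hv).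
move=> b; apply: le_trans (b _) _; last first.
  by rewrite mulrA (_ : 16 * 2 = 32) ?ltW //; clear; lra.
move=> z /nz[z0 [za [z1 za2]]].
rewrite addrAC subrr sub0r nmN nmM nmX nmM !nmV mulrC -exprVn.
apply: ler_pM; rewrite ?invr_ge0 ?nm_ge0 ?exprn_ge0 ?mulr_ge0 ?invr_ge0 ?nm_ge0 //.
  by rewrite invf_ple ?posrE //; move: za2; clear; lra.
apply: lerXn2r; rewrite ?nnegrE ?mulr_ge0 ?invr_ge0 ?nm_ge0 //.
rewrite -[leRHS]mulr1 ler_pM ?invr_ge0 ?nm_ge0 //; first by move: ha; clear; lra.
by rewrite invf_le1 // (lt_le_trans _ z1).
Qed.

(** The difference quotient of [F] at [a], completed by the derivative, is continuous at [a] and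
    differentiable elsewhere, so its contour integral is 0; what is left is [F a / (z - a)]. *)
Lemma cauchy_formula F (c a : C) : contour (fun z => z^-1) c -> nm a <= 1 / 2 ->
  (forall z, nm z < 4 -> differentiable F z) ->
  contour (fun z => F z / (z - a)) (F a * c).
Proof.
move=> hc ha dF.
pose g z := if z == a then 'd F a 1 else (F z - F a) / (z - a).
have a4 : nm a < 4 by move: ha; clear; lra.
have dFa := dF a a4.
have ea : a = cpt (complex.Re a) (complex.Im a) by case: (a).
have h0 : contour g 0.
  apply: (@contour_goursat g (complex.Re a) (complex.Im a)).
  - by rewrite (le_lt_trans (nm_Re _)) //; move: ha; clear; lra.
  - by rewrite (le_lt_trans (nm_Im _)) //; move: ha; clear; lra.
  - rewrite -ea => z z4 za.
    have za0 : 0 < nm (z - a) by rewrite nm_gt0 subr_eq0.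
    apply: (differentiable_local (g := fun w => (F w - F a) / (w - a)) za0).
      move=> y; rewrite /pball /= /g; case: eqP => // ->.
      by rewrite nmB ltxx.
    apply: differentiableM.
      exact/differentiable_subc/dF.
    apply: differentiableV; last by rewrite subr_eq0.
    exact/differentiable_subc/differentiable_id.
  - rewrite -ea; apply/continuous_pballP => e e0.
    have e2 : 0 < e / 2 by rewrite divr_gt0.
    have [d d0 hd] := differentiable1_epsE dFa e2.
    exists d => // y hy; rewrite /g eqxx; case: eqP => [_|/eqP ya].
      by rewrite subrr nm0.
    have := hd (y - a) hy; rewrite (addrC a) subrK => h.
    have ya0 : 0 < nm (y - a) by rewrite nm_gt0 subr_eq0.
    rewrite (_ : _ - _ = (F y - F a - (y - a) * 'd F a 1) / (y - a)); last first.
      by field; rewrite subr_eq0.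
    rewrite nmM nmV ltr_pdivrMr //; apply: le_lt_trans h _.
    by rewrite ltr_pM2r //; clear -e0; lra.
have := contourD h0 (contourZ (F a) (contour_inv hc ha)); rewrite add0r.
apply: contour_ext => z /frame_nm/andP[z1 _].
have [za _] := nm_small_neq z1 ha.
by rewrite /g (negbTE za) -mulrDl subrK.
Qed.

End Cauchy.

(** * Difference quotients at 0 in one variable *)

Section DifferenceQuotient.
Variables (R : realType).
Local Notation C := (Cplx R).
Implicit Types (F : C -> C) (z a : C).

(** The basic operator: [iter i dquot F 0] is the [i]-th Taylor coefficient of [F] at 0, and
    [iter m dquot F] is the Taylor remainder divided by [z ^+ m]. *)
Definition dquot F z : C := if z == 0 then 'd F 0 1 else (F z - F 0) / z.

Lemma dquot_eq F z : F z = F 0 + z * dquot F z.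
Proof.
rewrite /dquot; case: eqVneq => [->|z0]; first by rewrite mul0r addr0.
by field.
Qed.

Lemma dquot_differentiable F z : z != 0 -> differentiable F z ->
  differentiable (dquot F) z.
Proof.
move=> z0 dF; have zz : 0 < nm z by rewrite nm_gt0.
apply: (differentiable_local (g := fun w => (F w - F 0) / w) zz).
  move=> y; rewrite /pball /= /dquot; case: eqP => // ->.
  by rewrite nmB subr0 ltxx.
apply: differentiableM.
  by apply: differentiableB => //; exact: differentiable_cst.
by apply: (@differentiableV _ _ id).
Qed.

Lemma dquot_unit_bound : exists2 K : R, 0 < K & forall F (M : R),
  (forall z, nm z < 4 -> differentiable F z) ->
  (forall z, nm z < 4 -> nm (F z) <= M) ->
  forall z, nm z < 4 -> differentiable (dquot F) z /\ nm (dquot F z) <= K * M.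
Proof.
have [c c0 hc] := cauchy_constant R.
have nc : 0 < nm c by rewrite nm_gt0.
exists (32 / nm c + 4) => [|F M dF hM]; first by rewrite addr_gt0 // divr_gt0.
have M0 : 0 <= M by apply: le_trans (hM 0 _); rewrite ?nm_ge0 // nm0.
have frnz z : frame z -> z != 0.
  by move=> /frame_nm/andP[z1 _]; rewrite -nm_gt0 (lt_le_trans _ z1).
have frM z : frame z -> nm (F z) <= M.
  move=> /frame_nm/andP[_ z2]; apply: hM.
  by apply: le_lt_trans z2 _; rewrite ltr_nat.
have coef m : exists v, contour (fun z => F z / z ^+ m) v.
  apply: contour_exists => z z1 z4.
  apply: differentiableM; first exact: dF.
  apply: differentiableV; first exact/differentiable_pow/differentiable_id.
  by rewrite expf_neq0 // -nm_gt0 (lt_le_trans _ z1).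
have [v2 h2] := coef 2%N; have [v3 h3] := coef 3%N.
pose D1 := v2 / c; pose D2 := v3 / c.
have ha0 : nm (0 : C) <= 1 / 2 by rewrite nm0 divr_ge0.
have h1 := cauchy_formula hc ha0 dF.
have [B2 B3] : (forall a, nm a <= 1 / 2 ->
    nm (F a - F 0 - a * D1) <= (32 / nm c * M) * nm a ^+ 2) /\
   (forall a, nm a <= 1 / 2 ->
    nm (F a - F 0 - a * D1 - a ^+ 2 * D2) <= (32 / nm c * M) * nm a ^+ 3).
  (* On the frame [nm (z - a) >= 1 / 2], so the integrand is at most [nm a ^+ m * (2 * M)]; the
     factor 16 of [contour_bound] and the division by [c] give the constant. *)
  have gen m a V : nm a <= 1 / 2 ->
      contour (fun z => a ^+ m * (F z / (z ^+ m * (z - a)))) (V * c) ->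
      nm V <= (32 / nm c * M) * nm a ^+ m.
    move=> ha /(contour_bound (M := nm a ^+ m * (2 * M))) h.
    have {}h : nm (V * c) <= 16 * (nm a ^+ m * (2 * M)).
      apply: h => z fz; have /andP[z1 _] := frame_nm fz.
      have [za za2] := nm_small_neq z1 ha.
      rewrite nmM nmX ler_wpM2l ?exprn_ge0 ?nm_ge0 // nmM nmV nmM nmX.
      rewrite ler_pdivrMr; last first.
        by rewrite mulr_gt0 ?exprn_gt0 ?(lt_le_trans _ z1) // nm_gt0 subr_eq0.
      apply: le_trans (frM _ fz) _.
      have e1 : 1 <= nm z ^+ m by rewrite exprn_ege1.
      have := ler_pM ler01 (_ : 0 <= 1 / 2) e1 za2; rewrite divr_ge0 // => /(_ isT).
      set k := _ * nm (z - a) => hk.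
      have := ler_wpM2l M0 hk; clear; lra.
    rewrite nmM -ler_pdivlMr // in h; apply: le_trans h _.
    by rewrite le_eqVlt; apply/orP; left; apply/eqP; field; rewrite gt_eqF.
  split=> a ha; apply: gen => //.
    have h := contourB (contourB (cauchy_formula hc ha dF) h1) (contourZ a h2).
    rewrite mulrBl mulrBl -[a * D1 * c]mulrA divfK //.
    apply: contour_ext h => z fz; have /andP[z1 _] := frame_nm fz.
    have [za _] := nm_small_neq z1 ha; have z0 := frnz z fz.
    by rewrite subr0; field; rewrite z0 subr_eq0 za.
  have h := contourB (contourB (contourB (cauchy_formula hc ha dF) h1)
    (contourZ a h2)) (contourZ (a ^+ 2) h3).
  rewrite mulrBl mulrBl mulrBl -[a * D1 * c]mulrA -[a ^+ 2 * D2 * c]mulrA !divfK //.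
  apply: contour_ext h => z fz; have /andP[z1 _] := frame_nm fz.
  have [za _] := nm_small_neq z1 ha; have z0 := frnz z fz.
  by rewrite subr0; field; rewrite z0 subr_eq0 za.
set K := 32 / nm c * M in B2 B3.
have K0 : 0 <= K by rewrite mulr_ge0 // divr_ge0 // ltW.
have [dF0 dF01] : differentiable F 0 /\ 'd F 0 1 = D1.
  apply: differentiable1_eps => e e0.
  exists (Num.min (1 / 2) (e / (K + 1))).
    by rewrite lt_min !divr_gt0 // ltr_wpDl.
  move=> h; rewrite lt_min => /andP[ha hb]; rewrite add0r.
  apply: le_trans (B2 _ (ltW ha)) _.
  rewrite ltr_pdivlMr ?ltr_wpDl // in hb.
  rewrite expr2 mulrA ler_wpM2r ?nm_ge0 //.
  by apply: le_trans (ltW hb); rewrite mulrC ler_wpM2l ?nm_ge0 // lerDl.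
have dT0 : differentiable (dquot F) 0.
  apply: (proj1 (differentiable1_eps (l := D2) _)) => e e0.
  exists (Num.min (1 / 2) (e / (K + 1))).
    by rewrite lt_min !divr_gt0 // ltr_wpDl.
  move=> h; rewrite lt_min => /andP[ha hb]; rewrite add0r /dquot eqxx dF01.
  case: eqVneq => [->|h0]; first by rewrite mul0r subrr subr0 nm0 mulr0.
  have nh : 0 < nm h by rewrite nm_gt0.
  rewrite (_ : _ - _ - _ = (F h - F 0 - h * D1 - h ^+ 2 * D2) / h); last by field.
  rewrite nmM nmV ler_pdivrMr //; apply: le_trans (B3 _ (ltW ha)) _.
  rewrite ltr_pdivlMr ?ltr_wpDl // in hb.
  rewrite (_ : K * nm h ^+ 3 = K * nm h * nm h * nm h); last by ring.
  do 2![rewrite ler_wpM2r ?nm_ge0 //].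
  by apply: le_trans (ltW hb); rewrite mulrC ler_wpM2l ?nm_ge0 // lerDl.
have D1b : nm D1 <= 16 * M / nm c.
  rewrite /D1 nmM nmV ler_wpM2r ?invr_ge0 ?nm_ge0 //.
  apply: (contour_bound h2) => z fz; have /andP[z1 _] := frame_nm fz.
  rewrite nmM nmV nmX ler_pdivrMr ?exprn_gt0 ?(lt_le_trans _ z1) //.
  by apply: le_trans (frM _ fz) _; rewrite ler_peMr // exprn_ege1.
have KE : (32 / nm c + 4) * M = K + 4 * M by rewrite mulrDl.
have D1K : nm D1 <= K / 2.
  by apply: le_trans D1b _; rewrite /K le_eqVlt; apply/orP; left; apply/eqP; field; rewrite gt_eqF.
move=> z z4; split.
  have [->|z0] := eqVneq z 0; first exact: dT0.
  by apply: (dquot_differentiable z0); exact: dF.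
rewrite KE /dquot; case: eqVneq => [_|z0].
  by rewrite dF01; apply: le_trans D1K _; move: K0 M0; clear; lra.
have nz : 0 < nm z by rewrite nm_gt0.
rewrite nmM nmV ler_pdivrMr //.
have [hz|hz] := lerP (nm z) (1 / 2).
  have := B2 z hz; have := nmD (F z - F 0 - z * D1) (z * D1); rewrite subrK nmM.
  have : nm z ^+ 2 <= nm z * (1 / 2) by rewrite expr2 ler_wpM2l // nm_ge0.
  move=> /(ler_wpM2l K0); have := ler_wpM2l (nm_ge0 z) D1K.
  have := mulr_ge0 M0 (nm_ge0 z); have := mulr_ge0 K0 (nm_ge0 z).
  move: (nm (F z - F 0)) (nm (_ - _ - _)); clear; move=> *; lra.
have h00 : nm (0 : C) < 4 by rewrite nm0.
have := nmBD (F z) (F 0); have := hM z z4; have := hM 0 h00.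
have := ler_wpM2l M0 (ltW hz); have := mulr_ge0 K0 (nm_ge0 z).
move: (nm (F z - F 0)) (nm (F z)) (nm (F 0)); clear; move=> *; lra.
Qed.

Definition on_disc (r M : R) F := forall z, nm z < r ->
  differentiable F z /\ nm (F z) <= M.

(** Scaling by [r / 4] reduces to the disc of radius 4. The added 1 gives [K >= 1], so that radii
    such as [r / (2 * K)] lie below [r]. *)
Lemma dquot_bound : exists2 K : R, 1 <= K & forall (r M : R) F, 0 < r ->
  on_disc r M F -> on_disc r (K / r * M) (dquot F).
Proof.
have [K K0 hK] := dquot_unit_bound; exists (4 * K + 1); first by rewrite lerDr mulr_ge0 // ltW.
move=> r M F r0 hF z zr.
pose k : C := (r / 4)%:C%C.
have r40 : 0 < r / 4 by rewrite divr_gt0.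
have nk : nm k = r / 4 by rewrite nm_real ger0_norm // ltW.
have k0 : k != 0 by rewrite -nm_gt0 nk.
pose G (w : C) := F (k * w).
have lt4 (w : C) : nm w < 4 -> nm (k * w) < r.
  rewrite nmM nk => h; have := h; rewrite -(ltr_pM2l r40).
  by rewrite divfK // gt_eqF.
have dscale (a w : C) : differentiable (fun x : C => a * x) w.
  exact: (@differentiableZ _ _ _ (fun x : C => x) a w (differentiable_id w)).
have dG w : nm w < 4 -> differentiable G w.
  move=> w4; have [dFw _] := hF _ (lt4 w w4).
  exact: (differentiable_comp (dscale k w) dFw).
have dG0 : 'd G 0 1 = k * 'd F 0 1.
  have dF0 : differentiable F (k * 0) by rewrite mulr0; have [] := hF 0; rewrite ?nm0.
  have [dG0 E] : differentiable G 0 /\ 'd G 0 1 = k * 'd F 0 1.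
    rewrite mulr0 in dF0; apply: differentiable1_eps => e e0.
    have e1 : 0 < e / (r / 4) by rewrite divr_gt0.
    have [d d0 hd] := differentiable1_epsE dF0 e1.
    exists (d / (r / 4)); first by rewrite divr_gt0.
    move=> h; rewrite ltr_pdivlMr // => hh; rewrite /G add0r mulr0.
    have nkh : nm (k * h) < d by rewrite nmM nk mulrC.
    have := hd (k * h) nkh; rewrite add0r nmM nk mulrA divfK ?gt_eqF //.
    by rewrite mulrCA mulrA.
  by [].
have key (X Y : C) : X = k * Y -> Y = k^-1 * X.
  by move=> ->; rewrite mulrA mulVf // mul1r.
have E w : dquot F w = k^-1 * dquot G (k^-1 * w).
  rewrite /dquot mulf_eq0 invr_eq0 (negbTE k0) /=; case: eqVneq => [_|w0].
    exact: key dG0.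
  have -> : G (k^-1 * w) = F w by rewrite /G mulrA mulfV // mul1r.
  have -> : G 0 = F 0 by rewrite /G mulr0.
  by rewrite invfM invrK [in RHS]mulrCA mulKf.
have [||dT bT] := hK G M dG _ (k^-1 * z).
- by move=> w w4; have [] := hF _ (lt4 w w4).
- rewrite nmM nmV nk invf_div -ltr_pdivlMl ?divr_gt0 //.
  by rewrite invf_div divfK.
split.
  rewrite (_ : dquot F = (fun w => k^-1 * dquot G (k^-1 * w))); last exact/funext.
  have h1 : differentiable (dquot G \o (fun x : C => k^-1 * x)) z.
    exact: (differentiable_comp (dscale _ _) dT).
  exact: (differentiable_comp h1 (dscale _ _)).
rewrite E nmM nmV nk invf_div.
have M0 : 0 <= M by have [_] := hF z zr; apply: le_trans; exact: nm_ge0.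
apply: le_trans (ler_wpM2l _ bT) _; first by rewrite divr_ge0 // ltW.
rewrite mulrA ler_wpM2r // mulrAC ler_wpM2r ?invr_ge0 ?(ltW r0) //.
by rewrite lerDl.
Qed.

End DifferenceQuotient.

(** * Several variables *)

Section SeveralVariables.
Variables (R : realType).
Local Notation C := (Cplx R).

Definition cauchyK : R := sval (cid2 (dquot_bound R)).

Lemma cauchyK_ge1 : 1 <= cauchyK.
Proof. by rewrite /cauchyK; case: cid2. Qed.

Lemma cauchyK_gt0 : 0 < cauchyK.
Proof. exact: lt_le_trans cauchyK_ge1. Qed.

Lemma dquot_disc (r M : R) (F : C -> C) : 0 < r ->
  on_disc r M F -> on_disc r (cauchyK / r * M) (dquot F).
Proof. by rewrite /cauchyK; case: cid2 => K /= K1; apply. Qed.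

Lemma iter_dquot_disc (r M : R) (F : C -> C) m : 0 < r ->
  on_disc r M F -> on_disc r ((cauchyK / r) ^+ m * M) (iter m (@dquot R) F).
Proof.
move=> r0 hF; elim: m => [|m IH]; first by rewrite expr0 mul1r.
by rewrite exprS -mulrA; exact: dquot_disc.
Qed.

Lemma dquot_expand (F : C -> C) m z :
  F z = \sum_(i < m) z ^+ i * iter i (@dquot R) F 0 + z ^+ m * iter m (@dquot R) F z.
Proof.
elim: m => [|m IH]; first by rewrite big_ord0 add0r mul1r.
rewrite big_ord_recr /= {1}IH -addrA; congr (_ + _).
by rewrite [iter m _ _ z]dquot_eq mulrDr exprSr mulrA.
Qed.

Lemma diff_scale (V : normedModType C) (G : V -> C) (x h : V) (a : C) :
  'd G x (a *: h) = a * 'd G x h.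
Proof. by rewrite linearZ. Qed.

Lemma slice_differentiable (V : normedModType C) (G : V -> C) (x v : V) (t : C) :
  differentiable G (x + t *: v) ->
  differentiable (fun s : C => G (x + s *: v)) t /\
  'd (fun s : C => G (x + s *: v)) t 1 = 'd G (x + t *: v) v.
Proof.
move=> dG; apply: differentiable1_eps => e e0.
have v0 : 0 < nm v + 1 by rewrite ltr_wpDl ?nm_ge0.
have [|d d0 hd] := differentiable_eps dG (e := e / (nm v + 1)).
  by rewrite divr_gt0.
exists (d / (nm v + 1)); first by rewrite divr_gt0.
move=> h hh.
have hv : nm (h *: v) <= nm h * (nm v + 1) by rewrite nmZ ler_wpM2l ?nm_ge0 // lerDl.
have hA := hd (h *: v); rewrite diff_scale in hA; rewrite scalerDl addrA.
apply: le_trans (hA _) _.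
  by rewrite (le_lt_trans hv) // -ltr_pdivlMr.
apply: le_trans (ler_wpM2l _ hv) _; first by rewrite divr_ge0 // ltW.
by rewrite [leLHS](_ : _ = e * nm h) //; field; rewrite gt_eqF.
Qed.

Lemma pball_slice (V : normedModType C) (x h : V) (r : R) : 0 < r -> nm h < r ->
  exists v : V, exists t : C, [/\ h = t *: v, nm t = nm h &
    forall s : C, nm s < r -> pball x r (x + s *: v)].
Proof.
move=> r0 hr; have [->|h0] := eqVneq h 0.
  exists 0, 0; split; rewrite ?nm0 ?scaler0 // => s _; rewrite scaler0 addr0.
  exact: pball_center.
have nh : 0 < nm h by rewrite nm_gt0.
have n0 : ((nm h)%:C%C : C) != 0.
  by rewrite -nm_gt0 nm_real ger0_norm // nm_ge0.
exists ((nm h)%:C%C^-1 *: h), ((nm h)%:C%C : C); split.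
- by rewrite scalerA mulfV // scale1r.
- by rewrite nm_real ger0_norm // nm_ge0.
- move=> s sr; rewrite /pball /= addrAC subrr add0r nmZ nmZ nmV nm_real.
  by rewrite ger0_norm ?nm_ge0 // mulVf ?mulr1 // gt_eqF.
Qed.

Section CauchyEstimates.
Variables (V : normedModType C) (G : V -> C) (x : V) (r M : R).
Hypothesis r0 : 0 < r.
Hypothesis dG : forall y, pball x r y -> differentiable G y.
Hypothesis bG : forall y, pball x r y -> nm (G y) <= M.

Let slice_disc v : (forall s : C, nm s < r -> pball x r (x + s *: v)) ->
  on_disc r M (fun s : C => G (x + s *: v)).
Proof.
move=> hv z zr; split; last by apply: bG; exact: hv.
by apply: (proj1 (slice_differentiable _)); apply: dG; exact: hv.
Qed.

(** On the complex line through [x] and [x + h], parametrised so that the disc of radius [r] maps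
    into the ball, these are the bounds for one and two applications of [dquot]. *)
Lemma cauchy_estimate h : nm h < r ->
  [/\ nm (G (x + h) - G x) <= cauchyK / r * M * nm h,
      nm ('d G x h) <= cauchyK / r * M * nm h &
      nm (G (x + h) - G x - 'd G x h) <= (cauchyK / r) ^+ 2 * M * nm h ^+ 2].
Proof.
move=> hr; have [v [t [hE tE hv]]] := pball_slice x r0 hr.
have hphi := slice_disc hv.
set phi := (fun s : C => G (x + s *: v)) in hphi.
have dq := dquot_disc r0 hphi.
have dq2 := iter_dquot_disc 2 r0 hphi.
have E0 : dquot phi 0 = 'd G x v.
  rewrite /dquot eqxx.
  have [|_ ->] := @slice_differentiable _ G x v 0; last by rewrite scale0r addr0.
  by rewrite scale0r addr0; apply: dG; exact: pball_center.
have E1 : G (x + h) = phi t by rewrite hE.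
have E2 : G x = phi 0 by rewrite /phi scale0r addr0.
have E3 : 'd G x h = t * 'd G x v by rewrite hE diff_scale.
have tr : nm t < r by rewrite tE.
have z0 : nm (0 : C) < r by rewrite nm0.
have D1 : phi t - phi 0 = t * dquot phi t by rewrite {1}(dquot_eq phi t) addrAC subrr add0r.
rewrite E1 E2 E3; split.
- rewrite D1 nmM tE mulrC ler_wpM2r ?nm_ge0 //; exact: (dq t tr).2.
- rewrite nmM tE mulrC ler_wpM2r ?nm_ge0 // -E0; exact: (dq 0 z0).2.
- rewrite D1 -E0 -mulrBr (dquot_eq (dquot phi) t) addrAC subrr add0r mulrA.
  rewrite nmM nmM tE -expr2 mulrC ler_wpM2r ?exprn_ge0 ?nm_ge0 //.
  exact: (dq2 t tr).2.
Qed.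

End CauchyEstimates.

Lemma diff_row N (f : 'rV[C]_N -> C) x h :
  'd f x h = \sum_i h 0 i * 'd f x (delta_mx 0 i).
Proof.
rewrite {1}(row_sum_delta h) linear_sum; apply: eq_bigr => i _.
by rewrite diff_scale.
Qed.

Lemma row_form_bound N (L : 'I_N -> C) (h : 'rV[C]_N) :
  nm (\sum_i h 0 i * L i) <= (\sum_i nm (L i)) * nm h.
Proof.
rewrite (le_trans (nm_sum _ _ _)) // mulr_suml; apply: ler_sum => i _.
by rewrite nmM mulrC ler_wpM2l ?nm_ge0 // nm_coord.
Qed.

Lemma eps_differentiable_row N (f : 'rV[C]_N -> C) x (L : 'I_N -> C) :
  (forall e : R, 0 < e -> exists2 d : R, 0 < d & forall h, nm h < d ->
     nm (f (x + h) - f x - \sum_i h 0 i * L i) <= e * nm h) ->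
  differentiable f x.
Proof.
move=> H; pose l (h : 'rV[C]_N) : C := \sum_i h 0 i * L i.
have llin : linear l.
  move=> a u v; rewrite /l scaler_sumr -big_split /=; apply: eq_bigr => i _.
  by rewrite !mxE mulrDl -[RHS]/(a * _ + _) mulrA.
pose lM := GRing.isLinear.Build _ _ _ _ _ llin.
pose lL : {linear _ -> _} := HB.pack l lM.
apply: (eps_differentiable (df := lL)) => // y.
apply/continuous_pballP => e e0.
have S0 : 0 < \sum_i nm (L i) + 1 by rewrite ltr_wpDl // sumr_ge0 // => i _; exact: nm_ge0.
exists (e / (\sum_i nm (L i) + 1)); first by rewrite divr_gt0.
move=> z; rewrite ltr_pdivlMr // => hz; rewrite -linearB.
apply: le_lt_trans (row_form_bound L (z - y)) _; apply: le_lt_trans hz.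
by rewrite mulrC ler_wpM2l ?nm_ge0 // lerDl.
Qed.

Lemma differentiable_cont (V : normedModType C) (f : V -> C) x : differentiable f x ->
  forall e : R, 0 < e -> exists2 d : R, 0 < d &
    forall y, nm (y - x) < d -> nm (f y - f x) < e.
Proof. by move=> /differentiable_continuous/continuous_pballP. Qed.

Lemma ler_geometric0 (a b : R) : (forall k, a <= b / 2 ^+ k) -> a <= 0.
Proof.
move=> h; apply/ler_addgt0Pl => e e0; rewrite addr0.
pose n := Num.bound (`|b| / e).
apply: le_trans (h n) _; rewrite ler_pdivrMr ?exprn_gt0 //.
apply: le_trans (ler_norm _) _; rewrite mulrC -ler_pdivrMr //.
apply: le_trans (ltW (archi_boundP _)) _; first by rewrite divr_ge0 // ltW.
by rewrite -natrX ler_nat ltnW // ltn_expl.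
Qed.

(** Along a sequence [G k] at distance [2 ^- k] the gradients at [x] converge geometrically, by the
    Cauchy estimate applied to [G k.+1 - G k], and the second-order remainders are bounded uniformly
    in [k]. The limit of the gradients is the differential. *)
Lemma limit_holomorphic N (D : set 'rV[C]_N) (F : 'rV[C]_N -> C) : open D ->
  (forall e : R, 0 < e -> exists G : 'rV[C]_N -> C,
     (forall x, D x -> differentiable G x) /\ forall x, D x -> nm (F x - G x) <= e) ->
  forall x, D x -> differentiable F x.
Proof.
move=> oD hF x Dx.
have hF' k : exists G : 'rV[C]_N -> C, (forall x, D x -> differentiable G x) /\
    forall x, D x -> nm (F x - G x) <= 2 ^- k.
  by apply: hF; rewrite invr_gt0 exprn_gt0.
have [G hG] := choice hF'.
have [r1 r10 hr1] := (open_pballP D).1 oD x Dx.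
have [r2 r20 hr2] := differentiable_cont ((hG 0).1 x Dx) ltr01.
pose r := Num.min r1 r2.
have r0 : 0 < r by rewrite lt_min r10.
have rD y : pball x r y -> D y.
  by rewrite /pball /= lt_min => /andP[h _]; apply: hr1.
(* A common bound of all [G k] on the ball: 1 for the oscillation of [G 0], and 1 for each of the
   distances of [G 0] and [G k] to [F]. *)
pose M := nm (G 0%N x) + 3.
have M0 : 0 <= M by rewrite addr_ge0 ?nm_ge0.
have two k : (2 : R) ^- k <= 1.
  by rewrite invf_le1 ?exprn_gt0 // exprn_ege1 // ler1n.
have two0 k : 0 <= (2 : R) ^- k by rewrite invr_ge0 exprn_ge0.
have bG k y : pball x r y -> nm (G k y) <= M.
  move=> hy; have Dy := rD y hy.
  have := (hG k).2 y Dy; have := (hG 0%N).2 y Dy; have := two k; have := two 0%N.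
  have : nm (y - x) < r2 by move: hy; rewrite /pball /= lt_min => /andP[].
  move=> /hr2; rewrite /M; have := nmD (G 0%N y - G 0%N x) (G 0%N x); rewrite subrK.
  have := nmBD (F y) (F y - G k y); rewrite subKr.
  have := nmD (F y - G 0%N y) (G 0%N y); rewrite subrK.
  by move: (nm (G k y)) (nm (F y - G k y)) (nm (F y)); clear; move=> *; lra.
have [Dk DkE] : exists Dk : nat -> 'rV[C]_N -> C, forall k h, Dk k h = 'd (G k) x h.
  by exists (fun k h => 'd (G k) x h).
pose u k i := Dk k (delta_mx 0 i) : C.
have dG k y : pball x r y -> differentiable (G k) y.
  by move=> /rD; exact: (hG k).1.
have xr : pball x r x by exact: pball_center.
pose A := cauchyK / r * 2.
have A0 : 0 <= A by rewrite mulr_ge0 // divr_ge0 // ltW // cauchyK_gt0.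
have small (i : 'I_N) : exists2 s : R, 0 < s &
    nm ((s%:C%C : C) *: delta_mx 0 i : 'rV[C]_N) < r.
  have n1 : 0 < nm (delta_mx 0 i : 'rV[C]_N) + 1 by rewrite ltr_wpDl ?nm_ge0.
  exists (r / 2 / (nm (delta_mx 0 i : 'rV[C]_N) + 1)).
    by rewrite !divr_gt0.
  rewrite nmZ nm_real ger0_norm; last by rewrite !divr_ge0 // ltW.
  rewrite mulrAC ltr_pdivrMr //.
  have := mulr_ge0 (ltW r0) (nm_ge0 (delta_mx 0 i : 'rV[C]_N)).
  by move: (nm _) r0 => n; clear; move: r => r r0 rn; lra.
have diffk k h : nm h < r ->
    nm (Dk k.+1 h - Dk k h) <= A * 2 ^- k * nm h.
  move=> hr; rewrite (DkE k) (DkE k.+1).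
  have e := @cauchy_estimate _ (fun y => G k.+1 y - G k y) x r (2 * 2 ^- k) r0.
  have [||_ h2 _] := e _ _ h hr.
  - by move=> y hy; exact: (differentiableB (dG k.+1 y hy) (dG k y hy)).
  - move=> y hy; have Dy := rD y hy.
    have := (hG k).2 y Dy; have := (hG k.+1).2 y Dy.
    have := nmBD (F y - G k y) (F y - G k.+1 y).
    rewrite (_ : _ - _ - _ = G k.+1 y - G k y) => [l1 l2 l3|]; last by ring.
    have l4 : (2 : R) ^- k.+1 <= 2 ^- k.
      rewrite lef_pV2 ?posrE ?exprn_gt0 // exprS ler_peMl ?exprn_ge0 // ler1n //.
    by move: l1 l2 l3 l4; clear; move=> *; lra.
  rewrite -[X in nm X]/(('d (G k.+1) x \- 'd (G k) x) h) -diffB; [|exact: dG|exact: dG].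
  by rewrite /A -[_ / r * 2 * _]mulrA; exact: h2.
have [L hL] : exists L : 'I_N -> C, exists2 B : R, 0 <= B & forall i k,
    nm (u k i - L i) <= B * (1 / 2) ^+ k.
  have hi i : exists l, exists2 B : R, 0 <= B & forall k, nm (u k i - l) <= B * (1 / 2) ^+ k.
    have [s s0 hs] := small i.
    have ns : nm (s%:C%C : C) = s by rewrite nm_real ger0_norm // ltW.
    have [|||l hl] := @geometric_cvg R (fun k => u k i)
      (A * nm ((s%:C%C : C) *: delta_mx 0 i : 'rV[C]_N) / s) (1 / 2).
    - by clear; lra.
    - by clear; lra.
    - move=> k; have Ej j : Dk j ((s%:C%C : C) *: delta_mx 0 i) = (s%:C%C : C) * u j i.
        by rewrite /u (DkE j) (DkE j) diff_scale.
      have := diffk k _ hs; rewrite (Ej k) (Ej k.+1) -mulrBr nmM ns.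
      rewrite expr_div_n expr1n mul1r => h; rewrite mulrAC ler_pdivlMr // mulrC.
      by apply: le_trans h _; rewrite mulrAC.
    exists l; eexists; last exact: hl.
    rewrite mulr_ge0 // divr_ge0 //; last by clear; lra.
    by apply: divr_ge0; [exact: mulr_ge0 A0 (nm_ge0 _)|exact: ltW].
  have [L hL] := choice hi; exists L.
  have [B hB] := @choice 'I_N R (fun i b => 0 <= b /\
      forall k, nm (u k i - L i) <= b * (1 / 2) ^+ k)
    (fun i => let: ex_intro2 b b0 hb := hL i in ex_intro _ b (conj b0 hb)).
  exists (\sum_i B i); first by apply: sumr_ge0 => i _; exact: (hB i).1.
  move=> i k; apply: le_trans ((hB i).2 k) _; rewrite ler_wpM2r //.
  rewrite (bigD1 i) //= lerDl sumr_ge0 // => j _; exact: (hB j).1.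
have [B B0 {}hL] := hL.
have key h : nm h < r ->
    nm (F (x + h) - F x - \sum_i h 0 i * L i) <= (cauchyK / r) ^+ 2 * M * nm h ^+ 2.
  move=> hr; rewrite -subr_le0.
  apply: (@ler_geometric0 _ (2 + (\sum_(i < N) B) * nm h)) => k.
  have [_ _ h3] := @cauchy_estimate _ (G k) x r M r0 (dG k) (bG k) h hr.
  have Dxh : D (x + h) by apply: rD; rewrite /pball /= addrAC subrr add0r.
  have g1 := (hG k).2 x Dx; have g2 := (hG k).2 _ Dxh.
  rewrite -DkE in h3.
  have g3 : nm (Dk k h - \sum_i h 0 i * L i) <= (\sum_(i < N) B) * nm h * 2 ^- k.
    rewrite DkE diff_row -sumrB (eq_bigr (fun i => h 0 i * (u k i - L i))); last first.
      by move=> i _; rewrite mulrBr /u DkE.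
    apply: le_trans (row_form_bound _ _) _.
    rewrite mulrAC ler_wpM2r ?nm_ge0 // mulr_suml; apply: ler_sum => i _.
    by have := hL i k; rewrite expr_div_n expr1n mul1r.
  have E : F (x + h) - F x - \sum_i h 0 i * L i =
      (F (x + h) - G k (x + h)) - (F x - G k x) +
      (G k (x + h) - G k x - Dk k h) + (Dk k h - \sum_i h 0 i * L i).
    move: (Dk _ _) (\sum_i _) => a b; ring.
  rewrite E lerBlDr.
  set a1 := F (x + h) - G k (x + h) in g2 *; set a2 := F x - G k x in g1 *.
  set a3 := G k (x + h) - _ - _ in h3 *; set a4 := Dk k h - _ in g3 *.
  have := nmD (a1 - a2 + a3) a4; have := nmD (a1 - a2) a3; have := nmBD a1 a2.
  by move: g1 g2 g3 h3; clear; rewrite mulrDl; move=> *; lra.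
apply: (@eps_differentiable_row _ _ _ L) => e e0.
set Q := (cauchyK / r) ^+ 2 * M in key.
have Q0 : 0 <= Q by rewrite mulr_ge0 // exprn_ge0 // divr_ge0 // ltW // cauchyK_gt0.
have Q1 : 0 < Q + 1 by rewrite ltr_wpDl.
exists (Num.min r (e / (Q + 1))); first by rewrite lt_min r0 divr_gt0.
move=> h; rewrite lt_min ltr_pdivlMr // => /andP[hr he].
apply: le_trans (key h hr) _; rewrite expr2 mulrA ler_wpM2r ?nm_ge0 //.
by apply: le_trans (ltW he); rewrite mulrC ler_wpM2l ?nm_ge0 // lerDl.
Qed.

End SeveralVariables.

(** * The identity theorem on balls *)

Section IdentityTheorem.
Variables (R : realType).
Local Notation C := (Cplx R).

(** If all Taylor coefficients vanish, [F z] equals [z ^+ k * iter k dquot F z] for every [k], which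
    is at most [M / 2 ^+ k] on the smaller disc; otherwise the first nonzero coefficient gives
    [m]. *)
Lemma disc_zero_or_factor (r M : R) (F : C -> C) : 0 < r -> on_disc r M F ->
  (forall z, nm z < r / (2 * cauchyK R) -> F z = 0) \/
  exists m, iter m (@dquot R) F 0 != 0 /\ forall z, F z = z ^+ m * iter m (@dquot R) F z.
Proof.
move=> r0 hF; have K0 := cauchyK_gt0 R.
have [all0|/existsNP[m0 /eqP hm0]] := pselect (forall m, iter m (@dquot R) F 0 = 0).
  left=> z hz; apply/eqP; rewrite -nm_eq0; apply/eqP/le_anti; rewrite nm_ge0 andbT.
  apply: (@ler_geometric0 _ _ M) => k.
  have M0 : 0 <= M by apply: le_trans (hF 0 _).2; rewrite ?nm_ge0 // nm0.
  have zr : nm z < r.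
    apply: lt_le_trans hz _; rewrite ler_pdivrMr ?mulr_gt0 // ler_peMr ?ltW //.
    by have := cauchyK_ge1 R; clear; lra.
  rewrite (dquot_expand F k z) big1 ?add0r; last by move=> i _; rewrite all0 mulr0.
  have [_] := iter_dquot_disc k r0 hF zr.
  rewrite nmM nmX => /(ler_wpM2l (exprn_ge0 k (nm_ge0 z)))/le_trans; apply.
  rewrite mulrA -exprMn mulrC ler_wpM2l // -exprVn.
  have kr0 : 0 <= cauchyK R / r by rewrite divr_ge0 // ltW.
  apply: lerXn2r; rewrite ?nnegrE ?invr_ge0 ?(mulr_ge0 (nm_ge0 _) kr0) //.
  rewrite mulrA ler_pdivrMr //; move: hz; rewrite ltr_pdivlMr ?mulr_gt0 //.
  by move: (nm z) => n; clear -K0; set K := cauchyK R; move=> h; lra.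
right; have ex : exists m, iter m (@dquot R) F 0 != 0 by exists m0.
exists (ex_minn ex); case: ex_minnP => m hm min; split=> // z.
rewrite {1}(dquot_expand F m z) big1 ?add0r // => i _.
have [->|ne] := eqVneq (iter i (@dquot R) F 0) 0; first by rewrite mulr0.
by have := min i ne; rewrite leqNgt ltn_ord.
Qed.

(** In the second alternative of [disc_zero_or_factor] the cofactor is nonzero near 0 by continuity,
    so the zeros other than 0 keep away from 0. *)
Lemma disc_zero_of_cluster (r M : R) (F : C -> C) : 0 < r -> on_disc r M F ->
  (forall e : R, 0 < e -> exists2 z, z != 0 /\ nm z < e & F z = 0) ->
  forall z, nm z < r / (2 * cauchyK R) -> F z = 0.
Proof.
move=> r0 hF acc; have [//|[m [hm Fm]]] := disc_zero_or_factor r0 hF.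
have z0 : nm (0 : C) < r by rewrite nm0.
have [d _] := iter_dquot_disc m r0 hF z0.
have hm0 : 0 < nm (iter m (@dquot R) F 0) by rewrite nm_gt0.
have [e e0 he] := differentiable_cont d hm0.
exfalso; have [z [zn ze] Fz] := acc e e0.
have := he z; rewrite subr0 => /(_ ze).
move/eqP: Fz; rewrite Fm mulf_eq0 expf_eq0 (negbTE zn) andbF /= => /eqP ->.
by rewrite sub0r nmN ltxx.
Qed.

Variable (V : normedModType C).
Implicit Types (F G : V -> C) (c x y : V).

Lemma holo_bounded_slice F x v : 
  (exists2 r : R, 0 < r & forall y, pball x r y -> differentiable F y) ->
  exists r : R, exists2 M : R, 0 < r & on_disc r M (fun t : C => F (x + t *: v)).
Proof.
move=> [r r0 dF].
have [d d0 hd] := differentiable_cont (dF x (pball_center x r0)) ltr01.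
have v1 : 0 < nm v + 1 by rewrite ltr_wpDl ?nm_ge0.
pose s := Num.min r d / (nm v + 1).
have m0 : 0 < Num.min r d by rewrite lt_min r0.
exists s, (nm (F x) + 1); first by rewrite divr_gt0.
move=> z hz; have hx : nm (x + z *: v - x) < Num.min r d.
  rewrite addrAC subrr add0r nmZ; move: hz; rewrite /s ltr_pdivlMr //.
  by apply: le_lt_trans; rewrite ler_wpM2l ?nm_ge0 // lerDl.
move: hx; rewrite lt_min => /andP[h1 h2]; split.
  by apply: (proj1 (slice_differentiable _)); exact: dF.
have := nmD (F (x + z *: v) - F x) (F x); rewrite subrK.
by have := hd _ h2; move: (nm _) (nm _) (nm _); clear; move=> *; lra.
Qed.

(** A ball is convex, so a segment from [x1] to [x] suffices. Zeros accumulate at the supremum [s0]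
    of the parameters up to which [F] vanishes, and on the complex line containing the segment this
    forces [F] to vanish beyond [s0]. *)
Theorem identity_theorem F c (r : R) x1 :
  (forall x, pball c r x -> differentiable F x) -> pball c r x1 ->
  (exists2 e : R, 0 < e & forall y, pball x1 e y -> F y = 0) ->
  forall x, pball c r x -> F x = 0.
Proof.
move=> dF cx1 [e e0 he] x cx.
pose v := x - x1; pose p (t : R) := x1 + (t%:C%C : C) *: v.
have pin (t : R) : 0 <= t <= 1 -> pball c r (p t).
  move=> /andP[t0 t1]; rewrite /pball /=.
  have -> : p t - c = ((1 - t)%:C%C : C) *: (x1 - c) + (t%:C%C : C) *: (x - c).
    have -> : ((1 - t)%:C%C : C) = 1 - t%:C%C by rewrite rmorphB.
    transitivity ((x1 - c) + (t%:C%C : C) *: ((x - c) - (x1 - c))).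
      by rewrite opprB addrA subrK /p /v addrAC.
    by rewrite scalerBl scale1r scalerBr addrA addrAC.
  apply: le_lt_trans (nmD _ _) _; rewrite !nmZ !nm_real !ger0_norm ?subr_ge0 //.
  have [->|tn0] := eqVneq t 0; first by rewrite subr0 mul1r mul0r addr0.
  have tp : 0 < t by rewrite lt_def tn0.
  have l1 : (1 - t) * nm (x1 - c) <= (1 - t) * r by rewrite ler_wpM2l ?subr_ge0 // ltW.
  have l2 : t * nm (x - c) < t * r by rewrite ltr_pM2l.
  by move: l1 l2; clear; move=> *; lra.
have loc (t : R) : 0 <= t <= 1 ->
    (forall d : R, 0 < d -> exists2 s : R, s != t /\ `|s - t| < d & F (p s) = 0) ->
    exists2 d : R, 0 < d & forall s : R, `|s - t| < d -> F (p s) = 0.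
  move=> ht acc.
  have [|rr [M rr0 od]] := @holo_bounded_slice F (p t) v.
    have [d d0 hd] := (open_pballP (pball c r)).1 (pball_open c r) _ (pin t ht).
    by exists d => // y /hd; exact: dF.
  have pE s : p s = p t + ((s - t)%:C%C : C) *: v.
    rewrite /p -addrA -scalerDl; congr (_ + _ *: _).
    by rewrite -real_complexD addrC subrK.
  have := disc_zero_of_cluster rr0 od => h.
  exists (rr / (2 * cauchyK R)); first by rewrite divr_gt0 // mulr_gt0 // cauchyK_gt0.
  move=> s hs; rewrite pE; apply: h; last by rewrite nm_real.
  move=> d d0; have [s' [s't s'd] Fs'] := acc d d0.
  exists ((s' - t)%:C%C : C); last by rewrite -pE.
  by rewrite -nm_gt0 nm_real normr_gt0 subr_eq0.
have [v0|vn0] := eqVneq v 0.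
  have -> : x = x1 by apply/eqP; rewrite -subr_eq0 -/v v0.
  by apply: he; exact: pball_center.
have nv : 0 < nm v by rewrite nm_gt0.
pose E := [set s : R | 0 <= s <= 1 /\ forall t, 0 <= t <= s -> F (p t) = 0].
have near0 (t : R) : `|t| < e / nm v -> F (p t) = 0.
  move=> ht; apply: he; rewrite /pball /= /p addrAC subrr add0r nmZ nm_real.
  by rewrite -ltr_pdivlMr.
have ev : 0 < e / nm v by rewrite divr_gt0.
have E0 : E 0.
  by split=> [|t]; rewrite ?lexx ?ler01 // => /le_anti <-; apply: near0; rewrite normr0.
have hE : has_sup E by split; [exists 0|exists 1 => s [/andP[]]].
pose s0 := sup E.
have s00 : 0 <= s0 by apply: ub_le_sup; [exact: hE.2|].
have s01 : s0 <= 1 by apply: ge_sup; [exact: hE.1|move=> s [/andP[]]].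
have below (t : R) : 0 <= t < s0 -> F (p t) = 0.
  move=> /andP[t0 ts].
  have ts' : 0 < s0 - t by rewrite subr_gt0.
  have [s [_ hs] hts] := sup_adherent ts' hE.
  by apply: hs; rewrite t0 ltW // -[t](subKr s0).
have [d d0 hd] : exists2 d : R, 0 < d & forall s : R, `|s - s0| < d -> F (p s) = 0.
  have [s0E|s0n] := eqVneq s0 0.
    by exists (e / nm v) => // s; rewrite s0E subr0; exact: near0.
  have s0p : 0 < s0 by rewrite lt_def s0n.
  apply: loc => [|d d0]; first by rewrite s00.
  exists (s0 - Num.min (d / 2) (s0 / 2)).
    have m0 : 0 < Num.min (d / 2) (s0 / 2) by rewrite lt_min !divr_gt0.
    split; first by rewrite -subr_eq0 addrAC subrr add0r oppr_eq0 gt_eqF.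
    rewrite addrAC subrr add0r normrN gtr0_norm // gt_min.
    by rewrite ltr_pdivrMr // ltr_pMr // ltr1n.
  apply: below; rewrite subr_ge0 ge_min ltrBlDr ltrDl lt_min !divr_gt0 // andbT.
  rewrite andbT; apply/orP; right; rewrite ler_pdivrMr //.
  by rewrite ler_peMr // ler1n.
have s1 : s0 = 1.
  apply/eqP; rewrite eq_le s01 /= leNgt; apply/negP => s0lt.
  pose s2 := Num.min 1 (s0 + d / 2).
  have s2lt : s0 < s2 by rewrite lt_min s0lt ltrDl divr_gt0.
  have : E s2.
    split; first by rewrite ge_min lexx /= andbT (le_trans s00) // ltW.
    move=> t /andP[t0]; rewrite le_min => /andP[t1 td].
    have [ts|st] := ltP t s0; first by apply: below; rewrite t0.
    apply: hd; rewrite ger0_norm ?subr_ge0 //.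
    by move: td d0; clear; move=> *; lra.
  by move=> /(ub_le_sup hE.2); rewrite leNgt s2lt.
have -> : x = p s0 by rewrite s1 /p scale1r addrC subrK.
by apply: hd; rewrite subrr normr0.
Qed.

(** Around a point where [F] is nonzero, [G] vanishes on a neighbourhood, hence everywhere. This is
    how factors that have zeros are cancelled in the sequel. *)
Lemma holo_zero_divisor F G c (r : R) : 
  (forall x, pball c r x -> differentiable F x) ->
  (forall x, pball c r x -> differentiable G x) ->
  (forall x, pball c r x -> F x * G x = 0) ->
  (forall x, pball c r x -> F x = 0) \/ (forall x, pball c r x -> G x = 0).
Proof.
move=> dF dG FG; have [|/existsNP[x1 /not_implyP[cx1 /eqP F1]]] :=
  pselect (forall x, pball c r x -> F x = 0); first by left.
right; apply: (identity_theorem dG cx1).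
have F1' : 0 < nm (F x1) by rewrite nm_gt0.
have [d d0 hd] := differentiable_cont (dF _ cx1) F1'.
have [d' d'0 hd'] := (open_pballP (pball c r)).1 (pball_open c r) _ cx1.
exists (Num.min d d'); first by rewrite lt_min d0.
move=> y; rewrite /pball /= lt_min => /andP[h1 h2].
have /eqP := FG _ (hd' _ h2); rewrite mulf_eq0 => /orP[/eqP Fy|/eqP //].
by have := hd _ h1; rewrite Fy sub0r nmN ltxx.
Qed.

End IdentityTheorem.

(** * Difference quotients in the first of several variables *)

Section FirstVariable.
Variables (R : realType).
Local Notation C := (Cplx R).

Lemma affine_differentiable N (W : normedModType C) (A : 'rV[C]_N -> W)
    (l : {linear 'rV[C]_N -> W}) (a : W) :
  (forall x, A x = l x + a) -> forall x, differentiable A x.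
Proof.
move=> AE x.
have bl h : nm (l h) <= (\sum_i nm (l (delta_mx 0 i))) * nm h.
  rewrite {1}(row_sum_delta h) linear_sum (le_trans (nm_sum _ _ _)) // mulr_suml.
  apply: ler_sum => i _; rewrite linearZ nmZ mulrC ler_wpM2l ?nm_ge0 //.
  exact: nm_coord.
apply: (eps_differentiable (df := l)) => [y|e e0].
  apply/continuous_pballP => e e0; set S := \sum_i _ in bl.
  have S0 : 0 < S + 1 by rewrite ltr_wpDl // sumr_ge0 // => i _; exact: nm_ge0.
  exists (e / (S + 1)); first by rewrite divr_gt0.
  move=> z; rewrite ltr_pdivlMr // => hz; rewrite -linearB.
  apply: le_lt_trans (bl (z - y)) _; apply: le_lt_trans hz.
  by rewrite mulrC ler_wpM2l ?nm_ge0 // lerDl.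
exists 1 => // h _; rewrite !AE linearD.
rewrite (_ : _ - _ - _ = 0) ?nm0 ?mulr_ge0 ?nm_ge0 ?ltW //.
by rewrite [l x + l h + a]addrAC [l x + a + l h - _]addrAC subrr add0r subrr.
Qed.

Lemma differentiable_row (V : normedModType C) k (F : V -> 'rV[C]_k) x :
  (forall j, differentiable (fun y => F y 0 j) x) -> differentiable F x.
Proof.
move=> dF.
rewrite (_ : F = \sum_(j < k) (fun y => F y 0 j *: (delta_mx 0 j : 'rV[C]_k))).
  by apply: differentiable_sum => j; apply: differentiableZl; exact: dF.
by apply/funext => y; rewrite fct_sumE [LHS]row_sum_delta.
Qed.

Lemma differentiable_compo (U V W : normedModType C) (f : U -> V) (g : V -> W) x :
  differentiable f x -> differentiable g (f x) -> differentiable (fun y => g (f y)) x.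
Proof. exact: differentiable_comp. Qed.

Lemma differentiable_proj n (x : 'rV[C]_n) i : differentiable (fun y : 'rV[C]_n => y 0 i) x.
Proof. exact: differentiable_coord. Qed.

(** As [k x = 0], the variation of [m] is multiplied by a quantity of order [nm h], so that
    continuity of [m] at [x] is enough; the differential is [m x] times that of [k]. *)
Lemma mul_vanishing_differentiable N (k m : 'rV[C]_N -> C) x :
  differentiable k x -> k x = 0 ->
  (forall e : R, 0 < e -> exists2 d : R, 0 < d &
     forall y, nm (y - x) < d -> nm (m y - m x) < e) ->
  differentiable (fun y => k y * m y) x.
Proof.
move=> dk kx cm.
pose L i := m x * 'd k x (delta_mx 0 i) : C.
pose B := \sum_(i < N) nm ('d k x (delta_mx 0 i) : C).
have B0 : 0 <= B by apply: sumr_ge0 => i _; exact: nm_ge0.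
apply: (@eps_differentiable_row _ _ _ _ L) => e e0.
pose e1 := e / (2 * (nm (m x) + 1)); pose e2 := Num.min 1 (e / (2 * (B + 1))).
have mx0 : 0 < nm (m x) + 1 by rewrite ltr_wpDl ?nm_ge0.
have e10 : 0 < e1 by rewrite divr_gt0 // mulr_gt0.
have B1 : 0 < B + 1 by rewrite ltr_wpDl.
have e20 : 0 < e2 by rewrite lt_min ltr01 divr_gt0 // mulr_gt0.
have [d1 d10 hd1] := differentiable_eps dk e10; have [d2 d20 hd2] := cm _ e20.
exists (Num.min d1 d2); first by rewrite lt_min d10.
move=> h; rewrite lt_min => /andP[h1 h2]; rewrite kx mul0r subr0.
have {}hd1 := hd1 h h1.
have {}hd2 : nm (m (x + h) - m x) < e2 by apply: hd2; rewrite addrAC subrr add0r.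
have E : \sum_i h 0 i * L i = m x * 'd k x h.
  by rewrite diff_row mulr_sumr; apply: eq_bigr => i _; rewrite mulrCA.
have bd : nm ('d k x h : C) <= B * nm h by rewrite diff_row; exact: row_form_bound.
rewrite E; move: ('d k x h : C) hd1 bd => l; rewrite kx subr0 => hd1 bd.
rewrite (_ : _ - _ = (k (x + h) - l) * m (x + h) + l * (m (x + h) - m x)); last by ring.
apply: le_trans (nmD _ _) _; rewrite !nmM.
have hm : nm (m (x + h)) <= nm (m x) + 1.
  have := nmD (m (x + h) - m x) (m x); rewrite subrK.
  move: hd2; rewrite /e2 lt_min => /andP[+ _].
  by move: (nm _) (nm _) (nm _); clear; move=> *; lra.
have l1 : nm (k (x + h) - l) * nm (m (x + h)) <= e / 2 * nm h.
  apply: le_trans (ler_pM (nm_ge0 _) (nm_ge0 _) hd1 hm) _.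
  by rewrite le_eqVlt; apply/orP; left; apply/eqP; rewrite /e1; field; rewrite gt_eqF.
have l2 : nm l * nm (m (x + h) - m x) <= e / 2 * nm h.
  have l3 : nm (m (x + h) - m x) <= e / (2 * (B + 1)).
    by move: hd2; rewrite /e2 lt_min => /andP[_ /ltW].
  have l4 : nm l <= (B + 1) * nm h.
    by apply: le_trans bd _; rewrite ler_wpM2r ?nm_ge0 // lerDl.
  apply: le_trans (ler_pM (nm_ge0 _) (nm_ge0 _) l4 l3) _.
  by rewrite le_eqVlt; apply/orP; left; apply/eqP; field; rewrite gt_eqF.
by move: l1 l2; clear; move: (nm h) => n; lra.
Qed.

Definition rcons0 n (z : C) (x : 'rV[C]_n) : 'rV[C]_(1 + n) := row_mx z%:M x.
Definition rhd n (p : 'rV[C]_(1 + n)) : C := p 0 (lshift n 0).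
Definition rtl n (p : 'rV[C]_(1 + n)) : 'rV[C]_n := rsubmx p.

Lemma rcons0K n (p : 'rV[C]_(1 + n)) : rcons0 (rhd p) (rtl p) = p.
Proof.
rewrite /rcons0 /rtl -[RHS]hsubmxK; congr row_mx.
by apply/matrixP => i j; rewrite !ord1 !mxE mulr1n.
Qed.

Lemma rhd_cons n z (x : 'rV[C]_n) : rhd (rcons0 z x) = z.
Proof. by rewrite /rhd /rcons0 row_mxEl mxE mulr1n. Qed.

Lemma rtl_cons n z (x : 'rV[C]_n) : rtl (rcons0 z x) = x.
Proof. exact: row_mxKr. Qed.

Lemma rcons0B n z w (x y : 'rV[C]_n) :
  rcons0 z x - rcons0 w y = rcons0 (z - w) (x - y).
Proof. by rewrite /rcons0 opp_row_mx add_row_mx raddfB. Qed.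

Lemma nm_rcons0_lt n z (x : 'rV[C]_n) (e : R) : 0 < e ->
  (nm (rcons0 z x) < e) = (nm z < e) && (nm x < e).
Proof.
move=> e0; apply/idP/andP => [h|[hz hx]].
  split; first by apply: le_lt_trans h; rewrite -{1}(rhd_cons z x); exact: nm_coord.
  apply: nm_row_lt => // i; apply: le_lt_trans h.
  by rewrite -(row_mxEr (z%:M : 'rV_1) x); exact: nm_coord.
apply: nm_row_lt => // i; rewrite /rcons0 mxE; case: splitP => j _.
  by rewrite mxE ord1 mulr1n.
by apply: le_lt_trans hx; exact: nm_coord.
Qed.

Lemma nm_rtl n (p : 'rV[C]_(1 + n)) : nm (rtl p) <= nm p.
Proof.
apply: nm_row_le => [|i]; first exact: nm_ge0.
by rewrite mxE; exact: nm_coord.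
Qed.

Lemma nm_rhd n (p : 'rV[C]_(1 + n)) : nm (rhd p) <= nm p.
Proof. exact: nm_coord. Qed.

Lemma rtlB n (p q : 'rV[C]_(1 + n)) : rtl (p - q) = rtl p - rtl q.
Proof. exact: raddfB. Qed.

Lemma rhdB n (p q : 'rV[C]_(1 + n)) : rhd (p - q) = rhd p - rhd q.
Proof. by rewrite /rhd !mxE. Qed.

Lemma rcons0_differentiable n z (x : 'rV[C]_n) : differentiable (rcons0 z) x.
Proof.
apply: (@affine_differentiable _ _ _ (mulmxr (row_mx 0 1%:M)) (rcons0 z 0)) => y.
by rewrite /= mul_mx_row mulmx0 mulmx1 /rcons0 add_row_mx add0r addr0.
Qed.

Lemma rtl_differentiable n (p : 'rV[C]_(1 + n)) : differentiable (@rtl n) p.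
Proof.
by apply: (@affine_differentiable _ _ _ (@rsubmx C 1 1 n) 0) => y; rewrite addr0.
Qed.

Lemma rcons0_slice n z (x : 'rV[C]_n) : rcons0 z x = rcons0 0 x + z *: rcons0 1 0.
Proof.
rewrite /rcons0 scale_row_mx scaler0 add_row_mx addr0; congr row_mx.
by rewrite raddf0 add0r -[in RHS]scalemx1 scalerA mulr1 scalemx1.
Qed.

Lemma rcons0_slice_differentiable n (F : 'rV[C]_(1 + n) -> C) z x :
  differentiable F (rcons0 z x) -> differentiable (fun w => F (rcons0 w x)) z.
Proof.
rewrite rcons0_slice => /slice_differentiable[+ _].
by rewrite (_ : (fun s : C => _) = (fun w => F (rcons0 w x))) //;
  apply/funext => w; rewrite -rcons0_slice.
Qed.

Definition cyl n (r : R) (X : set 'rV[C]_n) : set 'rV[C]_(1 + n) :=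
  [set p | nm (rhd p) < r /\ X (rtl p)].

Lemma cyl_open n (r : R) (X : set 'rV[C]_n) : open X -> open (cyl r X).
Proof.
move=> oX; apply/open_pballP => p [hp Xp].
have [s s0 hs] := (open_pballP X).1 oX _ Xp.
exists (Num.min s (r - nm (rhd p))); first by rewrite lt_min s0 subr_gt0.
move=> q; rewrite /pball /= lt_min => /andP[q1 q2]; split.
  have := nmD (rhd (q - p)) (rhd p); rewrite {1}rhdB subrK.
  by have := nm_rhd (q - p); move: q2; move: (nm _) (nm _) (nm _) (nm _); clear; move=> *; lra.
by apply: hs; rewrite /pball /= -rtlB (le_lt_trans (nm_rtl _)).
Qed.

Definition bholo (V : normedModType C) (D : set V) (M : R) (F : V -> C) :=
  forall x, D x -> differentiable F x /\ nm (F x) <= M.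

Definition dq1 n (F : 'rV[C]_(1 + n) -> C) (p : 'rV[C]_(1 + n)) : C :=
  dquot (fun z => F (rcons0 z (rtl p))) (rhd p).

Lemma bholo_slice n (r M : R) (X : set 'rV[C]_n) F x : X x ->
  bholo (cyl r X) M F -> on_disc r M (fun z => F (rcons0 z x)).
Proof.
move=> Xx hF z zr; have [|d b] := hF (rcons0 z x).
  by split; rewrite ?rhd_cons ?rtl_cons.
by split=> //; exact: rcons0_slice_differentiable.
Qed.

(** For [l != 0] the quotient is explicit; for [l = 0] it is the uniform limit of the slices at
    small [l], by the bound on the second quotient. *)
Lemma dq1_coef n (r M : R) (X : set 'rV[C]_n) (H : 'rV[C]_(1 + n) -> C) :
  0 < r -> open X ->
  (forall x, X x -> on_disc r M (fun z => H (rcons0 z x))) ->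
  (forall l : C, nm l < r -> forall x, X x -> differentiable (fun x => H (rcons0 l x)) x) ->
  (forall l : C, nm l < r -> forall x, X x -> differentiable (fun x => dq1 H (rcons0 l x)) x).
Proof.
move=> r0 oX sl hH.
have nz l : nm l < r -> l != 0 ->
    forall x, X x -> differentiable (fun x => dq1 H (rcons0 l x)) x.
  move=> lr l0 x Xx.
  have -> : (fun x => dq1 H (rcons0 l x)) =
      (fun x => (H (rcons0 l x) - H (rcons0 0 x)) * l^-1).
    by apply/funext => y; rewrite /dq1 rhd_cons rtl_cons /dquot (negbTE l0).
  apply: differentiableM; last exact: (differentiable_cst (l^-1 : C) x).
  by apply: differentiableB; [exact: hH|apply: hH; rewrite ?nm0].
move=> l lr; have [->|l0] := eqVneq l 0; last exact: nz.
move=> x; apply: (limit_holomorphic oX) => e e0.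
pose Q := (cauchyK R / r) ^+ 2 * `|M|.
have Q0 : 0 <= Q by rewrite mulr_ge0 // exprn_ge0 // divr_ge0 // ltW // cauchyK_gt0.
have Q1 : 0 < Q + 1 by rewrite ltr_wpDl.
pose s := Num.min (r / 2) (e / (Q + 1)).
have s0 : 0 < s by rewrite lt_min !divr_gt0.
have ns : nm (s%:C%C : C) = s by rewrite nm_real ger0_norm // ltW.
have sr : nm (s%:C%C : C) < r.
  by rewrite ns /s gt_min ltr_pdivrMr // ltr_pMr // ltr1n.
exists (fun x => dq1 H (rcons0 (s%:C%C : C) x)); split.
  by apply: nz => //; rewrite -nm_gt0 ns.
move=> y Xy; rewrite /dq1 !rhd_cons !rtl_cons.
set phi := (fun z => _); have od : on_disc r M phi by exact: sl.
rewrite (dquot_eq (dquot phi) (s%:C%C : C)) opprD addrA subrr sub0r nmN nmM ns.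
have [_ b] := iter_dquot_disc 2 r0 od sr.
have {}b : nm (dquot (dquot phi) (s%:C%C : C)) <= Q.
  apply: le_trans b _; rewrite ler_wpM2l ?ler_norm // exprn_ge0 // divr_ge0 // ltW //.
  exact: cauchyK_gt0.
apply: le_trans (ler_wpM2l (ltW s0) b) _.
have : s <= e / (Q + 1) by rewrite ge_min lexx orbT.
rewrite ler_pdivlMr // => h; apply: le_trans h.
by rewrite mulrDr mulr1 lerDl ltW.
Qed.

(** Off [rhd p = 0] the quotient is explicit. At a point of this hyperplane it is written as its
    value at first coordinate 0, a function of [rtl p] alone, plus [rhd] times the second quotient;
    for the latter continuity is enough, because [rhd] vanishes there. *)
Lemma dq1_bholo n (r M : R) (X : set 'rV[C]_n) (F : 'rV[C]_(1 + n) -> C) :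
  0 < r -> open X -> bholo (cyl r X) M F ->
  bholo (cyl r X) (cauchyK R / r * M) (dq1 F).
Proof.
move=> r0 oX hF p [pr Xp].
have sl x : X x -> on_disc r M (fun z => F (rcons0 z x)).
  by move=> Xx; exact: bholo_slice hF.
have sl1 x : X x -> on_disc r (cauchyK R / r * M) (fun z => dq1 F (rcons0 z x)).
  move=> Xx; rewrite (_ : (fun z => _) = dquot (fun z => F (rcons0 z x))).
    exact: dquot_disc (sl _ Xx).
  by apply/funext => z; rewrite /dq1 rhd_cons rtl_cons.
have sl2 x : X x -> on_disc r (cauchyK R / r * (cauchyK R / r * M))
    (fun z => dq1 (dq1 F) (rcons0 z x)).
  move=> Xx; rewrite (_ : (fun z => _) = dquot (fun z => dq1 F (rcons0 z x))).
    exact: dquot_disc (sl1 _ Xx).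
  by apply/funext => z; rewrite {1}/dq1 rhd_cons rtl_cons.
split; last by have [_] := sl1 _ Xp _ pr; rewrite rcons0K.
have dFl (l : C) : nm l < r -> forall x, X x -> differentiable (fun x => F (rcons0 l x)) x.
  move=> lr x Xx; apply: (differentiable_compo (rcons0_differentiable l x)).
  by apply: (hF _ _).1; split; rewrite ?rhd_cons ?rtl_cons.
have d1 := dq1_coef r0 oX sl dFl.
have d2 := dq1_coef r0 oX sl1 d1.
have [p0|p0] := eqVneq (rhd p) 0; last first.
  have np : 0 < nm (rhd p) by rewrite nm_gt0.
  apply: (differentiable_local
    (g := fun q => (F q - F (rcons0 0 (rtl q))) / rhd q) np).
    move=> q hq; rewrite /dq1 /dquot; case: eqP => [q0|_]; last by rewrite rcons0K.
    have : nm (rhd (q - p)) < nm (rhd p) by exact: le_lt_trans (nm_rhd _) hq.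
    by rewrite rhdB q0 sub0r nmN ltxx.
  apply: differentiableM.
    apply: differentiableB; first exact: (hF p _).1.
    apply: (differentiable_compo (g := fun x => F (rcons0 0 x)) (rtl_differentiable p)).
    by apply: dFl => //; rewrite nm0.
  apply: differentiableV; [exact: differentiable_proj|exact: p0].
have E q : dq1 F q = dq1 F (rcons0 0 (rtl q)) + rhd q * dq1 (dq1 F) q.
  rewrite {1}/dq1 dquot_eq; congr (_ + _ * _).
    by rewrite /dq1 rhd_cons rtl_cons.
  rewrite -[RHS]/(dquot (fun z => dq1 F (rcons0 z (rtl q))) (rhd q)).
  congr (dquot _ _); apply/funext => z.
  by rewrite /dq1 rhd_cons rtl_cons.
rewrite (_ : dq1 F = (fun q => dq1 F (rcons0 0 (rtl q)) + rhd q * dq1 (dq1 F) q)); last exact/funext.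
have z0 : nm (0 : C) < r by rewrite nm0.
apply: differentiableD.
  apply: (differentiable_compo (g := fun x => dq1 F (rcons0 0 x)) (rtl_differentiable p)).
  exact: d1.
apply: mul_vanishing_differentiable => //; first exact: differentiable_proj.
move=> e e0; have e2 : 0 < e / 2 by rewrite divr_gt0.
have [b b0 hb] := differentiable_cont (d2 0 z0 _ Xp) e2.
have [b' b'0 hb'] := (open_pballP X).1 oX _ Xp.
pose Q := (cauchyK R / r) ^+ 3 * `|M|.
have kr0 : 0 <= cauchyK R / r by rewrite divr_ge0 // ltW // cauchyK_gt0.
have Q0 : 0 <= Q by rewrite mulr_ge0 // exprn_ge0.
have Q1 : 0 < Q + 1 by rewrite ltr_wpDl.
exists (Num.min (Num.min b b') (Num.min r (e / 2 / (Q + 1)))).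
  by rewrite !lt_min b0 b'0 r0 divr_gt0.
move=> q; rewrite !lt_min => /andP[/andP[q1 q2] /andP[q3 q4]].
have nh : nm (rhd q) <= nm (q - p) by rewrite -[rhd q]subr0 -p0 -rhdB; exact: nm_rhd.
have Xq : X (rtl q).
  by apply: hb'; rewrite /pball /= -rtlB; exact: le_lt_trans (nm_rtl _) q2.
have t1 : nm (dq1 (dq1 F) (rcons0 0 (rtl q)) - dq1 (dq1 F) p) < e / 2.
  have := hb (rtl q); rewrite -rtlB => /(_ (le_lt_trans (nm_rtl _) q1)).
  by rewrite -[in X in _ -> X](rcons0K p) p0.
have t2 : nm (dq1 (dq1 F) q - dq1 (dq1 F) (rcons0 0 (rtl q))) <= e / 2.
  rewrite -{1}(rcons0K q).
  set phi := (fun z => dq1 (dq1 F) (rcons0 z (rtl q))).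
  rewrite -[X in nm (X - _)]/(phi (rhd q)) -[X in nm (_ - X)]/(phi 0).
  have qr : nm (rhd q) < r by exact: le_lt_trans nh q3.
  have od := sl2 _ Xq; rewrite -/phi in od.
  rewrite (dquot_eq phi (rhd q)) addrAC subrr add0r nmM.
  have [_ bq] := dquot_disc r0 od qr.
  have {}bq : nm (dquot phi (rhd q)) <= Q.
    by apply: le_trans bq _; rewrite /Q !exprS expr0 mulr1 -!mulrA !ler_wpM2l ?ler_norm ?(ltW (cauchyK_gt0 R)) ?invr_ge0 ?(ltW r0).
  apply: le_trans (ler_wpM2l (nm_ge0 _) bq) _.
  move: q4; rewrite ltr_pdivlMr // => /ltW; apply: le_trans.
  by apply: ler_pM => //; rewrite ?nm_ge0 // lerDl.
have := nmD (dq1 (dq1 F) q - dq1 (dq1 F) (rcons0 0 (rtl q)))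
  (dq1 (dq1 F) (rcons0 0 (rtl q)) - dq1 (dq1 F) p); rewrite subrKA.
by move: t1 t2; move: (nm _) (nm _) (nm _); clear; move=> *; lra.
Qed.

End FirstVariable.

(** * Bounded holomorphic functions and their approximation by polynomials *)

Section BoundedHolomorphic.
Variables (R : realType).
Local Notation C := (Cplx R).

Definition bh (V : normedModType C) (D : set V) (F : V -> C) := exists M : R, bholo D M F.

Section Closure.
Variables (V : normedModType C) (D : set V).
Implicit Types F G : V -> C.

Lemma bh_diff F x : bh D F -> D x -> differentiable F x.
Proof. by move=> [M h] /h[]. Qed.

Lemma bh_cst (c : C) : bh D (fun=> c).
Proof. by exists (nm c) => x _; split=> //; exact: differentiable_cst. Qed.

Lemma bhD F G : bh D F -> bh D G -> bh D (fun x => F x + G x).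
Proof.
move=> [M hM] [M' hM']; exists (M + M') => x Dx.
have [d1 b1] := hM x Dx; have [d2 b2] := hM' x Dx; split.
  exact: differentiableD.
exact: le_trans (nmD _ _) (lerD b1 b2).
Qed.

Lemma bhM F G : bh D F -> bh D G -> bh D (fun x => F x * G x).
Proof.
move=> [M hM] [M' hM']; exists (M * M') => x Dx.
have [d1 b1] := hM x Dx; have [d2 b2] := hM' x Dx; split.
  exact: differentiableM.
by rewrite nmM ler_pM // nm_ge0.
Qed.

Lemma bhN F : bh D F -> bh D (fun x => - F x).
Proof.
move=> [M hM]; exists M => x Dx; have [d1 b1] := hM x Dx; split.
  exact: differentiableN.
by rewrite nmN.
Qed.

Lemma bhB F G : bh D F -> bh D G -> bh D (fun x => F x - G x).
Proof. by move=> hF hG; exact: (bhD hF (bhN hG)). Qed.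

Lemma bhX F n : bh D F -> bh D (fun x => F x ^+ n).
Proof.
move=> hF; elim: n => [|n IH]; first exact: bh_cst.
rewrite (_ : (fun x => _) = (fun x => F x * F x ^+ n)); first exact: bhM.
by apply/funext => x; rewrite exprS.
Qed.

Lemma bh_sum (I : Type) (r : seq I) (P : pred I) (F : I -> V -> C) :
  (forall i, bh D (F i)) -> bh D (fun x => \sum_(i <- r | P i) F i x).
Proof.
move=> hF; elim: r => [|a r IH].
  rewrite (_ : (fun x => _) = (fun=> 0)); first exact: bh_cst.
  by apply/funext => x; rewrite big_nil.
rewrite (_ : (fun x => _) = (fun x => (if P a then F a x else 0) + \sum_(i <- r | P i) F i x)).
  by apply: bhD => //; case: (P a) => //; exact: bh_cst.
by apply/funext => x; rewrite big_cons; case: (P a); rewrite ?add0r.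
Qed.

Lemma bh_prod (I : Type) (r : seq I) (P : pred I) (F : I -> V -> C) :
  (forall i, bh D (F i)) -> bh D (fun x => \prod_(i <- r | P i) F i x).
Proof.
move=> hF; elim: r => [|a r IH].
  rewrite (_ : (fun x => _) = (fun=> 1)); first exact: bh_cst.
  by apply/funext => x; rewrite big_nil.
rewrite (_ : (fun x => _) = (fun x => (if P a then F a x else 1) * \prod_(i <- r | P i) F i x)).
  by apply: bhM => //; case: (P a) => //; exact: bh_cst.
by apply/funext => x; rewrite big_cons; case: (P a); rewrite ?mul1r.
Qed.

Lemma bh_meval n (P : mpoly n C) (v : V -> 'I_n -> C) :
  (forall i, bh D (fun x => v x i)) -> bh D (fun x => meval (v x) P).
Proof.
move=> hv; rewrite (_ : (fun x => _) =
    (fun x => \sum_(m <- msupp P) mcoeff m P * \prod_i v x i ^+ m i)).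
  by apply: bh_sum => m; apply: bhM; [exact: bh_cst|apply: bh_prod => i; exact: bhX].
by apply/funext => x; rewrite mevalE.
Qed.

End Closure.

Lemma bhS (V : normedModType C) (D D' : set V) (F : V -> C) :
  D' `<=` D -> bh D F -> bh D' F.
Proof. by move=> DD [M hM]; exists M => x /DD; exact: hM. Qed.

Lemma differentiable_meval (V : normedModType C) n (P : mpoly n C) (v : V -> 'I_n -> C) x :
  (forall i, differentiable (fun x => v x i) x) ->
  differentiable (fun x => meval (v x) P) x.
Proof.
move=> hv; have h i : bh [set x] (fun x => v x i).
  by exists (nm (v x i)) => y ->; split.
exact: (bh_diff (bh_meval P h) (erefl x)).
Qed.

Lemma local_bh (V : normedModType C) (F : V -> C) x (r : R) : 0 < r ->
  (forall y, pball x r y -> differentiable F y) ->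
  exists2 s : R, 0 < s <= r & bh (pball x s) F.
Proof.
move=> r0 dF; have [d d0 hd] := differentiable_cont (dF x (pball_center x r0)) ltr01.
exists (Num.min r d); first by rewrite lt_min r0 d0 ge_min lexx.
exists (nm (F x) + 1) => y; rewrite /pball /= lt_min => /andP[y1 y2].
split; first exact: dF.
have := nmD (F y - F x) (F x); rewrite subrK.
by have := hd y y2; move: (nm _) (nm _) (nm _); clear; move=> *; lra.
Qed.

Definition mvar n (i : 'I_n) : mpoly n C := mpolyX C (mnm1 i).
Definition ev n (x : 'rV[C]_n) (P : mpoly n C) : C := meval (fun i => x 0 i) P.

Lemma ev_var n (x : 'rV[C]_n) i : ev x (mvar i) = x 0 i.
Proof. exact: mevalXU. Qed.

Lemma ev_differentiable n (P : mpoly n C) x : differentiable (fun x => ev x P) x.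
Proof. by apply: differentiable_meval => i; exact: differentiable_proj. Qed.

Definition msubst n m (h : 'I_n -> mpoly m C) (P : mpoly n C) : mpoly m C :=
  comp_mpoly [tuple h i | i < n] P.

Lemma ev_msubst n m (h : 'I_n -> mpoly m C) (P : mpoly n C) (x : 'rV[C]_m) :
  ev x (msubst h P) = ev (\row_i ev x (h i)) P.
Proof.
rewrite /ev /msubst comp_mpoly_meval; apply: meval_eq => i.
by rewrite tnth_mktuple mxE.
Qed.

Definition iter_dq1 n (F : 'rV[C]_(1 + n) -> C) m := iter m (@dq1 R n) F.

Lemma dq1_slice n (F : 'rV[C]_(1 + n) -> C) x m :
  (fun z => iter_dq1 F m (rcons0 z x)) = iter m (@dquot R) (fun z => F (rcons0 z x)).
Proof.
elim: m => [//|m IH]; rewrite /= -IH; apply/funext => z.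
by rewrite /iter_dq1 /= {1}/dq1 rhd_cons rtl_cons.
Qed.

Lemma dq1_expand n (F : 'rV[C]_(1 + n) -> C) m p :
  F p = \sum_(i < m) rhd p ^+ i * iter_dq1 F i (rcons0 0 (rtl p))
        + rhd p ^+ m * iter_dq1 F m p.
Proof.
have := dquot_expand (fun z => F (rcons0 z (rtl p))) m (rhd p).
rewrite rcons0K => ->; congr (_ + _ * _).
  apply: eq_bigr => i _; congr (_ * _).
  by rewrite -dq1_slice.
by rewrite -dq1_slice rcons0K.
Qed.

Lemma iter_dq1_bholo n (r M : R) (X : set 'rV[C]_n) (F : 'rV[C]_(1 + n) -> C) m :
  0 < r -> open X -> bholo (cyl r X) M F ->
  bholo (cyl r X) ((cauchyK R / r) ^+ m * M) (iter_dq1 F m).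
Proof.
move=> r0 oX hF; elim: m => [|m IH]; first by rewrite mul1r.
by rewrite exprS -mulrA; exact: dq1_bholo.
Qed.

Lemma bholo_base n (r M : R) (X : set 'rV[C]_n) (F : 'rV[C]_(1 + n) -> C) :
  0 < r -> bholo (cyl r X) M F -> bholo X M (fun x => F (rcons0 0 x)).
Proof.
move=> r0 hF x Xx; have [|d b] := hF (rcons0 0 x).
  by split; rewrite ?rhd_cons ?rtl_cons ?nm0.
split=> //; exact: (differentiable_compo (rcons0_differentiable 0 x)).
Qed.

Lemma pball0_cyl n (r : R) : 0 < r ->
  pball (0 : 'rV[C]_(1 + n)) r = cyl r (pball 0 r).
Proof.
move=> r0; apply/seteqP; split=> p; rewrite /pball /cyl /= !subr0.
  by rewrite -{1}(rcons0K p) nm_rcons0_lt // => /andP[].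
by move=> [h1 h2]; rewrite -(rcons0K p) nm_rcons0_lt // h1.
Qed.

Lemma geometric_tail (M e : R) : 0 < e -> exists m, M / 2 ^+ m <= e.
Proof.
move=> e0; exists (Num.bound (`|M| / e)).
rewrite ler_pdivrMr ?exprn_gt0 //; apply: le_trans (ler_norm _) _.
rewrite mulrC -ler_pdivrMr //; apply: le_trans (ltW (archi_boundP _)) _.
  by rewrite divr_ge0 // ltW.
by rewrite -natrX ler_nat ltnW // ltn_expl.
Qed.

(** Taylor expansion in the first variable, with coefficients approximated by induction. The radius
    [s] is chosen before [F], so that several functions are approximated on one ball. *)
Lemma polynomial_approximation n (r : R) : 0 < r ->
  exists2 s : R, 0 < s <= r & forall F, bh (pball (0 : 'rV[C]_n) r) F ->
    forall e : R, 0 < e -> exists P : mpoly n C,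
      forall x, pball 0 s x -> nm (F x - ev x P) <= e.
Proof.
elim: n => [|n IH] r0.
  exists r; first by rewrite r0 lexx.
  move=> F _ e e0; exists (mpolyC 0 (F 0)) => x _.
  by rewrite /ev mevalC (_ : x = 0) ?subrr ?nm0 ?ltW //; apply/rowP => -[].
have [s /andP[s0 sr] hs] := IH r0.
have K0 := cauchyK_gt0 R.
(* The bound 1 controls the powers of the first coordinate in the Taylor sum; the other bound makes
   the remainder at most [M / 2 ^+ m]. *)
pose t := Num.min 1 (r / (2 * cauchyK R)).
have t0 : 0 < t by rewrite lt_min ltr01 divr_gt0 // mulr_gt0.
exists (Num.min s t); first by rewrite lt_min s0 t0 ge_min sr.
move=> F [M hF] e e0.
rewrite -[n.+1]/(1 + n)%N pball0_cyl // in hF.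
have e2 : 0 < e / 2 by rewrite divr_gt0.
have [m hm] := geometric_tail M e2.
have ob : open (pball (0 : 'rV[C]_n) r) by exact: pball_open.
have hi i := iter_dq1_bholo i r0 ob hF.
have e3 : 0 < e / 2 / (m%:R + 1) by rewrite divr_gt0 // ltr_wpDl // ler0n.
have /choice[P hP] : forall i, exists P : mpoly n C, forall x, pball 0 s x ->
    nm (iter_dq1 F i (rcons0 0 x) - ev x P) <= e / 2 / (m%:R + 1).
  move=> i; apply: hs => //; exists ((cauchyK R / r) ^+ i * M).
  exact: bholo_base (hi i).
pose sub (Q : mpoly n C) : mpoly (1 + n) C := msubst (fun i => mvar (rshift 1 i)) Q.
have ev_sub Q (p : 'rV[C]_(1 + n)) : ev p (sub Q) = ev (rtl p) Q.
  by rewrite ev_msubst; congr (ev _ Q); apply/rowP => i; rewrite !mxE ev_var.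
exists (\sum_(i < m) mvar (lshift n ord0) ^+ i * sub (P i)) => p.
rewrite /pball /= subr0 => hp.
have hp1 : nm (rhd p) < t.
  by apply: le_lt_trans (nm_rhd p) _; move: hp; rewrite lt_min => /andP[].
have hp2 : pball 0 s (rtl p).
  rewrite /pball /= subr0; apply: le_lt_trans (nm_rtl p) _.
  by move: hp; rewrite lt_min => /andP[].
have z1 : nm (rhd p) <= 1 by move: hp1; rewrite lt_min => /andP[/ltW].
have zK : nm (rhd p) * (cauchyK R / r) <= 1 / 2.
  move: hp1; rewrite lt_min => /andP[_]; rewrite ltr_pdivlMr ?mulr_gt0 // => h.
  rewrite mulrA ler_pdivrMr //; move: h; move: (nm _) => a; clear -K0.
  by move: (cauchyK R) K0 => K K0 h; lra.
have Dp : cyl r (pball 0 r) p.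
  split; last by apply: pball_le sr _ hp2.
  apply: lt_le_trans hp1 _; apply: (@le_trans _ _ (r / (2 * cauchyK R))).
    by rewrite ge_min lexx orbT.
  rewrite ler_pdivrMr ?mulr_gt0 // ler_peMr ?(ltW r0) //.
  by have := cauchyK_ge1 R; clear; lra.
have evE : ev p (\sum_(i < m) mvar (lshift n ord0) ^+ i * sub (P i)) =
    \sum_(i < m) rhd p ^+ i * ev (rtl p) (P i).
  rewrite /ev rmorph_sum; apply: eq_bigr => i _.
  rewrite rmorphM rmorphXn /= -/(ev _ _) -/(ev p _).
  by rewrite ev_sub ev_var.
rewrite evE (dq1_expand F m p) addrAC -sumrB.
apply: le_trans (nmD _ _) _; rewrite [e]splitr; apply: lerD.
  apply: le_trans (nm_sum _ _ _) _.
  apply: (@le_trans _ _ (\sum_(i < m) e / 2 / (m%:R + 1))).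
    apply: ler_sum => i _; rewrite -mulrBr nmM nmX.
    apply: le_trans (_ : _ <= 1 * nm (iter_dq1 F i (rcons0 0 (rtl p)) - ev (rtl p) (P i))) _.
      by rewrite ler_wpM2r ?nm_ge0 // exprn_ile1 // nm_ge0.
    by rewrite mul1r; exact: hP.
  rewrite sumr_const card_ord -[_ *+ m]mulr_natr mulrAC ler_pdivrMr.
    by rewrite ler_wpM2l ?(ltW e2) // lerDl.
  by rewrite ltr_wpDl // ler0n.
apply: le_trans hm; rewrite nmM nmX.
have [_ b] := hi m _ Dp.
apply: le_trans (ler_wpM2l _ b) _; first by rewrite exprn_ge0 // nm_ge0.
rewrite mulrA -exprMn mulrC.
have M0 : 0 <= M by have [_] := hF _ Dp; apply: le_trans; exact: nm_ge0.
rewrite ler_wpM2l // -exprVn; apply: lerXn2r; rewrite ?nnegrE ?invr_ge0 //.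
  by rewrite mulr_ge0 ?nm_ge0 // divr_ge0 // ltW.
by rewrite -[leRHS]mul1r.
Qed.

End BoundedHolomorphic.

(** * Weierstrass division *)

Section Weierstrass.
Variables (R : realType).
Local Notation C := (Cplx R).

Lemma bh_base n (r : R) (X : set 'rV[C]_n) (F : 'rV[C]_(1 + n) -> C) : 0 < r ->
  bh (cyl r X) F -> bh X (fun x => F (rcons0 0 x)).
Proof. by move=> r0 [M hM]; exists M; exact: bholo_base hM. Qed.

Lemma geometric_series_bholo (V : normedModType C) (D : set V) (f : nat -> V -> C) (M : R) :
  (forall k x, D x -> nm (f k x) <= M * (1 / 2) ^+ k) ->
  exists F : V -> C, forall x, D x -> forall k,
    nm (\sum_(i < k) f i x - F x) <= 4 * M * (1 / 2) ^+ k.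
Proof.
move=> hf.
suff /choice[F hF] : forall x, exists l, D x -> forall k,
    nm (\sum_(i < k) f i x - l) <= 4 * M * (1 / 2) ^+ k by exists F.
move=> x; have [Dx|nDx] := pselect (D x); last by exists 0.
have [|||l hl] := @geometric_cvg R (fun k => \sum_(i < k) f i x) M (1 / 2).
- by clear; lra.
- by clear; lra.
- by move=> k; rewrite big_ord_recr /= addrAC subrr add0r; exact: hf.
exists l => _ k; apply: le_trans (hl k) _.
by rewrite le_eqVlt; apply/orP; left; apply/eqP; congr (_ * _); field.
Qed.

Lemma series_limit_bh N (D : set 'rV[C]_N) (f : nat -> 'rV[C]_N -> C) F (M : R) : open D ->
  (forall k x, D x -> differentiable (f k) x) ->
  (forall x, D x -> forall k, nm (\sum_(i < k) f i x - F x) <= M * (1 / 2) ^+ k) ->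
  bh D F.
Proof.
move=> oD df hF; exists M => x Dx; split; last first.
  by have := hF x Dx 0%N; rewrite big_ord0 sub0r nmN expr0 mulr1.
move: x Dx; apply: limit_holomorphic => // e e0.
have [m hm] := geometric_tail M e0.
exists (fun x => \sum_(i < m) f i x); split.
  move=> x Dx; rewrite (_ : (fun x => _) = \sum_(i < m) f i).
    by apply: differentiable_sum => i; exact: df.
  by apply/funext => y; rewrite fct_sumE.
move=> x Dx; rewrite nmB; apply: le_trans (hF x Dx m) _.
by rewrite expr_div_n expr1n mul1r.
Qed.

(* Dividing by [z ^+ d] instead of [z ^+ d + b] leaves the error [- q b], which is
   at most half the size of the dividend and is divided in turn. *)
Theorem weierstrass_division n d (r theta : R) (X : set 'rV[C]_n) b F :
  0 < r -> open X -> bholo (cyl r X) theta b ->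
  (cauchyK R / r) ^+ d * theta <= 1 / 2 -> bh (cyl r X) F ->
  exists q : 'rV[C]_(1 + n) -> C, exists c : nat -> 'rV[C]_n -> C,
  [/\ bh (cyl r X) q, forall i, bh X (c i) & forall p, cyl r X p ->
    F p = \sum_(i < d) rhd p ^+ i * c i (rtl p) + q p * (rhd p ^+ d + b p)].
Proof.
move=> r0 oX hb htheta [M hF].
have kr0 : 0 <= cauchyK R / r by rewrite divr_ge0 // ltW // cauchyK_gt0.
pose step (G : 'rV[C]_(1 + n) -> C) := fun p => - (iter_dq1 G d p * b p).
pose G k := iter k step F.
have hG k : bholo (cyl r X) (M * (1 / 2) ^+ k) (G k).
  elim: k => [|k IH]; first by rewrite expr0 mulr1.
  move=> p Dp; have [d1 b1] := iter_dq1_bholo d r0 oX IH Dp.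
  have [d2 b2] := hb p Dp; split.
    by apply: differentiableN; exact: differentiableM.
  rewrite /G /= /step nmN nmM.
  apply: le_trans (ler_pM (nm_ge0 _) (nm_ge0 _) b1 b2) _.
  have Mk : 0 <= M * (1 / 2) ^+ k.
    by have [_] := IH p Dp; apply: le_trans; exact: nm_ge0.
  rewrite exprSr [leRHS]mulrA.
  rewrite [leLHS](_ : _ = M * (1 / 2) ^+ k * ((cauchyK R / r) ^+ d * theta)); last by ring.
  by rewrite ler_wpM2l.
have tG i k := iter_dq1_bholo i r0 oX (hG k).
have [q hq] : exists q, forall p, cyl r X p -> forall k,
    nm (\sum_(i < k) iter_dq1 (G i) d p - q p) <= 4 * ((cauchyK R / r) ^+ d * M) * (1 / 2) ^+ k.
  apply: (geometric_series_bholo (f := fun i => iter_dq1 (G i) d)) => k p Dp.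
  by rewrite -mulrA; exact: (tG d k p Dp).2.
have : forall i, exists c, forall x, X x -> forall k,
    nm (\sum_(j < k) iter_dq1 (G j) i (rcons0 0 x) - c x)
    <= 4 * ((cauchyK R / r) ^+ i * M) * (1 / 2) ^+ k.
  move=> i; apply: (geometric_series_bholo
    (f := fun j x => iter_dq1 (G j) i (rcons0 0 x))) => k x Xx; rewrite -mulrA.
  exact: (bholo_base r0 (tG i k) Xx).2.
move=> /choice[c hc].
exists q, c; split.
- have dG k p : cyl r X p -> differentiable (iter_dq1 (G k) d) p.
    by move=> Dp; exact: (tG d k p Dp).1.
  exact: (series_limit_bh (cyl_open oX) dG hq).
- move=> i; have dG k x : X x -> differentiable (fun x => iter_dq1 (G k) i (rcons0 0 x)) x.
    by move=> Xx; exact: (bholo_base r0 (tG i k) Xx).1.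
  exact: (series_limit_bh oX dG (hc i)).
move=> p Dp; have [_ Xp] := Dp.
pose low k := \sum_(i < d) rhd p ^+ i * iter_dq1 (G k) i (rcons0 0 (rtl p)).
have stepE k : G k p = low k + iter_dq1 (G k) d p * (rhd p ^+ d + b p) + G k.+1 p.
  rewrite {1}(dq1_expand (G k) d p) -/(low k).
  rewrite -[G k.+1 p]/(- (iter_dq1 (G k) d p * b p)); ring.
have part m : F p = \sum_(k < m) low k
    + (\sum_(k < m) iter_dq1 (G k) d p) * (rhd p ^+ d + b p) + G m p.
  elim: m => [|m IH]; first by rewrite !big_ord0 mul0r !add0r.
  by rewrite !big_ord_recr /= {1}IH stepE; ring.
have M0 : 0 <= M by have [_] := hF p Dp; apply: le_trans; exact: nm_ge0.
pose B := \sum_(i < d) nm (rhd p) ^+ i * (4 * ((cauchyK R / r) ^+ i * M)).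
pose g := rhd p ^+ d + b p.
apply/eqP; rewrite -subr_eq0 -nm_eq0; apply/eqP/le_anti; rewrite nm_ge0 andbT.
apply: (@ler_geometric0 _ _ (B + 4 * ((cauchyK R / r) ^+ d * M) * nm g + M)) => m.
rewrite -/g.
have E : F p - (\sum_(i < d) rhd p ^+ i * c i (rtl p) + q p * g) =
   (\sum_(i < d) rhd p ^+ i * (\sum_(k < m) iter_dq1 (G k) i (rcons0 0 (rtl p)) - c i (rtl p)))
   + (\sum_(k < m) iter_dq1 (G k) d p - q p) * g + G m p.
  have -> : \sum_(i < d) rhd p ^+ i *
       (\sum_(k < m) iter_dq1 (G k) i (rcons0 0 (rtl p)) - c i (rtl p)) =
       \sum_(k < m) low k - \sum_(i < d) rhd p ^+ i * c i (rtl p).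
    rewrite /low exchange_big /= -sumrB; apply: eq_bigr => i _.
    by rewrite mulrBr mulr_sumr.
  rewrite {1}(part m) -/g; move: (\sum_(k < m) low k) (\sum_(i < d) _) => a a'.
  by ring.
rewrite E.
have l1 : nm (\sum_(i < d) rhd p ^+ i *
    (\sum_(k < m) iter_dq1 (G k) i (rcons0 0 (rtl p)) - c i (rtl p))) <= B * (1 / 2) ^+ m.
  apply: le_trans (nm_sum _ _ _) _; rewrite /B mulr_suml; apply: ler_sum => i _.
  rewrite nmM nmX -[leRHS]mulrA ler_wpM2l ?exprn_ge0 ?nm_ge0 //; exact: hc.
have l2 : nm ((\sum_(k < m) iter_dq1 (G k) d p - q p) * g) <=
    4 * ((cauchyK R / r) ^+ d * M) * nm g * (1 / 2) ^+ m.
  by rewrite nmM mulrAC ler_wpM2r ?nm_ge0 //; exact: hq.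
have [_ l3] := hG m p Dp.
have P2 : (1 / 2 : R) ^+ m = 2 ^- m by rewrite expr_div_n expr1n mul1r.
rewrite P2 in l1 l2 l3; rewrite [leRHS]mulrDl [X in _ <= X + _]mulrDl.
apply: le_trans (nmD _ _) (lerD _ l3).
exact: le_trans (nmD _ _) (lerD l1 l2).
Qed.

Lemma poly_disc0 (p : {poly C}) (r : R) : 0 < r ->
  (forall z, nm z < r -> p.[z] = 0) -> p = 0.
Proof.
move=> r0 hp; apply/eqP; apply: contraT => p0.
pose f (k : nat) : C := (r / (k%:R + 2))%:C%C.
have fpos k : 0 < r / (k%:R + 2) by rewrite divr_gt0 // ltr_wpDl // ler0n.
have f_inj : injective f.
  move=> i j /complexI/(congr1 (fun x => r * x^-1)).
  rewrite !invf_div !mulrA ![r * _]mulrC !mulfK ?gt_eqF //.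
  by move=> /addIr/eqP; rewrite eqr_nat => /eqP.
have := max_poly_roots (rs := [seq f k | k <- iota 0 (size p)]) p0.
rewrite size_map size_iota ltnn map_inj_uniq // iota_uniq => h.
suff : false by []; apply: h => //.
apply/allP => _ /mapP[k _ ->]; apply/rootP; apply: hp.
rewrite /f nm_real gtr0_norm //.
have k1 : 1 < k%:R + 2 :> R by have := ler0n R k; clear; move=> *; lra.
by rewrite ltr_pdivrMr ?ltr_pMr // (lt_trans ltr01).
Qed.

Lemma dquot_cons (F G : C -> C) (c : C) (r : R) : 0 < r ->
  (forall z, nm z < r -> F z = c + z * G z) -> differentiable G 0 ->
  forall z, nm z < r -> dquot F z = G z.
Proof.
move=> r0 FG dG z zr; have F0 : F 0 = c by rewrite FG ?nm0 // mul0r addr0.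
rewrite /dquot; case: eqVneq => [->|z0].
  apply: (proj2 (differentiable1_eps (l := G 0) _)) => e e0.
  have [d d0 hd] := differentiable_cont dG e0.
  exists (Num.min d r); first by rewrite lt_min d0.
  move=> h; rewrite lt_min add0r => /andP[h1 h2]; rewrite F0 FG // (addrC c) addrK.
  rewrite -mulrBr nmM mulrC ler_wpM2r ?nm_ge0 //.
  by apply: ltW; apply: hd; rewrite subr0.
by rewrite F0 FG // (addrC c) addrK mulrC mulKf.
Qed.

(** Uniqueness of the division by [z ^+ d]; it gives a cofactor [G] the bounds of an iterated
    quotient. *)
Lemma iter_dquot_cons (F G : C -> C) (p : {poly C}) d (r : R) : 0 < r ->
  (size p <= d)%N -> (forall z, nm z < r -> F z = p.[z] + z ^+ d * G z) ->
  (forall z, nm z < r -> differentiable G z) ->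
  forall z, nm z < r -> iter d (@dquot R) F z = G z.
Proof.
move=> r0; elim: d F p => [|d IH] F p sp FG dG z zr.
  have p0 : p = 0 by apply/eqP; rewrite -size_poly_eq0 -leqn0.
  by rewrite /= FG // p0 horner0 add0r mul1r.
rewrite iterSr.
have [p' [c [pE sp']]] : exists p' c, p = p' * 'X + c%:P /\ (size p' <= d)%N.
  elim/poly_ind: p sp {FG} => [|p' c _] sp.
    by exists 0, 0; rewrite mul0r addr0 size_poly0.
  exists p', c; split=> //; move: sp; rewrite size_MXaddC.
  by case: ifP => // /andP[/eqP -> _]; rewrite size_poly0.
have dp w : differentiable (fun w : C => p'.[w]) w.
  rewrite (_ : (fun w => _) = \sum_(i < size p') (fun w : C => p'`_i * w ^+ i)).
    apply: differentiable_sum => i; apply: differentiableM.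
      exact: differentiable_cst.
    exact/differentiable_pow/differentiable_id.
  by apply/funext => x; rewrite fct_sumE horner_coef.
have dpG w : nm w < r -> differentiable (fun w => p'.[w] + w ^+ d * G w) w.
  move=> wr; apply: differentiableD; first exact: dp.
  apply: differentiableM; last exact: dG.
  exact/differentiable_pow/differentiable_id.
have E w : nm w < r -> dquot F w = p'.[w] + w ^+ d * G w.
  have z0 : nm (0 : C) < r by rewrite nm0.
  apply: (@dquot_cons F (fun w => p'.[w] + w ^+ d * G w) c r r0 _ (dpG 0 z0)).
  by move=> u ur; rewrite FG // pE hornerMXaddC exprS; ring.
exact: (IH _ p' sp' E dG).
Qed.

(** The equation reads [- (h * b) = - p + z ^+ d * h], so [h] is the [d]-th quotient of [- (h * b)]:
    any bound of [h] can be halved, whence [h = 0]. *)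
Theorem weierstrass_uniqueness (r theta M : R) d (h b : C -> C) (p : {poly C}) :
  0 < r -> on_disc r M h -> on_disc r theta b ->
  (cauchyK R / r) ^+ d * theta <= 1 / 2 -> (size p <= d)%N ->
  (forall z, nm z < r -> p.[z] = h z * (z ^+ d + b z)) -> p = 0.
Proof.
move=> r0 hh hb ht sp E.
have half M' : on_disc r M' h -> on_disc r (M' * (1 / 2)) h.
  move=> hM'; have z0 : nm (0 : C) < r by rewrite nm0.
  have M'0 : 0 <= M' by have [_] := hM' 0 z0; apply: le_trans; exact: nm_ge0.
  have hF : on_disc r (M' * theta) (fun z => - (h z * b z)).
    move=> z zr; have [d1 b1] := hM' z zr; have [d2 b2] := hb z zr; split.
      by apply: differentiableN; exact: differentiableM.
    by rewrite nmN nmM ler_pM ?nm_ge0.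
  move=> z zr; split; first exact: (hh z zr).1.
  have <- : iter d (@dquot R) (fun z => - (h z * b z)) z = h z.
    apply: (iter_dquot_cons (p := - p) r0) => //; first by rewrite size_polyN.
      by move=> w wr; rewrite hornerN E //; ring.
    by move=> w wr; exact: (hh w wr).1.
  apply: le_trans (iter_dquot_disc d r0 hF zr).2 _.
  by rewrite mulrCA ler_wpM2l.
have hk k : on_disc r (M * (1 / 2) ^+ k) h.
  elim: k => [|k /half h']; first by rewrite expr0 mulr1; exact: hh.
  by rewrite (_ : M * _ = M * (1 / 2) ^+ k * (1 / 2)) // exprSr; ring.
apply: (poly_disc0 r0) => z zr; rewrite E //.
suff -> : h z = 0 by rewrite mul0r.
apply/eqP; rewrite -nm_eq0; apply/eqP/le_anti; rewrite nm_ge0 andbT.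
apply: (@ler_geometric0 _ _ M) => k.
by have [_] := hk k z zr; rewrite expr_div_n expr1n mul1r.
Qed.

End Weierstrass.

(** * Algebraic functions *)

Section Algebraic.
Variables (R : realType).
Local Notation C := (Cplx R).

Definition evp n (x : 'rV[C]_n) (p : {poly mpoly n C}) : {poly C} := map_poly (@ev R n x) p.

Lemma evpD n (x : 'rV[C]_n) p q : evp x (p + q) = evp x p + evp x q.
Proof. exact: (rmorphD (map_poly (meval (fun i => x 0 i)))). Qed.
Lemma evpM n (x : 'rV[C]_n) p q : evp x (p * q) = evp x p * evp x q.
Proof. exact: (rmorphM (map_poly (meval (fun i => x 0 i)))). Qed.
Lemma evpXn n (x : 'rV[C]_n) p k : evp x (p ^+ k) = evp x p ^+ k.
Proof. exact: (rmorphXn (map_poly (meval (fun i => x 0 i)))). Qed.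
Lemma evpC n (x : 'rV[C]_n) P : evp x P%:P = (ev x P)%:P.
Proof. exact: (map_polyC (meval (fun i => x 0 i))). Qed.
Lemma evpX n (x : 'rV[C]_n) : evp x 'X = 'X.
Proof. exact: (map_polyX (meval (fun i => x 0 i))). Qed.
Lemma evp0 n (x : 'rV[C]_n) : evp x 0 = 0.
Proof. exact: (rmorph0 (map_poly (meval (fun i => x 0 i)))). Qed.
Lemma coef_evp n (x : 'rV[C]_n) p i : (evp x p)`_i = ev x p`_i.
Proof. exact: (coef_map (meval (fun i => x 0 i))). Qed.
Lemma evp_deriv n (x : 'rV[C]_n) p : evp x p^`() = (evp x p)^`().
Proof. by rewrite /evp -(deriv_map (meval (fun i => x 0 i))). Qed.
Lemma horner_evp_sum n (x : 'rV[C]_n) p z :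
  (evp x p).[z] = \sum_(i < size p) ev x p`_i * z ^+ i.
Proof. exact: horner_poly. Qed.

Lemma muni_mulE n (p : mpoly n.+1 C) :
  (map_poly (@mwiden n C) (muni p)).[mpolyX C (mnm1 ord_max)] = p.
Proof.
rewrite muniE raddf_sum /= horner_sum [RHS]mpolyE; apply: eq_bigr => m _.
rewrite -!mul_polyC !rmorphM /= !map_polyC map_polyXn /= !hornerM !hornerC hornerXn.
rewrite mwidenZ mwidenX mpolyXn -scalerAl -mpolyXD; congr (_ *: mpolyX C _).
apply/mnmP => i; rewrite mnmDE mulmnE mnm1E.
case: (unliftP ord_max i) => [j ->|->].
  rewrite (negbTE (neq_lift ord_max j)) mul0n addn0.
  have -> : lift ord_max j = widen_ord (leqnSn n) j.
    by apply/val_inj; rewrite /= /bump leqNgt ltn_ord.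
  by rewrite mnmwiden_widen multinomE tnth_mktuple.
by rewrite mnmwiden_ordmax eqxx mul1n.
Qed.

Lemma ev_muni n (P : mpoly n.+1 C) (x : 'rV[C]_n) (z : C) :
  (evp x (muni P)).[z] =
  meval (fun i => oapp (fun j => x 0 j) z (unlift ord_max i)) P.
Proof.
rewrite muniE mevalE.
rewrite (_ : evp x _ = \sum_(m <- msupp P) (mcoeff m P * \prod_(i < n) x 0 i ^+ m (widen_ord (leqnSn n) i)) *: 'X^(m ord_max)).
  rewrite horner_sum; apply: eq_bigr => m _.
  rewrite hornerZ hornerXn big_ord_recr /= unlift_none /= mulrA; congr (_ * _ * _).
  apply: eq_bigr => i _.
  rewrite (_ : widen_ord _ i = lift ord_max i) ?liftK //.
  by apply/val_inj; rewrite /= /bump leqNgt ltn_ord.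
rewrite /evp raddf_sum; apply: eq_bigr => m _.
rewrite -[LHS]/(evp x _) -!mul_polyC evpM evpC evpXn evpX.
congr (_%:P * _); rewrite /ev mevalZ mevalX; congr (_ * _).
by apply: eq_bigr => i _; rewrite multinomE tnth_mktuple.
Qed.

Lemma ev_neq0 n (P : mpoly n C) : P != 0 -> exists x, ev x P != 0.
Proof.
elim: n P => [|n IH] P P0.
  exists 0; apply: contraNneq P0 => h.
  have E : P = mpolyC 0 (mcoeff (@mnm0 0) P).
    apply/mpolyP => m; rewrite mcoeffC (_ : m = @mnm0 0) ?eqxx ?mulr1 //.
    by apply/mnmP => -[].
  by move: h; rewrite E /ev mevalC => ->; rewrite mpolyC0.
apply: contraPP P0 => /forallNP all0; apply/negP; rewrite negbK; apply/eqP.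
rewrite -[P]muni_mulE (_ : muni P = 0) ?rmorph0 ?horner0 //.
apply/polyP => i; rewrite coef0; apply/eqP; apply: contraT => /IH[x /eqP []].
rewrite -coef_evp (@poly_disc0 R (evp x (muni P)) 1) ?coef0 // => z _.
rewrite ev_muni; have /negP := all0 (\row_i oapp (fun j => x 0 j) z (unlift ord_max i)).
rewrite negbK => /eqP <-; apply: meval_eq => j.
by rewrite mxE.
Qed.

End Algebraic.

(** * Closure of algebraic functions under ring operations and roots *)

Section AlgebraicFunctions.
Variables (R : realType) (n : nat).
Local Notation C := (Cplx R).
Implicit Types (D : set 'rV[C]_n) (f g v : 'rV[C]_n -> C).

(** One equation for the whole of [D], unlike the local ones of [nash_at]. It is nonzero as a
    polynomial, but may become zero at some points of [D] when its coefficients are evaluated. *)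
Definition alg D g := exists2 p : {poly mpoly n C}, p != 0 &
  forall x, D x -> (evp x p).[g x] = 0.

(** Monic equations serve for the closure under sums and products, through [integralOver];
    [alg_intg] and [intg_alg] relate the two notions by multiplication with a nonzero polynomial. *)
Definition intg D g := exists2 p : {poly mpoly n C}, p \is monic &
  forall x, D x -> (evp x p).[g x] = 0.

Definition evf (P : mpoly n C) : 'rV[C]_n -> C := fun x => ev x P.

Fact evf_additive : zmod_morphism evf.
Proof. by move=> P Q; apply/funext => x; exact: mevalB. Qed.

Fact evf_multiplicative : monoid_morphism evf.
Proof.
by split=> [|P Q]; apply/funext => x; [exact: meval1|exact: mevalM].
Qed.

HB.instance Definition _ :=
  GRing.isZmodMorphism.Build (mpoly n C) ('rV[C]_n -> C) evf evf_additive.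
HB.instance Definition _ :=
  GRing.isMonoidMorphism.Build (mpoly n C) ('rV[C]_n -> C) evf evf_multiplicative.

Lemma horner_fun (p : {poly ('rV[C]_n -> C)}) v x :
  p.[v] x = \sum_(i < size p) p`_i x * v x ^+ i.
Proof.
rewrite horner_coef fct_sumE; apply: eq_bigr => i _.
rewrite -[LHS]/(p`_i x * (v ^+ i) x); congr (_ * _).
by elim: (i : nat) => [|k IH]; rewrite ?expr0 // !exprS -IH.
Qed.

Lemma horner_evf (p : {poly mpoly n C}) v x :
  (map_poly evf p).[v] x = (evp x p).[v x].
Proof.
rewrite horner_evp_sum horner_fun.
have sz : (size (map_poly evf p) <= size p)%N by exact: size_poly.
rewrite (big_ord_widen _ (fun i => (map_poly evf p)`_i x * v x ^+ i) sz).
rewrite [LHS]big_mkcond; apply: eq_bigr => i _.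
rewrite coef_map /=; case: ltnP => // hi.
have h : evf p`_i = 0 by rewrite -coef_map nth_default.
have -> : ev x p`_i = 0 by exact: (congr1 (@^~ x) h).
by rewrite mul0r.
Qed.

(** Extension by 0 turns a relation that holds on [D] into an identity in the ring of all functions,
    where [integralOver] is stated. *)
Definition cut D g : 'rV[C]_n -> C := fun x => if `[< D x >] then g x else 0.

Lemma cutE D g x : D x -> cut D g x = g x.
Proof. by move=> Dx; rewrite /cut asboolT. Qed.

Lemma cutN D g x : ~ D x -> cut D g x = 0.
Proof. by move=> Dx; rewrite /cut asboolF. Qed.

Lemma intg_integral D g : intg D g <-> integralOver evf (cut D g).
Proof.
split=> [[p mp hp]|[p mp /rootP hp]].
  (* The factor ['X] makes 0 a root, for the points outside [D]. *)
  exists (p * 'X); first by rewrite monicMr ?monicX.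
  apply/rootP/funext => x; rewrite horner_evf evpM evpX hornerM hornerX.
  have [Dx|nDx] := pselect (D x); first by rewrite cutE // hp // mul0r.
  by rewrite cutN // mulr0.
exists p => // x Dx; have := congr1 (@^~ x) hp.
by rewrite horner_evf cutE.
Qed.

Lemma intg_ext D f g : (forall x, D x -> f x = g x) -> intg D f -> intg D g.
Proof. by move=> fg [p mp hp]; exists p => // x Dx; rewrite -fg // hp. Qed.

Lemma intgD D f g : intg D f -> intg D g -> intg D (fun x => f x + g x).
Proof.
move=> /intg_integral hf /intg_integral hg; apply/intg_integral.
rewrite (_ : cut D _ = cut D f + cut D g); first exact: integral_add.
by apply/funext => x; rewrite -[RHS]/(cut D f x + cut D g x) /cut; case: ifP => // _; rewrite addr0.
Qed.

Lemma intgM D f g : intg D f -> intg D g -> intg D (fun x => f x * g x).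
Proof.
move=> /intg_integral hf /intg_integral hg; apply/intg_integral.
rewrite (_ : cut D _ = cut D f * cut D g); first exact: integral_mul.
by apply/funext => x; rewrite -[RHS]/(cut D f x * cut D g x) /cut; case: ifP => // _; rewrite mul0r.
Qed.

Lemma intg_ev D P : intg D (fun x => ev x P).
Proof.
exists ('X - P%:P); first exact: monicXsubC.
by move=> x _; rewrite -rmorphN /= evpD evpX evpC hornerD hornerX hornerC /ev mevalN subrr.
Qed.

Lemma intg_cst D (c : C) : intg D (fun=> c).
Proof.
by apply: intg_ext (intg_ev D (mpolyC n c)) => x _; rewrite /ev mevalC.
Qed.

Lemma intgN D f : intg D f -> intg D (fun x => - f x).
Proof.
move=> hf; apply: intg_ext (intgM (intg_cst D (-1)) hf) => x _.
by rewrite mulN1r.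
Qed.

Lemma intgX D f k : intg D f -> intg D (fun x => f x ^+ k).
Proof.
move=> hf; elim: k => [|k IH]; first exact: intg_cst.
by apply: intg_ext (intgM hf IH) => x _; rewrite exprS.
Qed.

Lemma intg_sum D (I : Type) (r : seq I) (f : I -> 'rV[C]_n -> C) :
  (forall i, intg D (f i)) -> intg D (fun x => \sum_(i <- r) f i x).
Proof.
move=> hf; elim: r => [|a r IH].
  by apply: intg_ext (intg_cst D 0) => x _; rewrite big_nil.
by apply: intg_ext (intgD (hf a) IH) => x _; rewrite big_cons.
Qed.

(** Transitivity of integrality, for a monic equation whose coefficients are themselves integral
    over the polynomials. *)
Lemma intg_root D v d (c : nat -> 'rV[C]_n -> C) : (0 < d)%N ->
  (forall i, intg D (c i)) ->
  (forall x, D x -> v x ^+ d + \sum_(i < d) c i x * v x ^+ i = 0) -> intg D v.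
Proof.
move=> d0 ic hv; apply/intg_integral.
pose q : {poly ('rV[C]_n -> C)} := \poly_(i < d) cut D (c i).
have sq : (size q <= d)%N by exact: size_poly.
apply: (@integral_root_monic _ _ evf (cut D v) ('X^d + q)).
- rewrite monicE lead_coefDl ?lead_coefXn // size_polyXn ltnS //.
- apply/rootP/funext => x; rewrite hornerD hornerXn -[LHS]/((cut D v ^+ d) x + q.[cut D v] x).
  have -> : (cut D v ^+ d) x = cut D v x ^+ d.
    by elim: d {d0 hv q sq} => [//|d IH]; rewrite !exprS -IH.
  have -> : q.[cut D v] x = \sum_(i < d) cut D (c i) x * cut D v x ^+ i.
    rewrite horner_poly fct_sumE; apply: eq_bigr => i _.
    rewrite -[LHS]/(cut D (c i) x * (cut D v ^+ i) x); congr (_ * _).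
    by elim: (i : nat) => [//|k IH]; rewrite !exprS -IH.
  have [Dx|nDx] := pselect (D x).
    rewrite cutE // -[RHS](hv x Dx); congr (_ + _); apply: eq_bigr => i _.
    by rewrite cutE.
  rewrite cutN // expr0n gtn_eqF //= add0r big1 // => i _.
  by rewrite cutN // mul0r.
- apply/integral_poly => i; rewrite coefD coefXn coef_poly.
  apply: integral_add.
    by case: (_ == _); [exact: (integral1 (evf : {rmorphism _ -> _}))|exact/integral_nat].
  case: ifP => _; last exact: (integral_nat _ 0).
  exact/intg_integral.
Qed.

Lemma evp_lead (p : {poly mpoly n C}) x z :
  (evp x p).[z] = \sum_(i < (size p).-1) ev x p`_i * z ^+ i
    + ev x (lead_coef p) * z ^+ (size p).-1.
Proof.
have [->|p0] := eqVneq p 0.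
  by rewrite evp0 horner0 lead_coef0 /ev meval0 mul0r addr0 size_poly0 big_ord0.
rewrite horner_evp_sum lead_coefE.
rewrite -(big_mkord xpredT (fun i => ev x p`_i * z ^+ i)).
by rewrite {1}(polySpred p0) big_nat_recr //= big_mkord.
Qed.

Lemma evM x (P Q : mpoly n C) : ev x (P * Q) = ev x P * ev x Q.
Proof. exact: mevalM. Qed.

Lemma evXn x (P : mpoly n C) i : ev x (P ^+ i) = ev x P ^+ i.
Proof. exact: (rmorphXn (meval _)). Qed.

(** Multiplying the equation by [s ^+ d.-1], with [s] the leading coefficient, makes it monic in
    [s * g]. *)
Lemma alg_intg D g : alg D g ->
  exists2 s : mpoly n C, s != 0 & intg D (fun x => ev x s * g x).
Proof.
move=> [p p0 hp]; exists (lead_coef p); first by rewrite lead_coef_eq0.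
set s := lead_coef p; set d := (size p).-1.
have [d0|d0] := posnP d.
  apply: intg_ext (intg_cst D 0) => x Dx; have := hp x Dx.
  by rewrite evp_lead -/d d0 big_ord0 add0r expr0 mulr1 -/s => ->; rewrite mul0r.
apply: (intg_root (c := fun i x => ev x (p`_i * s ^+ (d.-1 - i))) d0).
  by move=> i; exact: intg_ev.
move=> x Dx; have := hp x Dx; rewrite evp_lead -/d -/s => /(congr1 ( *%R (ev x s ^+ d.-1))).
rewrite mulr0 mulrDr addrC => E; rewrite -[RHS]E; congr (_ + _).
  by rewrite exprMn mulrA -exprSr prednK.
rewrite mulr_sumr; apply: eq_bigr => i _.
rewrite evM evXn exprMn.
have -> : ev x s ^+ d.-1 = ev x s ^+ (d.-1 - i) * ev x s ^+ i.
  by rewrite -exprD subnK // -ltnS prednK.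
by move: (ev x _) (ev x _ ^+ _) (ev x _ ^+ _) (g x ^+ _) => *; ring.
Qed.

Lemma intg_alg D g (s : mpoly n C) : s != 0 -> intg D (fun x => ev x s * g x) -> alg D g.
Proof.
move=> s0 [p mp hp]; exists (p \Po (s%:P * 'X)).
  rewrite comp_poly_eq0 ?monic_neq0 // mul_polyC size_scale // size_polyX //.
move=> x Dx; rewrite -[RHS](hp x Dx).
rewrite {1}/evp -[X in X.[_]]/(map_poly (meval (fun i => x 0 i)) _) map_comp_poly /=.
rewrite -/(evp x p) -/(evp x _) horner_comp evpM evpX evpC.
by rewrite hornerM hornerC hornerX.
Qed.

Lemma alg_ext D f g : (forall x, D x -> f x = g x) -> alg D f -> alg D g.
Proof. by move=> fg [p p0 hp]; exists p => // x Dx; rewrite -fg // hp. Qed.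

Lemma algS D D' f : D' `<=` D -> alg D f -> alg D' f.
Proof. by move=> DD [p p0 hp]; exists p => // x /DD; exact: hp. Qed.

Lemma alg_of_intg D f : intg D f -> alg D f.
Proof. by move=> [p mp hp]; exists p => //; exact: monic_neq0. Qed.

Lemma alg_ev D P : alg D (fun x => ev x P).
Proof. exact/alg_of_intg/intg_ev. Qed.

Lemma alg_cst D (c : C) : alg D (fun=> c).
Proof. exact/alg_of_intg/intg_cst. Qed.

Lemma algD D f g : alg D f -> alg D g -> alg D (fun x => f x + g x).
Proof.
move=> /alg_intg[s s0 hs] /alg_intg[t t0 ht].
apply: (@intg_alg _ _ (s * t)); first by rewrite mulf_neq0.
apply: intg_ext (intgD (intgM (intg_ev D t) hs) (intgM (intg_ev D s) ht)) => x _.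
by rewrite /ev mevalM; ring.
Qed.

Lemma algM D f g : alg D f -> alg D g -> alg D (fun x => f x * g x).
Proof.
move=> /alg_intg[s s0 hs] /alg_intg[t t0 ht].
apply: (@intg_alg _ _ (s * t)); first by rewrite mulf_neq0.
by apply: intg_ext (intgM hs ht) => x _; rewrite /ev mevalM; ring.
Qed.

Lemma algX D f k : alg D f -> alg D (fun x => f x ^+ k).
Proof.
move=> hf; elim: k => [|k IH]; first exact: alg_cst.
by apply: alg_ext (algM hf IH) => x _; rewrite exprS.
Qed.

Lemma alg_sum D (I : Type) (r : seq I) (f : I -> 'rV[C]_n -> C) :
  (forall i, alg D (f i)) -> alg D (fun x => \sum_(i <- r) f i x).
Proof.
move=> hf; elim: r => [|a r IH].
  by apply: alg_ext (alg_cst D 0) => x _; rewrite big_nil.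
by apply: alg_ext (algD (hf a) IH) => x _; rewrite big_cons.
Qed.

Lemma alg_prod D (I : Type) (r : seq I) (f : I -> 'rV[C]_n -> C) :
  (forall i, alg D (f i)) -> alg D (fun x => \prod_(i <- r) f i x).
Proof.
move=> hf; elim: r => [|a r IH].
  by apply: alg_ext (alg_cst D 1) => x _; rewrite big_nil.
by apply: alg_ext (algM (hf a) IH) => x _; rewrite big_cons.
Qed.

Lemma alg_meval D m (P : mpoly m C) (v : 'rV[C]_n -> 'I_m -> C) :
  (forall i, alg D (fun x => v x i)) -> alg D (fun x => meval (v x) P).
Proof.
move=> hv; apply: (@alg_ext _
    (fun x => \sum_(k <- msupp P) mcoeff k P * \prod_i v x i ^+ k i)).
  by move=> x _; rewrite mevalE.
apply: alg_sum => k; apply: algM; first exact: alg_cst.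
by apply: alg_prod => i; exact: algX.
Qed.

Lemma ev_ball0 (a : 'rV[C]_n) (r : R) (P : mpoly n C) : 0 < r ->
  (forall x, pball a r x -> ev x P = 0) -> P = 0.
Proof.
move=> r0 h; apply/eqP; apply: contraT => /ev_neq0[y /eqP []].
apply: (@identity_theorem R _ (fun x => ev x P) a (nm (y - a) + 1) a).
- by move=> x _; exact: ev_differentiable.
- by apply: pball_center; rewrite ltr_wpDl ?nm_ge0.
- by exists r.
- by rewrite /pball /= ltrDl.
Qed.

Lemma strip_X (q : {poly mpoly n C}) : q != 0 ->
  exists m (q' : {poly mpoly n C}), q = q' * 'X^m /\ q'`_0 != 0.
Proof.
elim/poly_ind: q => [|q1 c0 IHq]; first by rewrite eqxx.
have [->|c00] := eqVneq c0 0.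
  rewrite addr0 mulf_eq0 negb_or => /andP[/IHq[m [q' [-> h]]] _].
  by exists m.+1, q'; rewrite exprSr mulrA.
move=> _; exists 0%N, (q1 * 'X + c0%:P); rewrite expr0 mulr1; split=> //.
by rewrite coefD coefMX coefC eqxx add0r.
Qed.

(* Clearing denominators makes the coefficients integral; then [e v] is integral
   for the leading coefficient [e], and [e] divides a nonzero polynomial. *)
Theorem alg_root (a : 'rV[C]_n) (r : R) (k : nat) (c : nat -> 'rV[C]_n -> C) v :
  (forall i x, pball a r x -> differentiable (c i) x) ->
  (forall i, alg (pball a r) (c i)) ->
  (exists i x, [/\ (i < k)%N, pball a r x & c i x != 0]) ->
  (forall x, pball a r x -> \sum_(i < k) c i x * v x ^+ i = 0) ->
  alg (pball a r) v.
Proof.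
set D := pball a r => dc ac.
elim: k => [|d IH] [i0 [x0 [i0k Dx0 ci0]]] hv; first by rewrite ltn0 in i0k.
(* A leading coefficient that vanishes identically is dropped; otherwise [e d] is not identically 0,
   which is [enz]. *)
have [cd0|] := pselect (forall x, D x -> c d x = 0).
  apply: IH.
    exists i0, x0; split=> //; move: i0k; rewrite ltnS leq_eqVlt => /orP[/eqP i0d|//].
    by move: ci0; rewrite i0d cd0 ?eqxx.
  by move=> x Dx; have := hv x Dx; rewrite big_ord_recr /= cd0 // mul0r addr0.
move=> /existsNP[x1 /not_implyP[Dx1 /eqP cd1]].
have [d0|d0] := posnP d.
  subst d; have := hv x1 Dx1; rewrite big_ord_recr /= big_ord0 add0r expr0 mulr1.
  by move/eqP; rewrite (negbTE cd1).
have /choice[s hs] : forall i, exists s : mpoly n C, s != 0 /\ intg D (fun x => ev x s * c i x).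
  by move=> i; have [s s0 hs] := alg_intg (ac i); exists s.
pose t := \prod_(i < d.+1) s i.
have t0 : t != 0 by apply/prodf_neq0 => i _; exact: (hs i).1.
pose e (i : nat) := if (i <= d)%N then (fun x => ev x t * c i x) else (fun=> 0).
have ie i : intg D (e i).
  rewrite /e; case: leqP => hi; last exact: intg_cst.
  pose j : 'I_d.+1 := Ordinal (hi : (i < d.+1)%N).
  apply: intg_ext (intgM (intg_ev D (\prod_(l < d.+1 | l != j) s l)) (hs i).2) => x _.
  rewrite /t [in RHS](bigD1 j) //= evM; move: (ev x _) (ev x _) (c i x) => A B F; ring.
have eE i x : (i <= d)%N -> e i x = ev x t * c i x by move=> hi; rewrite /e hi.
have iw : intg D (fun x => e d x * v x).
  apply: (intg_root (c := fun i x => e i x * e d x ^+ (d.-1 - i)) d0).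
    by move=> i; apply: intgM => //; exact: intgX.
  move=> x Dx; have := hv x Dx; rewrite big_ord_recr /=.
  move=> /(congr1 ( *%R (ev x t * e d x ^+ d.-1))).
  rewrite mulr0 mulrDr addrC => E; rewrite -[RHS]E; congr (_ + _).
    rewrite exprMn (_ : e d x ^+ d = e d x * e d x ^+ d.-1); last by rewrite -exprS prednK.
    rewrite {1}eE //; move: (ev x t) (c d x) (e d x ^+ _) (v x ^+ d) => *; ring.
  rewrite mulr_sumr; apply: eq_bigr => i _.
  rewrite (eE i) ?(ltnW (ltn_ord i)) // exprMn.
  have -> : e d x ^+ d.-1 = e d x ^+ (d.-1 - i) * e d x ^+ i.
    by rewrite -exprD subnK // -ltnS prednK.
  by ring.
have [q mq hq] := ie d.
have de x : D x -> differentiable (e d) x.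
  move=> Dx; rewrite (_ : e d = (fun x => ev x t * c d x)).
    apply: differentiableM; [exact: ev_differentiable|exact: dc].
  by apply/funext => y; rewrite eE.
have enz : ~ (forall x, D x -> e d x = 0).
  move=> e0; have FG y : D y -> ev y t * c d y = 0 by move=> Dy; rewrite -eE // e0.
  have dt y : D y -> differentiable (fun x => ev x t) y by move=> _; exact: ev_differentiable.
  have [tz|cz] := holo_zero_divisor dt (dc d) FG.
    have r0 : 0 < r by apply: le_lt_trans Dx1; exact: nm_ge0.
    by move/eqP: t0; apply; exact: (ev_ball0 r0 tz).
  by have /eqP := cz x1 Dx1; rewrite (negbTE cd1).
(* A power of [e d] is cancelled from the equation of [e d]; the constant coefficient of what
   remains is nonzero, and it is a multiple of [e d]. *)
have [m [q' [qE q'0]]] := strip_X (monic_neq0 mq).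
have hq' : forall x, D x -> (evp x q').[e d x] = 0.
  have de' x : D x -> differentiable (fun x => (evp x q').[e d x]) x.
    move=> Dx; rewrite (_ : (fun x => _) = \sum_(i < size q') (fun x => ev x q'`_i * e d x ^+ i)).
      apply: differentiable_sum => i; apply: differentiableM; first exact: ev_differentiable.
      by apply: differentiable_pow; exact: de.
    by apply/funext => y; rewrite fct_sumE horner_evp_sum.
  have dem x : D x -> differentiable (fun x => e d x ^+ m) x.
    by move=> Dx; apply: differentiable_pow; exact: de.
  have [|z1|z2] := @holo_zero_divisor R _ (fun x => e d x ^+ m) (fun x => (evp x q').[e d x]) a r dem de'.
  - move=> y Dy; rewrite -[RHS](hq y Dy) qE evpM hornerM evpXn evpX hornerXn mulrC //.
  - by exfalso; apply: enz => y Dy; have /eqP := z1 y Dy; rewrite expf_eq0 => /andP[_ /eqP].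
  - exact: z2.
have [q2 q2E] : exists q2, q' = q2 * 'X + (q'`_0)%:P.
  elim/poly_ind: q' {qE q'0 hq'} => [|q2 c0 _]; first by exists 0; rewrite mul0r add0r coef0.
  by exists q2; rewrite coefD coefMX coefC eqxx add0r.
apply: (intg_alg q'0).
apply: (@intg_ext _ (fun x => - ((evp x q2).[e d x] * (e d x * v x)))).
  move=> x Dx; have := hq' x Dx; rewrite {1}q2E evpD evpM evpX evpC hornerD hornerM hornerX hornerC.
  by move=> /eqP; rewrite addrC addr_eq0 => /eqP ->; ring.
apply: intgN; apply: intgM => //.
apply: (@intg_ext _ (fun x => \sum_(i < size q2) ev x q2`_i * e d x ^+ i)).
  by move=> x _; rewrite horner_evp_sum.
by apply: intg_sum => i; apply: intgM; [exact: intg_ev|exact: intgX].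
Qed.

End AlgebraicFunctions.

(** * Substitutions, and equations as polynomials in one or in several variables *)

Section Conversions.
Variable (R : realType).
Local Notation C := (Cplx R).

Lemma poly_mpoly_neq0 n (p : {poly mpoly n C}) : p != 0 -> exists x z, (evp x p).[z] != 0.
Proof.
rewrite -lead_coef_eq0 => /ev_neq0[x hx]; exists x; apply/not_existsP => all0.
move: hx; rewrite lead_coefE -coef_evp (_ : evp x p = 0) ?coef0 ?eqxx //.
apply: (@poly_disc0 R _ 1) => // z _; apply/eqP/negPn/negP; exact: all0.
Qed.

Lemma evp_msubst n m (h : 'I_n -> mpoly m C) (p : {poly mpoly n C}) x :
  evp x (map_poly (msubst h) p) = evp (\row_i ev x (h i)) p.
Proof.
apply/polyP => i; rewrite !coef_evp coef_map_id0 ?ev_msubst //.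
by rewrite /msubst comp_mpoly0.
Qed.

(** Surjectivity of [pi] ensures that the equation is still nonzero after the substitution. *)
Lemma alg_comp n m (D : set 'rV[C]_n) (D' : set 'rV[C]_m) (h : 'I_n -> mpoly m C)
    (pi : 'rV[C]_m -> 'rV[C]_n) g :
  (forall x, pi x = \row_i ev x (h i)) -> (forall y, exists x, pi x = y) ->
  (forall x, D' x -> D (pi x)) -> alg D g -> alg D' (fun x => g (pi x)).
Proof.
move=> piE pis DD [p p0 hp]; exists (map_poly (msubst h) p); last first.
  by move=> x /DD /hp E; rewrite -[RHS]E piE evp_msubst.
have [y [z hz]] := poly_mpoly_neq0 p0; have [x xE] := pis y.
apply: contraNneq hz => h0; rewrite -xE piE.
by rewrite -evp_msubst h0 evp0 horner0.
Qed.

Lemma horner_of_mpoly n (P : mpoly (n + 1) C) : exists p : {poly mpoly n C},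
  forall x z, (evp x p).[z] = ev (row_mx x z%:M) P.
Proof.
pose h (i : 'I_(n + 1)) : mpoly n.+1 C := mvar R (cast_ord (addn1 n) i).
exists (muni (msubst h P)) => x z; rewrite ev_muni.
pose y : 'rV[C]_n.+1 := \row_i oapp (fun j => x 0 j) z (unlift ord_max i).
transitivity (ev y (msubst h P)); first by apply: meval_eq => i; rewrite mxE.
rewrite ev_msubst; congr (ev _ P); apply/rowP => i; rewrite mxE ev_var mxE.
rewrite [RHS]mxE; case: splitP => j ij.
  rewrite (_ : cast_ord _ i = lift ord_max j) ?liftK //.
  by apply/val_inj; rewrite /= ij /bump leqNgt ltn_ord.
rewrite (_ : cast_ord _ i = ord_max) ?unlift_none /= ?ord1 ?mxE ?mulr1n //.
by apply/val_inj; rewrite /= ij ord1 addn0.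
Qed.

Lemma mpoly_of_horner n (p : {poly mpoly n C}) : exists P : mpoly (n + 1) C,
  forall x z, ev (row_mx x z%:M) P = (evp x p).[z].
Proof.
pose h (i : 'I_n) : mpoly (n + 1) C := mvar R (lshift 1 i).
exists (\sum_(i < size p) msubst h p`_i * mvar R (rshift n 0) ^+ i) => x z.
rewrite horner_evp_sum /ev rmorph_sum; apply: eq_bigr => i _.
rewrite -[LHS]/(ev (row_mx x z%:M) (_ * _)) evM evXn ev_msubst ev_var.
rewrite row_mxEr mxE mulr1n; congr (ev _ _ * _).
by apply/rowP => j; rewrite !mxE ev_var row_mxEl.
Qed.

Lemma poly_of_mpoly n (P : mpoly (n + 1) C) : P != 0 ->
  exists2 p : {poly mpoly n C}, p != 0 &
    forall x z, (evp x p).[z] = ev (row_mx x z%:M) P.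
Proof.
move=> P0; have [p hE] := horner_of_mpoly P; exists p => //.
have [y hy] := ev_neq0 P0; apply: contraNneq hy => h0.
have := hE (lsubmx y) (rsubmx y 0 0).
by rewrite h0 evp0 horner0 -mx11_scalar hsubmxK => <-.
Qed.

Lemma mpoly_of_poly n (p : {poly mpoly n C}) : p != 0 ->
  exists2 P : mpoly (n + 1) C, P != 0 &
    forall x z, ev (row_mx x z%:M) P = (evp x p).[z].
Proof.
move=> p0; have [P PE] := mpoly_of_horner p; exists P => //.
have [x [z hz]] := poly_mpoly_neq0 p0; apply: contraNneq hz => P0.
by rewrite -PE P0 /ev meval0.
Qed.

End Conversions.

(** * The implicit function theorem for a simple root of a polynomial *)

Section ImplicitRoot.
Variable (R : realType).
Local Notation C := (Cplx R).

Lemma common_radius k (P : 'I_k -> R -> Prop) :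
  (forall j, exists2 r : R, 0 < r & P j r) ->
  (forall j r s, 0 < s <= r -> P j r -> P j s) ->
  exists2 r : R, 0 < r & forall j, P j r.
Proof.
move=> hP mP; have /choice[F hF] : forall j, exists r : R, 0 < r /\ P j r.
  by move=> j; have [r r0 Pr] := hP j; exists r.
have F0 : 0 < \big[Order.min/1]_j F j.
  by apply: lt_bigmin => [|j _]; [exact: ltr01|exact: (hF j).1].
exists (\big[Order.min/1]_j F j) => // j.
by apply: (mP j (F j)); [rewrite F0 bigmin_le|exact: (hF j).2].
Qed.

(** The logarithmic derivative is a sum of [size s] terms [(w - z)^-1], each at most [B^-1]. Stated
    without quotients, the bound also covers a root at [w]. *)
Lemma prod_deriv_bound (s : seq C) (w : C) (B : R) : 0 <= B ->
  (forall z, z \in s -> B <= nm (w - z)) ->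
  nm (\prod_(z <- s) ('X - z%:P))^`().[w] * B
    <= (size s)%:R * nm (\prod_(z <- s) ('X - z%:P)).[w].
Proof.
move=> B0; elim: s => [|a s IH] hs.
  by rewrite big_nil -polyC1 derivC horner0 nm0 !mul0r.
rewrite !big_cons derivM derivXsubC mul1r hornerD !hornerM hornerXsubC /=.
set P := \prod_(z <- s) ('X - z%:P).
have ha : B <= nm (w - a) by apply: hs; rewrite mem_head.
have := IH (fun z zs => hs z (@mem_behead _ (a :: s) z zs)); rewrite -/P => h.
apply: (@le_trans _ _ ((nm P.[w] + nm ((w - a) * P^`().[w])) * B)).
  by rewrite ler_wpM2r // nmD.
rewrite !nmM mulrDl -natr1 mulrDl mul1r addrC lerD //.
  by rewrite -mulrA [leRHS]mulrCA ler_wpM2l ?nm_ge0.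
by rewrite mulrC ler_wpM2r ?nm_ge0.
Qed.

(** Were all roots at distance at least [B] from [w], the bound on the logarithmic derivative would
    be violated. This is the existence half of the implicit function theorem. *)
Lemma root_near (p : {poly C}) d (w : C) (B : R) : (size p <= d)%N -> 0 <= B ->
  d%:R * nm p.[w] < nm p^`().[w] * B -> exists2 z, nm (z - w) < B & p.[z] = 0.
Proof.
move=> sp B0; have [s sE] := closed_field_poly_normal p.
set P := \prod_(z <- s) _ in sE.
have [l0|l0] := eqVneq (lead_coef p) 0.
  by move/eqP: l0; rewrite lead_coef_eq0 => /eqP ->; rewrite deriv0 !horner0 nm0 mulr0 mul0r ltxx.
have -> : p.[w] = lead_coef p * P.[w] by rewrite {1}sE hornerZ.
have -> : p^`().[w] = lead_coef p * P^`().[w] by rewrite {1}sE derivZ hornerZ.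
rewrite !nmM mulrCA -mulrA ltr_pM2l ?nm_gt0 // => h.
apply/not_exists2P => nroot.
have : nm P^`().[w] * B <= (size s)%:R * nm P.[w].
  apply: prod_deriv_bound => // z zs; rewrite leNgt nmB; apply/negP => zw.
  have [//|] := nroot z; apply; rewrite sE hornerZ /P (big_rem z) //= hornerM hornerXsubC subrr mul0r mulr0 //.
apply/negP; rewrite -ltNge; apply: le_lt_trans h; rewrite ler_wpM2r ?nm_ge0 // ler_nat.
apply: leq_trans sp; rewrite sE size_scale // /P size_prod_XsubC //.
Qed.

Section Branch.
Variables (M : nat) (Phi : {poly mpoly M C}).
Implicit Types (p : 'rV[C]_M) (s t : C).

(** The divided difference of [Phi], written as a polynomial so that it is defined and continuous
    also at [s = t], where it is the derivative. *)
Definition divdiff p s t : C :=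
  \sum_(i < size Phi) ev p Phi`_i * \sum_(j < i) s ^+ (i.-1 - j) * t ^+ j.

Lemma divdiffE p s t : (evp p Phi).[s] - (evp p Phi).[t] = (s - t) * divdiff p s t.
Proof.
rewrite !horner_evp_sum -sumrB mulr_sumr; apply: eq_bigr => i _.
by rewrite -mulrBr subrXX mulrCA.
Qed.

Lemma divdiff_diag p s : divdiff p s s = (evp p Phi^`()).[s].
Proof.
rewrite evp_deriv; have -> : evp p Phi = \sum_(i < size Phi) (ev p Phi`_i) *: 'X^i.
  by rewrite -(poly_def _ (fun i => ev p Phi`_i)).
rewrite (raddf_sum (@deriv C)) horner_sum; apply: eq_bigr => i _.
rewrite /= derivZ derivXn hornerZ hornerMn hornerXn; congr (_ * _).
rewrite (eq_bigr (fun=> s ^+ i.-1)) ?sumr_const ?card_ord // => j _.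
by rewrite -exprD subnK // -ltnS (leq_trans (ltn_ord j)) // leqSpred.
Qed.

Lemma divdiff_cont p s t (e : R) : 0 < e -> exists2 d : R, 0 < d &
  forall p' s' t', nm (p' - p) < d -> nm (s' - s) < d -> nm (t' - t) < d ->
    nm (divdiff p' s' t' - divdiff p s t) < e.
Proof.
move=> e0.
pose H (y : 'rV[C]_(M + 2)) := divdiff (lsubmx y) (y 0 (rshift M 0)) (y 0 (rshift M 1)).
pose mk p s t : 'rV[C]_(M + 2) := row_mx p (\row_(i < 2) if i == 0 then s else t).
have HE p' s' t' : H (mk p' s' t') = divdiff p' s' t'.
  by rewrite /H /mk row_mxKl !row_mxEr !mxE.
have dH : differentiable H (mk p s t).
  rewrite (_ : H = \sum_(i < size Phi) (fun y => ev (lsubmx y) Phi`_i *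
     \sum_(j < i) y 0 (rshift M 0) ^+ (i.-1 - j) * y 0 (rshift M 1) ^+ j)); last first.
    by apply/funext => y; rewrite fct_sumE.
  apply: differentiable_sum => i; apply: differentiableM.
    apply: differentiable_meval => l.
    rewrite (_ : (fun y => _) = (fun y : 'rV[C]_(M + 2) => y 0 (lshift 2 l))).
      exact: differentiable_proj.
    by apply/funext => y; rewrite mxE.
  rewrite (_ : (fun y => _) = \sum_(j < i) (fun y : 'rV[C]_(M + 2) =>
     y 0 (rshift M 0) ^+ (i.-1 - j) * y 0 (rshift M 1) ^+ j)); last first.
    by apply/funext => y; rewrite fct_sumE.
  apply: differentiable_sum => j.
  by apply: differentiableM; apply: differentiable_pow; exact: differentiable_proj.
have [d d0 hd] := differentiable_cont dH e0.
exists d => // p' s' t' hp hs ht; rewrite -!HE; apply: hd.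
apply: nm_row_lt => // i; rewrite /mk !mxE; case: splitP => j _.
  by have := le_lt_trans (nm_coord (p' - p) j) hp; rewrite !mxE.
by rewrite !mxE; case: ifP.
Qed.

Lemma evp_differentiable s p : differentiable (fun p => (evp p Phi).[s]) p.
Proof.
rewrite (_ : (fun p => _) = \sum_(i < size Phi) (fun p => ev p Phi`_i * s ^+ i)).
  apply: differentiable_sum => i; apply: differentiableM; first exact: ev_differentiable.
  exact: differentiable_cst.
by apply/funext => y; rewrite fct_sumE horner_evp_sum.
Qed.

(** Existence of the root comes from [root_near], uniqueness from the divided difference being
    nonzero near the base point. Solving [divdiffE] for [psi] expresses its increment as [K] times a
    continuous factor, and [K] vanishes at the point considered, so [mul_vanishing_differentiable]
    applies. *)
Theorem implicit_root p0 s0 :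
  (evp p0 Phi).[s0] = 0 -> (evp p0 Phi^`()).[s0] != 0 ->
  exists rho eta : R, exists psi : 'rV[C]_M -> C,
  [/\ 0 < rho, 0 < eta, psi p0 = s0 & forall p, pball p0 rho p ->
   [/\ differentiable psi p, nm (psi p - s0) < eta, (evp p Phi).[psi p] = 0 &
     forall s, nm (s - s0) < eta -> (evp p Phi).[s] = 0 -> s = psi p]].
Proof.
move=> F0; rewrite -divdiff_diag => G0; set a := nm (divdiff p0 s0 s0).
have a0 : 0 < a by rewrite nm_gt0.
have a2 : 0 < a / 2 by rewrite divr_gt0.
have [eta eta0 heta] := divdiff_cont p0 s0 s0 a2.
have lowG p s t : nm (p - p0) < eta -> nm (s - s0) < eta -> nm (t - s0) < eta ->
    a / 2 < nm (divdiff p s t).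
  move=> hp hs ht; have h := nm_triangle (divdiff p s t) (divdiff p0 s0 s0) 0.
  rewrite !subr0 nmB in h; rewrite -(ltrD2l (a / 2)) -splitr.
  by apply: (le_lt_trans h); rewrite ltrD2r; exact: heta.
have uniq p s t : nm (p - p0) < eta -> nm (s - s0) < eta -> nm (t - s0) < eta ->
    (evp p Phi).[s] = 0 -> (evp p Phi).[t] = 0 -> s = t.
  move=> hp hs ht Fs Ft; have := divdiffE p s t; rewrite Fs Ft subrr => /esym/eqP.
  rewrite mulf_eq0 subr_eq0 => /orP[/eqP //|/eqP G]; have := lowG p s t hp hs ht.
  by rewrite G nm0 => /(lt_trans a2); rewrite ltxx.
pose D : R := (size Phi)%:R + 1.
have D0 : 0 < D by rewrite ltr_wpDl.
have e0 : 0 < a / 2 * eta / D by rewrite !divr_gt0 ?mulr_gt0.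
have [r1 r10 hr1] := differentiable_cont (evp_differentiable s0 p0) e0.
pose rho := Num.min r1 eta.
have rho0 : 0 < rho by rewrite lt_min r10.
have ex p : exists s, pball p0 rho p -> nm (s - s0) < eta /\ (evp p Phi).[s] = 0.
  have [|np] := pselect (pball p0 rho p); last by exists 0.
  rewrite /pball /= lt_min => /andP[h1 h2].
  have [|||s hs Fs] := @root_near (evp p Phi) (size Phi) s0 eta.
  - exact: size_poly.
  - exact: ltW.
  - rewrite -evp_deriv -divdiff_diag; apply: (@lt_trans _ _ (a / 2 * eta)); last first.
      have s0s0 : nm (s0 - s0) < eta by rewrite subrr nm0.
      rewrite ltr_pM2r; [exact: (lowG p s0 s0 h2 s0s0 s0s0)|exact: eta0].
    have := hr1 _ h1; rewrite F0 subr0 ltr_pdivlMr // mulrC; apply: le_lt_trans.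
    by rewrite ler_wpM2r ?nm_ge0 // /D lerDl.
  by exists s.
have [psi hpsi] := choice ex.
exists rho, eta, psi; split=> //.
  have [h1 h2] := hpsi p0 (pball_center p0 rho0).
  by apply: (uniq p0) => //; rewrite subrr nm0.
have inb p : pball p0 rho p -> nm (p - p0) < eta by rewrite /pball /= lt_min => /andP[].
move=> p pB; have [h1 h2] := hpsi p pB; split=> //; last first.
  by move=> s hs Fs; apply: (uniq p) => //; exact: inb.
pose K p' := (evp p' Phi).[psi p].
have psiE p' : pball p0 rho p' ->
    psi p' = psi p + K p' * - (divdiff p' (psi p') (psi p))^-1.
  move=> p'B; have [h1' h2'] := hpsi p' p'B.
  have := divdiffE p' (psi p') (psi p); rewrite h2' sub0r -/(K p') => E.
  have Gn : divdiff p' (psi p') (psi p) != 0.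
    rewrite -nm_gt0; apply: (lt_trans a2); exact: (lowG _ _ _ (inb p' p'B) h1' h1).
  by rewrite mulrN -mulNr E mulfK // addrC subrK.
have [t t0 ht] := (open_pballP _).1 (pball_open p0 rho) _ pB.
have dK : differentiable K p by exact: evp_differentiable.
have cpsi (e : R) : 0 < e -> exists2 d : R, 0 < d & forall y, nm (y - p) < d -> nm (psi y - psi p) < e.
  move=> e1; have ea : 0 < e * (a / 2) by rewrite mulr_gt0.
  have [d d0 hd] := differentiable_cont dK ea.
  exists (Num.min d t) => [|y]; first by rewrite lt_min d0.
  rewrite lt_min => /andP[y1 y2]; have yB := ht y y2; have [g1 g2] := hpsi y yB.
  rewrite psiE // addrC addKr nmM nmN nmV.
  have := hd y y1; rewrite /K h2 subr0 -/(K y) => hK.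
  have lG := lowG y _ _ (inb y yB) g1 h1.
  rewrite ltr_pdivrMr; last by apply: lt_trans lG.
  by apply: (lt_trans hK); rewrite ltr_pM2l.
apply: (@differentiable_local R _ _ psi (fun p' => psi p + K p' * - (divdiff p' (psi p') (psi p))^-1) p t t0).
  by move=> y hy; exact: (psiE y (ht y hy)).
apply: differentiableD; first exact: differentiable_cst.
apply: mul_vanishing_differentiable => // e e1.
pose g := divdiff p (psi p) (psi p).
have lg : a / 2 < nm g by apply: lowG => //; exact: inb.
have g0 : 0 < nm g by apply: lt_trans lg.
have ee : 0 < e * (a / 2 * (a / 2)) := mulr_gt0 e1 (mulr_gt0 a2 a2).
have [d d0 hd] := divdiff_cont p (psi p) (psi p) ee.
have [d' d'0 hd'] := cpsi d d0.
exists (Num.min t (Num.min d d')) => [|y]; first by rewrite !lt_min t0 d0.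
rewrite !lt_min => /and3P[y1 y2 y3]; have yB := ht y y1; have [g1 g2] := hpsi y yB.
have psd : nm (psi p - psi p) < d by rewrite subrr nm0.
have := hd y (psi y) (psi p) y2 (hd' y y3) psd.
have := lowG y _ _ (inb y yB) g1 h1; rewrite -/g.
move: (divdiff y _ _) => h lh hgh.
have h0 : 0 < nm h by apply: lt_trans lh.
have hn0 : h != 0 by rewrite -nm_gt0.
have gn0 : g != 0 by rewrite -nm_gt0.
have -> : - h^-1 - - g^-1 = (h - g) / (h * g) by field; rewrite hn0 gn0.
rewrite nmM nmV nmM ltr_pdivrMr ?mulr_gt0 //; apply: (lt_trans hgh).
rewrite ltr_pM2l //; apply: ltr_pM => //; exact: ltW.
Qed.

End Branch.
End ImplicitRoot.

(** * Independent components *)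

Section Transcendence.
Variable (R : realType).
Local Notation C := (Cplx R).

Definition indep N M (D : set 'rV[C]_N) (V : 'rV[C]_N -> 'rV[C]_M) :=
  forall P : mpoly M C, (forall x, D x -> ev (V x) P = 0) -> P = 0.

Definition adjoin N k m (f : 'rV[C]_N -> 'rV[C]_k) (s : 'I_m -> 'I_k) x : 'rV[C]_(N + m) :=
  row_mx x (\row_l f x 0 (s l)).

Lemma indep_injective N k m (D : set 'rV[C]_N) f (s : 'I_m -> 'I_k) :
  indep D (adjoin f s) -> injective s.
Proof.
move=> hi a b sab; apply/eqP; apply: contraT => ab.
have : mvar R (rshift N a) - mvar R (rshift N b) = 0.
  apply: hi => x _; rewrite /ev mevalB -!/(ev _ _) !ev_var /adjoin !row_mxEr !mxE sab.
  exact: subrr.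
move=> /(congr1 (@ev R (N + m) (delta_mx 0 (rshift N a)))).
rewrite /ev mevalB meval0 -!/(ev _ _) !ev_var !mxE eqxx eqxx /=.
rewrite (inj_eq (@rshift_inj N m)) eq_sym (negbTE ab) subr0 => /eqP.
by rewrite oner_eq0.
Qed.

Lemma indep_base N k (r : R) (f : 'rV[C]_N -> 'rV[C]_k) (s : 'I_0 -> 'I_k) : 0 < r ->
  indep (pball 0 r) (adjoin f s).
Proof.
move=> r0 P hP; apply: (ev_ball0 (a := 0) r0) => v; rewrite /pball /= subr0 => hv.
have -> : v = adjoin f s (lsubmx v).
  by rewrite /adjoin -{1}[v]hsubmxK; congr row_mx; apply/rowP => -[].
apply: hP; rewrite /pball /= subr0; apply: le_lt_trans hv.
by apply: nm_row_le => [|i]; [exact: nm_ge0|rewrite mxE; exact: nm_coord].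
Qed.

Definition relation N M (D : set 'rV[C]_N) (V : 'rV[C]_N -> 'rV[C]_M) (g : 'rV[C]_N -> C)
  (p : {poly mpoly M C}) := forall x, D x -> (evp (V x) p).[g x] = 0.

Lemma indep_extend N k m (D : set 'rV[C]_N) f (s : 'I_m -> 'I_k) j :
  indep D (adjoin f s) ->
  (forall p, relation D (adjoin f s) (fun x => f x 0 j) p -> p = 0) ->
  exists s' : 'I_(m + 1) -> 'I_k, indep D (adjoin f s').
Proof.
move=> hi nrel.
exists (fun i : 'I_(m + 1) => match fintype.split i with inl l => s l | inr _ => j end) => P hP.
pose P' := msubst (fun i => mvar R (cast_ord (addnA N m 1) i)) P.
have P'E v z : ev (row_mx v z%:M) P' = ev (row_mx (lsubmx v) (row_mx (rsubmx v) z%:M)) P.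
  rewrite /P' ev_msubst; congr (ev _ P).
  rewrite row_mxA hsubmxK; apply/rowP => i; rewrite mxE ev_var castmxE /=.
  by congr (row_mx _ _ _ _); [rewrite ord1|apply/val_inj].
have [P'0|P'0] := eqVneq P' 0.
  apply/eqP; apply: contraT => /ev_neq0[y /eqP []].
  have := P'E (row_mx (lsubmx y) (lsubmx (rsubmx y))) (rsubmx (rsubmx y) 0 0).
  by rewrite P'0 row_mxKl row_mxKr -mx11_scalar !hsubmxK /ev meval0.
have [p p0 pE] := poly_of_mpoly P'0.
move/eqP: p0; case; apply: nrel => x Dx; rewrite pE P'E -[RHS](hP x Dx).
rewrite /adjoin row_mxKl row_mxKr; congr (ev (row_mx _ _) P).
apply/rowP => i; rewrite [RHS]mxE mxE; case: splitP => l il; first by rewrite mxE.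
by rewrite ord1 mxE mulr1n.
Qed.

Lemma deriv_eq0 M (p : {poly mpoly M C}) : p^`() = 0 -> p = (p`_0)%:P.
Proof.
move=> dp; apply/polyP => -[|i]; rewrite coefC //=.
have := congr1 (fun q : {poly mpoly M C} => q`_i) dp; rewrite coef_deriv coef0 -scaler_nat => /eqP.
by rewrite scaler_eq0 pnatr_eq0 /= => /eqP.
Qed.

(** A maximal [m] exists because [s] is injective, whence [m <= k]. For an equation of minimal size
    the derivative is nonzero, as a constant equation would contradict independence; being smaller
    than the equation, it cannot be a relation. *)
Theorem transcendence_basis N k (r : R) (f : 'rV[C]_N -> 'rV[C]_k) : 0 < r ->
  exists (m : nat) (s : 'I_m -> 'I_k) (g : 'I_k -> {poly mpoly (N + m) C}),
  indep (pball 0 r) (adjoin f s) /\ forall j,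
    [/\ g j != 0, relation (pball 0 r) (adjoin f s) (fun x => f x 0 j) (g j) &
    exists2 x, pball 0 r x & (evp (adjoin f s x) (g j)^`()).[f x 0 j] != 0].
Proof.
move=> r0; set D := pball 0 r.
pose B m := `[< exists s : 'I_m -> 'I_k, indep D (adjoin f s) >].
have exB : exists m, B m.
  exists 0%N; apply/asboolP.
  have /choice[s _] : forall i : 'I_0, exists j : 'I_k, True by case.
  by exists s; exact: indep_base.
have ubB m : B m -> (m <= k)%N.
  move=> /asboolP[s hs]; have := leq_card s (indep_injective hs).
  by rewrite !card_ord.
have [m /asboolP[s hs] mmax] := ex_maxnP exB ubB; exists m, s.
have hg j : exists g : {poly mpoly (N + m) C},
    [/\ g != 0, relation D (adjoin f s) (fun x => f x 0 j) g &
    exists2 x, D x & (evp (adjoin f s x) g^`()).[f x 0 j] != 0].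
  pose S d := `[< exists p : {poly mpoly (N + m) C}, [/\ p != 0, size p = d & relation D (adjoin f s) (fun x => f x 0 j) p] >].
  have exS : exists d, S d.
    apply: contrapT => /forallNP nS; have [|s' hs'] := indep_extend (j := j) hs.
      move=> p hp; apply/eqP; apply: contraT => p0; exfalso; apply: (nS (size p)).
      by apply/asboolP; exists p.
    have : B (m + 1)%N by apply/asboolP; exists s'.
    by move=> /mmax; rewrite addn1 ltnn.
  have [d /asboolP[p [p0 sp hp]] dmin] := ex_minnP exS.
  exists p; split=> //; apply: contrapT => /forall2NP np.
  have hp' : relation D (adjoin f s) (fun x => f x 0 j) p^`().
    by move=> x Dx; have [//|/negP] := np x; rewrite negbK => /eqP.
  have [dp|dp] := eqVneq p^`() 0.
    move/deriv_eq0: dp => pE; move/eqP: p0; apply; rewrite pE (_ : p`_0 = 0) ?polyC0 //.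
    by apply: hs => x Dx; have E := hp x Dx; rewrite pE evpC hornerC in E.
  have : S (size p^`()) by apply/asboolP; exists p^`().
  by move=> /dmin; rewrite -sp leqNgt lt_size_deriv.
by have /choice[g hg'] := hg; exists g.
Qed.

End Transcendence.

(** * Restriction and composition of algebraic functions *)

Section Composition.
Variable (R : realType).
Local Notation C := (Cplx R).

Lemma pball_row_mx M (v1 v : 'rV[C]_M) (z : C) (s : R) :
  0 < s -> pball (row_mx v1 (0 : 'rV_1)) s (row_mx v z%:M) <-> pball v1 s v /\ nm z < s.
Proof.
move=> s0; rewrite /pball /= opp_row_mx add_row_mx subr0; split=> [h|[h1 h2]].
  split; first apply: nm_row_lt => // i.
    by apply: le_lt_trans h; rewrite -(row_mxEl (v - v1) (z%:M : 'rV_1)); exact: (nm_coord (row_mx (v - v1) z%:M)).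
  apply: le_lt_trans h; have {1}-> : z = row_mx (v - v1) (z%:M : 'rV_1) 0 (rshift M 0).
    by rewrite row_mxEr mxE mulr1n.
  exact: (nm_coord (row_mx (v - v1) z%:M)).
apply: nm_row_lt => // i; rewrite mxE; case: splitP => j _.
  by apply: le_lt_trans h1; exact: nm_coord.
by rewrite ord1 mxE mulr1n.
Qed.

(** Setting the last variable [z] to 0 may annihilate the equation. In that case every coefficient
    is divisible by [z], and [z] can be cancelled by [holo_zero_divisor]; the size of one nonzero
    coefficient bounds the number of cancellations. *)
Lemma alg_restrict M (v1 : 'rV[C]_M) (s : R) (G : 'rV[C]_(M + 1) -> C) : 0 < s ->
  (forall w, pball (row_mx v1 0) s w -> differentiable G w) ->
  alg (pball (row_mx v1 0) s) G -> alg (pball v1 s) (fun v => G (row_mx v 0%:M)).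
Proof.
move=> s0 dG [p p0 hp].
have /choice[q qE] i := horner_of_mpoly p`_i.
suff : forall b (q : nat -> {poly mpoly M C}) i0, (i0 < size p)%N -> q i0 != 0 ->
    (size (q i0) <= b)%N ->
    (forall v z, pball v1 s v -> nm z < s ->
       \sum_(i < size p) (evp v (q i)).[z] * G (row_mx v z%:M) ^+ i = 0) ->
    alg (pball v1 s) (fun v => G (row_mx v 0%:M)).
  move=> /(_ (size (q (size p).-1)) q (size p).-1); apply=> //.
  - by rewrite -polySpred.
  - have := p0; rewrite -lead_coef_eq0 lead_coefE => /ev_neq0[y hy].
    apply: contraNneq hy => q0; have := qE (size p).-1 (lsubmx y) (rsubmx y 0 0).
    by rewrite q0 evp0 horner0 -mx11_scalar hsubmxK => <-.
  - move=> v z hv hz; rewrite -[RHS](hp (row_mx v z%:M)); last exact/pball_row_mx.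
    by rewrite horner_evp_sum; apply: eq_bigr => i _; rewrite qE.
clear p0 hp q qE; move: (size p) => K {p}.
elim=> [|b IH] q i0 hi0 qi0 sq hq.
  by move: sq; rewrite leqn0 size_poly_eq0 (negbTE qi0).
have [[i1 hi1 q1]|nq] := pselect (exists2 i, (i < K)%N & (q i)`_0 != 0).
  exists (\poly_(i < K) (q i)`_0).
    apply: contraNneq q1 => /(congr1 (fun r : {poly mpoly M C} => r`_i1)).
    by rewrite coef_poly hi1 coef0 => ->.
  move=> v hv; rewrite -[RHS](hq v 0 hv) ?nm0 //.
  have -> : evp v (\poly_(i < K) (q i)`_0) = \poly_(i < K) ev v (q i)`_0.
    apply/polyP => i; rewrite coef_evp !coef_poly; case: ifP => // _; exact: meval0.
  by rewrite horner_poly; apply: eq_bigr => i _; rewrite horner_coef0 coef_evp.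
pose q' i := drop_poly 1 (q i).
have q'E i : (i < K)%N -> q i = q' i * 'X.
  move=> hi; rewrite -[LHS](poly_take_drop 1) expr1 (_ : take_poly 1 (q i) = 0) ?add0r //.
  apply/polyP => -[|l]; rewrite coef_take_poly coef0 //=.
  by apply/eqP; apply: contraT => q0; exfalso; apply: nq; exists i.
apply: (IH q' i0) => //.
- by apply: contraNneq qi0 => q'0; rewrite q'E // q'0 mul0r.
- by rewrite /q' size_drop_poly leq_subLR.
have /choice[P PE] i := mpoly_of_horner (q' i).
pose T w := \sum_(i < K) ev w (P i) * G w ^+ i.
have TE v z : T (row_mx v z%:M) = \sum_(i < K) (evp v (q' i)).[z] * G (row_mx v z%:M) ^+ i.
  by apply: eq_bigr => i _; rewrite PE.
have dT w : pball (row_mx v1 0) s w -> differentiable T w.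
  move=> hw; rewrite (_ : T = \sum_(i < K) (fun w => ev w (P i) * G w ^+ i)).
    apply: differentiable_sum => i; apply: differentiableM; first exact: ev_differentiable.
    by apply: differentiable_pow; exact: dG.
  by apply/funext => y; rewrite fct_sumE.
have dz w : pball (row_mx v1 0) s w -> differentiable (fun w : 'rV[C]_(M + 1) => w 0 (rshift M 0)) w.
  by move=> _; exact: differentiable_proj.
have zT w : pball (row_mx v1 0) s w -> w 0 (rshift M 0) * T w = 0.
  rewrite -[w]hsubmxK [rsubmx w]mx11_scalar; move: (lsubmx w) (rsubmx w 0 0) => v z.
  move=> /(pball_row_mx v1 v z s0)[hv hz]; rewrite TE -[RHS](hq v z hv hz) mulr_sumr.
  apply: eq_bigr => i _; rewrite row_mxEr mxE mulr1n q'E // evpM evpX hornerM hornerX.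
  by rewrite [_ * z]mulrC mulrA.
have [z0|T0] := holo_zero_divisor dz dT zT; last first.
  by move=> v z hv hz; rewrite -TE; apply: T0; exact/pball_row_mx.
have := z0 (row_mx v1 ((s / 2)%:C%C)%:M).
rewrite row_mxEr mxE mulr1n => /(_ _)/eqP; rewrite -nm_eq0 nm_real.
rewrite normr_eq0 mulf_eq0 gt_eqF //= invr_eq0 (pnatr_eq0 R 2) /= => h.
have // : false.
apply: h; apply/(pball_row_mx _ _ _ s0); split; first exact: pball_center.
by rewrite nm_real ger0_norm ?ltr_pdivrMr ?ltr_pMr ?ltW ?ltr1n ?divr_gt0.
Qed.

Lemma lsubmx_row M K (w : 'rV[C]_(M + K)) : lsubmx w = \row_i ev w (mvar R (lshift K i)).
Proof. by apply/rowP => i; rewrite !mxE ev_var. Qed.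

Lemma lsubmx_pball M K (v1 : 'rV[C]_M) (w1 : 'rV[C]_K) (s : R) (w : 'rV[C]_(M + K)) : 0 < s ->
  pball (row_mx v1 w1) s w -> pball v1 s (lsubmx w).
Proof.
rewrite /pball /= => s0 h; apply: nm_row_lt => // i; rewrite !mxE.
by have := le_lt_trans (nm_coord _ (lshift K i)) h; rewrite !mxE (unsplitK (inl i)).
Qed.

(* The coefficients of an equation of [Q] may vanish identically along [Psi].
   They do not along [Psi v + t *: c] for a generic direction [c], and an
   equation for [Q (Psi v + t *: c)] specializes to [t = 0]. *)
Lemma alg_compose M K (v1 : 'rV[C]_M) (rho e : R) (Psi : 'rV[C]_M -> 'rV[C]_K) (Q : 'rV[C]_K -> C) :
  0 < rho -> 0 < e -> (forall v, pball v1 rho v -> differentiable Psi v) ->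
  (forall j, alg (pball v1 rho) (fun v => Psi v 0 j)) ->
  (forall y, pball (Psi v1) e y -> differentiable Q y) -> alg (pball (Psi v1) e) Q ->
  exists2 s : R, 0 < s & alg (pball v1 s) (fun v => Q (Psi v)).
Proof.
move=> rho0 e0 dPsi aPsi dQ [q q0 hq].
have e2 : 0 < e / 2 by rewrite divr_gt0.
have [t t0 ht] := (continuous_pballP _ _).1
  (differentiable_continuous (dPsi v1 (pball_center v1 rho0))) _ e2.
pose s := Num.min (Num.min rho t) 1.
have s0 : 0 < s by rewrite !lt_min rho0 t0 ltr01.
have srho : s <= rho by rewrite /s !ge_min lexx.
have st : s <= t by rewrite /s !ge_min lexx orbT.
have s1 : s <= 1 by rewrite /s !ge_min lexx !orbT.
have r40 : 0 < e * s / 4 by rewrite divr_gt0 // mulr_gt0.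
have [y hy qy] : exists2 y, pball (Psi v1) (e * s / 4) y & ev y (lead_coef q) != 0.
  apply: contrapT => /forall2NP ny; move: q0; rewrite -lead_coef_eq0 => /eqP; apply.
  apply: (ev_ball0 (a := Psi v1) r40) => y hy; have [nhy|/negP] := ny y; first by case: nhy.
  by rewrite negbK => /eqP.
(* With this scaling [t = s / 2] leads from [Psi v1] to [y], where the leading coefficient of [q] is
   nonzero, while [nm c < e / 2] keeps the line in the ball where [Q] is controlled. *)
pose c := ((2 / s)%:C%C : C) *: (y - Psi v1).
have cn : nm c < e / 2.
  rewrite nmZ nm_real ger0_norm; last by rewrite ltW // divr_gt0.
  move: hy; rewrite /pball /= => hy.
  apply: (@lt_le_trans _ _ (2 / s * (e * s / 4))); first by rewrite ltr_pM2l ?divr_gt0.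
  have -> : 2 / s * (e * s / 4) = e / 2 by field; rewrite gt_eqF.
  exact: lexx.
pose B := pball (row_mx v1 (0 : 'rV[C]_1)) s.
pose L (w : 'rV[C]_(M + 1)) := Psi (lsubmx w) + w 0 (rshift M 0) *: c.
have BE w : B w -> pball v1 s (lsubmx w) /\ nm (w 0 (rshift M 0)) < s.
  move=> Bw; split; first exact: (lsubmx_pball s0 Bw).
  have := le_lt_trans (nm_coord _ (rshift M 0)) Bw.
  by rewrite !mxE (unsplitK (inr 0)) mxE subr0.
have LB w : B w -> pball (Psi v1) e (L w).
  move=> /BE[h1 h2]; rewrite /pball /= /L addrAC (splitr e).
  apply: le_lt_trans (nmD _ _) _; apply: ltrD; first exact: ht (lt_le_trans h1 st).
  rewrite nmZ; apply: le_lt_trans cn; rewrite ler_piMl ?nm_ge0 //.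
  exact: ltW (lt_le_trans h2 s1).
have dl w : differentiable (@lsubmx C 1 M 1) w.
  apply: (affine_differentiable (l := @lsubmx C 1 M 1) (a := 0)) => x.
  by rewrite addr0.
have dL w : B w -> differentiable L w.
  move=> /BE[h1 h2]; apply: differentiableD.
    apply: (differentiable_compo (g := Psi) (dl w)); apply: dPsi.
    exact: lt_le_trans h1 srho.
  by apply: differentiableZl; exact: differentiable_proj.
have aL j : alg B (fun w => L w 0 j).
  apply: (@alg_ext _ _ _ (fun w => Psi (lsubmx w) 0 j + ev w (mvar R (rshift M 0)) * c 0 j)).
    by move=> w _; rewrite /L ev_var !mxE.
  apply: algD; last by apply: algM; [exact: alg_ev|exact: alg_cst].
  apply: (alg_comp (pi := fun w => lsubmx w) (g := fun v => Psi v 0 j) _ _ _ (aPsi j)).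
  - by move=> w; exact: lsubmx_row.
  - by move=> v; exists (row_mx v 0); rewrite row_mxKl.
  - by move=> w /BE[h _]; exact: lt_le_trans h srho.
have dQL w : B w -> differentiable (fun w => Q (L w)) w.
  by move=> Bw; apply: (differentiable_compo (dL w Bw)); apply: dQ; exact: LB.
have aQL : alg B (fun w => Q (L w)).
  apply: (@alg_root R (M + 1) (row_mx v1 0) s (size q) (fun i w => ev (L w) q`_i)).
  - move=> i w Bw; apply: (differentiable_compo (g := fun x => ev x q`_i) (dL w Bw)).
    exact: ev_differentiable.
  - by move=> i; apply: alg_meval.
  - exists (size q).-1, (row_mx v1 ((s / 2)%:C%C)%:M); split.
    + by rewrite -polySpred.
    + apply/(pball_row_mx _ _ _ s0); split; first exact: pball_center.
      rewrite nm_real ger0_norm ?ltW ?divr_gt0 // ltr_pdivrMr // ltr_pMr // ltr1n //.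
    + rewrite -lead_coefE (_ : L _ = y) // /L row_mxKl row_mxEr mxE mulr1n /c scalerA.
      rewrite -real_complexM (_ : s / 2 * (2 / s) = 1).
        by rewrite scale1r addrC subrK.
      by field; rewrite gt_eqF.
  - by move=> w Bw; rewrite -[RHS](hq _ (LB w Bw)) horner_evp_sum.
exists s => //; have := alg_restrict s0 dQL aQL; apply: alg_ext => v _.
by rewrite /L row_mxKl row_mxEr mxE mulr1n scale0r addr0.
Qed.

(** A power of [F] is cancelled from the equation unless [F] vanishes identically. Wherever [F] is
    0, the equation that remains says that its constant coefficient vanishes. *)
Lemma alg_nonzero_coef M (v1 : 'rV[C]_M) (s : R) F : 0 < s ->
  (forall v, pball v1 s v -> differentiable F v) -> alg (pball v1 s) F ->
  (forall v, pball v1 s v -> F v = 0) \/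
  exists2 q : {poly mpoly M C}, q`_0 != 0 & forall v, pball v1 s v -> (evp v q).[F v] = 0.
Proof.
move=> s0 dF [p p0 hp]; have [m [q [pE q0]]] := strip_X p0.
have dF' v : pball v1 s v -> differentiable (fun v => F v ^+ m) v.
  by move=> hv; apply: differentiable_pow; exact: dF.
have dq v : pball v1 s v -> differentiable (fun v => (evp v q).[F v]) v.
  move=> hv; rewrite (_ : (fun v => _) = \sum_(i < size q) (fun v => ev v q`_i * F v ^+ i)).
    apply: differentiable_sum => i; apply: differentiableM; first exact: ev_differentiable.
    by apply: differentiable_pow; exact: dF.
  by apply/funext => y; rewrite fct_sumE horner_evp_sum.
have [|z1|z2] := @holo_zero_divisor R _ _ _ v1 s dF' dq.
- by move=> v hv; rewrite -[RHS](hp v hv) pE evpM evpXn evpX hornerM hornerXn mulrC.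
- by left=> v hv; have /eqP := z1 v hv; rewrite expf_eq0 => /andP[_ /eqP].
- by right; exists q.
Qed.

(** Otherwise [Q (Psi v)] has an equation with nonzero constant coefficient. The latter vanishes at
    [V x] for [x] near [x1], hence on the ball by the identity theorem, against the independence of
    [V]. *)
Theorem vanishing_transfer N m k (c x1 : 'rV[C]_N) (r rho : R) (V : 'rV[C]_N -> 'rV[C]_(N + m))
    (Psi : 'rV[C]_(N + m) -> 'rV[C]_k) (Uhat : set 'rV[C]_k) (Q : 'rV[C]_k -> C) (e : R) :
  pball c r x1 -> (forall x, pball c r x -> differentiable V x) -> indep (pball c r) V ->
  0 < rho -> (forall v, pball (V x1) rho v -> differentiable Psi v) ->
  (forall j, alg (pball (V x1) rho) (fun v => Psi v 0 j)) ->
  (forall v, pball (V x1) rho v -> Uhat (Psi v)) ->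
  open Uhat -> (forall y, Uhat y -> differentiable Q y) ->
  0 < e -> alg (pball (Psi (V x1)) e) Q ->
  (exists2 d : R, 0 < d & forall x, pball x1 d x -> Q (Psi (V x)) = 0) ->
  forall v, pball (V x1) rho v -> Q (Psi v) = 0.
Proof.
move=> cx1 dV iV rho0 dPsi aPsi UPsi oU dQ e0 aQ [d d0 hd].
have dF v : pball (V x1) rho v -> differentiable (fun v => Q (Psi v)) v.
  by move=> hv; apply: (differentiable_compo (dPsi v hv)); apply: dQ; exact: UPsi.
have [e' e'0 he'] := (open_pballP Uhat).1 oU _ (UPsi _ (pball_center (V x1) rho0)).
have m0 : 0 < Num.min e e' by rewrite lt_min e0.
have dQ' y : pball (Psi (V x1)) (Num.min e e') y -> differentiable Q y.
  by rewrite /pball /= lt_min => /andP[_ h]; apply: dQ; exact: he'.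
have aQ' : alg (pball (Psi (V x1)) (Num.min e e')) Q.
  by apply: algS aQ; apply: pball_le; rewrite ge_min lexx.
have [s s0 aF] := alg_compose rho0 m0 dPsi aPsi dQ' aQ'.
pose s' := Num.min s rho.
have s'0 : 0 < s' by rewrite lt_min s0.
have s'rho : s' <= rho by rewrite ge_min lexx orbT.
have aF' : alg (pball (V x1) s') (fun v => Q (Psi v)).
  by apply: algS aF; apply: pball_le; rewrite ge_min lexx.
have dF' v : pball (V x1) s' v -> differentiable (fun v => Q (Psi v)) v.
  by move=> hv; apply: dF; exact: lt_le_trans hv s'rho.
have [F0|[q q0 hq]] := alg_nonzero_coef s'0 dF' aF'.
  apply: (identity_theorem dF (pball_center _ rho0)).
  by exists s'.
exfalso; move/eqP: q0; apply; apply: iV.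
have dqV x : pball c r x -> differentiable (fun x => ev (V x) q`_0) x.
  move=> cx; apply: (differentiable_compo (g := fun x => ev x q`_0) (dV x cx)).
  exact: ev_differentiable.
apply: (identity_theorem dqV cx1).
have [t t0 ht] := (continuous_pballP _ _).1 (differentiable_continuous (dV x1 cx1)) _ s'0.
exists (Num.min t d) => [|x]; first by rewrite lt_min t0.
rewrite /pball /= lt_min => /andP[h1 h2].
by have := hq _ (ht _ h1); rewrite hd // horner_coef0 coef_evp.
Qed.

End Composition.

(** * Weierstrass preparation *)

Section Preparation.
Variable (R : realType).
Local Notation C := (Cplx R).

Lemma bh_inv (V : normedModType C) (D : set V) (F : V -> C) (c : R) : 0 < c ->
  bh D F -> (forall x, D x -> c <= nm (F x)) -> bh D (fun x => (F x)^-1).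
Proof.
move=> c0 [M hM] lF; exists c^-1 => x Dx; have Fx0 : 0 < nm (F x) by exact: lt_le_trans (lF x Dx).
split; last by rewrite nmV lef_pV2 ?posrE //; exact: lF.
apply: differentiableV; first exact: (hM x Dx).1.
by rewrite -nm_gt0.
Qed.

Definition wpoly n d (a : nat -> 'rV[C]_n -> C) (p : 'rV[C]_(1 + n)) : C :=
  \sum_(i < d) rhd p ^+ i * a i (rtl p).

Lemma bh_rhd n (rho : R) (D : set 'rV[C]_n) : bh (cyl rho D) (@rhd R n).
Proof. by exists rho => p [/ltW h _]; split; [exact: differentiable_proj|]. Qed.

Lemma bh_wpoly n d (rho : R) (D : set 'rV[C]_n) (a : nat -> 'rV[C]_n -> C) :
  (forall i, bh D (a i)) -> bh (cyl rho D) (wpoly d a).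
Proof.
move=> ha; apply: bh_sum => i; apply: bhM; first by apply: bhX; exact: bh_rhd.
have [B hB] := ha i; exists B => p [_ h]; have [h1 h2] := hB _ h; split; last exact: h2.
by apply: (differentiable_compo (g := a i) _ h1); exact: rtl_differentiable.
Qed.

Lemma cyl_pball n (rho t r : R) : 0 < r -> rho <= r -> t <= r ->
  cyl rho (pball (0 : 'rV[C]_n) t) `<=` pball 0 r.
Proof.
move=> r0 rhor tr x [h1 h2]; rewrite /pball /= subr0 -(rcons0K x) nm_rcons0_lt //.
rewrite (lt_le_trans h1 rhor) /=; move: h2; rewrite /pball /= subr0 => h2.
exact: (lt_le_trans h2).
Qed.

Lemma wpoly_small n d (a : nat -> 'rV[C]_n -> C) (rho e : R) : 0 < rho -> 0 < e ->
  (forall i, (i < d)%N -> differentiable (a i) 0) -> (forall i, (i < d)%N -> a i 0 = 0) ->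
  exists2 s : R, 0 < s <= rho & forall p, cyl rho (pball 0 s) p -> nm (wpoly d a p) <= e.
Proof.
move=> rho0 e0 da a0; pose S : R := \sum_(i < d) rho ^+ i + 1.
have S0 : 0 < S.
  by rewrite ltr_wpDl // sumr_ge0 // => i _; rewrite exprn_ge0 // ltW.
have mu0 : 0 < e / S by rewrite divr_gt0.
have [s s0 hs] : exists2 s : R, 0 < s & forall i : 'I_d, forall x, nm x < s -> nm (a i x) <= e / S.
  apply: (common_radius (P := fun i s => forall x, nm x < s -> nm (a i x) <= e / S)).
    move=> i; have [s s0 hs] := differentiable_cont (da i (ltn_ord i)) mu0; exists s => // x xs.
    by have := hs x; rewrite subr0 a0 ?ltn_ord // subr0 => /(_ xs)/ltW.
  by move=> j s t /andP[_ ts] hs x xt; apply: hs; exact: lt_le_trans ts.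
exists (Num.min s rho) => [|p [h1]]; first by rewrite lt_min s0 rho0 ge_min lexx orbT.
rewrite /pball /= subr0 lt_min => /andP[h2 _].
apply: le_trans (nm_sum _ _ _) _.
apply: (@le_trans _ _ (\sum_(i < d) rho ^+ i * (e / S))).
  apply: ler_sum => i _; rewrite nmM nmX; apply: ler_pM.
  - by rewrite exprn_ge0 // nm_ge0.
  - exact: nm_ge0.
  - by rewrite lerXn2r ?nnegrE ?nm_ge0 // ltW.
  - exact: hs.
rewrite -mulr_suml mulrA ler_pdivrMr // mulrC ler_wpM2l ?ltW // /S.
by rewrite ltrDl ltr01.
Qed.

Lemma rcons00 n : rcons0 0 0 = 0 :> 'rV[C]_(1 + n).
Proof. by rewrite /rcons0 raddf0 row_mx0. Qed.

Lemma rhd0 n : rhd (0 : 'rV[C]_(1 + n)) = 0.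
Proof. by rewrite /rhd mxE. Qed.

Lemma bh_cont (V : normedModType C) (D : set V) (F : V -> C) x : bh D F -> D x ->
  forall e : R, 0 < e -> exists2 d : R, 0 < d & forall y, nm (y - x) < d -> nm (F y - F x) < e.
Proof. by move=> hF Dx; apply: differentiable_cont; exact: bh_diff Dx. Qed.

(** On the axis [Dl] is [z ^+ d * psi z] with [psi 0 = gam] nonzero, so [Dl] is [gam] times
    [z ^+ d + b] with [b] small on a thin cylinder. Dividing [z ^+ d] by [z ^+ d + b] gives the
    Weierstrass polynomial, and the quotient is a unit. The clause on [theta] says that the
    Weierstrass polynomial can itself serve as divisor in [weierstrass_division]. *)
Theorem weierstrass_preparation n (r : R) (Dl : 'rV[C]_(1 + n) -> C) : 0 < r ->
  (forall x, pball 0 r x -> differentiable Dl x) ->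
  (exists2 z, nm z < r & Dl (rcons0 z 0) != 0) -> Dl 0 = 0 ->
  exists (d : nat) (rho s : R) (a : nat -> 'rV[C]_n -> C) (e : 'rV[C]_(1 + n) -> C),
  [/\ (0 < d)%N, 0 < s <= rho, rho <= r &
      [/\ forall i, (i < d)%N -> a i 0 = 0, forall i, bh (pball 0 s) (a i),
      bh (cyl rho (pball 0 s)) e,
      e 0 != 0 /\ forall p, cyl rho (pball 0 s) p -> Dl p = e p * (rhd p ^+ d + wpoly d a p) &
      exists2 theta, (cauchyK R / rho) ^+ d * theta <= 1 / 2 &
        forall p, cyl rho (pball 0 s) p -> nm (wpoly d a p) <= theta]].
Proof.
move=> r0 dD [z0 z0r Dz0] D0; have K0 := cauchyK_gt0 R; set K := cauchyK R in K0 *.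
have [s /andP[s0 sr] [M hM]] := local_bh r0 dD.
pose F0 z := Dl (rcons0 z 0).
have cylE (t : R) : 0 < t -> cyl t (pball (0 : 'rV[C]_n) t) = pball 0 t by move=> t0; rewrite -pball0_cyl.
have hMc : bholo (cyl s (pball 0 s)) M Dl by rewrite cylE.
have F0d : on_disc s M F0.
  by apply: bholo_slice hMc; exact: pball_center.
have dF0 z : pball 0 r z -> differentiable F0 z.
  rewrite /pball /= subr0 => hz; apply: rcons0_slice_differentiable; apply: dD.
  by rewrite /pball /= subr0 nm_rcons0_lt // hz nm0.
have [F00|[d [psi0 F0E]]] := disc_zero_or_factor s0 F0d.
  exfalso; move/eqP: Dz0; apply.
  have cr : pball (0 : C) r 0 by exact: pball_center.
  apply: (@identity_theorem R _ F0 0 r 0 dF0 cr); last by rewrite /pball /= subr0.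
  exists (s / (2 * K)); first by rewrite divr_gt0 // mulr_gt0.
  by move=> y; rewrite /pball /= subr0; exact: F00.
have d0 : (0 < d)%N.
  case: d psi0 F0E => // p0 /(_ 0); rewrite expr0 mul1r /= => E.
  by move: p0; rewrite /= /F0 rcons00 D0 eqxx.
set psi := iter d (@dquot R) F0 in psi0 F0E.
pose c i x := iter_dq1 Dl i (rcons0 0 x).
pose G := iter_dq1 Dl d.
have GE z : G (rcons0 z 0) = psi z.
  by rewrite /G /psi -dq1_slice.
have bG : bh (cyl s (pball 0 s)) G.
  by exists ((cauchyK R / s) ^+ d * M); apply: iter_dq1_bholo => //; exact: pball_open.
have bc i : bh (pball 0 s) (c i).
  apply: (bh_base (r := s) (F := iter_dq1 Dl i)) => //.
  by exists ((cauchyK R / s) ^+ i * M); apply: iter_dq1_bholo => //; exact: pball_open.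
have psid z : nm z < s -> differentiable psi z /\ nm (psi z) <= (cauchyK R / s) ^+ d * M.
  by move=> hz; exact: (iter_dquot_disc d s0 F0d hz).
have c0 i : (i < d)%N -> c i 0 = 0.
  move=> hi; rewrite /c; have := congr1 (@^~ 0) (dq1_slice Dl (0 : 'rV[C]_n) i).
  rewrite /= => ->; rewrite (@iter_dquot_cons R F0 (fun z => z ^+ (d - i) * psi z) 0 i s) ?nm0 //.
  - by rewrite expr0n subn_eq0 leqNgt hi mul0r.
  - by rewrite size_poly0.
  - by move=> z _; rewrite horner0 add0r mulrA -exprD subnKC ?F0E // ltnW.
  - move=> z hz; apply: differentiableM; last exact: (psid z hz).1.
    by apply: differentiable_pow; exact: differentiable_id.
set gam := psi 0 in psi0.
have gam0 : 0 < nm gam by rewrite nm_gt0.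
(* Chosen so that [theta = 2 * eta * rho ^+ d] satisfies the smallness condition of the division
   with equality; the two parts of [b] get half of [theta] each. *)
pose eta : R := (4 * K ^+ d)^-1.
have Kd0 : 0 < K ^+ d by exact: exprn_gt0.
have eta0 : 0 < eta by rewrite invr_gt0 mulr_gt0.
have eg0 : 0 < eta * nm gam by exact: mulr_gt0.
have c00 : cyl s (pball (0 : 'rV[C]_n) s) 0 by rewrite cylE //; exact: pball_center.
have [t t0 ht] := bh_cont bG c00 eg0.
pose rho := Num.min s t.
have rho0 : 0 < rho by rewrite lt_min s0.
have rs : rho <= s by rewrite ge_min lexx.
have rhod : 0 < eta * rho ^+ d * nm gam by rewrite !mulr_gt0 // exprn_gt0.
have dc i : (i < d)%N -> differentiable (c i) 0.
  by move=> _; apply: (bh_diff (bc i)); exact: pball_center.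
have [s1 /andP[s10 s1rho] hs1] := wpoly_small rho0 rhod dc c0.
pose b p := wpoly d c p / gam + rhd p ^+ d * (G p / gam - 1).
have DlE p : Dl p = gam * (rhd p ^+ d + b p).
  rewrite /b {1}(dq1_expand Dl d p) -/(G p) -/(wpoly d c p); move: (wpoly _ _ _) (rhd p ^+ d) (G p) => A B D.
  by field.
have sub1 : cyl rho (pball (0 : 'rV[C]_n) s1) `<=` cyl s (pball 0 s).
  move=> p [h1 h2]; split; first exact: lt_le_trans rs.
  by apply: lt_le_trans h2 _; exact: le_trans rs.
pose theta := 2 * eta * rho ^+ d.
have thE : (cauchyK R / rho) ^+ d * theta <= 1 / 2.
  rewrite /theta expr_div_n -/K.
  have -> : K ^+ d / rho ^+ d * (2 * eta * rho ^+ d) = 1 / 2.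
    rewrite /eta; have : rho ^+ d != 0 by rewrite gt_eqF // exprn_gt0.
    have : K ^+ d != 0 by rewrite gt_eqF.
    by move: (K ^+ d) (rho ^+ d); clear => x y x0 y0; field; rewrite x0 y0.
  exact: lexx.

have bb : bholo (cyl rho (pball 0 s1)) theta b.
  move=> p hp; split.
    have /bh_diff : bh (cyl s (pball 0 s)) b.
      apply: bhD; first by apply: bhM; [exact: bh_wpoly|exact: bh_cst].
      apply: bhM; first by apply: bhX; exact: bh_rhd.
      by apply: bhB; [apply: bhM|]; [exact: bG|exact: bh_cst|exact: bh_cst].
    by apply; exact: sub1.
  rewrite /b /theta -mulrA mulr_natl mulr2n; apply: le_trans (nmD _ _) _; apply: lerD.
    by rewrite nmM nmV ler_pdivrMr //; exact: hs1.
  have -> : G p / gam - 1 = (G p - gam) / gam by rewrite mulrBl mulfV.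
  rewrite nmM nmX [leRHS]mulrC; case: hp => h1 h2; apply: ler_pM.
  - by rewrite exprn_ge0 // nm_ge0.
  - exact: nm_ge0.
  - by rewrite lerXn2r ?nnegrE ?nm_ge0 // ltW.
  - rewrite nmM nmV ler_pdivrMr //; apply/ltW.
    have GG : gam = G 0 by rewrite -rcons00 GE.
    rewrite {1}GG; apply: ht; rewrite subr0 -(rcons0K p) nm_rcons0_lt //.
    rewrite (lt_le_trans h1) ?ge_min ?lexx ?orbT //=.
    by move: h2; rewrite /pball /= subr0 => h2; apply: lt_le_trans h2 _; apply: le_trans s1rho _; rewrite ge_min lexx orbT.
have o1 : open (pball (0 : 'rV[C]_n) s1) by exact: pball_open.
have bzd : bh (cyl rho (pball (0 : 'rV[C]_n) s1)) (fun p => rhd p ^+ d).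
  by apply: bhX; exact: bh_rhd.
have [q [c' [bq bc' qE]]] := weierstrass_division rho0 o1 bb thE bzd.
pose a i x := - c' i x.
have ba i : bh (pball 0 s1) (a i) by exact: bhN.
have wE p : cyl rho (pball 0 s1) p -> rhd p ^+ d + wpoly d a p = q p * (rhd p ^+ d + b p).
  move=> hp; rewrite {1}(qE p hp) addrAC /wpoly -big_split /= big1 ?add0r // => i _.
  by rewrite -mulrDr addrN mulr0.
have z1 z : nm z < rho -> cyl rho (pball (0 : 'rV[C]_n) s1) (rcons0 z 0).
  by move=> hz; split; [rewrite rhd_cons; exact: hz|rewrite rtl_cons; exact: (pball_center 0 s10)].
pose h z := q (rcons0 z 0) * (psi z / gam) - 1.
have hE z : nm z < rho -> wpoly d a (rcons0 z 0) = h z * z ^+ d.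
  move=> hz; have := wE _ (z1 z hz); have := DlE (rcons0 z 0).
  rewrite -/(F0 z) F0E !rhd_cons => E; have -> : z ^+ d + b (rcons0 z 0) = z ^+ d * psi z / gam.
    by rewrite E mulrAC mulfV // mul1r.
  by move=> /(canRL (addKr _)) ->; rewrite /h; ring.
have [M' hh] : exists M', on_disc rho M' h.
  have [Mq hq] := bq; exists (Mq * ((cauchyK R / s) ^+ d * M / nm gam) + 1) => z hz.
  have [q1 q2] := hq _ (z1 z hz); have [p1 p2] := psid z (lt_le_trans hz rs).
  split.
    apply: differentiableB; last exact: differentiable_cst.
    apply: differentiableM; first exact: rcons0_slice_differentiable.
    by apply: differentiableM => //; exact: differentiable_cst.
  apply: le_trans (nmBD _ _) _; rewrite nm1 lerD2r nmM ler_pM ?nm_ge0 // nmM nmV.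
  by rewrite ler_wpM2r // invr_ge0 ltW.
have polyE z : (\poly_(i < d) a i 0).[z] = wpoly d a (rcons0 z 0).
  by rewrite horner_poly /wpoly rhd_cons rtl_cons; apply: eq_bigr => i _; rewrite mulrC.
(* On the axis the lower part of the Weierstrass polynomial has degree less than [d] and is a
   multiple of [z ^+ d]: uniqueness of the division with [b = 0]. *)
have p0 : \poly_(i < d) a i 0 = 0.
  apply: (@weierstrass_uniqueness R rho 0 M' d h (fun=> 0)) => //.
  - by move=> z _; split; [exact: differentiable_cst|rewrite nm0].
  - by rewrite mulr0.
  - by move=> z hz; rewrite polyE hE // addr0.
have a0 i : (i < d)%N -> a i 0 = 0.
  by move=> hi; have := congr1 (fun p : {poly C} => p`_i) p0; rewrite coef_poly hi coef0.
have q0 : q 0 = 1.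
  have hz0 (z : C) : pball (0 : C) rho z -> z ^+ d * h z = 0.
    by rewrite /pball /= subr0 => hz; rewrite mulrC -hE // -polyE p0 horner0.
  have dz (z : C) : pball (0 : C) rho z -> differentiable (fun z : C => z ^+ d) z.
    by move=> _; apply: differentiable_pow; exact: differentiable_id.
  have dh (z : C) : pball (0 : C) rho z -> differentiable h z.
    by rewrite /pball /= subr0 => hz; exact: (hh z hz).1.
  have [zz|hz] := holo_zero_divisor dz dh hz0.
    have := zz ((rho / 2)%:C%C); rewrite /pball /= subr0 nm_real ger0_norm ?ltW ?divr_gt0 //.
    rewrite half_lt // => /(_ isT)/eqP; rewrite expf_eq0 d0 /= => /eqP zr.
    have : nm ((rho / 2)%:C%C : C) = 0 by rewrite zr nm0.
    by rewrite nm_real => /eqP; rewrite normr_eq0 gt_eqF // divr_gt0.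
  have := hz 0 (pball_center 0 rho0); rewrite /h -/gam mulfV // mulr1 rcons00.
  by move/eqP; rewrite subr_eq0 => /eqP.
have half : 0 < 1 / 2 :> R by rewrite divr_gt0.
have z10 : cyl rho (pball (0 : 'rV[C]_n) s1) 0.
  by rewrite -rcons00; apply: z1; rewrite nm0.
(* A second reduction of the cylinder keeps [q] away from 0 and makes the lower part of the
   Weierstrass polynomial small relative to the new radius. *)
have [t2 t20 ht2] := bh_cont bq z10 half.
pose rho2 := Num.min t2 s1.
have rho20 : 0 < rho2 by rewrite lt_min t20.
have r2s1 : rho2 <= s1 by rewrite ge_min lexx orbT.
have tau0 : 0 < (1 / 2) / (K / rho2) ^+ d by rewrite divr_gt0 // exprn_gt0 // divr_gt0.
have da i : (i < d)%N -> differentiable (a i) 0.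
  by move=> _; apply: (bh_diff (ba i)); exact: pball_center.
have [s3 /andP[s30 s3r] hs3] := wpoly_small rho20 tau0 da a0.
have sub2 : cyl rho2 (pball (0 : 'rV[C]_n) s3) `<=` cyl rho (pball 0 s1).
  move=> p [h1 h2]; split; first by apply: lt_le_trans h1 _; exact: le_trans s1rho.
  by apply: lt_le_trans h2 _; exact: le_trans r2s1.
have qlow p : cyl rho2 (pball 0 s3) p -> 1 / 2 <= nm (q p).
  move=> [h1 h2]; have pt : nm (p - 0) < t2.
    rewrite subr0 -(rcons0K p) nm_rcons0_lt //.
    rewrite (lt_le_trans h1) ?ge_min ?lexx //=; move: h2; rewrite /pball /= subr0 => h2.
    by apply: lt_le_trans h2 _; apply: le_trans s3r _; rewrite ge_min lexx.
  have hq1 := ht2 p pt; rewrite q0 in hq1.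
  have tri := nm_triangle (q p) 1 0; rewrite !subr0 nm1 nmB in tri.
  rewrite -(lerD2l (1 / 2)) -splitr; apply: (le_trans tri).
  by rewrite lerD2r ltW.
exists d, rho2, s3, a, (fun p => gam * (q p)^-1); split=> //; first by rewrite s30.
  by apply: le_trans r2s1 _; apply: le_trans s1rho _; apply: le_trans rs _.
split=> //.
- by move=> i; apply: bhS (ba i); apply: pball_le; exact: le_trans r2s1.
- apply: bhM; first exact: bh_cst.
  by apply: (bh_inv half _ qlow); apply: bhS bq.
- split; first by rewrite q0 invr1 mulr1.
  move=> p hp; rewrite wE; last exact: sub2.
  rewrite {1}DlE mulrA mulfVK // -nm_gt0; exact: lt_le_trans (qlow p hp).
- exists ((1 / 2) / (K / rho2) ^+ d) => //.
  rewrite mulrCA mulfV ?mulr1; first exact: lexx.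
  by rewrite gt_eqF // exprn_gt0 // divr_gt0.
Qed.
End Preparation.

(** * Polynomial functions: congruences and division *)

Section PolynomialFunctions.
Variable (R : realType).
Local Notation C := (Cplx R).

Lemma mpoly_gen_ind M (K : mpoly M C -> Prop) :
  (forall c, K (mpolyC M c)) -> (forall i, K (mvar R i)) ->
  (forall P Q, K P -> K Q -> K (P + Q)) -> (forall P Q, K P -> K Q -> K (P * Q)) ->
  forall P, K P.
Proof.
move=> Kc Kv KD KM P; rewrite [P]mpolyE; apply: big_ind => //.
  by rewrite -(mpolyC0 M C).
move=> m _; rewrite -mul_mpolyC; apply: (KM _ _) => //; rewrite mpolyXE_id.
apply: (big_ind K); first by rewrite -(mpolyC1 M C).
  by move=> p q; exact: KM.
by move=> i _; elim: (m i) => [|e IH]; [rewrite expr0 -(mpolyC1 M C)|rewrite exprS; exact: (KM _ _ (Kv i) IH)].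
Qed.

Definition pf N (F : 'rV[C]_N -> C) := exists P : mpoly N C, forall x, F x = ev x P.

Lemma pf_differentiable N (F : 'rV[C]_N -> C) x : pf F -> differentiable F x.
Proof.
move=> [P hP]; rewrite (_ : F = fun p => ev p P); first exact: ev_differentiable.
exact/funext.
Qed.

Section Closure.
Variable N : nat.
Implicit Types F G : 'rV[C]_N -> C.

Lemma pf_ext F G : (forall x, F x = G x) -> pf G -> pf F.
Proof. by move=> FG [P hP]; exists P => x; rewrite FG. Qed.

Lemma pf_cst (c : C) : pf (fun _ : 'rV[C]_N => c).
Proof. by exists (mpolyC N c) => x; rewrite /ev mevalC. Qed.

Lemma pf_coord i : pf (fun x : 'rV[C]_N => x 0 i).
Proof. by exists (mvar R i) => x; rewrite ev_var. Qed.

Lemma pfD F G : pf F -> pf G -> pf (fun x => F x + G x).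
Proof. by move=> [P hP] [Q hQ]; exists (P + Q) => x; rewrite hP hQ /ev mevalD. Qed.

Lemma pfM F G : pf F -> pf G -> pf (fun x => F x * G x).
Proof. by move=> [P hP] [Q hQ]; exists (P * Q) => x; rewrite hP hQ /ev mevalM. Qed.

Lemma pfN F : pf F -> pf (fun x => - F x).
Proof. by move=> [P hP]; exists (- P) => x; rewrite hP /ev mevalN. Qed.

Lemma pfX F e : pf F -> pf (fun x => F x ^+ e).
Proof. by move=> [P hP]; exists (P ^+ e) => x; rewrite hP evXn. Qed.

Lemma pf_sum (I : Type) (r : seq I) (S : pred I) (F : I -> 'rV[C]_N -> C) :
  (forall i, pf (F i)) -> pf (fun x => \sum_(i <- r | S i) F i x).
Proof.
move=> hF; elim: r => [|a r IH].
  by apply: pf_ext (pf_cst 0) => x; rewrite big_nil.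
have [Sa|nSa] := boolP (S a).
  by apply: pf_ext (pfD (hF a) IH) => x; rewrite big_cons Sa.
by apply: pf_ext IH => x; rewrite big_cons (negbTE nSa).
Qed.

Lemma pf_prod (I : Type) (r : seq I) (S : pred I) (F : I -> 'rV[C]_N -> C) :
  (forall i, pf (F i)) -> pf (fun x => \prod_(i <- r | S i) F i x).
Proof.
move=> hF; elim: r => [|a r IH].
  by apply: pf_ext (pf_cst 1) => x; rewrite big_nil.
have [Sa|nSa] := boolP (S a).
  by apply: pf_ext (pfM (hF a) IH) => x; rewrite big_cons Sa.
by apply: pf_ext IH => x; rewrite big_cons (negbTE nSa).
Qed.

Lemma pf_comp M (v : 'rV[C]_N -> 'rV[C]_M) (F : 'rV[C]_M -> C) :
  (forall i, pf (fun x => v x 0 i)) -> pf F -> pf (fun x => F (v x)).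
Proof.
move=> hv [P hP]; apply: (@pf_ext _ (fun x => ev (v x) P)) => //.
elim/mpoly_gen_ind: P {F hP} => [c|i|P Q hP hQ|P Q hP hQ].
- by apply: pf_ext (pf_cst c) => x; rewrite /ev mevalC.
- by apply: pf_ext (hv i) => x; rewrite ev_var.
- by apply: pf_ext (pfD hP hQ) => x; rewrite /ev mevalD.
- by apply: pf_ext (pfM hP hQ) => x; rewrite /ev mevalM.
Qed.

Lemma pf_horner M (v : 'rV[C]_N -> 'rV[C]_M) t (p : {poly mpoly M C}) :
  (forall i, pf (fun x => v x 0 i)) -> pf t -> pf (fun x => (evp (v x) p).[t x]).
Proof.
move=> hv ht; apply: (pf_ext (fun x => horner_evp_sum _ _ _)).
apply: pf_sum => i; apply: pfM; last exact: pfX.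
by apply: (pf_comp (F := fun x => ev x p`_i) hv) => //; exists p`_i.
Qed.

Lemma pf_congr M (v e : 'rV[C]_N -> 'rV[C]_M) (w : 'rV[C]_N -> C) (P : mpoly M C) :
  (forall i, pf (fun x => v x 0 i)) -> (forall i, pf (fun x => e x 0 i)) -> pf w ->
  exists2 B, pf B & forall x, ev (v x + w x *: e x) P = ev (v x) P + w x * B x.
Proof.
move=> hv he hw; have pfP Q : pf (fun x => ev (v x) Q).
  by apply: (pf_comp (F := fun x => ev x Q) hv) => //; exists Q.
elim/mpoly_gen_ind: P => [c|i|P Q [B hB PE] [D hD QE]|P Q [B hB PE] [D hD QE]].
- by exists (fun=> 0); [exact: pf_cst|move=> x; rewrite /ev !mevalC mulr0 addr0].
- by exists (fun x => e x 0 i) => // x; rewrite !ev_var !mxE.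
- exists (fun x => B x + D x); first exact: pfD.
  by move=> x; rewrite /ev !mevalD -!/(ev _ _) PE QE; ring.
- exists (fun x => B x * ev (v x) Q + ev (v x) P * D x + w x * (B x * D x)).
    by apply: pfD; [apply: pfD; apply: pfM|apply: pfM => //; apply: pfM].
  by move=> x; rewrite !evM PE QE; ring.
Qed.

End Closure.

Lemma taylor2 (A : comNzRingType) (p : {poly A}) K (a h : A) : (size p <= K)%N ->
  p.[a + h] = p.[a] + p^`().[a] * h + h ^+ 2 * \sum_(i < K) p^`N(i.+2).[a] * h ^+ i.
Proof.
move=> sp; have -> : p.[a + h] = \sum_(i < K.+2) p^`N(i).[a] * h ^+ i.
  rewrite (nderiv_taylor p (mulrC a h)).
  rewrite (big_ord_widen K.+2 (fun i => p^`N(i).[a] * h ^+ i)); last by rewrite (leq_trans sp) // ltnW.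
  rewrite [LHS]big_mkcond; apply: eq_bigr => i _; case: ltnP => // hi.
  by rewrite nderivn_poly0 // horner0 mul0r.
rewrite 2!big_ord_recl /= nderivn0 expr0 mulr1 poly.nderivn1 expr1 addrA; congr (_ + _).
by rewrite mulr_sumr; apply: eq_bigr => i _; rewrite /bump /= [RHS]mulrCA -exprD.
Qed.

Lemma pf_rtl n (f : 'rV[C]_n -> C) : pf f -> pf (fun p : 'rV[C]_(1 + n) => f (rtl p)).
Proof.
move=> hf; apply: (pf_comp (v := @rtl R n) (F := f)) => // i.
by apply: (pf_ext (G := fun x => x 0 (rshift 1 i))) (pf_coord _) => x; rewrite /rtl mxE.
Qed.

Lemma pf_wpoly n d (a : nat -> 'rV[C]_n -> C) : (forall i, pf (a i)) -> pf (wpoly d a).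
Proof.
move=> ha; apply: pf_sum => i; apply: pfM; last exact: pf_rtl.
by apply: pfX; exact: pf_coord.
Qed.

(** The functions that admit such a division are stable under multiplication by functions of
    [rtl p], and also by the first coordinate: the overflowing top coefficient is moved to the
    quotient and reduced by the divisor. *)
Lemma pf_division n d (A : nat -> 'rV[C]_n -> C) (F : 'rV[C]_(1 + n) -> C) :
  (forall i, pf (A i)) -> pf F ->
  exists S r, [/\ pf S, forall i, pf (r i) &
    forall p, F p = S p * (rhd p ^+ d.+1 + wpoly d.+1 A p) + wpoly d.+1 r p].
Proof.
move=> hA [P hP].
pose D (F : 'rV[C]_(1 + n) -> C) := exists S r, [/\ pf S, forall i, pf (r i) &
    forall p, F p = S p * (rhd p ^+ d.+1 + wpoly d.+1 A p) + wpoly d.+1 r p].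
have Dext F1 F2 : (forall p, F1 p = F2 p) -> D F2 -> D F1.
  by move=> E [S [r [hS hr h]]]; exists S, r; split=> // p; rewrite E.
have DD F1 F2 : D F1 -> D F2 -> D (fun p => F1 p + F2 p).
  move=> [S1 [r1 [hS1 hr1 h1]]] [S2 [r2 [hS2 hr2 h2]]].
  exists (fun p => S1 p + S2 p), (fun i t => r1 i t + r2 i t); split.
  - exact: pfD.
  - by move=> i; exact: pfD.
  move=> p; rewrite h1 h2; have -> : wpoly d.+1 (fun i t => r1 i t + r2 i t) p = wpoly d.+1 r1 p + wpoly d.+1 r2 p.
    by rewrite /wpoly -big_split /=; apply: eq_bigr => i _; rewrite mulrDr.
  ring.
have Dc (c : 'rV[C]_n -> C) F1 : pf c -> D F1 -> D (fun p => c (rtl p) * F1 p).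
  move=> hc [S1 [r1 [hS1 hr1 h1]]].
  exists (fun p => c (rtl p) * S1 p), (fun i t => c t * r1 i t); split.
  - by apply: pfM => //; exact: pf_rtl.
  - by move=> i; exact: pfM.
  move=> p; rewrite h1; have -> : wpoly d.+1 (fun i t => c t * r1 i t) p = c (rtl p) * wpoly d.+1 r1 p.
    by rewrite /wpoly mulr_sumr; apply: eq_bigr => i _; rewrite mulrCA.
  ring.
have Dz F1 : D F1 -> D (fun p => rhd p * F1 p).
  move=> [S [r [hS hr h]]].
  exists (fun p => rhd p * S p + r d (rtl p)).
  exists (fun i t => (if i is i'.+1 then r i' t else 0) - r d t * A i t); split.
  - by apply: pfD; [apply: pfM => //; exact: pf_coord|exact: pf_rtl].
  - move=> i; apply: pfD; last by apply: pfN; exact: pfM.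
    by case: i => [|i]; [exact: pf_cst|exact: hr].
  move=> p; rewrite h; have -> : wpoly d.+1 (fun i t => (if i is i'.+1 then r i' t else 0) - r d t * A i t) p
      = rhd p * wpoly d.+1 r p - r d (rtl p) * (rhd p ^+ d.+1 + wpoly d.+1 A p).
    rewrite /wpoly mulrDr opprD addrA.
    have -> : rhd p * (\sum_(i < d.+1) rhd p ^+ i * r i (rtl p)) - r d (rtl p) * rhd p ^+ d.+1 =
        \sum_(i < d.+1) rhd p ^+ i * (if i : nat is i'.+1 then r i' (rtl p) else 0).
      rewrite big_ord_recr [RHS]big_ord_recl /= mulr0 add0r exprS.
      rewrite (_ : forall s z e f : C, z * (s + e * f) - f * (z * e) = z * s); last by move=> *; ring.
      by rewrite mulr_sumr; apply: eq_bigr => i _; rewrite /bump /= exprS mulrA.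
    by rewrite mulr_sumr -sumrB; apply: eq_bigr => i _; rewrite mulrBr [_ * (r d _ * _)]mulrCA.
  ring.
apply: (Dext _ _ hP).
(* A strengthening that passes through products of generators; the claim is the case [F1 = 1], and 1
   is its own remainder because the degree [d.+1] is positive. *)
suff DM : forall F1, D F1 -> D (fun p => ev p P * F1 p).
  apply: (Dext _ (fun p => ev p P * 1)) => [p|]; first by rewrite mulr1.
  apply: DM; exists (fun=> 0), (fun i _ => if i is 0%N then 1 else 0); split.
  - exact: pf_cst.
  - by case=> [|i]; exact: pf_cst.
  move=> p; rewrite mul0r add0r /wpoly big_ord_recl /= expr0 mulr1 big1 ?addr0 // => i _.
  by rewrite mulr0.
elim/mpoly_gen_ind: P {hP} => [c|i|P Q hP hQ|P Q hP hQ] F1 DF1.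
- apply: Dext (Dc (fun=> c) _ (pf_cst _ c) DF1) => p.
  by rewrite /ev mevalC.
- have [j ->|j ->] := split_ordP i.
    by apply: Dext (Dz _ DF1) => p; rewrite ev_var /rhd ord1.
  apply: Dext (Dc (fun t => t 0 j) _ (pf_coord j) DF1) => p.
  by rewrite ev_var /rtl mxE.
- by apply: Dext (DD _ _ (hP _ DF1) (hQ _ DF1)) => p; rewrite /ev mevalD mulrDl.
- by apply: Dext (hP _ (hQ _ DF1)) => p; rewrite evM mulrA.
Qed.

End PolynomialFunctions.

(** * The polynomial system for the coefficients *)

Section FormalSystem.
Variables (R : realType) (n k m d : nat).
Local Notation C := (Cplx R).
Variables (s : 'I_m -> 'I_k) (g : 'I_k -> {poly mpoly (1 + n + m) C}).

(* The indices of the coefficients of [w] (for [None]) and of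
   [y_j = y_j0 + w y_j1], with [y_j0] at [Some (j, true)] and [y_j1] at
   [Some (j, false)], all of degree at most [d] apart from the leading term of [w]. *)
Definition pidx : finType := (option ('I_k * bool) * 'I_d.+1)%type.
Definition pdim := #|pidx|.

(** [inord] makes the index total; [wpoly d.+1] reads only the values [i < d.+1]. *)
Definition par (c : option ('I_k * bool)) (i : nat) (t : 'rV[C]_(n + pdim)) : C :=
  rsubmx t 0 (enum_rank ((c, inord i) : pidx)).

Implicit Types (p : 'rV[C]_(1 + (n + pdim))) (h : 'rV[C]_k).

(** The data of the overview with the coefficients of [w] and of the [y_j] turned into independent
    variables: [p] stands for [z], [x'] and these coefficients. [fa p] is [(x, u)] computed from
    [y], [fb p h] the same computed from [y + w ^ 2 h], and [fc] is the multiplier of [g_j]. *)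
Definition fW p : C := rhd p ^+ d.+1 + wpoly d.+1 (par None) p.
Definition fY j p : C :=
  wpoly d.+1 (par (Some (j, true))) p + fW p * wpoly d.+1 (par (Some (j, false))) p.
Definition fx p : 'rV[C]_(1 + n) := rcons0 (rhd p) (lsubmx (rtl p)).
Definition fa p : 'rV[C]_(1 + n + m) := row_mx (fx p) (\row_l fY (s l) p).
Definition fe h : 'rV[C]_(1 + n + m) := row_mx 0 (\row_l h 0 (s l)).
Definition fb p h := fa p + fW p ^+ 2 *: fe h.
Definition fdelta j p : C := (evp (fa p) (g j)^`()).[fY j p].
Definition fc j p : C := rhd p * \prod_(i | i != j) fdelta i p.

Lemma pf_row_mx N M K (u : 'rV[C]_N -> 'rV[C]_M) (v : 'rV[C]_N -> 'rV[C]_K) :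
  (forall i, pf (fun x => u x 0 i)) -> (forall i, pf (fun x => v x 0 i)) ->
  forall i, pf (fun x => row_mx (u x) (v x) 0 i).
Proof.
move=> hu hv i; have [j ->|j ->] := split_ordP i.
  by apply: pf_ext (hu j) => x; rewrite row_mxEl.
by apply: pf_ext (hv j) => x; rewrite row_mxEr.
Qed.

Lemma pf_lsubmx N M K (u : 'rV[C]_N -> 'rV[C]_(M + K)) :
  (forall i, pf (fun x => u x 0 i)) -> forall i, pf (fun x => lsubmx (u x) 0 i).
Proof. by move=> hu i; apply: pf_ext (hu (lshift K i)) => x; rewrite mxE. Qed.

Lemma pf_rsubmx N M K (u : 'rV[C]_N -> 'rV[C]_(M + K)) :
  (forall i, pf (fun x => u x 0 i)) -> forall i, pf (fun x => rsubmx (u x) 0 i).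
Proof. by move=> hu i; apply: pf_ext (hu (rshift M i)) => x; rewrite mxE. Qed.

Lemma pf_par c i : pf (par c i).
Proof. by apply: (pf_rsubmx (u := id)) => l; exact: pf_coord. Qed.

Lemma pf_fW : pf fW.
Proof. by apply: pfD; [apply: pfX; exact: pf_coord|apply: pf_wpoly; exact: pf_par]. Qed.

Lemma pf_fY j : pf (fY j).
Proof.
apply: pfD; first by apply: pf_wpoly; exact: pf_par.
by apply: pfM; [exact: pf_fW|apply: pf_wpoly; exact: pf_par].
Qed.

Lemma pf_fx i : pf (fun p => fx p 0 i).
Proof.
apply: pf_row_mx => j.
  apply: (@pf_ext _ _ _ (fun x : 'rV[C]_(1 + (n + pdim)) => x 0 (lshift (n + pdim) 0))).
    by move=> x; rewrite ord1 mxE mulr1n.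
  exact: pf_coord.
apply: pf_lsubmx => l.
apply: (@pf_ext _ _ _ (fun x : 'rV[C]_(1 + (n + pdim)) => x 0 (rshift 1 l))).
  by move=> x; rewrite mxE.
exact: pf_coord.
Qed.

Lemma pf_fa i : pf (fun p => fa p 0 i).
Proof.
apply: pf_row_mx => j; first exact: pf_fx.
by apply: pf_ext (pf_fY (s j)) => x; rewrite mxE.
Qed.

Lemma pf_fdelta j : pf (fdelta j).
Proof. by apply: pf_horner; [exact: pf_fa|exact: pf_fY]. Qed.

Lemma pf_fc j : pf (fc j).
Proof.
apply: pfM; first exact: pf_coord.
by apply: pf_prod => i; exact: pf_fdelta.
Qed.

Lemma fc_fdelta j p : fc j p * fdelta j p = rhd p * \prod_i fdelta i p.
Proof. by rewrite [in RHS](bigD1 j) //= /fc -mulrA; congr (_ * _); rewrite mulrC. Qed.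

Lemma wpoly0 M e (a : nat -> 'rV[C]_M -> C) x : (forall i, (i < e)%N -> a i (rtl x) = 0) -> wpoly e a x = 0.
Proof. by move=> h; rewrite /wpoly big1 // => i _; rewrite h // mulr0. Qed.

(** Passing from [fa] to [fb] changes the coefficients of [g j] by multiples of [fW ^+ 2], and the
    Taylor terms of order at least 2 in [fW p * z] carry the same factor: both go into [Psi]. *)
Lemma taylor_system j : exists2 Psi : 'rV[C]_(1 + (n + pdim) + k + 1) -> C, pf Psi &
  forall p h z, (evp (fb p h) (g j)).[fY j p + fW p * z] =
    (evp (fa p) (g j)).[fY j p] + fdelta j p * (fW p * z)
    + fW p ^+ 2 * Psi (row_mx (row_mx p h) z%:M).
Proof.
pose qp (q : 'rV[C]_(1 + (n + pdim) + k + 1)) := lsubmx (lsubmx q).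
pose qh (q : 'rV[C]_(1 + (n + pdim) + k + 1)) := rsubmx (lsubmx q).
pose qz (q : 'rV[C]_(1 + (n + pdim) + k + 1)) := q 0 (rshift _ 0).
have pq i : pf (fun q => qp q 0 i).
  by apply: pf_lsubmx => l; apply: pf_lsubmx => l'; exact: pf_coord.
have ph i : pf (fun q => qh q 0 i).
  by apply: pf_rsubmx => l; apply: pf_lsubmx => l'; exact: pf_coord.
have pz : pf qz by exact: pf_coord.
have pfp F : pf F -> pf (fun q => F (qp q)) by exact: pf_comp.
have pe i : pf (fun q => fe (qh q) 0 i).
  apply: pf_row_mx => l; first by apply: pf_ext (pf_cst _ 0) => x; rewrite mxE.
  by apply: pf_ext (ph (s l)) => x; rewrite mxE.
have /choice[B hB] i : exists B, pf B /\ forall q,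
    ev (fb (qp q) (qh q)) (g j)`_i = ev (fa (qp q)) (g j)`_i + fW (qp q) ^+ 2 * B q.
  have [|||B pB hB] := @pf_congr R _ _ (fun q => fa (qp q)) (fun q => fe (qh q)) (fun q => fW (qp q) ^+ 2) (g j)`_i.
  - by move=> l; apply: (pfp (fun p => fa p 0 l)); exact: pf_fa.
  - exact: pe.
  - by apply: pfX; apply: pfp; exact: pf_fW.
  by exists B.
pose K := size (g j).
pose t q := fY j (qp q) + fW (qp q) * qz q.
exists (fun q => \sum_(i < K) B i q * t q ^+ i
   + qz q ^+ 2 * \sum_(i < K) (evp (fa (qp q)) (g j)^`N(i.+2)).[fY j (qp q)] * (fW (qp q) * qz q) ^+ i).
  have pt : pf t.
    by apply: pfD; [apply: (pfp (fY j)); exact: pf_fY|apply: pfM => //; apply: pfp; exact: pf_fW].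
  apply: pfD; first by apply: pf_sum => i; apply: pfM; [exact: (hB i).1|exact: pfX].
  apply: pfM; first exact: pfX.
  apply: pf_sum => i; apply: pfM.
    apply: pf_horner; last by apply: (pfp (fY j)); exact: pf_fY.
    by move=> l; apply: (pfp (fun p => fa p 0 l)); exact: pf_fa.
  by apply: pfX; apply: pfM => //; apply: pfp; exact: pf_fW.
move=> p h z; set q := row_mx _ _.
have qpE : qp q = p by rewrite /qp /q !row_mxKl.
have qhE : qh q = h by rewrite /qh /q row_mxKl row_mxKr.
have qzE : qz q = z by rewrite /qz /q row_mxEr mxE mulr1n.
rewrite /t qpE qzE.
have -> : (evp (fb p h) (g j)).[fY j p + fW p * z] = (evp (fa p) (g j)).[fY j p + fW p * z]
    + fW p ^+ 2 * \sum_(i < K) B i q * (fY j p + fW p * z) ^+ i.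
  rewrite !horner_evp_sum mulr_sumr -big_split /=; apply: eq_bigr => i _.
  by have := (hB i).2 q; rewrite qpE qhE => ->; rewrite mulrDl mulrA.
have sK : (size (evp (fa p) (g j)) <= K)%N by exact: size_poly.
rewrite (taylor2 (fY j p) (fW p * z) sK) -evp_deriv -/(fdelta j p).
rewrite (eq_bigr (fun i : 'I_K => (evp (fa p) (g j)^`N(i.+2)).[fY j p] * (fW p * z) ^+ i)); last first.
  by move=> i _; rewrite /evp -(nderivn_map (meval (fun i => fa p 0 i))).
set A1 := \sum_(i < K) B i q * _; set A2 := \sum_(i < K) _ * _.
move: A1 A2 (evp (fa p) (g j)).[_] (fdelta j p) (fW p); clear => *; ring.
Qed.

(** Relates the discriminant computed from the components [y_j + w ^ 2 h_j] of [f] to the one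
    computed from [y], which depends on the coefficients only. *)
Lemma taylor_delta : exists2 B : 'rV[C]_(1 + (n + pdim) + k) -> C, pf B & forall p h,
  rhd p * \prod_j (evp (fb p h) (g j)^`()).[fY j p + fW p ^+ 2 * h 0 j] =
    rhd p * \prod_j fdelta j p + fW p ^+ 2 * B (row_mx p h).
Proof.
pose D (v : 'rV[C]_(1 + n + k)) := rhd (lsubmx v) *
  \prod_j (evp (row_mx (lsubmx v) (\row_l rsubmx v 0 (s l))) (g j)^`()).[rsubmx v 0 j].
have pl i : pf (fun v : 'rV[C]_(1 + n + k) => lsubmx v 0 i).
  by apply: (pf_lsubmx (u := id)) => l; exact: pf_coord.
have pr i : pf (fun v : 'rV[C]_(1 + n + k) => rsubmx v 0 i).
  by apply: (pf_rsubmx (u := id)) => l; exact: pf_coord.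
have [P DP] : pf D.
  apply: pfM; first exact: pl.
  apply: pf_prod => j; apply: pf_horner => // i; apply: pf_row_mx => // l.
  by apply: pf_ext (pr (s l)) => x; rewrite mxE.
have pfp F : pf F -> pf (fun q : 'rV[C]_(1 + (n + pdim) + k) => F (lsubmx q)).
  by apply: pf_comp => i; apply: (pf_lsubmx (u := id)) => l; exact: pf_coord.
have [|||B pB hB] := @pf_congr R _ _
    (fun q : 'rV[C]_(1 + (n + pdim) + k) => row_mx (fx (lsubmx q)) (\row_j fY j (lsubmx q)))
    (fun q => row_mx 0 (rsubmx q)) (fun q => fW (lsubmx q) ^+ 2) P.
- apply: pf_row_mx => i; first exact: (pfp _ (pf_fx i)).
  by apply: pf_ext (pfp _ (pf_fY i)) => q; rewrite mxE.
- apply: pf_row_mx => i; first by apply: pf_ext (pf_cst _ 0) => q; rewrite mxE.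
  by apply: (pf_rsubmx (u := id)) => l; exact: pf_coord.
- by apply: pfX; exact: (pfp _ pf_fW).
exists B => // p h; have := hB (row_mx p h); rewrite row_mxKl row_mxKr -!DP.
have -> : D (row_mx (fx p) (\row_j fY j p)) = rhd p * \prod_j fdelta j p.
  rewrite /D row_mxKl row_mxKr rhd_cons; congr (_ * _); apply: eq_bigr => j _.
  rewrite /fdelta mxE; congr ((evp (row_mx _ _) _).[_]).
  by apply/rowP => l; rewrite !mxE.
move=> <-; rewrite /D scale_row_mx add_row_mx scaler0 addr0 row_mxKl row_mxKr rhd_cons.
congr (_ * _); apply: eq_bigr => j _; rewrite !mxE; congr ((evp _ _).[_]).
rewrite /fb /fa /fe scale_row_mx add_row_mx scaler0 addr0; congr row_mx.
by apply/rowP => l; rewrite !mxE.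
Qed.

(** [Rem] collects the remainders on division by the generic [w]: one for [z prod_j delta_j] and two
    successive ones for each [g_j]; their vanishing is the polynomial system given to the induction.
    Under it [fc * fdelta = E * fW], so the linear Taylor term carries [fW ^+ 2] too, and [Phi j] is
    [E * z] plus [fc] times the other quotients. As [fc] contains the first coordinate as a factor,
    [Phi j] is linear where that coordinate is 0. *)
Theorem formal_system :
  exists (Rem : option ('I_k * bool) -> nat -> mpoly (n + pdim) C)
    (E : 'rV[C]_(1 + (n + pdim)) -> C) (S : 'I_k -> 'rV[C]_(1 + (n + pdim)) -> C)
    (Phi : 'I_k -> {poly mpoly (1 + (n + pdim) + k) C}),
  let rem c := wpoly d.+1 (fun i t => ev t (Rem c i)) in
  [/\ pf E /\ (forall j, pf (S j)),
    forall p, rhd p * \prod_j fdelta j p = E p * fW p + rem None p,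
    forall j p, (evp (fa p) (g j)).[fY j p] =
      (S j p * fW p + rem (Some (j, false)) p) * fW p + rem (Some (j, true)) p,
    forall j p h, (forall c i, (i < d.+1)%N -> ev (rtl p) (Rem c i) = 0) -> forall z,
      fc j p * (evp (fb p h) (g j)).[fY j p + fW p * z]
      = fW p ^+ 2 * (evp (row_mx p h) (Phi j)).[z] &
    forall j p h z, rhd p = 0 -> (evp (row_mx p h) (Phi j)).[z] = E p * z].
Proof.
have pfR M (r : nat -> 'rV[C]_M -> C) : (forall i, pf (r i)) ->
    exists P : nat -> mpoly M C, r = fun i t => ev t (P i).
  move=> hr; have /choice[P hP] i : exists P : mpoly M C, forall t, r i t = ev t P.
    by have [P hP] := hr i; exists P.
  by exists P; apply/funext => i; apply/funext => t.
have pfd F : pf F -> exists S (P : nat -> mpoly (n + pdim) C), pf S /\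
    forall p, F p = S p * fW p + wpoly d.+1 (fun i t => ev t (P i)) p.
  move=> hF; have [S [r [hS hr h]]] := pf_division d (pf_par None) hF.
  have [P rP] := pfR _ r hr; exists S, P; split=> // p; rewrite h rP //.
have [E [P0 [pE hE]]] : exists S (P : nat -> mpoly (n + pdim) C), pf S /\
    forall p, rhd p * \prod_j fdelta j p = S p * fW p + wpoly d.+1 (fun i t => ev t (P i)) p.
  apply: pfd; apply: pfM; first exact: pf_coord.
  by apply: pf_prod => j; exact: pf_fdelta.
have /choice[X hX] j : exists X : ('rV[C]_(1 + (n + pdim)) -> C) * (bool -> nat -> mpoly (n + pdim) C),
    pf X.1 /\ forall p, (evp (fa p) (g j)).[fY j p] =
      (X.1 p * fW p + wpoly d.+1 (fun i t => ev t (X.2 false i)) p) * fW p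
      + wpoly d.+1 (fun i t => ev t (X.2 true i)) p.
  have [|S1 [P1 [pS1 h1]]] := pfd (fun p => (evp (fa p) (g j)).[fY j p]).
    by apply: pf_horner; [exact: pf_fa|exact: pf_fY].
  have [S2 [P2 [pS2 h2]]] := pfd _ pS1.
  by exists (S2, fun b => if b then P1 else P2); split=> // p; rewrite h1 h2.
have /choice[Psi hPsi] j : exists Psi, pf Psi /\ forall p h z,
    (evp (fb p h) (g j)).[fY j p + fW p * z] =
    (evp (fa p) (g j)).[fY j p] + fdelta j p * (fW p * z)
    + fW p ^+ 2 * Psi (row_mx (row_mx p h) z%:M).
  by have [Psi p1 p2] := taylor_system j; exists Psi.
have /choice[Phi hPhi] j : exists Phi : {poly mpoly (1 + (n + pdim) + k) C}, forall p h z,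
    (evp (row_mx p h) Phi).[z] = E p * z + fc j p * ((X j).1 p + Psi j (row_mx (row_mx p h) z%:M)).
  have pq F : pf F -> pf (fun q : 'rV[C]_(1 + (n + pdim) + k + 1) => F (lsubmx (lsubmx q))).
    by apply: pf_comp => i; apply: pf_lsubmx => l; apply: pf_lsubmx => l'; exact: pf_coord.
  have [P hP] : pf (fun q : 'rV[C]_(1 + (n + pdim) + k + 1) =>
      E (lsubmx (lsubmx q)) * q 0 (rshift _ 0) + fc j (lsubmx (lsubmx q)) * ((X j).1 (lsubmx (lsubmx q)) + Psi j q)).
    apply: pfD; first by apply: pfM; [exact: pq|exact: pf_coord].
    apply: pfM; first exact: (pq _ (pf_fc j)).
    by apply: pfD; [exact: (pq _ (hX j).1)|exact: (hPsi j).1].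
  have [Phi PhiE] := horner_of_mpoly P; exists Phi => p h z.
  by rewrite PhiE -hP !row_mxKl row_mxEr mxE mulr1n.
exists (fun c => if c is Some jb then (X jb.1).2 jb.2 else P0), E, (fun j => (X j).1), Phi.
split=> //.
- by split=> // j; exact: (hX j).1.
- by move=> j p; exact: (hX j).2.
- move=> j p h rem0 z; rewrite hPhi (hPsi j).2 (hX j).2.
  rewrite (wpoly0 (fun i hi => rem0 (Some (j, false)) i hi)) (wpoly0 (fun i hi => rem0 (Some (j, true)) i hi)) !addr0.
  have EW : fc j p * fdelta j p = E p * fW p.
    by rewrite fc_fdelta hE (wpoly0 (fun i hi => rem0 None i hi)) addr0.
  move: EW; move: (Psi j _) ((X j).1 p) (fc j p) (fdelta j p) (E p) (fW p); clear => P S c D e W EW.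
  transitivity (c * D * (W * z) + W ^+ 2 * (c * (S + P))); first by ring.
  by rewrite EW; ring.
- move=> j p h z p0; rewrite hPhi (_ : fc j p = 0) ?mul0r ?addr0 //.
  by rewrite /fc p0 mul0r.
Qed.

End FormalSystem.

(** * The Weierstrass data of a given holomorphic map *)

Section DivisionData.
Variables (R : realType) (n k : nat).
Local Notation C := (Cplx R).

Definition lift_par d (Y : 'rV[C]_n -> 'rV[C]_(pdim k d)) (x : 'rV[C]_(1 + n)) :
  'rV[C]_(1 + (n + pdim k d)) := rcons0 (rhd x) (row_mx (rtl x) (Y (rtl x))).

Lemma fx_lift d (Y : 'rV[C]_n -> 'rV[C]_(pdim k d)) x : fx (lift_par Y x) = x.
Proof. by rewrite /fx /lift_par rhd_cons rtl_cons row_mxKl rcons0K. Qed.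

Lemma wpoly_par d c (Y : 'rV[C]_n -> 'rV[C]_(pdim k d)) (a : nat -> 'rV[C]_n -> C) x :
  (forall i : 'I_d.+1, Y (rtl x) 0 (enum_rank ((c, i) : pidx k d)) = a i (rtl x)) ->
  wpoly d.+1 (par c) (lift_par Y x) = wpoly d.+1 a x.
Proof.
move=> hY; rewrite /wpoly; apply: eq_bigr => i _.
by rewrite /lift_par rhd_cons rtl_cons /par row_mxKr inord_val hY.
Qed.

(** The last clause is the uniqueness of Weierstrass division on a slice: it turns divisibility of a
    remainder by [w] into the vanishing of its coefficients. *)
Theorem division_data (r : R) (Dl : 'rV[C]_(1 + n) -> C) (f : 'rV[C]_(1 + n) -> 'rV[C]_k) :
  0 < r -> (forall x, pball 0 r x -> differentiable Dl x) ->
  (exists2 z, nm z < r & Dl (rcons0 z 0) != 0) -> Dl 0 = 0 ->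
  (forall j, bh (pball 0 r) (fun x => f x 0 j)) ->
  exists (d : nat) (rho t : R) (Y : 'rV[C]_n -> 'rV[C]_(pdim k d))
    (h : 'rV[C]_(1 + n) -> 'rV[C]_k) (e : 'rV[C]_(1 + n) -> C),
  [/\ 0 < t <= rho /\ rho <= r,
    [/\ forall i, bh (pball 0 t) (fun x' => Y x' 0 i),
        forall j, bh (cyl rho (pball 0 t)) (fun x => h x 0 j),
        bh (cyl rho (pball 0 t)) e & e 0 != 0],
    forall x, cyl rho (pball 0 t) x -> Dl x = e x * fW (lift_par Y x) /\
      forall j, f x 0 j = fY j (lift_par Y x) + fW (lift_par Y x) ^+ 2 * h x 0 j,
    forall z : C, fW (lift_par Y (rcons0 z 0)) = z ^+ d.+1 &
    forall x', pball 0 t x' -> forall (c : nat -> C) q, (exists M, on_disc rho M q) ->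
      (forall z : C, nm z < rho ->
         \sum_(i < d.+1) z ^+ i * c i = q z * fW (lift_par Y (rcons0 z x'))) ->
      forall i, (i < d.+1)%N -> c i = 0].
Proof.
move=> r0 dD Dz D0 bf.
have [d1 [rho [t [a [e [d10 /andP[t0 trho] rhor [a0 ba be [e0 De] [theta thE hth]]]]]]]] :=
  weierstrass_preparation r0 dD Dz D0.
case: d1 d10 a0 De thE hth => // d _ a0 De thE hth.
have rho0 : 0 < rho by exact: lt_le_trans trho.
have sub := @cyl_pball R n rho t r r0 rhor (le_trans trho rhor).
have bb : bholo (cyl rho (pball 0 t)) theta (wpoly d.+1 a).
  move=> x hx; split; last exact: hth.
  by apply: bh_diff hx; exact: bh_wpoly.
have oX : open (pball (0 : 'rV[C]_n) t) by exact: pball_open.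
have /choice[X hX] j : exists X : ('rV[C]_(1 + n) -> C) * (bool -> nat -> 'rV[C]_n -> C),
    [/\ bh (cyl rho (pball 0 t)) X.1, forall b i, bh (pball 0 t) (X.2 b i) &
    forall x, cyl rho (pball 0 t) x -> f x 0 j = wpoly d.+1 (X.2 true) x
      + (wpoly d.+1 (X.2 false) x + X.1 x * (rhd x ^+ d.+1 + wpoly d.+1 a x)) * (rhd x ^+ d.+1 + wpoly d.+1 a x)].
  have [q1 [c1 [bq1 bc1 E1]]] := weierstrass_division rho0 oX bb thE (bhS sub (bf j)).
  have [q2 [c2 [bq2 bc2 E2]]] := weierstrass_division rho0 oX bb thE bq1.
  (* [c1] is the remainder of [f_j] and [c2] that of its quotient, that is [y_j0] and [y_j1]. *)
  exists (q2, fun b => if b then c1 else c2); split=> //=; first by case.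
  by move=> x hx; rewrite E1 // E2.
pose Y x' : 'rV[C]_(pdim k d) := \row_(i < pdim k d)
  match (enum_val i : pidx k d) with
  | (Some jb, l) => (X jb.1).2 jb.2 l x' | (None, l) => a l x' end.
pose h x : 'rV[C]_k := \row_j (X j).1 x.
exists d, rho, t, Y, h, e.
have WE x : fW (lift_par Y x) = rhd x ^+ d.+1 + wpoly d.+1 a x.
  by rewrite /fW {1}/lift_par rhd_cons (@wpoly_par _ _ _ a) // => i; rewrite mxE enum_rankK.
have YE j x : fY j (lift_par Y x) = wpoly d.+1 ((X j).2 true) x + fW (lift_par Y x) * wpoly d.+1 ((X j).2 false) x.
  rewrite /fY (@wpoly_par _ _ _ ((X j).2 true)); last by move=> i; rewrite mxE enum_rankK.
  by rewrite (@wpoly_par _ _ _ ((X j).2 false)) // => i; rewrite mxE enum_rankK.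
split.
- by rewrite t0.
- split=> //.
  + move=> i; rewrite (_ : (fun x' => _) = match (enum_val i : pidx k d) with
      | (Some jb, l) => (X jb.1).2 jb.2 l | (None, l) => a l end).
      case: (enum_val i) => -[[j b]|] l /=; last exact: ba.
      by have [_ hb _] := hX j; exact: hb.
    by apply/funext => x'; rewrite mxE; case: (enum_val i) => -[[j b]|].
  + move=> j; rewrite (_ : (fun x => _) = (X j).1); first by have [] := hX j.
    by apply/funext => x; rewrite mxE.
- move=> x hx; split; first by rewrite WE; exact: De.
  move=> j; have [_ _ E] := hX j; rewrite (E x hx) YE mxE WE.
  move: (rhd x ^+ _ + _) (wpoly _ _ x) (wpoly _ _ x) ((X j).1 x); clear => *; ring.
- move=> z; rewrite WE rhd_cons (_ : wpoly _ _ _ = 0) ?addr0 //.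
  by apply: wpoly0 => i hi; rewrite rtl_cons a0.
- move=> x' hx' c q [M hq] hc i hi.
  have : \poly_(l < d.+1) c l = 0.
    apply: (@weierstrass_uniqueness R rho theta M d.+1 q (fun z => wpoly d.+1 a (rcons0 z x'))) => //.
    + exact: bholo_slice bb.
    + move=> z hz; rewrite horner_poly; have := hc z hz.
      rewrite WE rhd_cons => <-; by apply: eq_bigr => l _; rewrite mulrC.
  by move=> /(congr1 (fun p : {poly C} => p`_i)); rewrite coef_poly hi coef0.
Qed.

Lemma fW_slice_neq0 d (Y : 'rV[C]_n -> 'rV[C]_(pdim k d)) (rho : R) x' : 0 < rho ->
  ~ (forall z : C, nm z < rho -> fW (lift_par Y (rcons0 z x')) = 0).
Proof.
move=> rho0 h; pose p : {poly C} := 'X^(d.+1) + \poly_(i < d.+1) par None i (row_mx x' (Y x')).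
have : p = 0.
  apply: (poly_disc0 rho0) => z hz; rewrite -[RHS](h z hz) /p hornerD hornerXn horner_poly.
  rewrite /fW /lift_par !rhd_cons !rtl_cons; congr (_ + _).
  by rewrite /wpoly rhd_cons rtl_cons; apply: eq_bigr => i _; rewrite mulrC.
move=> /(congr1 (fun p : {poly C} => p`_d.+1)).
rewrite /p coefD coefXn eqxx coef_poly ltnn addr0 coef0 => /eqP.
by rewrite oner_eq0.
Qed.

End DivisionData.

Lemma bh_pf (R : realType) (V : normedModType (Cplx R)) (D : set V) N (v : V -> 'rV[Cplx R]_N) F :
  pf F -> (forall i, bh D (fun x => v x 0 i)) -> bh D (fun x => F (v x)).
Proof.
move=> [P FP] hv; rewrite (_ : (fun x => _) = (fun x => meval (fun i => v x 0 i) P)).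
  exact: bh_meval.
by apply/funext => x; rewrite FP.
Qed.

(** Cauchy's estimate on the ball of radius [t / 2] about the second point, which stays in the ball
    of radius [t] where [F] is bounded. *)
Lemma lipschitz (R : realType) (V : normedModType (Cplx R)) (F : V -> Cplx R) x (r : R) : 0 < r ->
  (forall y, pball x r y -> differentiable F y) ->
  exists s L : R, [/\ 0 < s <= r, 0 <= L &
    forall y z, pball x s y -> pball x s z -> nm (F y - F z) <= L * nm (y - z)].
Proof.
move=> r0 dF; have [t /andP[t0 tr] [M hM]] := local_bh r0 dF.
have M0 : 0 <= M by apply: le_trans (hM x (pball_center x t0)).2; exact: nm_ge0.
have t2 : 0 < t / 2 by rewrite divr_gt0.
have t4 : 0 < t / 2 / 2 by rewrite divr_gt0.
have t4t : t / 2 / 2 <= t by clear -t0; lra.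
exists (t / 2 / 2), (cauchyK R / (t / 2) * M); split.
- by rewrite t4 (le_trans t4t).
- by apply: mulr_ge0 M0; apply: divr_ge0; apply: ltW; [exact: cauchyK_gt0|exact: t2].
move=> y z; rewrite /pball /= => hy hz.
have sub w : pball z (t / 2) w -> pball x t w.
  move=> hw; apply: (pball_subset (y := z) (s := t / 2)) hw.
  rewrite [leRHS]splitr lerD2r; apply: (le_trans (ltW hz)).
  by clear -t0; lra.
have hyz : nm (y - z) < t / 2.
  rewrite (splitr (t / 2)); apply: (le_lt_trans (nm_triangle x _ _)).
  by apply: ltrD => //; rewrite nmB.
have [h _ _] := cauchy_estimate t2 (fun w hw => (hM w (sub w hw)).1) (fun w hw => (hM w (sub w hw)).2) hyz.
by rewrite [z + _]addrC subrK in h.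
Qed.

Lemma lipschitz_family (R : realType) (V : normedModType (Cplx R)) k (F : 'I_k -> V -> Cplx R) x (r : R) :
  0 < r -> (forall j y, pball x r y -> differentiable (F j) y) ->
  exists s L : R, [/\ 0 < s <= r, 0 <= L &
    forall j y z, pball x s y -> pball x s z -> nm (F j y - F j z) <= L * nm (y - z)].
Proof.
move=> r0 dF; have /choice[X hX] j : exists X : R * R, [/\ 0 < X.1 <= r, 0 <= X.2 &
    forall y z, pball x X.1 y -> pball x X.1 z -> nm (F j y - F j z) <= X.2 * nm (y - z)].
  by have [s [L h]] := lipschitz r0 (dF j); exists (s, L).
have [s s0 hs] : exists2 s : R, 0 < s & forall j, s <= (X j).1.
  apply: (common_radius (P := fun j s => s <= (X j).1)).
    by move=> j; exists (X j).1 => //; have [/andP[]] := hX j.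
  by move=> j a b /andP[_ ba]; exact: le_trans.
exists (Num.min s r), (\sum_j (X j).2); split.
- by rewrite lt_min s0 r0 ge_min lexx orbT.
- by apply: sumr_ge0 => j _; have [] := hX j.
move=> j y z; rewrite /pball /= !lt_min => /andP[hy _] /andP[hz _]; have [_ L0 hL] := hX j.
apply: (@le_trans _ _ ((X j).2 * nm (y - z))).
  by apply: hL; rewrite /pball /=; apply: lt_le_trans (hs j).
rewrite ler_wpM2r ?nm_ge0 // (bigD1 j) //= lerDl sumr_ge0 // => i _.
by have [] := hX i.
Qed.

Lemma quarter_half_lt (R : realFieldType) (r u v : R) : 0 < r -> u <= r / 4 -> v < r / 2 -> u + v < r.
Proof. by move=> *; lra. Qed.

Lemma alg_pf (R : realType) M N (D : set 'rV[Cplx R]_M) (v : 'rV[Cplx R]_M -> 'rV[Cplx R]_N) F :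
  pf F -> (forall i, alg D (fun x => v x 0 i)) -> alg D (fun x => F (v x)).
Proof.
move=> [P FP] hv; apply: (@alg_ext _ _ _ (fun x => meval (fun i => v x 0 i) P)).
  by move=> x _; rewrite FP.
exact: alg_meval.
Qed.

(* The identities [g_j(x, u) = 0] are only asked for near [x1], where the
   [f_j] are simple roots. *)
Definition approximable_roots (R : realType) N k m (f : 'rV[Cplx R]_N -> 'rV[Cplx R]_k)
    (s : 'I_m -> 'I_k) (g : 'I_k -> {poly mpoly (N + m) (Cplx R)}) (r : R) :=
  exists x1, [/\ pball 0 r x1,
  forall j, (evp (adjoin f s x1) (g j)^`()).[f x1 0 j] != 0 &
  forall eps : R, 0 < eps -> exists G : 'rV[Cplx R]_N -> 'rV[Cplx R]_k,
   [/\ forall x, pball 0 r x -> differentiable G x /\ nm (G x - f x) <= eps,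
       forall j, alg (pball 0 r) (fun x => G x 0 j) &
       exists2 e1 : R, 0 < e1 & forall x, pball x1 e1 x -> exists u : 'rV[Cplx R]_m,
         nm (u - \row_l f x 0 (s l)) <= eps /\
         forall j, (evp (row_mx x u) (g j)).[G x 0 j] = 0]].

(** * The induction step *)

Section Core.
Variables (R : realType) (n k m : nat).
Local Notation C := (Cplx R).
Variables (f : 'rV[C]_(1 + n) -> 'rV[C]_k) (s : 'I_m -> 'I_k)
  (g : 'I_k -> {poly mpoly (1 + n + m) C}).

Definition discr (x : 'rV[C]_(1 + n)) : C :=
  rhd x * \prod_j (evp (adjoin f s x) (g j)^`()).[f x 0 j].

Variables (d : nat) (rho t : R) (Y : 'rV[C]_n -> 'rV[C]_(pdim k d))
  (h : 'rV[C]_(1 + n) -> 'rV[C]_k) (e : 'rV[C]_(1 + n) -> C).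
Local Notation D := (cyl rho (pball (0 : 'rV[C]_n) t)).
Local Notation P := (lift_par Y).
Local Notation W x := (fW (P x)).
Definition lift_full (x : 'rV[C]_(1 + n)) := row_mx (P x) (h x).

(** Except for [hrel], these are conclusions of [division_data] for [discr]; those of
    [formal_system] and the induction hypothesis [approxY] join them below. *)
Hypotheses (t0 : 0 < t) (trho : t <= rho)
  (bY : forall i, bh (pball 0 t) (fun x' => Y x' 0 i))
  (b_h : forall j, bh D (fun x => h x 0 j)) (be : bh D e) (e0 : e 0 != 0)
  (discrE : forall x, D x -> discr x = e x * W x)
  (fE : forall x, D x -> forall j, f x 0 j = fY j (P x) + W x ^+ 2 * h x 0 j)
  (W0 : forall z : C, W (rcons0 z 0) = z ^+ d.+1)
  (divisible0 : forall x', pball 0 t x' -> forall (c : nat -> C) q, (exists M, on_disc rho M q) ->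
      (forall z : C, nm z < rho -> \sum_(i < d.+1) z ^+ i * c i = q z * W (rcons0 z x')) ->
      forall i, (i < d.+1)%N -> c i = 0)
  (hrel : forall j, relation D (adjoin f s) (fun x => f x 0 j) (g j)).

Let rho0 : 0 < rho. Proof. exact: lt_le_trans trho. Qed.

Lemma bh_lift i : bh D (fun x => P x 0 i).
Proof.
have [j ->|j ->] := split_ordP i.
  exists rho => x [/ltW h1 _]; rewrite (_ : (fun x => _) = @rhd R n).
    by rewrite /lift_par /rcons0 row_mxEl ord1 mxE mulr1n; split=> //; exact: differentiable_proj.
  by apply/funext => y; rewrite /lift_par /rcons0 row_mxEl ord1 mxE mulr1n.
have [l ->|l ->] := split_ordP j.
  exists t => x [_ h2]; rewrite (_ : (fun x => _) = (fun x : 'rV[C]_(1 + n) => x 0 (rshift 1 l))).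
    split; first exact: differentiable_proj.
    rewrite /lift_par /rcons0 row_mxEr row_mxEl; apply: ltW; move: h2.
    by rewrite /pball /= subr0; apply: le_lt_trans; exact: nm_coord.
  by apply/funext => y; rewrite /lift_par /rcons0 row_mxEr row_mxEl mxE.
have [B hB] := bY l; exists B => x [_ h2]; have [h3 h4] := hB _ h2.
rewrite (_ : (fun x => _) = (fun x => Y (rtl x) 0 l)).
  rewrite /lift_par /rcons0 !row_mxEr; split=> //.
  by apply: (differentiable_compo (g := fun y => Y y 0 l) _ h3); exact: rtl_differentiable.
by apply/funext => y; rewrite /lift_par /rcons0 !row_mxEr.
Qed.

Lemma bh_lift_pf F : pf F -> bh D (fun x => F (P x)).
Proof. by move=> pF; apply: bh_pf => // i; exact: bh_lift. Qed.

Lemma bh_lift_full i : bh D (fun x => lift_full x 0 i).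
Proof.
rewrite /lift_full; have [j ->|j ->] := split_ordP i.
  rewrite (_ : (fun x => _) = fun x => P x 0 j); first exact: bh_lift.
  by apply/funext => x; rewrite row_mxEl.
rewrite (_ : (fun x => _) = fun x => h x 0 j) //.
by apply/funext => x; rewrite row_mxEr.
Qed.

Lemma fb_lift x : D x -> fb s (P x) (h x) = adjoin f s x.
Proof.
move=> Dx; rewrite /fb /fa /fe scale_row_mx add_row_mx scaler0 addr0 fx_lift; congr row_mx.
by apply/rowP => l; rewrite !mxE fE.
Qed.

Lemma slice_disc q x' : pball 0 t x' -> bh D q ->
  exists M, on_disc rho M (fun z => q (rcons0 z x')).
Proof. by move=> hx [M hM]; exists M; exact: bholo_slice hM. Qed.

Lemma sub_ball : pball 0 t `<=` D.
Proof.
move=> x; rewrite pball0_cyl // => -[h1 h2]; split=> //.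
exact: lt_le_trans trho.
Qed.

Lemma W_cancel F : bh D F -> (forall x, pball 0 t x -> W x * F x = 0) ->
  forall x, pball 0 t x -> F x = 0.
Proof.
move=> bF WF.
have dW x : pball 0 t x -> differentiable (fun x => W x) x.
  by move=> /sub_ball; apply: bh_diff; apply: bh_lift_pf; exact: pf_fW.
have dF x : pball 0 t x -> differentiable F x by move=> /sub_ball; exact: bh_diff.
have [z0|//] := holo_zero_divisor dW dF WF.
have := z0 (rcons0 ((t / 2)%:C%C) 0).
rewrite W0 /pball /= subr0 nm_rcons0_lt // nm0 t0 andbT nm_real ger0_norm ?ltW ?divr_gt0 //.
rewrite half_lt // => /(_ isT)/eqP; rewrite expf_eq0 /= => /eqP zr.
have : nm ((t / 2)%:C%C : C) = 0 by rewrite zr nm0.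
by rewrite nm_real => /eqP; rewrite normr_eq0 gt_eqF // divr_gt0.
Qed.

(** On each slice [w] is a monic polynomial in the first coordinate, hence not identically 0. *)
Lemma slice_cancel F x' : bh D F -> pball 0 t x' ->
  (forall z : C, nm z < rho -> W (rcons0 z x') * F (rcons0 z x') = 0) ->
  forall z : C, nm z < rho -> F (rcons0 z x') = 0.
Proof.
move=> bF hx' WF.
have Dz (z : C) : nm z < rho -> D (rcons0 z x') by move=> hz; split; rewrite ?rhd_cons ?rtl_cons.
have dW (z : C) : pball (0 : C) rho z -> differentiable (fun z => W (rcons0 z x')) z.
  rewrite /pball /= subr0 => hz; apply: (rcons0_slice_differentiable (F := fun x => W x)).
  by apply: bh_diff (Dz z hz); apply: bh_lift_pf; exact: pf_fW.
have dF (z : C) : pball (0 : C) rho z -> differentiable (fun z => F (rcons0 z x')) z.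
  rewrite /pball /= subr0 => hz; apply: rcons0_slice_differentiable.
  exact: bh_diff (Dz z hz).
have WF0 (z : C) : pball (0 : C) rho z -> W (rcons0 z x') * F (rcons0 z x') = 0.
  by rewrite /pball /= subr0; exact: WF.
have [z0|z0] := holo_zero_divisor dW dF WF0.
  exfalso; apply: (@fW_slice_neq0 R n k d Y rho x' rho0) => z hz.
  by apply: z0; rewrite /pball /= subr0.
by move=> z hz; apply: z0; rewrite /pball /= subr0.
Qed.

Variables (Rem : option ('I_k * bool) -> nat -> mpoly (n + pdim k d) C)
  (E : 'rV[C]_(1 + (n + pdim k d)) -> C) (S : 'I_k -> 'rV[C]_(1 + (n + pdim k d)) -> C)
  (Phi : 'I_k -> {poly mpoly (1 + (n + pdim k d) + k) C}).
Local Notation rem c := (wpoly d.+1 (fun i t => ev t (Rem c i))).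
Hypotheses (pE : pf E) (pS : forall j, pf (S j))
  (remE : forall p, rhd p * \prod_j fdelta s g j p = E p * fW p + rem None p)
  (remG : forall j p, (evp (fa s p) (g j)).[fY j p] =
      (S j p * fW p + rem (Some (j, false)) p) * fW p + rem (Some (j, true)) p)
  (PhiE : forall j p y, (forall c i, (i < d.+1)%N -> ev (rtl p) (Rem c i) = 0) -> forall z,
      fc s g j p * (evp (fb s p y) (g j)).[fY j p + fW p * z]
      = fW p ^+ 2 * (evp (row_mx p y) (Phi j)).[z])
  (Phi0 : forall j p y z, rhd p = 0 -> (evp (row_mx p y) (Phi j)).[z] = E p * z).

Lemma bh_rem c : bh D (fun x => rem c (P x)).
Proof. by apply: bh_lift_pf; apply: pf_wpoly => i; exists (Rem c i). Qed.

Lemma rem_lift c x' : pball 0 t x' -> (exists2 q, bh D q & forall z : C, nm z < rho ->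
    rem c (P (rcons0 z x')) = q (rcons0 z x') * W (rcons0 z x')) ->
  forall i, (i < d.+1)%N -> ev (row_mx x' (Y x')) (Rem c i) = 0.
Proof.
move=> hx' [q bq hq]; apply: (divisible0 hx' (slice_disc hx' bq)) => z hz.
rewrite -hq // /wpoly /lift_par rhd_cons rtl_cons rhd_cons rtl_cons.
by [].
Qed.

(** Computed from [f], the discriminant is [e w]; computed from [y], it is [E w] plus a remainder;
    the two differ by a multiple of [w ^ 2]. So the remainder is divisible by [w], and once it
    vanishes, [E] is [e] up to a multiple of [w]. *)
Lemma cofactor_delta : exists2 B, bh D B &
  forall x, D x -> (e x - W x * B x) * W x = E (P x) * W x + rem None (P x).
Proof.
have [B pB hB] := taylor_delta d s g.
exists (fun x => B (lift_full x)); first by apply: bh_pf => // i; exact: bh_lift_full.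
move=> x Dx; rewrite -remE mulrBl -discrE //; apply/eqP; rewrite subr_eq; apply/eqP.
have := hB (P x) (h x); rewrite fb_lift // /lift_full.
have -> : rhd (P x) = rhd x by rewrite /lift_par rhd_cons.
have -> : \prod_j (evp (adjoin f s x) (g j)^`()).[fY j (P x) + W x ^+ 2 * h x 0 j]
   = \prod_j (evp (adjoin f s x) (g j)^`()).[f x 0 j].
  by apply: eq_bigr => j _; rewrite fE.
rewrite -/(discr x) => ->; congr (_ + _); rewrite expr2; ring.
Qed.

(** [f_j] is [y_j + w z] with [z = w h_j], and it is a root of [g_j]: in the Taylor expansion at
    this [z] all terms but [g_j] at [y] visibly carry [w ^ 2]. *)
Lemma divided_equation j : exists2 q, bh D q &
  forall x, D x -> (evp (fa s (P x)) (g j)).[fY j (P x)] = W x ^+ 2 * q x.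
Proof.
have [Psi pPsi hPsi] := taylor_system d s g j.
exists (fun x => - (fdelta s g j (P x) * h x 0 j + Psi (row_mx (lift_full x) (W x * h x 0 j)%:M))).
  apply: bhN; apply: bhD; first by apply: bhM => //; apply: bh_lift_pf; exact: pf_fdelta.
  apply: bh_pf => // i; have [l ->|l ->] := split_ordP i.
    rewrite (_ : (fun x => _) = fun x => lift_full x 0 l); first exact: bh_lift_full.
    by apply/funext => x; rewrite row_mxEl.
  rewrite (_ : (fun x => _) = fun x => W x * h x 0 j).
    by apply: bhM => //; apply: bh_lift_pf; exact: pf_fW.
  by apply/funext => x; rewrite row_mxEr ord1 mxE mulr1n.
move=> x Dx; have := hPsi (P x) (h x) (W x * h x 0 j).
rewrite mulrA -expr2 -fE // fb_lift // hrel // -/(lift_full x).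
set ps := Psi _; move: ps (evp _ _).[_] (fdelta s g j (P x)) (W x) (h x 0 j); clear => c a b u v eq0.
by apply/eqP; rewrite -subr_eq0; apply/eqP; rewrite [in RHS]eq0; ring.
Qed.

(** The actual coefficients solve the polynomial system. The outer remainder of [g_j] is divisible
    by [w], hence 0 by uniqueness; one [w] is then cancelled on the slice, and the inner remainder
    is divisible by [w] in turn. *)
Lemma remainders_vanish c i x' : pball 0 t x' -> (i < d.+1)%N ->
  ev (row_mx x' (Y x')) (Rem c i) = 0.
Proof.
move=> hx'; have Dz (z : C) : nm z < rho -> D (rcons0 z x').
  by move=> hz; split; rewrite ?rhd_cons ?rtl_cons.
have bW : bh D (fun x => W x) by apply: bh_lift_pf; exact: pf_fW.
have bE : bh D (fun x => E (P x)) by exact: bh_lift_pf.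
have bS j : bh D (fun x => S j (P x)) by exact: bh_lift_pf.
case: c => [[j b]|]; last first.
  have [B bB hB] := cofactor_delta; apply: rem_lift hx' _ i.
  exists (fun x => e x - W x * B x - E (P x)); first by apply: bhB => //; apply: bhB => //; exact: bhM.
  move=> z hz; rewrite mulrBl hB; last exact: Dz.
  by rewrite addrC addKr.
have [q bq hq] := divided_equation j.
have rem1 : forall i, (i < d.+1)%N -> ev (row_mx x' (Y x')) (Rem (Some (j, true)) i) = 0.
  apply: rem_lift hx' _.
  exists (fun x => W x * q x - (S j (P x) * W x + rem (Some (j, false)) (P x))).
    apply: bhB; first exact: bhM.
    by apply: bhD; [exact: bhM|exact: bh_rem].
  move=> z hz; have := remG j (P (rcons0 z x')); rewrite hq; last exact: Dz.
  move: (rem _ _) (rem _ _) (S j _) (q _) (fW _); clear => a b u v w E.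
  by apply/eqP; rewrite -subr_eq0; apply/eqP; rewrite mulrBl mulrAC -expr2 E; ring.
case: b; first exact: rem1.
move: i; apply: (rem_lift hx').
exists (fun x => q x - S j (P x)); first exact: bhB.
move=> z hz; apply/eqP; rewrite -subr_eq0; apply/eqP.
apply: (slice_cancel (F := fun x => rem (Some (j, false)) (P x) - (q x - S j (P x)) * W x)) hz => //.
  by apply: bhB; [exact: bh_rem|apply: bhM => //; exact: bhB].
move=> w hw; have := remG j (P (rcons0 w x')); rewrite hq; last exact: Dz.
have -> : rem (Some (j, true)) (P (rcons0 w x')) = 0.
  by apply: wpoly0 => l hl; rewrite /lift_par !rtl_cons rem1.
move: (rem _ _) (S j _) (q _) (fW _); clear => a u v w' eq0.
by rewrite addr0 in eq0; transitivity ((u * w' + a) * w' - w' ^+ 2 * v); [ring|rewrite eq0 subrr].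
Qed.

(** After cancellation of [w], [E = e - w B] on the ball; [w] vanishes at the origin and [e] does
    not. *)
Lemma cofactor_neq0 : E (P 0) != 0.
Proof.
have [B bB hB] := cofactor_delta.
have bW : bh D (fun x => W x) by apply: bh_lift_pf; exact: pf_fW.
have : forall x, pball 0 t x -> e x - W x * B x - E (P x) = 0.
  apply: W_cancel; first by apply: bhB; [apply: bhB => //; exact: bhM|exact: bh_lift_pf].
  move=> x hx; have := hB x (sub_ball hx).
  have -> : rem None (P x) = 0.
    apply: wpoly0 => i hi; rewrite /lift_par !rtl_cons; apply: remainders_vanish => //.
    by have := sub_ball hx; case.
  by rewrite addr0 => eq1; rewrite mulrC mulrBl eq1 subrr.
move=> /(_ 0 (pball_center 0 t0)); have -> : W 0 = 0 by rewrite -(rcons00 R n) W0 expr0n.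
by rewrite mul0r subr0 => /eqP; rewrite subr_eq0 => /eqP <-.
Qed.

(** For the actual functions the expansion divided by [w ^ 2] has the root [w h_j]; [w] is cancelled
    twice, as a factor that is not identically 0. *)
Lemma lift_root j x : pball 0 t x -> (evp (lift_full x) (Phi j)).[W x * h x 0 j] = 0.
Proof.
have bW : bh D (fun x => W x) by apply: bh_lift_pf; exact: pf_fW.
have bPhi : bh D (fun x => (evp (lift_full x) (Phi j)).[W x * h x 0 j]).
  rewrite (_ : (fun x => _) = fun x => \sum_(i < size (Phi j)) ev (lift_full x) (Phi j)`_i * (W x * h x 0 j) ^+ i).
    apply: bh_sum => i; apply: bhM; last by apply: bhX; exact: bhM.
    apply: (bh_pf (F := fun y => ev y (Phi j)`_i)); last exact: bh_lift_full.
    by exists (Phi j)`_i.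
  by apply/funext => y; rewrite horner_evp_sum.
move: x; apply: (W_cancel bPhi); apply: (W_cancel (F := fun x => W x * (evp (lift_full x) (Phi j)).[W x * h x 0 j]) (bhM bW bPhi)).
move=> x hx; have Dx := sub_ball hx; rewrite mulrA -expr2 -PhiE.
  by rewrite mulrA -expr2 -fE // fb_lift // hrel // mulr0.
move=> c i hi; rewrite /lift_par rtl_cons; apply: remainders_vanish => //.
by case: Dx.
Qed.

(** The [u'] of the overview, as a function of the coefficients and of [h']. *)
Definition cand (p : 'rV[C]_(1 + (n + pdim k d) + k)) : 'rV[C]_m :=
  \row_l (fY (s l) (lsubmx p) + fW (lsubmx p) ^+ 2 * rsubmx p 0 (s l)).

Lemma pf_cand l : pf (fun p => cand p 0 l).
Proof.
have pl i : pf (fun p : 'rV[C]_(1 + (n + pdim k d) + k) => lsubmx p 0 i).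
  by apply: (pf_lsubmx (u := id)) => j; exact: pf_coord.
have pr i : pf (fun p : 'rV[C]_(1 + (n + pdim k d) + k) => rsubmx p 0 i).
  by apply: (pf_rsubmx (u := id)) => j; exact: pf_coord.
apply: (@pf_ext _ _ _ (fun p => fY (s l) (lsubmx p) + fW (lsubmx p) ^+ 2 * rsubmx p 0 (s l))).
  by move=> x; rewrite mxE.
apply: pfD; first by apply: (pf_comp (v := fun p => lsubmx p) (F := fY (s l)) pl); exact: pf_fY.
by apply: pfM => //; apply: pfX; apply: (pf_comp (v := fun p => lsubmx p) (F := @fW R n k d) pl); exact: pf_fW.
Qed.

Lemma fb_cand p y : fb s p y = row_mx (fx p) (cand (row_mx p y)).
Proof.
rewrite /fb /fa /fe scale_row_mx add_row_mx scaler0 addr0; congr row_mx.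
by rewrite /cand row_mxKl row_mxKr; apply/rowP => l; rewrite !mxE.
Qed.

(** At the origin the first coordinate is 0, so [Phi j] is [E * z] there and 0 is a simple root. The
    uniqueness clause identifies the branch along the actual data with [w h_j]. *)
Lemma root_branch : exists (r : R) (psi : 'I_k -> 'rV[C]_(1 + (n + pdim k d) + k) -> C) (eta : 'I_k -> R),
  [/\ 0 < r, forall j, 0 < eta j &
  forall p, pball (lift_full 0) r p -> E (lsubmx p) != 0 /\ forall j,
   [/\ differentiable (psi j) p, nm (psi j p) < eta j, (evp p (Phi j)).[psi j p] = 0 &
     forall z, nm z < eta j -> (evp p (Phi j)).[z] = 0 -> z = psi j p]].
Proof.
have r0 : rhd (P 0) = 0 by rewrite /lift_par rhd_cons rhd0.
have /choice[X hX] j : exists X : R * R * ('rV[C]_(1 + (n + pdim k d) + k) -> C),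
  [/\ 0 < X.1.1, 0 < X.1.2 & forall p, pball (lift_full 0) X.1.1 p ->
   [/\ differentiable X.2 p, nm (X.2 p) < X.1.2, (evp p (Phi j)).[X.2 p] = 0 &
     forall z, nm z < X.1.2 -> (evp p (Phi j)).[z] = 0 -> z = X.2 p]].
  have eq0 : (evp (lift_full 0) (Phi j)).[0] = 0 by rewrite Phi0 // mulr0.
  have eq1 : (evp (lift_full 0) (Phi j)^`()).[0] != 0.
    rewrite evp_deriv (_ : evp _ _ = (E (P 0))%:P * 'X); last first.
      apply/eqP; rewrite -subr_eq0; apply/eqP; apply: (@poly_disc0 R _ 1) => // z _.
      by rewrite hornerD hornerN hornerM hornerX hornerC Phi0 // subrr.
    by rewrite derivM derivC mul0r add0r derivX mulr1 hornerC cofactor_neq0.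
  have [a [b [psi [a0 b0 _ hpsi]]]] := implicit_root eq0 eq1.
  exists (a, b, psi); split=> // p hp; have [h1 h2 h3 h4] := hpsi p hp.
  rewrite subr0 in h2; split=> // z hz; apply: h4; by rewrite subr0.
have [r1 r10 hr1] : exists2 r1 : R, 0 < r1 & forall j, r1 <= (X j).1.1.
  apply: (common_radius (P := fun j r1 => r1 <= (X j).1.1)).
    by move=> j; exists (X j).1.1 => //; have [] := hX j.
  by move=> j a b /andP[_ ba]; exact: le_trans.
have dE : differentiable (fun p : 'rV[C]_(1 + (n + pdim k d) + k) => E (lsubmx p)) (lift_full 0).
  apply/pf_differentiable/(pf_comp (v := fun p => lsubmx p)) => //.
  by move=> i; apply: (pf_lsubmx (u := id)) => l; exact: pf_coord.
have En : 0 < nm (E (P 0)) by rewrite nm_gt0; exact: cofactor_neq0.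
have [r2 r20 hr2] := differentiable_cont dE En.
exists (Num.min r1 r2), (fun j => (X j).2), (fun j => (X j).1.2); split.
- by rewrite lt_min r10.
- by move=> j; have [] := hX j.
move=> p; rewrite /pball /= lt_min => /andP[h1 h2]; split.
  apply: contraTneq (hr2 p h2) => ->; rewrite sub0r nmN /lift_full row_mxKl.
  by rewrite -leNgt lexx.
move=> j; have [_ _ hp] := hX j; apply: hp.
exact: lt_le_trans (hr1 j).
Qed.

Lemma lift_differentiable (Y' : 'rV[C]_n -> 'rV[C]_(pdim k d)) (r : R) x : pball 0 r x ->
  (forall y, pball 0 r y -> differentiable Y' y) -> differentiable (lift_par Y') x.
Proof.
move=> hx dY; have hr : pball 0 r (rtl x).
  by move: hx; rewrite /pball /= !subr0; apply: le_lt_trans; exact: nm_rtl.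
apply: differentiable_row => i; have [j ->|j ->] := split_ordP i.
  rewrite (_ : (fun y => _) = @rhd R n); first exact: differentiable_proj.
  by apply/funext => y; rewrite /lift_par /rcons0 row_mxEl ord1 mxE mulr1n.
have [l ->|l ->] := split_ordP j.
  rewrite (_ : (fun y => _) = (fun y : 'rV[C]_(1 + n) => y 0 (rshift 1 l))); first exact: differentiable_proj.
  by apply/funext => y; rewrite /lift_par /rcons0 row_mxEr row_mxEl mxE.
rewrite (_ : (fun y => _) = (fun y : 'rV[C]_(1 + n) => Y' (rtl y) 0 l)).
  apply: (differentiable_compo (g := fun y : 'rV[C]_n => Y' y 0 l)); first exact: rtl_differentiable.
  apply: (differentiable_compo (g := fun y : 'rV[C]_(pdim k d) => y 0 l)); first exact: dY.
  exact: differentiable_proj.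
by apply/funext => y; rewrite /lift_par /rcons0 !row_mxEr.
Qed.

Lemma lift_alg (Y' : 'rV[C]_n -> 'rV[C]_(pdim k d)) (r : R) :
  (forall i, alg (pball 0 r) (fun x => Y' x 0 i)) ->
  forall i, alg (pball 0 r) (fun x => lift_par Y' x 0 i).
Proof.
move=> aY i; have [j ->|j ->] := split_ordP i.
  apply: (@alg_ext _ _ _ (fun x => ev x (mvar R (lshift n 0)))); last exact: alg_ev.
  by move=> x _; rewrite ev_var /lift_par /rcons0 row_mxEl ord1 mxE mulr1n.
have [l ->|l ->] := split_ordP j.
  apply: (@alg_ext _ _ _ (fun x => ev x (mvar R (rshift 1 l)))); last exact: alg_ev.
  by move=> x _; rewrite ev_var /lift_par /rcons0 row_mxEr row_mxEl mxE.
apply: (@alg_ext _ _ _ (fun x => Y' (rtl x) 0 l)).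
  by move=> x _; rewrite /lift_par /rcons0 !row_mxEr.
apply: (alg_comp (pi := @rtl R n) (g := fun v => Y' v 0 l) (h := fun i => mvar R (rshift 1 i)) _ _ _ (aY l)).
- by move=> x; apply/rowP => a; rewrite !mxE ev_var.
- by move=> y; exists (rcons0 0 y); rewrite rtl_cons.
- by move=> x; rewrite /pball /= !subr0; apply: le_lt_trans; exact: nm_rtl.
Qed.

Hypothesis approxY : exists2 ry : R, 0 < ry & forall eps : R, 0 < eps ->
  exists Y' : 'rV[C]_n -> 'rV[C]_(pdim k d),
    [/\ forall x, pball 0 ry x -> differentiable Y' x /\ nm (Y' x - Y x) <= eps,
        forall i, alg (pball 0 ry) (fun x => Y' x 0 i) &
        forall x c i, pball 0 ry x -> (i < d.+1)%N -> ev (row_mx x (Y' x)) (Rem c i) = 0].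

(** [Theta j] gives [f_j] at the actual data and [G_j] at the approximate data [pn x]; Lipschitz
    bounds make the two close, and likewise for [cand]. Near [x1] the multiplier [fc] is nonzero,
    since [fc * fdelta = E * w'] and [w'] is close to the nonzero value of [w] at [x1]; there the
    root of [Phi j] yields a root of [g_j]. *)
Theorem local_family : exists2 r1 : R, 0 < r1 <= t & approximable_roots f s g r1.
Proof.
have [r0 [psi [eta [r00 eta0 hpsi]]]] := root_branch.
pose Theta j (p : 'rV[C]_(1 + (n + pdim k d) + k)) := fY j (lsubmx p) + fW (lsubmx p) * psi j p.
have pl i : pf (fun p : 'rV[C]_(1 + (n + pdim k d) + k) => lsubmx p 0 i).
  by apply: (pf_lsubmx (u := id)) => j; exact: pf_coord.
have dTheta j p : pball (lift_full 0) r0 p -> differentiable (Theta j) p.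
  move=> hp; have [_ /(_ j)[dp _ _ _]] := hpsi p hp.
  apply: differentiableD.
    by apply: pf_differentiable; apply: (pf_comp (v := fun p => lsubmx p) (F := fY j) pl); exact: pf_fY.
  apply: differentiableM; last exact: dp.
  by apply: pf_differentiable; apply: (pf_comp (v := fun p => lsubmx p) (F := @fW R n k d) pl); exact: pf_fW.
have [r2 [L [/andP[r20 r2r0] L0 hL]]] := lipschitz_family r00 dTheta.
have dcand l p : pball (lift_full 0) r0 p -> differentiable (fun p => cand p 0 l) p.
  by move=> _; apply: pf_differentiable; exact: pf_cand.
have [r3 [L' [/andP[r30 _] L'0 hL']]] := lipschitz_family r00 dcand.
pose r4 := Num.min r2 r3.
have r40 : 0 < r4 by rewrite lt_min r20.
have r42 : 0 < r4 / 2 by rewrite divr_gt0.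
have D0 : D 0 by apply: sub_ball; exact: pball_center.
have dlift x : D x -> differentiable lift_full x.
  by move=> Dx; apply: differentiable_row => i; exact: bh_diff (bh_lift_full i) Dx.
have bW : bh D (fun x => W x) by apply: bh_lift_pf; exact: pf_fW.
have W00 : W 0 = 0 by rewrite -(rcons00 R n) W0 expr0n.
have [a1 a10 ha1] := (continuous_pballP _ _).1 (differentiable_continuous (dlift 0 D0)) _ r42.
have [a2 a20 ha2] : exists2 a2 : R, 0 < a2 & forall j x, nm x < a2 -> nm (W x * h x 0 j) < eta j.
  apply: (common_radius (P := fun j a => forall x, nm x < a -> nm (W x * h x 0 j) < eta j)); last first.
    by move=> j a b /andP[_ ba] ha x hx; apply: ha; exact: lt_le_trans ba.
  move=> j; have [a a0 ha] := bh_cont (bhM bW (b_h j)) D0 (eta0 j); exists a => // x hx.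
  by have := ha x; rewrite W00 mul0r !subr0; apply.
have En : 0 < nm (e 0) by rewrite nm_gt0.
have [a3 a30 ha3] := bh_cont be D0 En.
have [a4 /andP[a40 a4t] ha4] := @polynomial_approximation R (1 + n) t t0.
have [ry ry0 hry] := approxY.
have r4r0 : r4 <= r0 by apply: le_trans r2r0; rewrite ge_min lexx.
have r4r02 : r4 / 2 <= r0.
  by apply: le_trans r4r0; exact: half_le (ltW r40).
pose r1 := Num.min (Num.min (Num.min a1 a2) (Num.min a3 a4)) (Num.min ry t).
have r10 : 0 < r1 by rewrite !lt_min a10 a20 a30 a40 ry0 t0.
have r1P (x : 'rV[C]_(1 + n)) : pball 0 r1 x -> [/\ nm x < a1, nm x < a2, nm x < a3 & nm x < a4] /\ nm x < ry /\ nm x < t.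
  by rewrite /pball /= subr0 !lt_min => /andP[/andP[/andP[-> ->] /andP[-> ->]] /andP[-> ->]].
have r1D x : pball 0 r1 x -> D x.
  by move=> /r1P[_ [_ h1]]; apply: sub_ball; rewrite /pball /= subr0.
have lift_near (x : 'rV[C]_(1 + n)) : pball 0 r1 x -> pball (lift_full 0) (r4 / 2) (lift_full x).
  by move=> /r1P[[h1 _ _ _] _]; apply: ha1; rewrite subr0.
have ThetaE j x : pball 0 r1 x -> Theta j (lift_full x) = f x 0 j.
  move=> hx; have Dx := r1D x hx; rewrite fE // /Theta {1 2}/lift_full row_mxKl; congr (_ + _).
  rewrite expr2 -mulrA; congr (_ * _).
  have [|_ /(_ j)[_ _ _ uq]] := hpsi (lift_full x).
    exact: (lt_le_trans (lift_near x hx)).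
  have [[_ h2 _ _] [_ ht]] := r1P x hx.
  by apply/esym/uq; [exact: ha2|apply: lift_root; rewrite /pball /= subr0].
(* A point of the axis, where [w] is a power of the first coordinate and hence nonzero; as [e] is
   nonzero there too, so is every [delta_j]. *)
pose z1 : C := (r1 / 2)%:C%C.
have nz1 : nm z1 = r1 / 2 by rewrite nm_real ger0_norm // ltW // divr_gt0.
pose x1 : 'rV[C]_(1 + n) := rcons0 z1 0.
have hx1 : pball 0 r1 x1.
  rewrite /pball /= subr0 nm_rcons0_lt // nm0 r10 nz1 andbT.
  exact: half_lt.
have Wx1 : W x1 != 0.
  by rewrite W0 expf_neq0 // -nm_gt0 nz1 divr_gt0.
exists r1; first by rewrite r10 /= !ge_min lexx !orbT.
exists x1; split; first exact: hx1.
- move=> j; have := discrE (r1D x1 hx1).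
  have : e x1 != 0.
    have [[_ _ h3 _] _] := r1P x1 hx1.
    apply: contraTneq (ha3 x1 _) => [->|]; last by rewrite subr0.
    by rewrite sub0r nmN -leNgt.
  move=> ex1 dE; have : discr x1 != 0 by rewrite dE mulf_neq0.
  by rewrite /discr mulf_eq0 negb_or => /andP[_ /prodf_neq0]; apply.
move=> eps eps0.
have Wn : 0 < nm (W x1) by rewrite nm_gt0.
have [d1 d10 hd1] := differentiable_cont (pf_differentiable (P x1) (@pf_fW R n k d)) Wn.
have LL0 : 0 < L + L' + 1 by rewrite ltr_wpDl // addr_ge0.
(* [r4 / 4] keeps [pn x] in the ball of the Lipschitz bounds, [d1 / 4] keeps [w'] nonzero near [x1],
   and the last term turns the Lipschitz bounds into [eps]. *)
pose ep := Num.min (Num.min (r4 / 4) (d1 / 4)) (eps / (L + L' + 1)).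
have ep0 : 0 < ep by rewrite !lt_min !divr_gt0.
have ep4 : ep <= r4 / 4 by rewrite !ge_min lexx.
have epd : ep <= d1 / 4 by rewrite !ge_min lexx orbT.
have epL : L * ep <= eps /\ L' * ep <= eps.
  have le1 : (L + L' + 1) * ep <= eps by rewrite mulrC -ler_pdivlMr // ge_min lexx orbT.
  split; apply: le_trans le1; apply: ler_wpM2r; try exact: (ltW ep0).
    by rewrite -addrA lerDl addr_ge0.
  by rewrite [L + L']addrC -addrA lerDl addr_ge0.
have [Y' [hY' aY' rY']] := hry ep ep0.
have /choice[H hH] j : exists Hj : mpoly (1 + n) C, forall x, pball 0 a4 x -> nm (h x 0 j - ev x Hj) <= ep.
  by apply: (ha4 _ (bhS sub_ball (b_h j))).
pose pn x : 'rV[C]_(1 + (n + pdim k d) + k) := row_mx (lift_par Y' x) (\row_j ev x (H j)).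
have rtl1 (x : 'rV[C]_(1 + n)) : pball 0 r1 x -> pball 0 ry (rtl x).
  by move=> /r1P[_ [hx _]]; rewrite /pball /= subr0; apply: le_lt_trans hx; exact: nm_rtl.
have near1 (x : 'rV[C]_(1 + n)) : pball 0 r1 x -> nm (lift_par Y' x - P x) <= ep.
  move=> hx; rewrite /lift_par rcons0B subrr opp_row_mx add_row_mx subrr.
  apply: nm_row_mx_le; [exact: ltW| |].
    by apply: nm_row_le => [|i]; [exact: ltW|rewrite !mxE ord1 mul0rn nm0 ltW].
  by apply: nm_row_mx_le; [exact: ltW|rewrite nm0 ltW|exact: (hY' _ (rtl1 x hx)).2].
have near (x : 'rV[C]_(1 + n)) : pball 0 r1 x -> nm (pn x - lift_full x) <= ep.
  move=> hx; rewrite /pn /lift_full opp_row_mx add_row_mx.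
  apply: nm_row_mx_le; [exact: ltW|exact: near1|].
  apply: nm_row_le => [|j]; first exact: ltW.
  have [[_ _ _ h4] _] := r1P x hx; rewrite !mxE nmB; apply: hH.
  by rewrite /pball /= subr0.
have pnr4 (x : 'rV[C]_(1 + n)) : pball 0 r1 x -> pball (lift_full 0) r4 (pn x).
  move=> hx; rewrite /pball /=; apply: (le_lt_trans (nm_triangle (lift_full x) _ _)).
  exact: (quarter_half_lt r40 (le_trans (near x hx) ep4) (lift_near x hx)).
have lfr4 (x : 'rV[C]_(1 + n)) : pball 0 r1 x -> pball (lift_full 0) r4 (lift_full x).
  by move=> hx; apply: (lt_le_trans (lift_near x hx)); exact: half_le (ltW r40).
have dpn (x : 'rV[C]_(1 + n)) : pball 0 r1 x -> differentiable pn x.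
  move=> hx; have hx' : pball 0 ry x by move: hx => /r1P[_ [hx _]]; rewrite /pball /= subr0.
  have dl : differentiable (lift_par Y') x.
    by apply: (lift_differentiable hx') => y hy; exact: (hY' y hy).1.
  apply: differentiable_row => i; have [j ->|j ->] := split_ordP i.
    rewrite (_ : (fun y => _) = fun y => lift_par Y' y 0 j).
      apply: (differentiable_compo (g := fun p : 'rV[C]_(1 + (n + pdim k d)) => p 0 j) dl).
      exact: differentiable_proj.
    by apply/funext => y; rewrite /pn row_mxEl.
  rewrite (_ : (fun y => _) = fun y => ev y (H j)); first exact: ev_differentiable.
  by apply/funext => y; rewrite /pn row_mxEr mxE.
exists (fun x => \row_j Theta j (pn x)); split.
- move=> x hx; split.
    apply: differentiable_row => j; rewrite (_ : (fun y => _) = fun y => Theta j (pn y)).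
      apply: (differentiable_compo (g := Theta j) (dpn x hx)); apply: dTheta.
      exact: lt_le_trans (pnr4 x hx) r4r0.
    by apply/funext => y; rewrite mxE.
  apply: nm_row_le => [|j]; first exact: ltW.
  rewrite !mxE -ThetaE //; apply: (@le_trans _ _ (L * nm (pn x - lift_full x))).
    by apply: hL; [apply: lt_le_trans (pnr4 x hx) _|apply: lt_le_trans (lfr4 x hx) _];
       rewrite ge_min lexx.
  by apply: le_trans epL.1; rewrite ler_wpM2l //; exact: near.
- move=> j.
  have al := lift_alg aY'.
  have ry1 : r1 <= ry by rewrite /r1 !ge_min lexx !orbT.
  have al1 i : alg (pball 0 r1) (fun x => lift_par Y' x 0 i).
    by apply: algS (al i); exact: pball_le.
  have apn i : alg (pball 0 r1) (fun x => pn x 0 i).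
    have [a ->|a ->] := split_ordP i.
      by apply: alg_ext (al1 a) => x _; rewrite /pn row_mxEl.
    by apply: alg_ext (alg_ev _ (H a)) => x _; rewrite /pn row_mxEr mxE.
  apply: (@alg_ext _ _ _ (fun x => fY j (lift_par Y' x) + fW (lift_par Y' x) * psi j (pn x))).
    by move=> x _; rewrite mxE /Theta /pn row_mxKl.
  apply: algD; first by apply: (alg_pf (F := fY j) (v := lift_par Y') _ al1); exact: pf_fY.
  apply: algM.
    by apply: (alg_pf (F := @fW R n k d) (v := lift_par Y') _ al1); exact: pf_fW.
  have roots (x : 'rV[C]_(1 + n)) : pball 0 r1 x -> (evp (pn x) (Phi j)).[psi j (pn x)] = 0.
    by move=> hx; have [|_ /(_ j)[]//] := hpsi (pn x); exact: lt_le_trans (pnr4 x hx) r4r0.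
  apply: (@alg_root R (1 + n) 0 r1 (size (Phi j)) (fun i x => ev (pn x) (Phi j)`_i)).
  + move=> i x hx; apply: (differentiable_compo (g := fun p => ev p (Phi j)`_i) (dpn x hx)).
    exact: ev_differentiable.
  + by move=> i; apply: alg_meval.
  + have h0 := pball_center (0 : 'rV[C]_(1 + n)) r10.
    (* If all coefficients of [Phi j] vanished at [pn 0], every small number would be a root,
       against the uniqueness of [psi]. *)
    apply: contrapT => nx.
    have pz : evp (pn 0) (Phi j) = 0.
      apply/polyP => i; rewrite coef_evp coef0.
      have [hi|hi] := ltnP i (size (Phi j)); last by rewrite nth_default // /ev meval0.
      by apply/eqP; apply: contraT => ne; exfalso; apply: nx; exists i, 0.
    have [|_ /(_ j)[_ _ _ uq]] := hpsi (pn 0).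
      exact: lt_le_trans (pnr4 0 h0) r4r0.
    have u0 : 0 = psi j (pn 0) by apply: uq; rewrite ?nm0 // pz horner0.
    have u1 : (eta j / 2)%:C%C = psi j (pn 0).
      apply: uq; last by rewrite pz horner0.
      rewrite nm_real ger0_norm ?ltr_pdivrMr // ?ltr_pMr ?ltr1n //.
      by rewrite ltW // divr_gt0.
    have : nm ((eta j / 2)%:C%C : C) = 0 by rewrite u1 -u0 nm0.
    by rewrite nm_real => /eqP; rewrite normr_eq0 gt_eqF // divr_gt0.
  + by move=> x hx; rewrite -horner_evp_sum; exact: roots.
have [b b0 hb] := (open_pballP _).1 (pball_open 0 r1) _ hx1.
have dP : differentiable (lift_par Y) x1.
  by apply: differentiable_row => i; exact: bh_diff (bh_lift i) (r1D x1 hx1).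
have d12 : 0 < d1 / 2 by rewrite divr_gt0.
have [b' b'0 hb'] := (continuous_pballP _ _).1 (differentiable_continuous dP) _ d12.
exists (Num.min b b'); first by rewrite lt_min b0.
move=> x; rewrite /pball /= lt_min => /andP[hxb hxb'].
have hx := hb x hxb; have Dx := r1D x hx.
exists (cand (pn x)); split.
  apply: nm_row_le => [|l]; first exact: ltW.
  have -> : (cand (pn x) - \row_l f x 0 (s l)) 0 l = cand (pn x) 0 l - cand (lift_full x) 0 l.
    by rewrite [LHS]mxE [X in _ + X]mxE [X in _ - X]mxE fE // [X in _ = _ - X]mxE /lift_full row_mxKl row_mxKr.
  apply: (@le_trans _ _ (L' * nm (pn x - lift_full x))).
    by apply: hL'; [apply: lt_le_trans (pnr4 x hx) _|apply: lt_le_trans (lfr4 x hx) _];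
       rewrite ge_min lexx orbT.
  by apply: le_trans epL.2; rewrite ler_wpM2l //; exact: near.
move=> j; rewrite mxE /Theta {2 3}/pn row_mxKl.
have [|En0 /(_ j)[_ _ rt _]] := hpsi (pn x); first exact: lt_le_trans (pnr4 x hx) r4r0.
have rem0 c i : (i < d.+1)%N -> ev (rtl (lift_par Y' x)) (Rem c i) = 0.
  by move=> hi; rewrite /lift_par rtl_cons; exact: (rY' _ _ _ (rtl1 x hx)).
have := PhiE j (\row_j ev x (H j)) rem0 (psi j (pn x)); rewrite rt mulr0 fb_cand fx_lift.
move/eqP; rewrite mulf_eq0 => /orP[/eqP fc0|/eqP //]; exfalso.
have := fc_fdelta s g j (lift_par Y' x); rewrite fc0 mul0r remE.
rewrite wpoly0 ?addr0; last by move=> i; exact: rem0.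
move=> /esym/eqP; rewrite mulf_eq0; rewrite /pn row_mxKl in En0; rewrite (negbTE En0) /= => /eqP W'0.
have hW : nm (lift_par Y' x - P x1) < d1.
  apply: (le_lt_trans (nm_triangle (P x) _ _)).
  exact: (quarter_half_lt d10 (le_trans (near1 x hx) epd) (hb' x hxb')).
by have := hd1 _ hW; rewrite W'0 sub0r nmN ltxx.
Qed.

End Core.

(** The induction statement, at the origin. The numbers of functions and of equations are arbitrary,
    as the coefficients form a longer tuple and satisfy one equation per remainder coefficient. The
    radius [r0] is chosen before [eps], so that one neighbourhood serves a whole sequence. *)
Definition approximable (R : realType) (n : nat) : Prop :=
  forall (k : nat) (f : 'rV[Cplx R]_n -> 'rV[Cplx R]_k) (r : R) (I : Type)
    (Q : I -> 'rV[Cplx R]_(n + k) -> Cplx R) (Uhat : set 'rV[Cplx R]_(n + k)),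
  0 < r -> (forall x, pball 0 r x -> differentiable f x) -> open Uhat ->
  (forall x, pball 0 r x -> Uhat (row_mx x (f x))) ->
  (forall i y, Uhat y -> differentiable (Q i) y) ->
  (forall i y, Uhat y -> exists2 e : R, 0 < e & alg (pball y e) (Q i)) ->
  (forall i x, pball 0 r x -> Q i (row_mx x (f x)) = 0) ->
  exists2 r0 : R, 0 < r0 <= r & forall eps : R, 0 < eps ->
    exists g : 'rV[Cplx R]_n -> 'rV[Cplx R]_k,
    (forall j, alg (pball 0 r0) (fun x => g x 0 j)) /\
    forall x, pball 0 r0 x -> [/\ differentiable g x, nm (g x - f x) <= eps,
      Uhat (row_mx x (g x)) & forall i, Q i (row_mx x (g x)) = 0].

(** * From roots of the [g_j] near one point to solutions of [Q = 0] *)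

Section Step.
Variables (R : realType) (n k m : nat).
Local Notation C := (Cplx R).
Variables (f : 'rV[C]_(1 + n) -> 'rV[C]_k) (s : 'I_m -> 'I_k)
  (g : 'I_k -> {poly mpoly (1 + n + m) C}) (r : R).
Hypotheses (r0 : 0 < r) (bf : forall j, bh (pball 0 r) (fun x => f x 0 j))
  (hrel : forall j, relation (pball 0 r) (adjoin f s) (fun x => f x 0 j) (g j))
  (hnz : exists2 z, nm z < r & discr f s g (rcons0 z 0) != 0).

Lemma bh_adjoin i : bh (pball 0 r) (fun x => adjoin f s x 0 i).
Proof.
have [j ->|j ->] := split_ordP i.
  exists r => x hx; rewrite (_ : (fun x => _) = (fun x : 'rV[C]_(1 + n) => x 0 j)).
    split; first exact: differentiable_proj.
    rewrite /adjoin row_mxEl; apply: ltW; move: hx; rewrite /pball /= subr0.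
    by apply: le_lt_trans; exact: nm_coord.
  by apply/funext => y; rewrite /adjoin row_mxEl.
rewrite (_ : (fun x => _) = (fun x => f x 0 (s j))) //.
by apply/funext => y; rewrite /adjoin row_mxEr mxE.
Qed.

Lemma bh_discr : bh (pball 0 r) (discr f s g).
Proof.
apply: bhM.
  exists r => x hx; split; first exact: differentiable_proj.
  by apply: ltW; move: hx; rewrite /pball /= subr0; apply: le_lt_trans; exact: nm_rhd.
apply: bh_prod => j; rewrite (_ : (fun x => _) = fun x =>
    \sum_(i < size (g j)^`()) ev (adjoin f s x) (g j)^`()`_i * f x 0 j ^+ i).
  apply: bh_sum => i; apply: bhM; last exact: bhX.
  apply: (bh_pf (F := fun y => ev y (g j)^`()`_i)); last exact: bh_adjoin.
  by exists (g j)^`()`_i.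
by apply/funext => y; rewrite horner_evp_sum.
Qed.

(** The induction hypothesis is applied to the coefficients of [w] and of the [y_j], with the
    entries of [Rem] as equations. *)
Lemma local_approximation : approximable R n ->
  exists2 r1 : R, 0 < r1 <= r & approximable_roots f s g r1.
Proof.
move=> IH; have D0 : discr f s g 0 = 0 by rewrite /discr rhd0 mul0r.
have dD x : pball 0 r x -> differentiable (discr f s g) x by exact: bh_diff bh_discr.
have [d [rho [t [Y [h [e [[/andP[t0 trho] rhor] [bY b_h be e0] fE W0 dv]]]]]]] :=
  division_data r0 dD hnz D0 bf.
have [Rem [E [S [Phi [[pE pS] remE remG PhiE Phi0]]]]] := formal_system d s g.
have DE x : cyl rho (pball (0 : 'rV[C]_n) t) x -> discr f s g x = e x * fW (lift_par Y x).
  by move=> hx; exact: (fE x hx).1.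
have fE' x : cyl rho (pball (0 : 'rV[C]_n) t) x -> forall j, f x 0 j =
    fY j (lift_par Y x) + fW (lift_par Y x) ^+ 2 * h x 0 j.
  by move=> hx; exact: (fE x hx).2.
have sub := @cyl_pball R n rho t r r0 rhor (le_trans trho rhor).
have hrel' j : relation (cyl rho (pball (0 : 'rV[C]_n) t)) (adjoin f s) (fun x => f x 0 j) (g j).
  by move=> x /sub; exact: hrel.
have approxY : exists2 ry : R, 0 < ry & forall eps : R, 0 < eps ->
  exists Y' : 'rV[C]_n -> 'rV[C]_(pdim k d),
    [/\ forall x, pball 0 ry x -> differentiable Y' x /\ nm (Y' x - Y x) <= eps,
        forall i, alg (pball 0 ry) (fun x => Y' x 0 i) &
        forall x c i, pball 0 ry x -> (i < d.+1)%N -> ev (row_mx x (Y' x)) (Rem c i) = 0].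
  have [||||||ry /andP[ry0 _] hry] := IH (pdim k d) Y t (option ('I_k * bool) * 'I_d.+1)%type
    (fun ci y => ev y (Rem ci.1 ci.2)) setT t0.
  - by move=> x hx; apply: differentiable_row => i; exact: bh_diff (bY i) hx.
  - exact: openT.
  - by [].
  - by move=> i y _; exact: ev_differentiable.
  - by move=> i y _; exists 1 => //; exact: alg_ev.
  - move=> [c i] x hx.
    exact: (remainders_vanish t0 trho bY b_h be DE fE' dv hrel' pE pS remE remG c hx (ltn_ord i)).
  exists ry => // eps eps0; have [Y' [aY' hY']] := hry eps eps0; exists Y'; split=> //.
  - by move=> x hx; have [h1 h2 _ _] := hY' x hx.
  - by move=> x c i hx hi; have [_ _ _ h4] := hY' x hx; exact: (h4 (c, Ordinal hi)).
have [r1 /andP[r10 r1t] hr1] :=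
  local_family t0 trho bY b_h be e0 DE fE' W0 dv hrel' pE pS remE remG PhiE Phi0 approxY.
by exists r1 => //; rewrite r10 (le_trans r1t) // (le_trans trho).
Qed.

Variables (I : Type) (Q : I -> 'rV[C]_(1 + n + k) -> C) (Uhat : set 'rV[C]_(1 + n + k)) (beta : R).
Hypotheses (hind : indep (pball 0 r) (adjoin f s)) (g0 : forall j, g j != 0)
  (oU : open Uhat) (beta0 : 0 < beta)
  (hU : forall x y, pball 0 r x -> nm (y - f x) < beta -> Uhat (row_mx x y))
  (dQ : forall i y, Uhat y -> differentiable (Q i) y)
  (aQ : forall i y, Uhat y -> exists2 e : R, 0 < e & alg (pball y e) (Q i))
  (Qf : forall i x, pball 0 r x -> Q i (row_mx x (f x)) = 0).

(** [Psi] is the map [(x, phi)] on a ball about [v1], and [vanishing_transfer] gives [Q = 0] along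
    it. Uniqueness of the branches identifies [G] with [phi (x, u')] near [x1], and the identity
    theorem carries the equation from there to the whole ball. *)
Theorem approximation_step : approximable R n ->
  exists2 r1 : R, 0 < r1 <= r & forall eps : R, 0 < eps ->
    exists G : 'rV[C]_(1 + n) -> 'rV[C]_k,
    (forall j, alg (pball 0 r1) (fun x => G x 0 j)) /\
    forall x, pball 0 r1 x -> [/\ differentiable G x, nm (G x - f x) <= eps,
      Uhat (row_mx x (G x)) & forall i, Q i (row_mx x (G x)) = 0].
Proof.
move=> IH; have [r1 /andP[r10 r1r] [x1 [hx1 h1 hG]]] := local_approximation IH.
have rx1 : pball 0 r x1 by exact: lt_le_trans hx1 r1r.
set v1 := adjoin f s x1 in h1.
have /choice[X hX] j : exists X : R * R * ('rV[C]_(1 + n + m) -> C),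
  [/\ 0 < X.1.1, 0 < X.1.2, X.2 v1 = f x1 0 j & forall v, pball v1 X.1.1 v ->
   [/\ differentiable X.2 v, nm (X.2 v - f x1 0 j) < X.1.2, (evp v (g j)).[X.2 v] = 0 &
     forall z, nm (z - f x1 0 j) < X.1.2 -> (evp v (g j)).[z] = 0 -> z = X.2 v]].
  have [a [b [psi [a0 b0 p0 hpsi]]]] := implicit_root (hrel j rx1) (h1 j).
  by exists (a, b, psi).
have [ra ra0 hra] : exists2 ra : R, 0 < ra & forall j, ra <= (X j).1.1.
  apply: (common_radius (P := fun j a => a <= (X j).1.1)).
    by move=> j; exists (X j).1.1 => //; have [] := hX j.
  by move=> j a b /andP[_ ba]; exact: le_trans.
have [eta eta0 heta] : exists2 eta : R, 0 < eta & forall j, eta <= (X j).1.2.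
  apply: (common_radius (P := fun j a => a <= (X j).1.2)).
    by move=> j; exists (X j).1.2 => //; have [] := hX j.
  by move=> j a b /andP[_ ba]; exact: le_trans.
pose Psi v : 'rV[C]_(1 + n + k) := row_mx (lsubmx v) (\row_j (X j).2 v).
have dPsi v : pball v1 ra v -> differentiable Psi v.
  move=> hv; apply: differentiable_row => i; have [j ->|j ->] := split_ordP i.
    rewrite (_ : (fun y => _) = fun y : 'rV[C]_(1 + n + m) => y 0 (lshift m j)).
      exact: differentiable_proj.
    by apply/funext => y; rewrite /Psi row_mxEl mxE.
  rewrite (_ : (fun y => _) = (X j).2).
    by have [_ _ _ /(_ v)[]] := hX j; first exact: lt_le_trans (hra j).
  by apply/funext => y; rewrite /Psi row_mxEr mxE.
have Psi1 : Psi v1 = row_mx x1 (f x1).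
  rewrite /Psi /v1 /adjoin row_mxKl; congr row_mx; apply/rowP => j; rewrite mxE.
  by have [_ _ -> _] := hX j.
have U1 : Uhat (Psi v1).
  by rewrite Psi1; apply: hU => //; rewrite subrr nm0.
have [bU bU0 hbU] := (open_pballP Uhat).1 oU _ U1.
have [rb rb0 hrb] := (continuous_pballP _ _).1
  (differentiable_continuous (dPsi v1 (pball_center v1 ra0))) _ bU0.
pose rho := Num.min ra rb.
have rho0 : 0 < rho by rewrite lt_min ra0.
have rhora : rho <= ra by rewrite ge_min lexx.
have rhoj j v : pball v1 rho v -> pball v1 (X j).1.1 v.
  by move=> hv; apply: lt_le_trans hv _; exact: le_trans (hra j).
have UPsi v : pball v1 rho v -> Uhat (Psi v).
  move=> hv; apply: hbU; apply: hrb; apply: lt_le_trans hv _.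
  by rewrite ge_min lexx orbT.
have aPsi i : alg (pball v1 rho) (fun v => Psi v 0 i).
  have [j ->|j ->] := split_ordP i.
    apply: (@alg_ext _ _ _ (fun v => ev v (mvar R (lshift m j)))); last exact: alg_ev.
    by move=> v _; rewrite ev_var /Psi row_mxEl mxE.
  exists (g j) => // v hv; rewrite /Psi row_mxEr mxE.
  by have [_ _ _ /(_ v (rhoj j v hv))[]] := hX j.
have dV x : pball 0 r x -> differentiable (adjoin f s) x.
  by move=> hx; apply: differentiable_row => i; exact: bh_diff (bh_adjoin i) hx.
have df x : pball 0 r x -> differentiable f x.
  by move=> hx; apply: differentiable_row => j; exact: bh_diff (bf j) hx.
have rho2 : 0 < rho / 2 by rewrite divr_gt0.
have eta2 : 0 < eta / 2 by rewrite divr_gt0.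
have [c1 c10 hc1] := (continuous_pballP _ _).1 (differentiable_continuous (dV x1 rx1)) _ rho2.
have [c2 c20 hc2] := (continuous_pballP _ _).1 (differentiable_continuous (df x1 rx1)) _ eta2.
have [c3 c30 hc3] := (open_pballP _).1 (pball_open 0 r1) _ hx1.
have QPsi i v : pball v1 rho v -> Q i (Psi v) = 0.
  have [ei ei0 hei] := aQ i U1.
  apply: (vanishing_transfer rx1 dV hind rho0 _ aPsi UPsi oU (dQ i) ei0 hei).
    by move=> w hw; apply: dPsi; exact: lt_le_trans hw rhora.
  exists (Num.min (Num.min c1 c2) c3) => [|x]; first by rewrite !lt_min c10 c20.
  rewrite /pball /= !lt_min => /andP[/andP[x1' x2'] x3'].
  have hx : pball 0 r x by exact: lt_le_trans (hc3 x x3') r1r.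
  have hv : pball v1 rho (adjoin f s x).
    by apply: lt_trans (hc1 x x1') _; exact: half_lt.
  rewrite (_ : Psi _ = row_mx x (f x)) ?Qf //.
  rewrite /Psi {1}/adjoin row_mxKl; congr row_mx; apply/rowP => j; rewrite mxE.
  have [_ _ _ /(_ _ (rhoj j _ hv))[_ _ _ uq]] := hX j; apply/esym/uq; last exact: hrel.
  apply: lt_le_trans (heta j); apply: (@lt_trans _ _ (eta / 2)).
    have := le_lt_trans (nm_coord (f x - f x1) j) (hc2 x x2').
    by rewrite !mxE.
  exact: half_lt.
exists r1 => [|eps eps0]; first by rewrite r10.
(* [beta / 2] keeps the graph of [G] in [Uhat]; the quarters of [rho] and [eta], added to the halves
   that come from continuity at [x1], stay in the domain of [Psi] and in the range where its
   branches are unique. *)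
pose ep := Num.min (Num.min eps (beta / 2)) (Num.min (rho / 4) (eta / 4)).
have ep0 : 0 < ep by rewrite !lt_min eps0 !divr_gt0.
have [G [hG1 aG [e1 e10 hG2]]] := hG ep ep0.
have UG x : pball 0 r1 x -> Uhat (row_mx x (G x)).
  move=> hx; apply: hU; first exact: lt_le_trans hx r1r.
  apply: (le_lt_trans (hG1 x hx).2); apply: (@le_lt_trans _ _ (beta / 2)).
    by rewrite !ge_min lexx !orbT.
  exact: half_lt.
exists G; split=> // x hx; split.
- exact: (hG1 x hx).1.
- by apply: le_trans (hG1 x hx).2 _; rewrite !ge_min lexx.
- exact: UG.
move=> i; move: x hx.
apply: (@identity_theorem R _ (fun x => Q i (row_mx x (G x))) 0 r1 x1 _ hx1).
  move=> x hx; apply: (differentiable_compo (g := Q i) (f := fun x => row_mx x (G x))).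
    apply: differentiable_row => l; have [j ->|j ->] := split_ordP l.
      rewrite (_ : (fun y => _) = fun y : 'rV[C]_(1 + n) => y 0 j); first exact: differentiable_proj.
      by apply/funext => y; rewrite row_mxEl.
    rewrite (_ : (fun y => _) = fun y => G y 0 j).
      apply: (differentiable_compo (g := fun y : 'rV[C]_k => y 0 j) (hG1 x hx).1).
      exact: differentiable_proj.
    by apply/funext => y; rewrite row_mxEr.
  by apply: dQ; exact: UG.
exists (Num.min (Num.min c1 c2) (Num.min c3 e1)) => [|x]; first by rewrite !lt_min c10 c20 c30.
rewrite /pball /= !lt_min => /andP[/andP[x1' x2'] /andP[x3' x4']].
have hx := hc3 x x3'; have [u [hu1 hu2]] := hG2 x x4'.
have hv : pball v1 rho (row_mx x u).
  rewrite /pball /=; apply: (le_lt_trans (nm_triangle (adjoin f s x) _ _)).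
  apply: (quarter_half_lt rho0 _ (hc1 x x1')).
  apply: (@le_trans _ _ ep); last by rewrite !ge_min lexx !orbT.
  rewrite /adjoin opp_row_mx add_row_mx subrr.
  by apply: nm_row_mx_le => //; [exact: ltW|rewrite nm0 ltW].
rewrite -(QPsi i _ hv); congr (Q i _); rewrite /Psi row_mxKl; congr row_mx.
apply/rowP => j; rewrite mxE.
have [_ _ _ /(_ _ (rhoj j _ hv))[_ _ _ uq]] := hX j; apply: uq; last exact: hu2.
apply: lt_le_trans (heta j); apply: (le_lt_trans (nm_triangle (f x 0 j) _ _)).
apply: (quarter_half_lt eta0).
  apply: (@le_trans _ _ ep); last by rewrite !ge_min lexx !orbT.
  by apply: le_trans (hG1 x hx).2; have := nm_coord (G x - f x) j; rewrite !mxE.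
by apply: le_lt_trans (hc2 x x2'); have := nm_coord (f x - f x1) j; rewrite !mxE.
Qed.

End Step.

(** * Shears along the first coordinate *)

Section Shear.
Variables (R : realType) (n : nat).
Local Notation C := (Cplx R).

(** The linear automorphism that preserves the first coordinate and sends its axis to the line
    spanned by [(1, v)]. *)
Definition shear (v : 'rV[C]_n) (x : 'rV[C]_(1 + n)) : 'rV[C]_(1 + n) :=
  rcons0 (rhd x) (rtl x + rhd x *: v).

Lemma shearK v x : shear (- v) (shear v x) = x.
Proof. by rewrite /shear rhd_cons rtl_cons scalerN addrK rcons0K. Qed.

Lemma shearNK v x : shear v (shear (- v) x) = x.
Proof. by rewrite -{1}[v]opprK shearK. Qed.

Lemma nm_shear v x : nm (shear v x) <= (1 + nm v) * nm x.
Proof.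
have l0 : 0 <= (1 + nm v) * nm x by rewrite mulr_ge0 ?addr_ge0 ?nm_ge0.
apply: nm_row_mx_le => //.
  apply: nm_row_le => // i; rewrite ord1 mxE mulr1n.
  by apply: (le_trans (nm_rhd x)); rewrite mulrDl mul1r lerDl mulr_ge0 ?nm_ge0.
apply: (le_trans (nmD _ _)); rewrite mulrDl mul1r lerD ?nm_rtl // nmZ mulrC.
by rewrite ler_wpM2l ?nm_ge0 // nm_rhd.
Qed.

Lemma pf_shear v i : pf (fun x => shear v x 0 i).
Proof.
have [j ->|j ->] := split_ordP i.
  apply: (@pf_ext _ _ _ (fun x => x 0 (lshift n 0))); last exact: pf_coord.
  by move=> x; rewrite /shear /rcons0 row_mxEl ord1 mxE mulr1n.
apply: (@pf_ext _ _ _ (fun x => x 0 (rshift 1 j) + x 0 (lshift n 0) * v 0 j)).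
  by move=> x; rewrite /shear /rcons0 row_mxEr !mxE.
apply: pfD; first exact: pf_coord.
by apply: pfM; [exact: pf_coord|exact: pf_cst].
Qed.

Lemma shear_differentiable v x : differentiable (shear v) x.
Proof.
by apply: differentiable_row => i; apply: pf_differentiable; exact: pf_shear.
Qed.

Definition shearl K v (y : 'rV[C]_(1 + n + K)) : 'rV[C]_(1 + n + K) :=
  row_mx (shear v (lsubmx y)) (rsubmx y).

Lemma shearlK K v (y : 'rV[C]_(1 + n + K)) : shearl (- v) (shearl v y) = y.
Proof. by rewrite /shearl row_mxKl row_mxKr shearK hsubmxK. Qed.

Lemma shearlNK K v (y : 'rV[C]_(1 + n + K)) : shearl v (shearl (- v) y) = y.
Proof. by rewrite -{1}[v]opprK shearlK. Qed.

Lemma pf_shearl K v i : pf (fun y : 'rV[C]_(1 + n + K) => shearl v y 0 i).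
Proof.
have pl j : pf (fun y : 'rV[C]_(1 + n + K) => lsubmx y 0 j).
  by apply: (pf_lsubmx (u := id)) => l; exact: pf_coord.
apply: pf_row_mx => j.
  by apply: (pf_comp (v := fun y => lsubmx y) (F := fun x => shear v x 0 j) pl); exact: pf_shear.
by apply: (pf_rsubmx (u := id)) => l; exact: pf_coord.
Qed.

Lemma pf_map N M (h : 'rV[C]_N -> 'rV[C]_M) : (forall i, pf (fun x => h x 0 i)) ->
  exists H : 'I_M -> mpoly N C, forall x, h x = \row_i ev x (H i).
Proof.
move=> ph; have /choice[H hH] i : exists P : mpoly N C, forall x, h x 0 i = ev x P.
  by have [P hP] := ph i; exists P.
by exists H => x; apply/rowP => i; rewrite mxE hH.
Qed.

End Shear.

(** * The induction on the number of variables *)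

Section Induction.
Variable (R : realType).
Local Notation C := (Cplx R).

Lemma alg_pf_comp N M (D : set 'rV[C]_N) (D' : set 'rV[C]_M) (pi : 'rV[C]_M -> 'rV[C]_N) F :
  (forall i, pf (fun x => pi x 0 i)) -> (forall y, exists x, pi x = y) ->
  (forall x, D' x -> D (pi x)) -> alg D F -> alg D' (fun x => F (pi x)).
Proof.
by move=> /pf_map[H hH] sur DD aF; exact: alg_comp hH sur DD aF.
Qed.

Lemma prod_nonzero N k (c : 'rV[C]_N) (r : R) (G : 'rV[C]_N -> C) (F : 'I_k -> 'rV[C]_N -> C) :
  (forall x, pball c r x -> differentiable G x) ->
  (forall j x, pball c r x -> differentiable (F j) x) ->
  (exists2 x, pball c r x & G x != 0) -> (forall j, exists2 x, pball c r x & F j x != 0) ->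
  exists2 x, pball c r x & G x * \prod_j F j x != 0.
Proof.
move=> dG dF G0 F0; suff : forall l : seq 'I_k, exists2 x, pball c r x & G x * \prod_(j <- l) F j x != 0.
  by move=> /(_ (index_enum 'I_k)).
elim=> [|a l [x0 hx0 P0]].
  by have [x hx Gx] := G0; exists x => //; rewrite big_nil mulr1.
apply: contrapT => /forall2NP np.
have dP x : pball c r x -> differentiable (fun x => G x * \prod_(j <- l) F j x) x.
  move=> hx; apply: differentiableM; first exact: dG.
  elim: l {x0 hx0 P0 np} => [|b l IH].
    rewrite (_ : (fun x => _) = fun=> 1); first exact: differentiable_cst.
    by apply/funext => y; rewrite big_nil.
  rewrite (_ : (fun x => _) = fun x => F b x * \prod_(j <- l) F j x).
    by apply: differentiableM; [exact: dF|exact: IH].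
  by apply/funext => y; rewrite big_cons.
have FP x : pball c r x -> F a x * (G x * \prod_(j <- l) F j x) = 0.
  move=> hx; have [//|/negP] := np x; rewrite negbK big_cons => /eqP <-.
  by rewrite mulrCA.
have [z|z] := holo_zero_divisor (dF a) dP FP.
  by have [x hx] := F0 a; rewrite z // eqxx.
by move: P0; rewrite z // eqxx.
Qed.

Lemma approximable0 : approximable R 0.
Proof.
move=> k f r I Q Uhat r0 df oU hU dQ aQ Qf; exists r => [|eps eps0]; first by rewrite r0 lexx.
have c0 (x : 'rV[C]_0) : x = 0 by apply/rowP => -[].
exists f; split.
  move=> j; apply: (@alg_ext _ _ _ (fun=> f 0 0 j)); last exact: alg_cst.
  by move=> x _; rewrite (c0 x).
move=> x hx; split; [exact: df|by rewrite subrr nm0 ltW|exact: hU|].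
by move=> i; exact: Qf.
Qed.

(** All data are pulled back by a shear after which the discriminant is not identically 0 on the
    axis of the first coordinate, and the result is carried back by the inverse shear. Both maps are
    polynomial, so they preserve algebraic functions and independence. *)
Lemma approximable_succ n : approximable R n -> approximable R (1 + n).
Proof.
move=> IH k f r I Q Uhat r0 df oU hU dQ aQ Qf.
have dfj j x : pball 0 r x -> differentiable (fun x => f x 0 j) x.
  move=> hx; apply: (differentiable_compo (g := fun y : 'rV[C]_k => y 0 j) (df x hx)).
  exact: differentiable_proj.
have [ra ra0 hra] : exists2 ra : R, 0 < ra & forall j, ra <= r /\ bh (pball 0 ra) (fun x => f x 0 j).
  apply: (common_radius (P := fun j a => a <= r /\ bh (pball 0 a) (fun x => f x 0 j))).
    by move=> j; have [a /andP[a0 ar] ba] := local_bh r0 (dfj j); exists a.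
  move=> j a a' /andP[_ a'a] [ar ba]; split; first exact: le_trans ar.
  by apply: bhS ba; exact: pball_le.
have c00 : pball (0 : 'rV[C]_(1 + n)) r 0 by exact: pball_center.
have [b b0 hb] := (open_pballP Uhat).1 oU _ (hU 0 c00).
have b2 : 0 < b / 2 by rewrite divr_gt0.
have [rc rc0 hrc] := (continuous_pballP _ _).1 (differentiable_continuous (df 0 c00)) _ b2.
(* Over this ball the graph has a tube of uniform radius [b / 2] inside [Uhat]. *)
pose r' := Num.min (Num.min r ra) (Num.min rc (b / 2)).
have r'0 : 0 < r' by rewrite !lt_min r0 ra0 rc0.
have r'r : r' <= r by rewrite !ge_min lexx.
have hU' x y : pball 0 r' x -> nm (y - f x) < b / 2 -> Uhat (row_mx x y).
  rewrite /pball /= subr0 !lt_min => /andP[_ /andP[x1 x2]] hy; apply: hb.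
  rewrite /pball /= opp_row_mx add_row_mx subr0; apply: nm_row_mx_lt => //.
    by apply: (lt_trans x2); exact: half_lt.
  rewrite (splitr b); apply: (le_lt_trans (nm_triangle (f x) _ _)); apply: ltrD => //.
  by apply: hrc; rewrite subr0.
have bf j : bh (pball 0 r') (fun x => f x 0 j).
  apply: bhS (hra j).2; apply: pball_le; rewrite !ge_min lexx !orbT //.
have [m [s [g [hind hg]]]] := transcendence_basis f r'0.
have hrel j : relation (pball 0 r') (adjoin f s) (fun x => f x 0 j) (g j) by have [] := hg j.
have dadj x : pball 0 r' x -> differentiable (adjoin f s) x.
  by move=> hx; apply: differentiable_row => i; exact: bh_diff (bh_adjoin s bf i) hx.
have [p hp discp] : exists2 p, pball 0 r' p & discr f s g p != 0.
  apply: prod_nonzero.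
  - by move=> x _; exact: differentiable_proj.
  - move=> j x hx; rewrite (_ : (fun x => _) = \sum_(i < size (g j)^`()) (fun x => ev (adjoin f s x) (g j)^`()`_i * f x 0 j ^+ i)).
      apply: differentiable_sum => i; apply: differentiableM.
        apply: (differentiable_compo (g := fun v => ev v (g j)^`()`_i) (dadj x hx)).
        exact: ev_differentiable.
      by apply: differentiable_pow; exact: bh_diff (bf j) hx.
    by apply/funext => y; rewrite fct_sumE horner_evp_sum.
  - exists (rcons0 ((r' / 2)%:C%C) 0).
      rewrite /pball /= subr0 nm_rcons0_lt // nm0 r'0 andbT nm_real ger0_norm ?ltW ?divr_gt0 //.
      exact: half_lt.
    by rewrite rhd_cons -nm_gt0 nm_real normr_gt0 gt_eqF // divr_gt0.
  - by move=> j; have [] := hg j.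
have p0 : rhd p != 0 by move: discp; rewrite /discr mulf_eq0 negb_or => /andP[].
(* The shear sends the axis to the line through [p]; [rhd p] is nonzero because the discriminant
   contains the first coordinate as a factor. *)
pose v := (rhd p)^-1 *: rtl p.
(* A common Lipschitz constant of the shear and its inverse; radii are divided by it once on the way
   in and once on the way back. *)
pose kap := 1 + nm v.
have kap0 : 0 < kap by rewrite ltr_wpDr // nm_ge0.
have shb (w : 'rV[C]_n) (a : R) x : nm w = nm v -> 0 < a -> pball 0 (a / kap) x -> pball 0 a (shear w x).
  rewrite /pball /= !subr0 => wv a0 hx; apply: (le_lt_trans (nm_shear w x)).
  by rewrite wv -/kap mulrC -ltr_pdivlMr.
pose r2 := r' / kap.
have r20 : 0 < r2 by rewrite divr_gt0.
pose f2 x := f (shear v x).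
have [H hH] := pf_map (@pf_shearl R n m v).
have [Hi hHi] := pf_map (@pf_shearl R n m (- v)).
pose g2 j := map_poly (msubst H) (g j).
have adj2 x : shearl v (adjoin f2 s x) = adjoin f s (shear v x).
  by rewrite /shearl /adjoin row_mxKl row_mxKr.
have g2E j x : evp (adjoin f2 s x) (g2 j) = evp (adjoin f s (shear v x)) (g j).
  by rewrite /g2 evp_msubst -hH adj2.
have bf2 j : bh (pball 0 r2) (fun x => f2 x 0 j).
  have [M hM] := bf j; exists M => x hx; have hs := shb v r' x erefl r'0 hx.
  have [h1 h2] := hM _ hs; split; last exact: h2.
  exact: (differentiable_compo (f := shear v) (g := fun y => f y 0 j) (shear_differentiable v x) h1).
have hrel2 j : relation (pball 0 r2) (adjoin f2 s) (fun x => f2 x 0 j) (g2 j).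
  by move=> x hx; rewrite g2E; apply: hrel; exact: (shb v r' x erefl r'0 hx).
have discr2 x : discr f2 s g2 x = discr f s g (shear v x).
  rewrite /discr rhd_cons; congr (_ * _); apply: eq_bigr => j _.
  by rewrite !evp_deriv g2E.
have np0 : 0 < nm (rhd p) by rewrite nm_gt0.
have np : 0 < nm p by apply: lt_le_trans (nm_rhd p).
have lineE (z : C) : shear v (rcons0 z 0) = (z / rhd p) *: p.
  have scal (a : C) : a *: p = rcons0 (a * rhd p) (a *: rtl p).
    by rewrite -{1}(rcons0K p) /rcons0 scale_row_mx scale_scalar_mx.
  by rewrite scal /shear rhd_cons rtl_cons add0r /v scalerA divfK.
have hnz2 : exists2 z, nm z < r2 & discr f2 s g2 (rcons0 z 0) != 0.
  apply: contrapT => /forall2NP nz; pose F (z : C) := discr f s g (shear v (rcons0 z 0)).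
  (* The parameters whose images on the line through [p] lie in the original ball. They include
     [rhd p], the parameter of [p] itself, so vanishing near 0 on the axis would give vanishing at
     [p]. *)
  pose R' := r' * nm (rhd p) / nm p.
  have R'0 : 0 < R' by rewrite divr_gt0 // mulr_gt0.
  have dF (z : C) : pball (0 : C) R' z -> differentiable F z.
    rewrite /pball /= subr0 => hz.
    apply: (rcons0_slice_differentiable (F := fun x => discr f s g (shear v x))).
    apply: (differentiable_compo (f := shear v) (g := discr f s g) (shear_differentiable v _)).
    apply: (bh_diff (bh_discr s g bf)); rewrite lineE /pball /= subr0 nmZ nmM nmV.
    by rewrite mulrAC ltr_pdivrMr // -ltr_pdivlMr.
  have F0 : forall z : C, pball (0 : C) R' z -> F z = 0.
    apply: (identity_theorem dF (pball_center (0 : C) R'0)).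
    exists r2 => // z; rewrite /pball /= subr0 => hz.
    by have [//|/negP] := nz z; rewrite negbK discr2 => /eqP.
  move/eqP: discp; apply; have <- : F (rhd p) = discr f s g p.
    by rewrite /F lineE mulfV // scale1r.
  apply: F0; rewrite /pball /= subr0 ltr_pdivlMr // [ltRHS]mulrC ltr_pM2l //.
  by move: hp; rewrite /pball /= subr0.
have hind2 : indep (pball 0 r2) (adjoin f2 s).
  move=> P2 hP2; have : msubst Hi P2 = 0.
    apply: hind => x hx.
    have dP y : pball 0 r' y -> differentiable (fun y => ev (adjoin f s y) (msubst Hi P2)) y.
      move=> hy; apply: (differentiable_compo (g := fun v => ev v (msubst Hi P2)) (dadj y hy)).
      exact: ev_differentiable.
    apply: (identity_theorem dP (pball_center 0 r'0)) hx.
    exists (r2 / kap) => [|y hy]; first by rewrite divr_gt0.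
    rewrite ev_msubst -hHi (_ : shearl _ _ = adjoin f2 s (shear (- v) y)).
      by apply: hP2; apply: (shb (- v)) hy => //; rewrite nmN.
    by rewrite /shearl /adjoin row_mxKl row_mxKr /f2 shearNK.
  move=> P0; apply/eqP; apply: contraT => /ev_neq0[y /eqP []].
  have := ev_msubst Hi P2 (shearl v y); rewrite -hHi shearlK P0 => <-.
  exact: meval0.
have g20 j : g2 j != 0.
  have [gj0 _ _] := hg j; have [y [z hz]] := poly_mpoly_neq0 gj0.
  apply: contraNneq hz => h0; have := evp_msubst H (g j) (shearl (- v) y).
  by rewrite -/(g2 j) h0 -hH shearlNK evp0 => <-; rewrite horner0.
have cS y : forall e : R, 0 < e -> exists2 d : R, 0 < d &
    forall y', nm (y' - y) < d -> nm (shearl v y' - shearl v y : 'rV[C]_(1 + n + k)) < e.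
  apply/continuous_pballP/differentiable_continuous.
  by apply: differentiable_row => i; apply: pf_differentiable; exact: pf_shearl.
pose U2 : set 'rV[C]_(1 + n + k) := [set y | Uhat (shearl v y)].
have oU2 : open U2.
  apply/open_pballP => y hy; have [e e0 he] := (open_pballP Uhat).1 oU _ hy.
  by have [e' e'0 he'] := cS y e e0; exists e' => // y' hy'; apply: he; exact: he'.
have sE x y : shearl v (row_mx x y : 'rV[C]_(1 + n + k)) = row_mx (shear v x) y.
  by rewrite /shearl row_mxKl row_mxKr.
have hU2 x y : pball 0 r2 x -> nm (y - f2 x) < b / 2 -> U2 (row_mx x y).
  move=> hx hy; rewrite /U2 /= sE.
  exact: (hU' _ _ (shb v r' x erefl r'0 hx) hy).
have dQ2 i y : U2 y -> differentiable (fun y => Q i (shearl v y)) y.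
  move=> hy; apply: (differentiable_compo (f := @shearl R n k v) (g := Q i)); last exact: (dQ i _ hy).
  by apply: differentiable_row => l; apply: pf_differentiable; exact: pf_shearl.
have aQ2 i y : U2 y -> exists2 e : R, 0 < e & alg (pball y e) (fun y => Q i (shearl v y)).
  move=> hy; have [e e0 ae] := aQ i _ hy; have [e' e'0 he'] := cS y e e0; exists e' => //.
  apply: alg_pf_comp ae.
  - exact: pf_shearl.
  - by move=> w; exists (shearl (- v) w); rewrite shearlNK.
  - by move=> w; exact: he'.
have Qf2 i x : pball 0 r2 x -> Q i (shearl v (row_mx x (f2 x))) = 0.
  move=> hx; rewrite sE; apply: Qf; apply: lt_le_trans r'r.
  exact: (shb v r' x erefl r'0 hx).
have [r3 /andP[r30 r3r2] hr3] :=
  approximation_step r20 bf2 hrel2 hnz2 hind2 g20 oU2 b2 hU2 dQ2 aQ2 Qf2 IH.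
have kap1 : 1 <= kap by rewrite /kap lerDl nm_ge0.
exists (r3 / kap).
  rewrite divr_gt0 //= ler_pdivrMr //; apply: (le_trans r3r2); rewrite /r2 ler_pdivrMr //.
  apply: (le_trans r'r); rewrite -mulrA ler_peMr //; first exact: ltW.
  by rewrite mulr_ege1.
move=> eps eps0; have [G [aG hG]] := hr3 eps eps0.
have back x : pball 0 (r3 / kap) x -> pball 0 r3 (shear (- v) x).
  by apply: shb => //; rewrite nmN.
exists (fun x => G (shear (- v) x)); split.
  move=> j; apply: (alg_pf_comp (F := fun x => G x 0 j)) (aG j).
  - exact: pf_shear.
  - by move=> y; exists (shear v y); rewrite shearK.
  - exact: back.
move=> x hx; have [h1 h2 h3 h4] := hG _ (back x hx).
rewrite /U2 /= sE shearNK in h3; rewrite /f2 shearNK in h2; split; [|exact: h2|exact: h3|].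
  exact: (differentiable_compo (f := shear (- v)) (g := G) (shear_differentiable (- v) x) h1).
by move=> i; have := h4 i; rewrite sE shearNK.
Qed.

Theorem approximable_all n : approximable R n.
Proof. by elim: n => [|n IH]; [exact: approximable0|exact: (approximable_succ IH)]. Qed.

End Induction.

(** * Nash functions, translation to an arbitrary point and uniform convergence *)

Section Final.
Variable (R : realType).
Local Notation C := (Cplx R).

Lemma alg_nash N (D U : set 'rV[C]_N) (f : 'rV[C]_N -> C) x : open D -> D x -> D `<=` U ->
  alg D f -> nash_at U f x.
Proof.
move=> oD Dx DU [p p0 hp]; have [P P0 hP] := mpoly_of_poly p0.
exists D, P; split=> // y Dy; have := hp y Dy; rewrite -hP => <-.
by apply: meval_eq => i.
Qed.

Lemma nash_alg N (U : set 'rV[C]_N) (f : 'rV[C]_N -> C) x : nash_at U f x ->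
  exists2 e : R, 0 < e & alg (pball x e) f.
Proof.
move=> [W [P [oW Wx _ P0 hP]]]; have [p p0 hp] := poly_of_mpoly P0.
have [e e0 he] := (open_pballP W).1 oW _ Wx; exists e => //; exists p => // y hy.
rewrite hp -[RHS](hP y (he y hy)); exact: meval_eq.
Qed.

Lemma translate_alg N (D : set 'rV[C]_N) (D' : set 'rV[C]_N) (a : 'rV[C]_N) f :
  (forall x, D' x -> D (x + a)) -> alg D f -> alg D' (fun x => f (x + a)).
Proof.
move=> DD; apply: (alg_pf_comp (pi := fun x => x + a)) => //.
  move=> i; apply: (@pf_ext _ _ _ (fun x => x 0 i + a 0 i)); first by move=> x; rewrite mxE.
  by apply: pfD; [exact: pf_coord|exact: pf_cst].
by move=> y; exists (y - a); rewrite subrK.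
Qed.

Lemma translate_differentiable N (a x : 'rV[C]_N) : differentiable (fun x => x + a) x.
Proof.
apply: differentiable_row => i; apply: pf_differentiable.
apply: (@pf_ext _ _ _ (fun x => x 0 i + a 0 i)); first by move=> y; rewrite mxE.
by apply: pfD; [exact: pf_coord|exact: pf_cst].
Qed.

Lemma uniform_cvg_nm N k (A : set 'rV[C]_N) (F : nat -> 'rV[C]_N -> 'rV[C]_k)
    (f : 'rV[C]_N -> 'rV[C]_k) :
  (forall nu x, A x -> nm (F nu x - f x) <= (nu.+1%:R)^-1) -> {uniform A, F @ \oo --> f}.
Proof.
move=> hF P /uniform_nbhs[E [entE EP]].
move: entE; rewrite -entourage_ballE => -[e /= e0 he].
have [eE re0] := real_pos e0; set a := complex.Re e in eE re0.
exists (Num.truncn a^-1) => // nu /= hnu; apply: EP => y Ay; apply: he => /=.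
rewrite -ball_normE /= eE norm_nm real_complex_lt nmB; apply: (le_lt_trans (hF nu y Ay)).
rewrite -[ltRHS]invrK ltf_pV2 ?posrE ?invr_gt0 //.
by apply: (lt_le_trans (truncnS_gt _)); rewrite ler_nat ltnS.
Qed.

End Final.

(** What is left is a translation of [x0] to the origin and the choice [eps = 1 / (nu + 1)].
    Membership in [Uhat] is part of the conclusion because [Q] is encoded as a total function,
    constrained only on [Uhat]. *)
Theorem theorem1p1 (R : realType) (n k q : nat)
    (U : set 'rV[Cplx R]_n) (f : 'rV[Cplx R]_n -> 'rV[Cplx R]_k)
    (Uhat : set 'rV[Cplx R]_(n + k))
    (Q : 'rV[Cplx R]_(n + k) -> 'rV[Cplx R]_q)
    (openU : open U) (holf : holomorphic U f)
    (openUhat : open Uhat)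
    (graphf : forall x, U x -> Uhat (row_mx x (f x)))
    (nashQ : nash_mapping Uhat Q)
    (Qf : forall x, U x -> Q (row_mx x (f x)) = 0) :
  forall x0 : 'rV[Cplx R]_n, U x0 ->
  exists (U0 : set 'rV[Cplx R]_n)
         (fnu : nat -> 'rV[Cplx R]_n -> 'rV[Cplx R]_k),
    [/\ open U0, U0 x0 & U0 `<=` U] /\
    [/\ forall nu, nash_mapping U0 (fnu nu),
        {uniform U0, fnu @ \oo --> f} &
        forall nu x, U0 x ->
          Uhat (row_mx x (fnu nu x)) /\ Q (row_mx x (fnu nu x)) = 0].
Proof.
move=> x0 Ux0; have [r r0 hr] := (open_pballP U).1 openU _ Ux0.
pose a := row_mx x0 (0 : 'rV[Cplx R]_k).
have aE x y : row_mx x y + a = row_mx (x + x0) y by rewrite /a add_row_mx addr0.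
have shU x : pball 0 r x -> U (x + x0).
  by move=> hx; apply: hr; rewrite /pball /= addrK; move: hx; rewrite /pball /= subr0.
have nearS y : forall e : R, pball y e `<=` [set z | pball (y + a) e (z + a)].
  by move=> e z; rewrite /pball /= opprD addrACA subrr addr0.
have dfS x : pball 0 r x -> differentiable (fun x => f (x + x0)) x.
  move=> hx; apply: (differentiable_compo (f := fun x => x + x0) (g := f)).
    exact: translate_differentiable.
  by apply: holf; exact: shU.
pose US : set 'rV[Cplx R]_(n + k) := [set y | Uhat (y + a)].
have oUS : open US.
  apply/open_pballP => y hy; have [e e0 he] := (open_pballP Uhat).1 openUhat _ hy.
  by exists e => // z hz; apply: he; exact: nearS.
have gS x : pball 0 r x -> US (row_mx x (f (x + x0))).
  by move=> hx; rewrite /US /= aE; apply: graphf; exact: shU.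
have dQS (i : 'I_q) y : US y -> differentiable (fun y => Q (y + a) 0 i) y.
  move=> hy; apply: (differentiable_compo (f := fun y => y + a) (g := fun y => Q y 0 i)).
    exact: translate_differentiable.
  exact: (nashQ.2 i).1.
have aQS (i : 'I_q) y : US y -> exists2 e : R, 0 < e & alg (pball y e) (fun y => Q (y + a) 0 i).
  move=> hy; have [e e0 ae] := nash_alg ((nashQ.2 i).2 _ hy); exists e => //.
  by apply: translate_alg ae; exact: nearS.
have QfS (i : 'I_q) x : pball 0 r x -> Q (row_mx x (f (x + x0)) + a) 0 i = 0.
  by move=> hx; rewrite aE Qf ?mxE //; exact: shU.
have [r1 /andP[r10 r1r] happ] := approximable_all r0 dfS oUS gS dQS aQS QfS.
have /choice[g hg] (nu : nat) : exists g : 'rV[Cplx R]_n -> 'rV[Cplx R]_k,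
    (forall j, alg (pball 0 r1) (fun x => g x 0 j)) /\
    forall x, pball 0 r1 x -> [/\ differentiable g x, nm (g x - f (x + x0)) <= (nu.+1%:R)^-1,
      US (row_mx x (g x)) & forall i : 'I_q, Q (row_mx x (g x) + a) 0 i = 0].
  by apply: happ; rewrite invr_gt0.
have back x : pball x0 r1 x -> pball 0 r1 (x - x0) by rewrite /pball /= subr0.
have backE x y : row_mx (x - x0) y + a = row_mx x y by rewrite aE subrK.
exists (pball x0 r1), (fun nu x => g nu (x - x0)); split.
  split; [exact: pball_open|exact: pball_center|].
  by move=> x hx; apply: hr; exact: lt_le_trans hx r1r.
have dg nu x : pball x0 r1 x -> differentiable (fun x => g nu (x - x0)) x.
  move=> /back hx; have [_ /(_ _ hx)[h1 _ _ _]] := hg nu.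
  by apply: (differentiable_compo (f := fun x => x - x0) (g := g nu)) h1; exact: translate_differentiable.
split.
- move=> nu; split; first exact: dg.
  move=> j; split.
    move=> x hx; apply: (differentiable_compo (g := fun y : 'rV[Cplx R]_k => y 0 j) (dg nu x hx)).
    exact: differentiable_proj.
  move=> x hx; apply: (@alg_nash R n (pball x0 r1)) => //; first exact: pball_open.
  by apply: (translate_alg (a := - x0) (f := fun x => g nu x 0 j) back); exact: (hg nu).1.
- apply: uniform_cvg_nm => nu x hx; have [_ /(_ _ (back x hx))[_ h2 _ _]] := hg nu.
  by rewrite subrK in h2.
- move=> nu x /back hx; have [_ /(_ _ hx)[_ _ h3 h4]] := hg nu.
  rewrite /US /= backE in h3; split=> //; apply/rowP => i; rewrite mxE.
  by have := h4 i; rewrite backE.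
Qed.
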